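(* Let $P\in\mathbb{Q}[t_1,\dots,t_r]$ be a multigraded Hilbert polynomial. Then the functor $\operatorname{Hilb}_X^P$ is represented by a projective scheme over $\Bbbk$. In fact, there is a finite subset $\mathcal{D}\subset\mathbb{Z}^r$ which produces a canonical closed embedding from $\operatorname{Hilb}_X^P$ into $H^P_{S_{\mathcal{D}}}$.
   Context: Setting. $X$ is a smooth projective toric variety of dimension $d$ over a field $\Bbbk$ determined by a fan $\Delta$ in $\mathbb{R}^d$. The rays of the fan are numbered $1,\dots,n$, with minimal lattice generators $\mathbf{b}_1,\dots,\mathbf{b}_n$ (spanning $\mathbb{R}^d$), and $\Delta$ is identified with a simplicial complex on $[n]=\{1,\dots,n\}$ ($\sigma\in\Delta$ iff the rays indexed by $\sigma$ span a cone of the fan). Put $r=n-d$ and fix an integer $r\times n$ matrix $A=[\mathbf{a}_1\cdots\mathbf{a}_n]$ such that $0\to\mathbb{Z}^d\xrightarrow{[\mathbf{b}_1\cdots\mathbf{b}_n]^{T}}\mathbb{Z}^n\xrightarrow{A}\mathbb{Z}^r\to0$ is exact; thus $\operatorname{Pic}(X)\cong\mathbb{Z}^r$, and $\mathcal{O}_X(\mathbf{t})$ is the line bundle corresponding to $\mathbf{t}\in\mathbb{Z}^r$. $S=\Bbbk[x_1,\dots,x_n]$ (the homogeneous coordinate ring of $X$) is $\mathbb{Z}^r$-graded by $\deg(x_i)=\mathbf{a}_i$; the irrelevant ideal is $B=\langle\prod_{i\notin\sigma}x_i:\sigma\in\Delta\rangle$. Let $\mathcal{K}=\bigcap_{\sigma\in\Delta}\mathbb{N}\{\mathbf{a}_i:i\notin\sigma\}$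 (lattice points of an $r$-dimensional pointed cone). Hilbert polynomials. For a finitely generated $\mathbb{Z}^r$-graded $S$-module $M$, $P_M(\mathbf{t})$ is the unique polynomial agreeing with $\dim_\Bbbk M_{\mathbf{t}}$ on some finite intersection of translates of $\mathcal{K}$; equivalently $P_M(\mathbf{t})=\chi(\mathcal{F}\otimes\mathcal{O}_X(\mathbf{t}))$, where $\mathcal{F}$ is the coherent sheaf associated to $M$. The Hilbert polynomial of a closed subscheme $Y\subseteq X$ with $B$-saturated ideal $I$ is $P_{S/I}(\mathbf{t})=\chi(\mathcal{O}_Y(\mathbf{t}))$. ''Multigraded Hilbert polynomial'' here means one of this form. The functor $\operatorname{Hilb}_X^P$. For a commutative $\Bbbk$-algebra $R$, $\operatorname{Hilb}_X^P(R)$ is the set of families over $\operatorname{Spec}(R)$ of closed subschemes $Y\subseteq X\times_\Bbbk\operatorname{Spec}(R)$ (flat over $\operatorname{Spec}(R)$) whose fibres have multigraded Hilbert polynomial $P$; the functor acts on ring homomorphisms by base change. The functor $H^P_{S_{\mathcal{D}}}$. For $\mathcal{D}\subset\mathbb{Z}^r$ let $S_{\mathcal{D}}=\bigoplus_{\mathbf{p}\in\mathcal{D}}S_{\mathbf{p}}$, and for $\mathbf{p},\mathbf{k}\in\mathcal{D}$ let $F_{\mathbf{p},\mathbf{k}}$ be the set of maps $S_{\mathbf{p}}\to S_{\mathbf{k}}$ given by multiplication by the monomials of $S_{\mathbf{k}-\mathbf{p}}$. For a commutative $\Bbbk$-algebra $R$, a graded submodule $L=\bigoplus_{\mathbf{p}\in\mathcal{D}}L_{\mathbf{p}}\subseteq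 R\otimes_\Bbbk S_{\mathcal{D}}$ is an $F$-submodule if $(1_R\otimes f)(L_{\mathbf{p}})\subseteq L_{\mathbf{k}}$ for all $\mathbf{p},\mathbf{k}\in\mathcal{D}$ and $f\in F_{\mathbf{p},\mathbf{k}}$. $H^P_{S_{\mathcal{D}}}(R)$ is the set of $F$-submodules $L$ such that $(R\otimes_\Bbbk S_{\mathbf{p}})/L_{\mathbf{p}}$ is a locally free $R$-module of rank $P(\mathbf{p})$ for every $\mathbf{p}\in\mathcal{D}$; a homomorphism $R\to R'$ sends $L$ to $R'\otimes_RL$ (its image in $R'\otimes S_{\mathcal D}$). The canonical map: a family $Y\in\operatorname{Hilb}_X^P(R)$ corresponds to a unique homogeneous $B$-saturated ideal $I\subseteq R[x_1,\dots,x_n]$, and the map sends $Y$ to $\bigoplus_{\mathbf{p}\in\mathcal{D}}I_{\mathbf{p}}$. *)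

(* Defs.v *)
From HB Require Import structures.
From mathcomp Require Import all_boot all_order all_algebra.
From mathcomp Require Import boolp classical_sets reals.
From mathcomp.multinomials Require Import freeg mpoly.

Set Implicit Arguments.
Unset Strict Implicit.
Unset Printing Implicit Defensive.

Import Order.TTheory GRing.Theory Num.Theory.
Local Open Scope ring_scope.
Local Open Scope classical_set_scope.

(** * Modules *)

(* A module is handled as a subquotient V0 / N, with N a submodule of V0 and
   V0 a submodule of an ambient lmodType. *)

Definition is_submodule (R : nzRingType) (V : lmodType R) (N : set V) : Prop :=
  N 0 /\ forall a u v, N u -> N v -> N (a *: u + v).

Definition span (R : nzRingType) (V : lmodType R) (G : set V) : set V :=
  smallest (@is_submodule R V) G.

Definition is_ideal (T : comNzRingType) (I : set T) : Prop :=
  I 0 /\ forall a x y, I x -> I y -> I (a * x + y).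

Definition ideal_gen (T : comNzRingType) (G : set T) : set T :=
  smallest (@is_ideal T) G.

(* The tensor \sum_(x <- s) x.1 (x) x.2 vanishes in (V0 / N) (x)_R W; by the
   universal property, every R-bilinear map out of (V0 / N) x W kills it. *)
Definition tensor_zero (R : comNzRingType) (V W : lmodType R) (V0 N : set V)
    (s : seq (V * W)) : Prop :=
  forall (Z : lmodType R) (beta : V -> W -> Z),
    (forall a v v' w, V0 v -> V0 v' ->
       beta (a *: v + v') w = a *: beta v w + beta v' w) ->
    (forall a v w w', V0 v ->
       beta v (a *: w + w') = a *: beta v w + beta v w') ->
    (forall v w, V0 v -> N v -> beta v w = 0) ->
    \sum_(x <- s) beta x.1 x.2 = 0.

(* V0 / N is flat: (V0 / N) (x)_R - preserves injectivity. *)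
Definition is_flat (R : comNzRingType) (V : lmodType R) (V0 N : set V) : Prop :=
  forall (W W' : lmodType R) (g : {linear W -> W'}), injective g ->
  forall s : seq (V * W), (forall x, x \in s -> V0 x.1) ->
    tensor_zero V0 N [seq (x.1, g x.2) | x <- s] -> tensor_zero V0 N s.

Definition has_dim (F : fieldType) (V : lmodType F) (V0 N : set V) (q : nat) :
    Prop :=
  exists e : 'I_q -> V, [/\ forall j, V0 (e j),
    forall v, V0 v -> exists c : 'I_q -> F, N (v - \sum_j c j *: e j) &
    forall c : 'I_q -> F, N (\sum_j c j *: e j) -> forall j, c j = 0].

(* (V0 / N)_f is free of rank q over R_f; a basis can be scaled by powers of f
   so as to consist of images of elements e_j of V0. *)
Definition free_at (R : comNzRingType) (V : lmodType R) (V0 N : set V) (q : nat)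
    (f : R) : Prop :=
  exists e : 'I_q -> V, [/\ forall j, V0 (e j),
    forall v, V0 v ->
      exists N0 (c : 'I_q -> R), N (f ^+ N0 *: v - \sum_j c j *: e j) &
    forall c : 'I_q -> R, N (\sum_j c j *: e j) ->
      exists N0, forall j, f ^+ N0 * c j = 0].

Definition locally_free (R : comNzRingType) (V : lmodType R) (V0 N : set V)
    (q : nat) : Prop :=
  exists fs : seq R, ideal_gen [set` fs] 1 /\
    forall f, f \in fs -> free_at V0 N q f.

(** * Fans *)

(* The rays of the fan are generated by the columns b_0, ..., b_(n-1) of b. *)

Definition cone (RR : realType) (d n : nat) (b : 'M[int]_(d, n))
    (s : {set 'I_n}) : set 'cV[RR]_d :=
  [set v | exists2 c : 'I_n -> RR, forall i, 0 <= c i &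
           v = \sum_(i in s) c i *: map_mx intr (col i b)].
Arguments cone RR {d n} b s.

Record smooth_projective_fan (RR : realType) (d n : nat) (b : 'M[int]_(d, n))
    (Delta : {set {set 'I_n}}) : Prop := SmoothProjectiveFan {
  fan_set0 : finset.set0 \in Delta;
  fan_ray : forall i, [set i]%SET \in Delta;
  fan_face : forall s t : {set 'I_n}, s \in Delta -> t \subset s -> t \in Delta;
  fan_meet : forall s t, s \in Delta -> t \in Delta ->
    cone RR b s `&` cone RR b t = cone RR b (s :&: t)%SET;
  (* smoothness: the generators of a cone are part of a Z-basis of Z^d *)
  fan_smooth : forall s, s \in Delta ->
    exists2 U : 'M[int]_d, U \in unitmx &
    exists2 h : 'I_n -> 'I_d, {in s &, injective h} &
      {in s, forall i, col i b = col (h i) U};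
  fan_complete : forall v, exists2 s, s \in Delta & cone RR b s v;
  (* projectivity: sum_i h_i D_i is an ample divisor, i.e. its support function
     (equal to the linear form - <m, _> on each maximal cone) is strictly
     convex *)
  fan_projective : exists h : 'I_n -> int, forall s, s \in Delta -> #|s| = d ->
    exists m : 'cV[int]_d,
      (forall i, i \in s -> (b^T *m m) i 0 = - h i) /\
      (forall i, i \notin s -> - h i < (b^T *m m) i 0)
}.

(* 0 -> Z^d -> Z^n -> Z^r -> 0, with maps b^T and A, is exact. *)
Definition short_exact (d n r : nat) (b : 'M[int]_(d, n)) (A : 'M[int]_(r, n)) :
    Prop :=
  [/\ injective (fun m : 'cV[int]_d => b^T *m m),
      forall u : 'cV[int]_n, A *m u = 0 <-> exists m, u = b^T *m m &
      forall t : 'cV[int]_r, exists u : 'cV[int]_n, A *m u = t].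

(** * The homogeneous coordinate ring R[x_1, ..., x_n] *)

Definition mdegree (n r : nat) (A : 'M[int]_(r, n)) (m : 'X_{1..n}) :
    'cV[int]_r := A *m (\col_i (m i)%:Z).

(* R (x) S_D *)
Definition supp_in (R : comNzRingType) (n r : nat) (A : 'M[int]_(r, n))
    (D : seq 'cV[int]_r) : set {mpoly R[n]} :=
  [set f | forall m, m \in msupp f -> mdegree A m \in D].

(* R (x) S_p *)
Definition graded_piece (R : comNzRingType) (n r : nat) (A : 'M[int]_(r, n))
    (p : 'cV[int]_r) : set {mpoly R[n]} := supp_in A [:: p].

Definition component (R : comNzRingType) (n r : nat) (A : 'M[int]_(r, n))
    (p : 'cV[int]_r) (f : {mpoly R[n]}) : {mpoly R[n]} :=
  \sum_(m <- msupp f | mdegree A m == p) f@_m *: 'X_[m].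

Definition is_graded (R : comNzRingType) (n r : nat) (A : 'M[int]_(r, n))
    (L : set {mpoly R[n]}) : Prop :=
  forall p f, L f -> L (component A p f).

Definition irrelevant_gen (R : comNzRingType) (n : nat) (s : {set 'I_n}) :
    {mpoly R[n]} := \prod_(i | i \notin s) 'X_i.

(* (I : B^oo) = I; the ideal B^N is generated by the N-fold products of the
   generators of B. *)
Definition is_saturated (R : comNzRingType) (n : nat) (Delta : {set {set 'I_n}})
    (I : set {mpoly R[n]}) : Prop :=
  forall f, (exists N, forall t : N.-tuple {set 'I_n},
               (forall s, s \in t -> s \in Delta) ->
               I ((\prod_(s <- t) irrelevant_gen R s) * f)) -> I f.

(** * Closed subschemes of X x Spec R *)

(* X x Spec R is covered by the affine charts U_s = Spec R[M_s], for s in Delta,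
   where M_s is the monoid of the characters m in Z^d with <m, b_i> >= 0 for all
   i in s; moreover the intersection of U_s and U_t is U_(s :&: t).  Elements of
   R[Z^d] are finitely supported functions on Z^d. *)

Definition laurent (R : comNzRingType) (d : nat) := {freeg 'cV[int]_d / R}.

Definition dual_monoid (d n : nat) (b : 'M[int]_(d, n)) (s : {set 'I_n}) :
    set 'cV[int]_d :=
  [set m | forall i, i \in s -> 0 <= (b^T *m m) i 0].

Definition chart_ring (R : comNzRingType) (d n : nat) (b : 'M[int]_(d, n))
    (s : {set 'I_n}) : set (laurent R d) :=
  [set g | forall m, coeff m g != 0 -> dual_monoid b s m].

(* Multiplication by the character m. *)
Definition translate (R : comNzRingType) (d : nat) (m : 'cV[int]_d)
    (g : laurent R d) : laurent R d :=
  \sum_(x <- dom g) << coeff x g *g (m + x) >>.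

Definition is_chart_ideal (R : comNzRingType) (d n : nat) (b : 'M[int]_(d, n))
    (s : {set 'I_n}) (N : set (laurent R d)) : Prop :=
  [/\ N `<=` chart_ring b s, is_submodule N &
      forall m g, dual_monoid b s m -> N g -> N (translate m g)].

(* The ideals of the charts of a closed subscheme. *)
Definition chart_ideals (R : comNzRingType) (d n : nat)
    (Delta : {set {set 'I_n}}) : Type :=
  {s : {set 'I_n} | s \in Delta} -> set (laurent R d).

(* A closed subscheme is a quasi-coherent sheaf of ideals: for t a face of s,
   the ideal on the open subset U_t of U_s is generated by the one on U_s. *)
Definition is_closed_subscheme (R : comNzRingType) (d n : nat)
    (b : 'M[int]_(d, n)) (Delta : {set {set 'I_n}})
    (Y : chart_ideals R d Delta) : Prop :=
  (forall s, is_chart_ideal b (val s) (Y s)) /\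
  (forall s t : {s : {set 'I_n} | s \in Delta}, val t \subset val s ->
     Y t = smallest (@is_chart_ideal R d n b (val t)) (Y s)).

Definition flat_over_base (R : comNzRingType) (d n : nat)
    (b : 'M[int]_(d, n)) (Delta : {set {set 'I_n}})
    (Y : chart_ideals R d Delta) : Prop :=
  forall s, is_flat (@chart_ring R d n b (val s)) (Y s).

Definition subscheme_base_change (R R' : comNzRingType) (phi : R -> R')
    (d n : nat) (Delta : {set {set 'I_n}}) (Y : chart_ideals R d Delta) :
    chart_ideals R' d Delta :=
  fun s => span [set g' | exists2 g, Y s g &
                          forall m, coeff m g' = phi (coeff m g)].

(* g = f / x^u in R[Z^d], for f homogeneous of the same degree as x^u; the
   character m is the Laurent monomial x^(b^T m). *)
Definition dehomogenizes (R : comNzRingType) (d n : nat) (b : 'M[int]_(d, n))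
    (u : 'X_{1..n}) (f : {mpoly R[n]}) (g : laurent R d) : Prop :=
  forall m : 'cV[int]_d, coeff m g =
    if [forall i, 0 <= (b^T *m m) i 0 + (u i)%:Z]
    then f@_[multinom absz ((b^T *m m) i 0 + (u i)%:Z)%R | i < n] else 0.

(* The degree zero part of the localization of I at \prod_(i | i \notin s) x_i. *)
Definition chart_of_ideal (R : comNzRingType) (d n r : nat)
    (b : 'M[int]_(d, n)) (A : 'M[int]_(r, n)) (I : set {mpoly R[n]})
    (s : {set 'I_n}) : set (laurent R d) :=
  [set g | exists (u : 'X_{1..n}) f,
     [/\ forall i, i \in s -> u i = 0%N, I f,
         graded_piece A (mdegree A u) f & dehomogenizes b u f g]].

(* I is the homogeneous B-saturated ideal of Y. *)
Definition is_saturated_ideal_of (R : comNzRingType) (d n r : nat)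
    (b : 'M[int]_(d, n)) (A : 'M[int]_(r, n)) (Delta : {set {set 'I_n}})
    (Y : chart_ideals R d Delta) (I : set {mpoly R[n]}) : Prop :=
  [/\ is_ideal I, is_graded A I, is_saturated Delta I &
      forall s, Y s = chart_of_ideal b A I (val s)].

(** * Hilbert polynomials *)

Definition nef_monoid (n r : nat) (A : 'M[int]_(r, n))
    (Delta : {set {set 'I_n}}) : set 'cV[int]_r :=
  [set t | forall s, s \in Delta ->
     exists c : 'I_n -> nat, t = \sum_(i | i \notin s) col i A *+ c i].

Definition eval_at (r : nat) (P : {mpoly rat[r]}) (t : 'cV[int]_r) : rat :=
  P.@[fun i => (t i 0)%:~R].

(* P = P_{S/I} *)
Definition is_hilbert_poly (F : fieldType) (n r : nat) (A : 'M[int]_(r, n))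
    (Delta : {set {set 'I_n}}) (I : set {mpoly F[n]}) (P : {mpoly rat[r]}) :
    Prop :=
  exists vs : seq 'cV[int]_r, forall t,
    (forall v, v \in vs -> nef_monoid A Delta (t - v)) ->
    exists2 q : nat, has_dim (@graded_piece F n r A t) I q &
                     eval_at P t = q%:R.

Definition has_hilbert_poly (F : fieldType) (d n r : nat) (b : 'M[int]_(d, n))
    (A : 'M[int]_(r, n)) (Delta : {set {set 'I_n}})
    (Y : chart_ideals F d Delta) (P : {mpoly rat[r]}) : Prop :=
  exists2 I, is_saturated_ideal_of b A Y I & is_hilbert_poly A Delta I P.

Definition multigraded_hilbert_poly (k : fieldType) (d n r : nat)
    (b : 'M[int]_(d, n)) (A : 'M[int]_(r, n)) (Delta : {set {set 'I_n}})
    (P : {mpoly rat[r]}) : Prop :=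
  exists2 Y : chart_ideals k d Delta,
    is_closed_subscheme b Y & has_hilbert_poly b A Y P.

(* phi exhibits F as the residue field of R at the prime ker phi. *)
Definition is_residue_field (R : comNzRingType) (F : fieldType) (phi : R -> F) :
    Prop :=
  forall z : F, exists x y : R, phi y != 0 /\ z = phi x / phi y.

(** * Functors from k-algebras to sets *)

(* A functor R |-> F(R) is given by F(R) as a subset of a type; the inclusion
   of the image of F(R) in F(R') is part of [is_functor]. *)
Record functor_data (k : fieldType) := FunctorData {
  carrier : comAlgType k -> Type;
  points : forall R : comAlgType k, set (carrier R);
  base_change : forall R R' : comAlgType k,
    {lrmorphism R -> R'} -> carrier R -> carrier R'
}.

Definition is_functor (k : fieldType) (F : functor_data k) : Prop :=
  [/\ forall (R R' : comAlgType k) (phi : {lrmorphism R -> R'}) x,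
        points x -> points (base_change (f := F) phi x),
      forall (R : comAlgType k) (x : carrier F R),
        points x -> base_change (idfun : {lrmorphism R -> R}) x = x &
      forall (R R' R'' : comAlgType k) (phi : {lrmorphism R -> R'})
          (psi : {lrmorphism R' -> R''}) (x : carrier F R),
        points x ->
        base_change (psi \o phi) x = base_change psi (base_change phi x)].

Definition is_natural (k : fieldType) (F G : functor_data k)
    (eta : forall R, carrier F R -> carrier G R) : Prop :=
  [/\ is_functor F, is_functor G,
      forall R x, points x -> points (eta R x) &
      forall (R R' : comAlgType k) (phi : {lrmorphism R -> R'}) x, points x ->
        eta R' (base_change phi x) = base_change phi (eta R x)].

Definition isomorphic (k : fieldType) (F G : functor_data k) : Prop :=
  exists2 eta : forall R, carrier F R -> carrier G R, is_natural eta &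
    forall R (y : carrier G R), points y ->
      exists! x : carrier F R, points x /\ eta R x = y.

(* eta is a monomorphism, and its pullback along each y : Spec R -> G is the
   closed subscheme Spec (R / a) of Spec R, for some ideal a of R. *)
Definition is_closed_embedding (k : fieldType) (F G : functor_data k)
    (eta : forall R, carrier F R -> carrier G R) : Prop :=
  [/\ is_natural eta,
      forall R x x', points x -> points x' -> eta R x = eta R x' -> x = x' &
      forall (R : comAlgType k) (y : carrier G R), points y ->
        exists2 a : set R, is_ideal a &
        forall (R' : comAlgType k) (phi : {lrmorphism R -> R'}),
          (exists2 x, points x & eta R' x = base_change phi y) <->
          (forall c, a c -> phi c = 0)].

(** * Projective schemes *)

Definition is_homogeneous_ideal (k : fieldType) (n : nat)
    (J : set {mpoly k[n]}) : Prop :=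
  is_ideal J /\ forall e f, J f -> J (pihomog [measure of mdeg] e f).

Definition linear_form (R : comNzRingType) (n : nat) (v : 'rV[R]_n) :
    {mpoly R[n]} := \sum_i v 0 i *: 'X_i.

(* The functor of points of V(J) in P^N over k: the rank one locally free
   quotients Q = R^(N+1) / L such that each form f in J, of degree e, vanishes
   in Sym^e Q = Q^(x)e; since Sym Q = R[y_0, ..., y_N] / (L), this means that f
   lies in the ideal generated by the linear forms in L. *)
Definition projective_scheme (k : fieldType) (N : nat)
    (J : set {mpoly k[N.+1]}) : functor_data k :=
  {| carrier := fun R => set 'rV[R]_N.+1;
     points := fun R => [set L | [/\ is_submodule L, locally_free setT L 1%N &
       forall f, J f ->
         ideal_gen (@linear_form R N.+1 @` L) (map_mpoly (in_alg R) f)]];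
     base_change := fun R R' phi L => span (map_mx phi @` L) |}.

Definition representable_by_projective_scheme (k : fieldType)
    (F : functor_data k) : Prop :=
  exists N (J : set {mpoly k[N.+1]}),
    is_homogeneous_ideal J /\ isomorphic F (projective_scheme J).

(** * The functors Hilb_X^P and H^P_{S_D} *)

Definition Hilb (k : fieldType) (d n r : nat) (b : 'M[int]_(d, n))
    (A : 'M[int]_(r, n)) (Delta : {set {set 'I_n}}) (P : {mpoly rat[r]}) :
    functor_data k :=
  {| carrier := fun R => chart_ideals R d Delta;
     points := fun R => [set Y | [/\ is_closed_subscheme b Y,
       flat_over_base b Y &
       forall (F : fieldType) (phi : {rmorphism R -> F}),
         is_residue_field phi ->
         has_hilbert_poly b A (subscheme_base_change phi Y) P]];
     base_change := fun R R' phi Y => subscheme_base_change phi Y |}.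

Definition HSD (k : fieldType) (n r : nat) (A : 'M[int]_(r, n))
    (P : {mpoly rat[r]}) (D : seq 'cV[int]_r) : functor_data k :=
  {| carrier := fun R => set {mpoly R[n]};
     points := fun R => [set L | [/\
       [/\ is_submodule L, L `<=` supp_in A D & is_graded A L],
       forall p q f m, p \in D -> q \in D -> L f -> graded_piece A p f ->
         mdegree A m = q - p -> L ('X_[m] * f) &
       forall p, p \in D -> exists2 q : nat, eval_at P p = q%:R &
         locally_free (graded_piece A p) L q]];
     base_change := fun R R' phi L => span (map_mpoly phi @` L) |}.

Definition is_canonical_map (k : fieldType) (d n r : nat) (b : 'M[int]_(d, n))
    (A : 'M[int]_(r, n)) (Delta : {set {set 'I_n}}) (P : {mpoly rat[r]})
    (D : seq 'cV[int]_r)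
    (eta : forall R, carrier (Hilb k b A Delta P) R -> carrier (HSD k A P D) R) :
    Prop :=
  forall R (Y : carrier (Hilb k b A Delta P) R), points Y ->
    exists2 I, is_saturated_ideal_of b A Y I & eta R Y = I `&` supp_in A D.

(* Main.v *)
From HB Require Import structures.
From mathcomp Require Import all_boot all_order all_algebra.
From mathcomp Require Import ring zify.
From mathcomp Require Import boolp classical_sets functions reals.
From mathcomp Require polyrcf.
From mathcomp.multinomials Require Import freeg mpoly.
Require Import Defs.

Set Implicit Arguments.
Unset Strict Implicit.
Unset Printing Implicit Defensive.

Import Order.TTheory GRing.Theory Num.Theory.
Local Open Scope ring_scope.
Local Open Scope classical_set_scope.

(** Fix an ample degree h.  Castelnuovo-Mumford regularity, bounded uniformly in terms of P, yields finitely many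
    rays p + N h, with union T, such that on every fibre the Hilbert function of the saturated ideal agrees with P
    on T.  Hence a flat family Y is the same thing as submodules L_p of S_p, for p in T, compatible with
    multiplication by monomials and with S_p / L_p locally free of rank P(p).

    Some finite subset D of T controls all monomial ideals with Hilbert function P on D (Haiman-Sturmfels), hence,
    through initial ideals, all L in H_{S_D}: the submodule generated by L never has corank larger than P(p) in a
    degree p of T.  So L comes from a family Y if and only if these coranks are not smaller either, that is, if
    certain minors vanish; this is the closed condition cutting out Hilb in H_{S_D}.

    Finally L is a point of a Grassmannian of S_D.  In terms of Pluecker coordinates, L is spanned by vectors whose
    entries are the coordinates, so the Grassmannian, the stability of L under multiplication, and the vanishing of
    the minors are all described by explicit homogeneous equations. *)

(** * Submodules, spans and ideals *)

(** Neither sheaf cohomology nor Noetherian hypotheses are at hand: the test rings [R] are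
    arbitrary. What cohomology would give comes from a generic hyperplane section, with equation
    $\ell = \sum_j z^j g_j$ in a new variable [z]. McCoy's argument makes $\ell$ a nonzerodivisor
    modulo every saturated family, so no associated primes are avoided, and the same $\ell$ serves a
    local ring and its residue field. The regularity bound and the lifting of the ideal of a fibre
    are both inductions along $\ell$.

    Local freeness of rank [q] of a quotient of $R^m$ is read off from minors, as in the Fitting
    criterion: those of size $m-q+1$ vanish, which is tested in local rings, and those of size $m-q$
    generate the unit ideal, which is tested in residue fields.

    The finitely many rays come from iterated differences: deep in the nef cone, Hilbert functions
    have vanishing differences of a known order, so a finite grid of starting points determines
    them.

    A locally free quotient is handled as an idempotent matrix, a line bundle quotient as a matrix
    of rank one; this spares the choice of local trivializations. *)

Section Submodules.
Variables (R : nzRingType) (V : lmodType R).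
Implicit Types (N G : set V).

Lemma sm0 N : is_submodule N -> N 0. Proof. by case. Qed.

Lemma smD N u v : is_submodule N -> N u -> N v -> N (u + v).
Proof. by case=> _ H hu hv; rewrite -[u]scale1r; apply: H. Qed.

Lemma smZ N a u : is_submodule N -> N u -> N (a *: u).
Proof. by case=> h0 H hu; rewrite -[_ *: _]addr0; apply: H. Qed.

Lemma smN N u : is_submodule N -> N u -> N (- u).
Proof. by move=> H hu; rewrite -scaleN1r; apply: smZ. Qed.

Lemma smB N u v : is_submodule N -> N u -> N v -> N (u - v).
Proof. by move=> H hu hv; apply: smD => //; apply: smN. Qed.

Lemma sm_sum N (I : Type) (r : seq I) (Q : pred I) (F : I -> V) :
  is_submodule N -> (forall i, Q i -> N (F i)) -> N (\sum_(i <- r | Q i) F i).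
Proof.
move=> H hF; elim/big_rec: _ => [|i x Qi hx]; first exact: sm0.
by apply: smD => //; apply: hF.
Qed.

Lemma smBr N u v : is_submodule N -> N v -> N (u - v) -> N u.
Proof. by move=> H hv huv; rewrite -(subrK v u); apply: smD. Qed.

Lemma smI N N' : is_submodule N -> is_submodule N' -> is_submodule (N `&` N').
Proof.
move=> H H'; split; first by split; apply: sm0.
move=> a u v [hu hu'] [hv hv']; split; first by case: H => _; apply.
by case: H' => _; apply.
Qed.

Definition smadd N N' : set V := [set v | exists2 u, N u & N' (v - u)].

Lemma smadd_sm N N' : is_submodule N -> is_submodule N' ->
  is_submodule (smadd N N').
Proof.
move=> H H'; split; first by exists 0; [exact: sm0|rewrite subr0; exact: sm0].
move=> a u v [x hx hx'] [y hy hy']; exists (a *: x + y).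
  by apply: smD => //; apply: smZ.
rewrite (_ : _ - _ = a *: (u - x) + (v - y)); last by rewrite scalerBr opprD addrACA.
by apply: smD => //; apply: smZ.
Qed.

Lemma smadd_l N N' : is_submodule N' -> N `<=` smadd N N'.
Proof. by move=> H v hv; exists v => //; rewrite subrr; apply: sm0. Qed.

Lemma smadd_r N N' : is_submodule N -> N' `<=` smadd N N'.
Proof. by move=> H v hv; exists 0; [apply: sm0|rewrite subr0]. Qed.

Lemma span_min G N : is_submodule N -> G `<=` N -> span G `<=` N.
Proof. by move=> H GN v; apply. Qed.

Lemma span_sub G : G `<=` span G.
Proof. by move=> v Gv N [_]; apply. Qed.

Lemma span_sm G : is_submodule (span G).
Proof.
split; first by move=> N [H _]; apply: sm0.
move=> a u v hu hv N [H GN]; apply: smD => //; last exact: hv.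
by apply: smZ => //; apply: hu.
Qed.

Lemma spanP G v : span G v <->
  exists (q : nat) (c : 'I_q -> R) (g : 'I_q -> V),
    (forall i, G (g i)) /\ v = \sum_i c i *: g i.
Proof.
split; last first.
  case=> q [c] [g] [hg ->]; apply: (sm_sum _ (span_sm G)) => i _.
  by apply: (smZ _ (span_sm G)); apply: span_sub.
pose N := [set v | exists (q : nat) (c : 'I_q -> R) (g : 'I_q -> V),
    (forall i, G (g i)) /\ v = \sum_i c i *: g i].
apply: (@span_min G N); last first.
  move=> w Gw; exists 1%N, (fun=> 1), (fun=> w); split => //.
  by rewrite big_ord1 scale1r.
split; first by exists 0%N, (fun=> 0), (fun=> 0); rewrite big_ord0; split=> // -[].
move=> a u w [q [c [g [hg ->]]]] [q' [c' [g' [hg' ->]]]].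
exists (q + q')%N, (fun i => match fintype.split i with inl j => a * c j | inr j => c' j end),
  (fun i => match fintype.split i with inl j => g j | inr j => g' j end).
split; first by move=> i; case: (fintype.split i).
rewrite big_split_ord /=; congr (_ + _).
  rewrite scaler_sumr; apply: eq_bigr => i _.
  by rewrite -[lshift _ _]/(unsplit (inl i)) unsplitK scalerA.
by apply: eq_bigr => i _; rewrite -[rshift _ _]/(unsplit (inr i)) unsplitK.
Qed.

End Submodules.

Section Ideals.
Variable T : comNzRingType.
Implicit Types (I G : set T).

Lemma id0 I : is_ideal I -> I 0. Proof. by case. Qed.

Lemma idM I a x : is_ideal I -> I x -> I (a * x).
Proof. by case=> h0 H hx; rewrite -[_ * _]addr0; apply: H. Qed.

Lemma idMr I a x : is_ideal I -> I x -> I (x * a).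
Proof. by rewrite mulrC; apply: idM. Qed.

Lemma idD I x y : is_ideal I -> I x -> I y -> I (x + y).
Proof. by case=> h0 H hx hy; rewrite -[x]mul1r; apply: H. Qed.

Lemma idN I x : is_ideal I -> I x -> I (- x).
Proof. by move=> H hx; rewrite -mulN1r; apply: idM. Qed.

Lemma id_sum I (J : Type) (r : seq J) (Q : pred J) (F : J -> T) :
  is_ideal I -> (forall i, Q i -> I (F i)) -> I (\sum_(i <- r | Q i) F i).
Proof.
move=> H hF; elim/big_rec: _ => [|i x Qi hx]; first exact: id0.
by apply: idD => //; apply: hF.
Qed.

Lemma idgen_min G I : is_ideal I -> G `<=` I -> ideal_gen G `<=` I.
Proof. by move=> H GN v; apply. Qed.

Lemma idgen_sub G : G `<=` ideal_gen G.
Proof. by move=> v Gv N [_]; apply. Qed.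

Lemma idgen_id G : is_ideal (ideal_gen G).
Proof.
split; first by move=> N [H _]; apply: id0.
move=> a u v hu hv N [H GN]; apply: idD => //; last exact: hv.
by apply: idM => //; apply: hu.
Qed.

Lemma idgenP G v : ideal_gen G v <->
  exists (q : nat) (c : 'I_q -> T) (g : 'I_q -> T),
    (forall i, G (g i)) /\ v = \sum_i c i * g i.
Proof. exact: (@spanP _ T^o G v). Qed.

Lemma idgen_seqP (s : seq T) v : ideal_gen [set` s] v ->
  exists c : 'I_(size s) -> T, v = \sum_i c i * s`_i.
Proof.
apply: (@idgen_min _ [set v | exists c : 'I_(size s) -> T, v = \sum_i c i * s`_i]).
  split; first by exists (fun=> 0); rewrite big1 // => i _; rewrite mul0r.
  move=> a x y [c ->] [c' ->]; exists (fun i => a * c i + c' i).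
  rewrite mulr_sumr -big_split /=; apply: eq_bigr => i _.
  by rewrite mulrDl mulrA.
move=> x /= xs; have hx := xs; rewrite -index_mem in hx.
exists (fun i => (i == Ordinal hx)%:R); rewrite (bigD1 (Ordinal hx)) //= eqxx mul1r nth_index //.
by rewrite big1 ?addr0 // => i /negPf->; rewrite mul0r.
Qed.

Definition is_maximal I := [/\ is_ideal I, ~ I 1 &
  forall x, ~ I x -> exists y, I (1 - x * y)].

Lemma maximal_ideal I : is_ideal I -> ~ I 1 ->
  exists2 M, is_maximal M & I `<=` M.
Proof.
move=> HI h1.
pose P := [set J | [/\ is_ideal J, I `<=` J & ~ J 1] \/ J = set0].
have [|M [HM maxM]] := @Zorn_bigcup T P.
  move=> F FP totF.
  have [[J FJ [HJ IJ J1]]|no] := pselect (exists2 J, F J & [/\ is_ideal J, I `<=` J & ~ J 1]);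
    last first.
    right; apply/seteqP; split => // x [J FJ Jx].
    have [HJ|J0] := FP _ FJ; first by case: no; exists J.
    by rewrite J0 in Jx.
  left; split.
  - split; first by exists J => //; apply: id0.
    move=> a x y [A FA Ax] [B FB By].
    have [AB|BA] := totF _ _ FA FB.
      exists B => //; have [[HB _ _]|B0] := FP _ FB; last by rewrite B0 in By.
      by case: HB => _; apply => //; apply: AB.
    exists A => //; have [[HB _ _]|B0] := FP _ FA; last by rewrite B0 in Ax.
    by case: HB => _; apply => //; apply: BA.
  - by move=> x Ix; exists J => //; apply: IJ.
  - move=> [A FA A1]; have [[_ _]|A0] := FP _ FA; first by [].
    by rewrite A0 in A1.
case: HM => [[HM IM M1]|M0]; last first.
  case: (maxM I); last by left; split.
  by rewrite M0; split => // H; apply: (H 0); apply: id0.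
exists M => //; split => // x Mx.
pose J := [set y | exists a, M (y - x * a)].
have HJ : is_ideal J.
  split; first by exists 0; rewrite mulr0 subrr; apply: id0.
  move=> a u v [p hp] [q hq]; exists (a * p + q).
  rewrite (_ : _ - _ = a * (u - x * p) + (v - x * q)); last by ring.
  by apply: idD => //; apply: idM.
have MJ : M `<=` J by move=> y My; exists 0; rewrite mulr0 subr0.
have [//|J1] := pselect (J 1).
case: (maxM J); last by left; split => // y /IM /MJ.
split => // JM; apply: Mx; apply: JM; exists 1.
by rewrite mulr1 subrr; apply: id0.
Qed.

Lemma maximal_prime I x y : is_maximal I -> I (x * y) -> I x \/ I y.
Proof.
move=> [HI _ mI] Ixy; have [|Ix] := pselect (I x); first by left.
right; have [z hz] := mI _ Ix.
rewrite (_ : y = (1 - x * z) * y + z * (x * y)); last by ring.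
by apply: idD => //; [apply: idMr|apply: idM].
Qed.

Lemma maximal_pow I x N : is_maximal I -> I (x ^+ N) -> I x.
Proof.
move=> HI; elim: N => [|N IH]; first by case: HI => H h1 _; rewrite expr0.
by rewrite exprS => /(maximal_prime HI) [].
Qed.

(** A maximal ideal above [I] would contain a power of each generator, hence each generator, since
    it is prime. *)
Lemma unit_ideal_powers I (s : seq T) : is_ideal I -> ideal_gen [set` s] 1 ->
  (forall f, f \in s -> exists N, I (f ^+ N)) -> I 1.
Proof.
move=> HI h1 hs; apply: contrapT => I1.
have [M HM IM] := maximal_ideal HI I1.
have [HMi M1 _] := HM; apply: M1; apply: (idgen_min HMi) h1.
by move=> f /= /hs [N /IM /(maximal_pow HM)].
Qed.

Lemma local_eq0 (x : T) (s : seq T) : ideal_gen [set` s] 1 ->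
  (forall f, f \in s -> exists N, f ^+ N * x = 0) -> x = 0.
Proof.
move=> h1 hs; rewrite -[x]mul1r.
apply: (@unit_ideal_powers [set a | a * x = 0] s) => //=.
split=> /=; first by rewrite mul0r.
by move=> a u v hu hv; rewrite mulrDl -mulrA hu hv mulr0 addr0.
Qed.

End Ideals.

Lemma finite_bound (T : finType) (P : T -> nat -> Prop) :
  (forall x N N', (N <= N')%N -> P x N -> P x N') ->
  (forall x, exists N, P x N) -> exists N, forall x, P x N.
Proof.
move=> mono /choice [f hf]; exists (\max_x f x)%N => x.
by apply: (mono x (f x)) => //; apply: leq_bigmax.
Qed.

Lemma seq_bound (T : eqType) (s : seq T) (P : T -> nat -> Prop) :
  (forall x N N', (N <= N')%N -> P x N -> P x N') ->
  (forall x, x \in s -> exists N, P x N) -> exists N, forall x, x \in s -> P x N.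
Proof.
move=> mono; elim: s => [|y s IH] hs; first by exists 0%N.
have [|N hN] := IH; first by move=> x xs; apply: hs; rewrite in_cons xs orbT.
have [N' hN'] := hs y (mem_head _ _).
exists (maxn N N') => x; rewrite in_cons => /orP [/eqP->|/hN h].
  by apply: mono hN'; rewrite leq_maxr.
by apply: mono h; rewrite leq_maxl.
Qed.

(** * Localization of a quotient ring *)

(* S^-1 (R / I); taking I = 0 gives localizations, S = {1} quotients, and
   S the complement of a prime ideal I gives residue fields. *)
Record fqdata (R : comNzRingType) := FQData {
  fqI : set R; fqS : set R;
  fqI_ideal : is_ideal fqI; fqS1 : fqS 1;
  fqSM : forall x y, fqS x -> fqS y -> fqS (x * y);
  fqSI : forall x, fqS x -> ~ fqI x }.

Section FQ.
Variables (R : comNzRingType) (X : fqdata R).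
Local Notation I := (fqI X).
Local Notation S := (fqS X).
Let HI := fqI_ideal X.

Definition fqrel (r s r' s' : R) := exists2 u, S u & I (u * (r * s' - r' * s)).

Definition fqset (r s : R) : set (R * R) := [set p | S p.2 /\ fqrel r s p.1 p.2].

(** Fractions are equivalence classes of pairs, so that equal fractions are Leibniz equal, as the
    ring structures require. *)
Definition fq := {A : set (R * R) | exists r s, S s /\ A = fqset r s}.

Lemma fqrel_refl r s : fqrel r s r s.
Proof. by exists 1; [apply: fqS1|rewrite subrr mulr0; apply: id0]. Qed.

Lemma fqrel_sym r s r' s' : fqrel r s r' s' -> fqrel r' s' r s.
Proof.
case=> u Su h; exists u => //; rewrite (_ : _ * _ = - (u * (r * s' - r' * s))); last by ring.
exact: idN.
Qed.

Lemma fqrel_trans r s r' s' r'' s'' : S s' ->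
  fqrel r s r' s' -> fqrel r' s' r'' s'' -> fqrel r s r'' s''.
Proof.
move=> Ss' [u Su h] [v Sv h']; exists (u * v * s').
  by do 2?apply: fqSM.
rewrite (_ : _ * _ = v * s'' * (u * (r * s' - r' * s)) + u * s * (v * (r' * s'' - r'' * s'))); last by ring.
by apply: idD => //; apply: idM.
Qed.

Definition fqpick (s : R) : R := if pselect (S s) then s else 1.

Lemma fqpickS s : S (fqpick s).
Proof. by rewrite /fqpick; case: pselect => h //; apply: fqS1. Qed.

Lemma fqpickE s : S s -> fqpick s = s.
Proof. by rewrite /fqpick; case: pselect. Qed.

(* r / s, with the junk value r / 1 if s is not in S *)
Definition fqf (r s : R) : fq.
Proof. by exists (fqset r (fqpick s)); exists r, (fqpick s); split => //; apply: fqpickS. Defined.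

Lemma fqfP r s r' s' : S s -> S s' -> fqf r s = fqf r' s' <-> fqrel r s r' s'.
Proof.
move=> Ss Ss'; split=> [[]|h].
  rewrite !fqpickE // => e.
  have : fqset r' s' (r', s') by split => //; apply: fqrel_refl.
  by rewrite -e => -[_].
apply: eq_exist; rewrite !fqpickE //; apply/seteqP; split=> -[a b] [/= Sb h'].
  by split => //; apply: fqrel_trans h' => //; apply: fqrel_sym.
by split => //; apply: fqrel_trans h'.
Qed.

Lemma fq_rep (x : fq) : exists r s, S s /\ x = fqf r s.
Proof.
case: x => A [r [s [Ss e]]]; exists r, s; split => //.
by apply: eq_exist; rewrite fqpickE.
Qed.

Definition fqn (x : fq) : R := projT1 (cid (fq_rep x)).
Definition fqd (x : fq) : R := projT1 (cid (projT2 (cid (fq_rep x)))).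

Lemma fqdS x : S (fqd x).
Proof. by rewrite /fqd; case: cid => r hr /=; case: cid => s [] /=. Qed.

Lemma fqK x : fqf (fqn x) (fqd x) = x.
Proof. by rewrite /fqn /fqd; case: cid => r hr /=; case: cid => s [] /=. Qed.

Lemma fqndP r s : S s -> fqrel (fqn (fqf r s)) (fqd (fqf r s)) r s.
Proof. by move=> Ss; apply/fqfP => //; [apply: fqdS|rewrite fqK]. Qed.

HB.instance Definition _ := gen_eqMixin fq.
HB.instance Definition _ := gen_choiceMixin fq.

Definition fqadd (x y : fq) := fqf (fqn x * fqd y + fqn y * fqd x) (fqd x * fqd y).
Definition fqmul (x y : fq) := fqf (fqn x * fqn y) (fqd x * fqd y).
Definition fqopp (x : fq) := fqf (- fqn x) (fqd x).

Lemma fqaddE r s r' s' : S s -> S s' ->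
  fqadd (fqf r s) (fqf r' s') = fqf (r * s' + r' * s) (s * s').
Proof.
move=> Ss Ss'; rewrite /fqadd.
have [u Su h] := fqndP r Ss; have [v Sv h'] := fqndP r' Ss'.
have Sb := fqdS (fqf r s); have Sd := fqdS (fqf r' s').
set a := fqn (fqf r s) in h *; set b := fqd (fqf r s) in h Sb *.
set c := fqn (fqf r' s') in h' *; set d := fqd (fqf r' s') in h' Sd *.
apply/fqfP; try exact: fqSM.
exists (u * v); first exact: fqSM.
rewrite (_ : _ * _ = v * d * s' * (u * (a * s - r * b)) + u * s * b * (v * (c * s' - r' * d))); last by ring.
by apply: idD => //; apply: idM.
Qed.

Lemma fqmulE r s r' s' : S s -> S s' ->
  fqmul (fqf r s) (fqf r' s') = fqf (r * r') (s * s').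
Proof.
move=> Ss Ss'; rewrite /fqmul.
have [u Su h] := fqndP r Ss; have [v Sv h'] := fqndP r' Ss'.
have Sb := fqdS (fqf r s); have Sd := fqdS (fqf r' s').
set a := fqn (fqf r s) in h *; set b := fqd (fqf r s) in h Sb *.
set c := fqn (fqf r' s') in h' *; set d := fqd (fqf r' s') in h' Sd *.
apply/fqfP; try exact: fqSM.
exists (u * v); first exact: fqSM.
rewrite (_ : _ * _ = v * c * s' * (u * (a * s - r * b)) + u * r * b * (v * (c * s' - r' * d))); last by ring.
by apply: idD => //; apply: idM.
Qed.

Lemma fqoppE r s : S s -> fqopp (fqf r s) = fqf (- r) s.
Proof.
move=> Ss; rewrite /fqopp; have [u Su h] := fqndP r Ss; have Sb := fqdS (fqf r s).
set a := fqn (fqf r s) in h *; set b := fqd (fqf r s) in h Sb *.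
apply/fqfP => //; exists u => //; rewrite (_ : _ * _ = - (u * (a * s - r * b))); last by ring.
exact: idN.
Qed.

Lemma fq_eq r s r' s' : S s -> S s' -> r * s' = r' * s -> fqf r s = fqf r' s'.
Proof.
move=> Ss Ss' e; apply/fqfP => //; exists 1; first exact: fqS1.
by rewrite e subrr mulr0; apply: id0.
Qed.

Local Notation S1 := (fqS1 X).

Lemma fqaddA : associative fqadd.
Proof.
move=> x y z; have [a [a' [Sa ->]]] := fq_rep x; have [b [b' [Sb ->]]] := fq_rep y.
have [c [c' [Sc ->]]] := fq_rep z.
rewrite !fqaddE //; try by [apply: fqSM]; apply: fq_eq; do ?[apply: fqSM] => //; ring.
Qed.

Lemma fqaddC : commutative fqadd.
Proof.
move=> x y; have [a [a' [Sa ->]]] := fq_rep x; have [b [b' [Sb ->]]] := fq_rep y.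
by rewrite !fqaddE //; apply: fq_eq; do ?[apply: fqSM] => //; ring.
Qed.

Lemma fqadd0 : left_id (fqf 0 1) fqadd.
Proof.
move=> x; have [a [a' [Sa ->]]] := fq_rep x.
rewrite !fqaddE //; try exact: S1; apply: fq_eq; do ?[apply: fqSM] => //; try exact: S1; ring.
Qed.

Lemma fqaddN : left_inverse (fqf 0 1) fqopp fqadd.
Proof.
move=> x; have [a [a' [Sa ->]]] := fq_rep x.
rewrite fqoppE // !fqaddE //; apply: fq_eq; do ?[apply: fqSM] => //; try exact: S1; ring.
Qed.

HB.instance Definition _ := GRing.isZmodule.Build fq fqaddA fqaddC fqadd0 fqaddN.

Lemma fqmulA : associative fqmul.
Proof.
move=> x y z; have [a [a' [Sa ->]]] := fq_rep x; have [b [b' [Sb ->]]] := fq_rep y.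
have [c [c' [Sc ->]]] := fq_rep z.
rewrite !fqmulE //; try by [apply: fqSM]; apply: fq_eq; do ?[apply: fqSM] => //; ring.
Qed.

Lemma fqmulC : commutative fqmul.
Proof.
move=> x y; have [a [a' [Sa ->]]] := fq_rep x; have [b [b' [Sb ->]]] := fq_rep y.
by rewrite !fqmulE //; apply: fq_eq; do ?[apply: fqSM] => //; ring.
Qed.

Lemma fqmul1 : left_id (fqf 1 1) fqmul.
Proof.
move=> x; have [a [a' [Sa ->]]] := fq_rep x.
rewrite !fqmulE //; try exact: S1; apply: fq_eq; do ?[apply: fqSM] => //; try exact: S1; ring.
Qed.

Lemma fqmulDl : left_distributive fqmul fqadd.
Proof.
move=> x y z; have [a [a' [Sa ->]]] := fq_rep x; have [b [b' [Sb ->]]] := fq_rep y.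
have [c [c' [Sc ->]]] := fq_rep z.
rewrite !(fqmulE, fqaddE) //; try by [apply: fqSM]; apply: fq_eq; do ?[apply: fqSM] => //; ring.
Qed.

Lemma fq1_neq0 : fqf 1 1 != fqf 0 1.
Proof.
apply/eqP => /(fqfP _ _ S1 S1) [u Su]; rewrite !mulr1 subr0 mulr1.
exact: fqSI.
Qed.

HB.instance Definition _ := GRing.Zmodule_isComNzRing.Build fq
  fqmulA fqmulC fqmul1 fqmulDl fq1_neq0.

Definition fqi (r : R) : fq := fqf r 1.

Lemma fqi_additive : additive fqi.
Proof.
move=> x y; rewrite /fqi -[fqf x 1 - fqf y 1]/(fqadd _ (fqopp _)) fqoppE ?fqaddE; try exact: S1.
by rewrite !mulr1.
Qed.

Lemma fqi_multiplicative : multiplicative fqi.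
Proof.
split=> // x y; rewrite /fqi -[fqf x 1 * fqf y 1]/(fqmul _ _) fqmulE; try exact: S1.
by rewrite mulr1.
Qed.

HB.instance Definition _ := GRing.isAdditive.Build R fq fqi fqi_additive.
HB.instance Definition _ := GRing.isMultiplicative.Build R fq fqi fqi_multiplicative.

Lemma fqi_eq0 r : fqi r = 0 <-> exists2 u, S u & I (u * r).
Proof.
rewrite /fqi; split=> [/(fqfP _ _ S1 S1)|] [u Su h].
  by exists u => //; rewrite !mulr1 subr0 in h.
by apply/(fqfP _ _ S1 S1); exists u => //; rewrite !mulr1 subr0.
Qed.

Lemma fqi_unit s : S s -> exists y, fqi s * y = 1.
Proof.
move=> Ss; exists (fqf 1 s); rewrite -[LHS]/(fqmul _ _) fqmulE //; try exact: S1.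
by apply: fq_eq; do ?[apply: fqSM] => //; try exact: S1; ring.
Qed.

Lemma fq_frac (x : fq) : exists r s, S s /\ fqi s * x = fqi r.
Proof.
have [r [s [Ss ->]]] := fq_rep x; exists r, s; split => //.
rewrite -[LHS]/(fqmul _ _) fqmulE //; try exact: S1.
by apply: fq_eq; do ?[apply: fqSM] => //; try exact: S1; ring.
Qed.

End FQ.

Section FQLift.
Variables (R T : comNzRingType) (X : fqdata R) (phi : {rmorphism R -> T}).
Hypothesis (phiI : forall x, fqI X x -> phi x = 0).
Hypothesis (phiS : forall x, fqS X x -> exists y, phi x * y = 1).

Definition fqlift (x : fq X) : T := phi (fqn x) * projT1 (cid (phiS (fqdS x))).

Lemma fqlift_spec x : phi (fqd x) * fqlift x = phi (fqn x).
Proof. by rewrite /fqlift; case: cid => y /= e; rewrite mulrCA e mulr1. Qed.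

(** Any presentation $x = r/s$ determines the value of the lift; additivity and multiplicativity
    follow from this without returning to the chosen representatives. *)
Lemma fqlift_uniq x r s t : fqS X s -> fqi X s * x = fqi X r -> phi s * t = phi r ->
  fqlift x = t.
Proof.
move=> Ss e e'.
have e2 : fqi X (s * fqn x) = fqi X (r * fqd x).
  have e3 : fqi X (fqn x) = fqi X (fqd x) * x.
    rewrite -{3}(fqK x) -[RHS]/(fqmul _ _) fqmulE //; last exact: fqdS; last exact: fqS1.
    by apply: fq_eq; rewrite ?mul1r; [exact: fqS1|exact: fqdS|rewrite mulr1 mulrC].
  by rewrite !rmorphM /= e3 mulrCA e mulrC.
have [u Su hu] : exists2 u, fqS X u & fqI X (u * (s * fqn x - r * fqd x)).
  by apply/fqi_eq0; rewrite rmorphB /= e2 subrr.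
have := phiI hu; rewrite rmorphM rmorphB !rmorphM -fqlift_spec -e' => e4.
have [v hv] := phiS Su; have [w hw] := phiS Ss; have [z hz] := phiS (fqdS x).
have : phi s * phi (fqd x) * (fqlift x - t) = 0.
  rewrite -[LHS]mul1r -hv (_ : _ * _ = v * (phi u * (phi s * (phi (fqd x) * fqlift x) - phi s * t * phi (fqd x)))); last by ring.
  by rewrite e4 mulr0.
move=> /(congr1 (fun c => w * z * c)).
rewrite mulr0 (_ : _ * _ = (phi s * w) * (phi (fqd x) * z) * (fqlift x - t)); last by ring.
by rewrite hw hz !mul1r => /eqP; rewrite subr_eq0 => /eqP.
Qed.

Lemma fqlift_i r : fqlift (fqi X r) = phi r.
Proof. by apply: (@fqlift_uniq _ r 1); rewrite ?rmorph1 ?mul1r //; exact: fqS1. Qed.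

Lemma fqlift_eq x r s : fqS X s -> fqi X s * x = fqi X r -> phi s * fqlift x = phi r.
Proof.
move=> Ss e; have [w hw] := phiS Ss.
rewrite (@fqlift_uniq x r s (w * phi r)) //; last by rewrite mulrA hw mul1r.
by rewrite mulrA hw mul1r.
Qed.

Lemma fqlift_additive : additive fqlift.
Proof.
move=> x y; have [r [s [Ss e]]] := fq_frac x; have [r' [s' [Ss' e']]] := fq_frac y.
apply: (@fqlift_uniq _ (r * s' - r' * s) (s * s')); first exact: fqSM.
  by rewrite rmorphB !rmorphM /= -e -e'; ring.
by rewrite rmorphB !rmorphM /= -(fqlift_eq Ss e) -(fqlift_eq Ss' e'); ring.
Qed.

Lemma fqlift_multiplicative : multiplicative fqlift.
Proof.
split; last by rewrite -[1](rmorph1 (fqi X)) fqlift_i rmorph1.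
move=> x y; have [r [s [Ss e]]] := fq_frac x; have [r' [s' [Ss' e']]] := fq_frac y.
apply: (@fqlift_uniq _ (r * r') (s * s')); first exact: fqSM.
  by rewrite !rmorphM /= -e -e'; ring.
by rewrite !rmorphM /= -(fqlift_eq Ss e) -(fqlift_eq Ss' e'); ring.
Qed.

Definition fqliftR : {rmorphism fq X -> T} :=
  HB.pack_for {rmorphism fq X -> T} fqlift
    (GRing.isAdditive.Build _ _ fqlift fqlift_additive)
    (GRing.isMultiplicative.Build _ _ fqlift fqlift_multiplicative).

Lemma fqliftR_i r : fqliftR (fqi X r) = phi r. Proof. exact: fqlift_i. Qed.

End FQLift.

Section Fieldify.
Variables (T : comNzRingType) (H : forall x : T, x <> 0 -> exists y, x * y = 1).

(** The dummy [let] keeps [H] in the type, so that the field structure below can be attached to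
    it. *)
Definition fieldify : Type := let _ := H in T.

HB.instance Definition _ := GRing.ComNzRing.copy fieldify T.

Definition fieldify_inv (x : fieldify) : fieldify :=
  match pselect ((x : T) <> 0) with
  | left h => projT1 (cid (H h)) | right _ => 0 end.

Lemma fieldify_mulVf (x : fieldify) : x != 0 -> fieldify_inv x * x = 1.
Proof.
move/eqP=> x0; rewrite /fieldify_inv; case: pselect => // h.
by case: cid => y /= e; rewrite mulrC.
Qed.

Lemma fieldify_inv0 : fieldify_inv 0 = 0.
Proof. by rewrite /fieldify_inv; case: pselect. Qed.

HB.instance Definition _ := GRing.ComNzRing_isField.Build fieldify fieldify_mulVf fieldify_inv0.

End Fieldify.

(** * Quotient modules and restriction of scalars *)

Section QuotMod.
Variables (R : nzRingType) (V : lmodType R) (N : set V) (HN : is_submodule N).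

Definition qm := let _ := HN in {A : set V | exists v, A = [set w | N (w - v)]}.

Definition qmi (v : V) : qm := exist _ [set w | N (w - v)] (ex_intro _ v erefl).

Lemma qmiP u v : qmi u = qmi v <-> N (u - v).
Proof.
split=> [[e]|h].
  have hu : [set w | N (w - u)] u by rewrite /= subrr; apply: sm0.
  by rewrite e in hu.
apply: eq_exist; apply/seteqP; split=> w /= hw.
  by rewrite -(subrKA u); apply: smD.
rewrite -(subrKA v); apply: smD => //.
by rewrite -opprB; apply: smN.
Qed.

Lemma qm_rep (x : qm) : exists v, x = qmi v.
Proof. by case: x => A [v e]; exists v; apply: eq_exist. Qed.

Definition qmr (x : qm) : V := projT1 (cid (qm_rep x)).

Lemma qmrK x : qmi (qmr x) = x.
Proof. by rewrite /qmr; case: cid. Qed.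

Lemma qmiK v : N (qmr (qmi v) - v).
Proof. by apply/qmiP; rewrite qmrK. Qed.

HB.instance Definition _ := gen_eqMixin qm.
HB.instance Definition _ := gen_choiceMixin qm.

Definition qmadd (x y : qm) := qmi (qmr x + qmr y).
Definition qmopp (x : qm) := qmi (- qmr x).
Definition qmscale (a : R) (x : qm) := qmi (a *: qmr x).

Lemma qmaddE u v : qmadd (qmi u) (qmi v) = qmi (u + v).
Proof. by apply/qmiP; rewrite opprD addrACA; apply: smD => //; apply: qmiK. Qed.

Lemma qmoppE u : qmopp (qmi u) = qmi (- u).
Proof. by apply/qmiP; rewrite -opprD; apply: smN => //; apply: qmiK. Qed.

Lemma qmscaleE a u : qmscale a (qmi u) = qmi (a *: u).
Proof. by apply/qmiP; rewrite -scalerBr; apply: smZ => //; apply: qmiK. Qed.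

Lemma qmaddA : associative qmadd.
Proof.
move=> x y z; have [a ->] := qm_rep x; have [b ->] := qm_rep y; have [c ->] := qm_rep z.
by rewrite !qmaddE addrA.
Qed.

Lemma qmaddC : commutative qmadd.
Proof. by move=> x y; rewrite /qmadd addrC. Qed.

Lemma qmadd0 : left_id (qmi 0) qmadd.
Proof. by move=> x; have [a ->] := qm_rep x; rewrite qmaddE add0r. Qed.

Lemma qmaddN : left_inverse (qmi 0) qmopp qmadd.
Proof. by move=> x; have [a ->] := qm_rep x; rewrite qmoppE qmaddE addNr. Qed.

HB.instance Definition _ := GRing.isZmodule.Build qm qmaddA qmaddC qmadd0 qmaddN.

Lemma qmscaleA a b x : qmscale a (qmscale b x) = qmscale (a * b) x.
Proof. by have [u ->] := qm_rep x; rewrite !qmscaleE scalerA. Qed.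

Lemma qmscale1 : left_id 1 qmscale.
Proof. by move=> x; have [u ->] := qm_rep x; rewrite qmscaleE scale1r. Qed.

Lemma qmscaleDr : right_distributive qmscale +%R.
Proof.
move=> a x y; have [u ->] := qm_rep x; have [v ->] := qm_rep y.
by rewrite -[qmi u + qmi v]/(qmadd _ _) qmaddE !qmscaleE -[RHS]/(qmadd _ _) qmaddE scalerDr.
Qed.

Lemma qmscaleDl x : {morph qmscale^~ x : a b / a + b}.
Proof.
move=> a b; have [u ->] := qm_rep x.
by rewrite !qmscaleE -[RHS]/(qmadd _ _) qmaddE scalerDl.
Qed.

HB.instance Definition _ := GRing.Zmodule_isLmodule.Build R qm
  qmscaleA qmscale1 qmscaleDr qmscaleDl.

Lemma qmi_linear a u v : qmi (a *: u + v) = a *: qmi u + qmi v.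
Proof. by rewrite -[RHS]/(qmadd (qmscale _ _) _) qmscaleE qmaddE. Qed.

Lemma qmi_eq0 u : qmi u = 0 <-> N u.
Proof. by rewrite -[0]/(qmi 0) qmiP subr0. Qed.

Lemma qmi_sum (I : Type) (r : seq I) (P : pred I) (F : I -> V) :
  qmi (\sum_(i <- r | P i) F i) = \sum_(i <- r | P i) qmi (F i).
Proof.
apply: (big_morph qmi) => // u v; have := qmi_linear 1 u v.
by rewrite !scale1r.
Qed.

End QuotMod.

Section Restriction.
Variables (R F : nzRingType) (phi : {rmorphism R -> F}) (W : lmodType F).

(** Restriction of scalars along [phi]; the dummy [let] keeps [phi] in the type, so that the
    [R]-module structure can be attached to it. *)
Definition rs : Type := let _ := phi in W.

HB.instance Definition _ := GRing.Zmodule.copy rs W.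

Definition rsscale (a : R) (w : rs) : rs := phi a *: (w : W).

Lemma rsscaleA a b x : rsscale a (rsscale b x) = rsscale (a * b) x.
Proof. by rewrite /rsscale scalerA rmorphM. Qed.

Lemma rsscale1 : left_id 1 rsscale.
Proof. by move=> x; rewrite /rsscale rmorph1 scale1r. Qed.

Lemma rsscaleDr : right_distributive rsscale +%R.
Proof. by move=> a x y; rewrite /rsscale scalerDr. Qed.

Lemma rsscaleDl x : {morph rsscale^~ x : a b / a + b}.
Proof. by move=> a b; rewrite /rsscale rmorphD scalerDl. Qed.

HB.instance Definition _ := GRing.Zmodule_isLmodule.Build R rs
  rsscaleA rsscale1 rsscaleDr rsscaleDl.

Lemma rsscaleE (a : R) (w : rs) : a *: w = phi a *: (w : W) :> W.
Proof. by []. Qed.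

End Restriction.

(** * Residue fields and local rings *)

Section Residue.
Variables (R : comNzRingType) (M : set R) (HM : is_maximal M).

Lemma resid_S (x : R) : [set x | x = 1] x -> ~ M x.
Proof. by move=> /= ->; case: HM. Qed.

Definition resid_data : fqdata R :=
  @FQData R M [set x | x = 1] (let: And3 h _ _ := HM in h) erefl
    (fun x y (hx : x = 1) (hy : y = 1) => etrans (congr2 *%R hx hy) (mulr1 1)) resid_S.

Lemma resid_field (x : fq resid_data) : x <> 0 -> exists y, x * y = 1.
Proof.
have [r [s [/= -> e]]] := fq_frac x; rewrite rmorph1 mul1r in e; subst x => x0.
have [HI _ mI] := HM.
have [|y hy] := mI r.
  by move=> Mr; apply: x0; apply/fqi_eq0; exists 1 => //; rewrite mul1r.
exists (fqi _ y); rewrite -rmorphM /=; apply/eqP; rewrite eq_sym -subr_eq0 -(rmorph1 (fqi resid_data)) -rmorphB.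
by apply/eqP/fqi_eq0; exists 1 => //; rewrite mul1r.
Qed.

Definition resid : fieldType := fieldify resid_field.

Definition resid_map : {rmorphism R -> resid} := fqi resid_data.

Lemma resid_map_eq0 x : resid_map x = 0 <-> M x.
Proof.
rewrite -[resid_map x]/(fqi resid_data x) -[0]/(0 : fq resid_data) fqi_eq0.
split=> [[u /= ->]|Mx]; first by rewrite mul1r.
by exists 1 => //; rewrite mul1r.
Qed.

Lemma resid_is_residue : is_residue_field resid_map.
Proof.
move=> z; have [r [s [/= -> e]]] := fq_frac (z : fq resid_data).
exists r, 1; rewrite rmorph1 oner_neq0 divr1; split => //.
by rewrite rmorph1 mul1r in e.
Qed.

End Residue.

(** Otherwise [I] lies in a maximal ideal, whose residue field kills it. In this form conditions at
    points become global ones. *)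
Lemma residue_ideal_unit (R : comNzRingType) (I : set R) : is_ideal I ->
  (forall (F : fieldType) (phi : {rmorphism R -> F}), is_residue_field phi ->
     exists2 x, I x & phi x != 0) -> I 1.
Proof.
move=> HI H; apply: contrapT => I1; have [M HM IM] := maximal_ideal HI I1.
have [x Ix /eqP] := H _ _ (@resid_is_residue _ _ HM); apply.
by apply/resid_map_eq0; apply: IM.
Qed.

(** The annihilator of [x] is contained in no maximal ideal. *)
Lemma residue_eq0 (R : comNzRingType) (x : R) :
  (forall (F : fieldType) (phi : {rmorphism R -> F}), is_residue_field phi ->
     exists2 s, phi s != 0 & s * x = 0) -> x = 0.
Proof.
move=> H; rewrite -[x]mul1r.
apply: (@residue_ideal_unit _ [set a | a * x = 0]) => /=.
  split=> /=; first by rewrite mul0r.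
  by move=> a u v hu hv; rewrite mulrDl -mulrA hu hv mulr0 addr0.
by move=> F phi /H [s ? ?]; exists s.
Qed.

(** [R] is a local ring with residue field [F] and residue map [phi]. *)
Definition local_map (R : comNzRingType) (F : fieldType) (phi : {rmorphism R -> F}) :=
  (forall z, exists x, phi x = z) /\ (forall x, phi x != 0 -> exists y, x * y = 1).

Section LocalizationAt.
Variables (R : comNzRingType) (F : fieldType) (phi : {rmorphism R -> F}).

Definition loc_data : fqdata R.
Proof.
refine (@FQData R [set 0] [set x | phi x != 0] _ _ _ _).
- by split=> // a x y -> -> /=; rewrite mulr0 addr0.
- by rewrite /= rmorph1 oner_neq0.
- by move=> x y /= hx hy; rewrite rmorphM mulf_neq0.
- by move=> x /= /eqP h e; apply: h; rewrite e rmorph0.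
Defined.

Lemma locI x : fqI loc_data x -> phi x = 0. Proof. by move=> ->; rewrite rmorph0. Qed.

Lemma locS x : fqS loc_data x -> exists y, phi x * y = 1.
Proof. by move=> h; exists (phi x)^-1; rewrite divff. Qed.

Definition locR : comNzRingType := fq loc_data.
Definition loci : {rmorphism R -> locR} := fqi loc_data.
Definition locphi : {rmorphism locR -> F} := fqliftR locI locS.

Lemma locphi_i r : locphi (loci r) = phi r. Proof. exact: fqliftR_i. Qed.

Lemma loci_eq0 r : loci r = 0 <-> exists2 s, phi s != 0 & s * r = 0.
Proof. exact: (@fqi_eq0 _ loc_data r). Qed.

Lemma loc_frac (x : locR) : exists r s, phi s != 0 /\ loci s * x = loci r.
Proof. exact: (@fq_frac _ loc_data x). Qed.

Lemma loci_unit s : phi s != 0 -> exists y, loci s * y = 1.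
Proof. exact: (@fqi_unit _ loc_data s). Qed.

Lemma locphi_unit x : locphi x != 0 -> exists y, x * y = 1.
Proof.
have [r [s [Ss e]]] := loc_frac x => h.
have [|y hy] := @loci_unit r.
  by rewrite -locphi_i -e rmorphM locphi_i mulf_neq0.
by exists (loci s * y); rewrite mulrA [x * _]mulrC e.
Qed.

Lemma locphi_local : is_residue_field phi -> local_map locphi.
Proof.
move=> res; split; last exact: locphi_unit.
move=> z; have [x [y [hy ->]]] := res z; have [w hw] := loci_unit hy.
exists (loci x * w); rewrite rmorphM locphi_i; congr (_ * _).
have := congr1 locphi hw; rewrite rmorphM locphi_i rmorph1 => e.
by apply: (mulfI hy); rewrite e divff.
Qed.

End LocalizationAt.

(** * Dimensions of subquotients over a field *)

Section HasDim.
Variables (F : fieldType).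

(** Writing a basis modulo [N'] in a basis modulo [N] gives a matrix with independent rows. If the
    dimensions agree, it is invertible, and the first basis also spans modulo [N]. *)
Lemma has_dim_le (V : lmodType F) (V0 N N' : set V) q q' :
  is_submodule V0 -> is_submodule N -> (forall v, V0 v -> N v -> N' v) ->
  has_dim V0 N q -> has_dim V0 N' q' ->
  (q' <= q)%N /\ (q = q' -> is_submodule N' -> forall v, V0 v -> N' v -> N v).
Proof.
move=> HV HN NN' [e [eV eS eI]] [e' [eV' eS' eI']].
have [c hc] := choice (fun j => eS _ (eV' j)).
pose A : 'M_(q', q) := \matrix_(j, k) c j k.
have sumA u : N (\sum_j u j *: e' j - \sum_k (\sum_j u j * c j k) *: e k).
  rewrite (_ : _ - _ = \sum_j u j *: (e' j - \sum_k c j k *: e k)).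
    by apply: sm_sum => // j _; apply: smZ.
  rewrite [RHS](eq_bigr (fun j => u j *: e' j - \sum_k (u j * c j k) *: e k)); last first.
    by move=> j _; rewrite scalerBr scaler_sumr; congr (_ - _); apply: eq_bigr => k _; rewrite scalerA.
  rewrite sumrB [X in _ = _ - X]exchange_big /=; congr (_ - _).
  by apply: eq_bigr => k _; rewrite scaler_suml.
have rfA : row_free A.
  apply/inj_row_free => u uA0; apply/rowP => j; rewrite mxE.
  apply: (eI' (u 0)); apply: NN'; first by apply: sm_sum => // i _; apply: smZ.
  apply: smBr (sumA (u 0)) => //; rewrite big1; first exact: sm0.
  move=> k _.
  have -> : \sum_j u 0 j * c j k = (u *m A) 0 k.
    by rewrite [RHS]mxE; apply: eq_bigr => j' _; rewrite [A _ _]mxE.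
  by rewrite uA0 mxE scale0r.
have le : (q' <= q)%N by rewrite -(eqP rfA) rank_leq_col.
split => // eqq HN' v V0v N'v; subst q'.
have uA : A \in unitmx by rewrite -row_free_unit.
have [a ha] := eS _ V0v.
pose u := \row_k a k *m invmx A.
have eu k : \sum_j u 0 j * c j k = a k.
  have : (u *m A) 0 k = a k by rewrite mulmxKV // mxE.
  by rewrite mxE => <-; apply: eq_bigr => j _; rewrite [A _ _]mxE.
have hv : N (v - \sum_j u 0 j *: e' j).
  rewrite -(subrKA (\sum_k a k *: e k)); apply: smD => //.
  rewrite -opprB; apply: smN => //.
  by have := sumA (u 0); under [X in N (_ - X)]eq_bigr do rewrite eu.
suff e0 j : u 0 j = 0.
  by move: hv; rewrite big1 ?subr0 // => j _; rewrite e0 scale0r.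
apply: (eI' (u 0)).
have VS : V0 (\sum_j u 0 j *: e' j) by apply: sm_sum => // i _; apply: smZ.
rewrite -(subKr v (\sum_j _)); apply: smB => //; apply: NN' => //.
exact: smB.
Qed.

Lemma has_dim_uniq (V : lmodType F) (V0 N : set V) q q' :
  is_submodule V0 -> is_submodule N -> has_dim V0 N q -> has_dim V0 N q' -> q = q'.
Proof.
move=> HV HN h h'; apply/eqP; rewrite eqn_leq.
by rewrite (proj1 (has_dim_le HV HN _ h h')) // (proj1 (has_dim_le HV HN _ h' h)).
Qed.

Lemma has_dim_ext (V : lmodType F) (V0 N N' : set V) q :
  is_submodule V0 -> (forall v, V0 v -> N v <-> N' v) -> has_dim V0 N q -> has_dim V0 N' q.
Proof.
move=> HV NN' [e [eV eS eI]]; exists e.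
have VS c : V0 (\sum_j c j *: e j) by apply: sm_sum => // i _; apply: smZ.
split => // [v V0v|c h]; last by apply: eI; apply/NN'.
have [c hc] := eS _ V0v; exists c; apply/NN' => //.
exact: smB.
Qed.

(** Additivity along $0 \to V_1/N_1 \to V_2/N_2 \to V_2/(N_2 + f(V_1)) \to 0$; the hypothesis
    comparing [N2] and [N1] is exactness on the left. *)
Lemma has_dim_exact (V V' : lmodType F) (f : V -> V') (V1 N1 : set V) (V2 N2 : set V') q1 q3 :
  (forall a u v, f (a *: u + v) = a *: f u + f v) ->
  is_submodule V1 -> is_submodule V2 -> is_submodule N2 -> is_submodule N1 ->
  (forall v, V1 v -> V2 (f v)) -> (forall v, V1 v -> N2 (f v) <-> N1 v) ->
  has_dim V1 N1 q1 -> has_dim V2 (smadd N2 (f @` V1)) q3 ->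
  has_dim V2 N2 (q1 + q3).
Proof.
move=> fL HV1 HV2 HN2 HN1 fV fN [e [eV eS eI]] [e' [eV' eS' eI']].
have f0 : f 0 = 0.
  by apply: (addIr (f 0)); rewrite -{1}(scale1r (f 0)) -fL scale1r !add0r.
have fB u v : f (u - v) = f u - f v.
  by rewrite addrC -scaleN1r fL scaleN1r addrC.
have fsum q (c : 'I_q -> F) (x : 'I_q -> V) :
    f (\sum_j c j *: x j) = \sum_j c j *: f (x j).
  elim/big_rec2: _ => // i y y' _ <-; by rewrite fL.
exists (fun i => match fintype.split i with inl j => f (e j) | inr j => e' j end).
have sumE (c : 'I_(q1 + q3) -> F) :
    \sum_j c j *: (match fintype.split j with inl j => f (e j) | inr j => e' j end) =
    f (\sum_j c (lshift q3 j) *: e j) + \sum_j c (rshift q1 j) *: e' j.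
  rewrite big_split_ord fsum /=; congr (_ + _); apply: eq_bigr => j _.
    by rewrite -{2}[lshift _ _]/(unsplit (inl j)) unsplitK.
  by rewrite -{2}[rshift _ _]/(unsplit (inr j)) unsplitK.
split.
- by move=> i; case: (fintype.split i) => j //; apply: fV.
- move=> v V2v; have [c' [u N2u [w V1w hw]]] := eS' _ V2v.
  have [c hc] := eS _ V1w.
  exists (fun i => match fintype.split i with inl j => c j | inr j => c' j end).
  rewrite sumE.
  under eq_bigr do rewrite -[lshift _ _]/(unsplit (inl _)) unsplitK.
  under [X in f _ + X]eq_bigr do rewrite -[rshift _ _]/(unsplit (inr _)) unsplitK.
  have -> : v - (f (\sum_i c i *: e i) + \sum_i c' i *: e' i) =
            u + f (w - \sum_i c i *: e i).
    rewrite fB hw; move: (f _) (\sum_i c' i *: _) => x y.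
    by rewrite [RHS]addrA [u + _]addrC subrK opprD addrA addrAC.
  apply: smD => //; apply/fN => //.
  by apply: smB => //; apply: sm_sum => // i _; apply: smZ.
- move=> c; rewrite sumE => h.
  have VS : V1 (\sum_j c (lshift q3 j) *: e j).
    by apply: sm_sum => // i _; apply: smZ.
  have c3 : forall j, c (rshift q1 j) = 0.
    apply: eI'; exists (f (\sum_j c (lshift q3 j) *: e j) + \sum_j c (rshift q1 j) *: e' j) => //.
    exists (- \sum_j c (lshift q3 j) *: e j); first exact: smN.
    by rewrite -[- _]sub0r fB f0 sub0r opprD addrCA subrr addr0.
  have c1 : forall j, c (lshift q3 j) = 0.
    apply: eI; apply/fN => //; move: h.
    by rewrite [X in _ + X]big1 ?addr0 // => j _; rewrite c3 scale0r.
  by move=> j; rewrite -(splitK j); case: (fintype.split j) => j' /=.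
Qed.

End HasDim.

(** * Matrices acting on families of vectors *)

Section AdjModule.
Variables (R : comNzRingType) (V : lmodType R).

Lemma mx_sum_comp m p (B : 'M[R]_(m, p)) n (C : 'M[R]_(p, n)) (x : 'I_n -> V) i :
  \sum_k B i k *: (\sum_j C k j *: x j) = \sum_j (B *m C) i j *: x j.
Proof.
under eq_bigr do rewrite scaler_sumr; rewrite exchange_big; apply: eq_bigr => j _.
by rewrite mxE scaler_suml; apply: eq_bigr => k _; rewrite scalerA.
Qed.

Lemma adj_module (N : set V) m (M : 'M[R]_m) (x : 'I_m -> V) : is_submodule N ->
  (forall k, N (\sum_j M k j *: x j)) -> forall i, N (\det M *: x i).
Proof.
move=> HN h i.
have -> : \det M *: x i = \sum_k (\adj M) i k *: (\sum_j M k j *: x j).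
  rewrite mx_sum_comp mul_adj_mx (bigD1 i) //= mxE eqxx mulr1n big1 ?addr0 // => j /negPf ji.
  by rewrite mxE eq_sym ji mulr0n scale0r.
by apply: sm_sum => // k _; apply: smZ.
Qed.

End AdjModule.

Section LocalLinear.
Variables (R : comNzRingType) (F : fieldType) (phi : {rmorphism R -> F}).
Hypothesis (Hphi : local_map phi).

Lemma local_lift_fun (T : Type) (z : T -> F) : exists x : T -> R, forall t, phi (x t) = z t.
Proof.
have H t : exists y, phi y = z t by case: Hphi => H _; apply: H.
by have [x hx] := choice H; exists x.
Qed.

(** The matrix $1 - \mu$ becomes the identity over [F], so its determinant is a unit and the
    determinant trick [adj_module] applies. *)
Lemma local_nakayama (V : lmodType R) (N : set V) m (x : 'I_m -> V) (mu : 'I_m -> 'I_m -> R) :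
  is_submodule N -> (forall i j, phi (mu i j) = 0) ->
  (forall i, N (x i - \sum_j mu i j *: x j)) -> forall i, N (x i).
Proof.
move=> HN mu0 h i.
pose M : 'M[R]_m := 1%:M - \matrix_(i, j) mu i j.
have [|y hy] := (proj2 Hphi) (\det M).
  rewrite -det_map_mx (_ : map_mx phi M = 1%:M) ?det1 ?oner_neq0 //.
  by apply/matrixP => a c; rewrite !mxE rmorphB mu0 subr0 rmorph_nat.
rewrite -[x i]scale1r -hy mulrC -scalerA; apply: smZ => //.
apply: (@adj_module _ _ N _ M) => // k.
rewrite (_ : \sum_j _ = x k - \sum_j mu k j *: x j) //.
rewrite (eq_bigr (fun j => (k == j)%:R *: x j - mu k j *: x j)); last first.
  by move=> j _; rewrite !mxE scalerBl.
rewrite sumrB; congr (_ - _); rewrite (bigD1 k) //= eqxx scale1r big1 ?addr0 // => j jk.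
by rewrite eq_sym (negPf jk) scale0r.
Qed.

(** Independent rows over the residue field have a right inverse; a lift of it is a right inverse up
    to a matrix whose determinant is a unit. *)
Lemma local_row_free q (K : finType) (a : 'I_q -> K -> R) :
  (forall c : 'I_q -> F, (forall x, \sum_j c j * phi (a j x) = 0) -> forall j, c j = 0) ->
  forall e : 'I_q -> R, (forall x, \sum_j e j * a j x = 0) -> forall j, e j = 0.
Proof.
move=> indep e he j.
pose A : 'M[R]_(q, #|K|) := \matrix_(j, x) a j (enum_val x).
have rf : row_free (map_mx phi A).
  apply/inj_row_free => u uA; apply/rowP => i; rewrite mxE; apply: (indep (u 0)) => x.
  have e0 : (u *m map_mx phi A) 0 (enum_rank x) = 0 by rewrite uA mxE.
  rewrite mxE in e0; rewrite -[RHS]e0.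
  by apply: eq_bigr => l _; rewrite !mxE enum_rankK.
have [B hB] := row_freeP rf.
have [b hb] := local_lift_fun (fun p : 'I_#|K| * 'I_q => B p.1 p.2).
pose B' : 'M[R]_(#|K|, q) := \matrix_(x, j) b (x, j).
have eB : map_mx phi B' = B by apply/matrixP => x i; rewrite !mxE hb.
have [|y hy] := (proj2 Hphi) (\det (A *m B')).
  by rewrite -det_map_mx map_mxM eB hB det1 oner_neq0.
have z : \row_j e j *m (A *m B') = 0.
  rewrite mulmxA (_ : \row_j e j *m A = 0) ?mul0mx //.
  by apply/rowP => x; rewrite !mxE -[RHS](he (enum_val x)); apply: eq_bigr => i _; rewrite !mxE.
have : \row_j e j *m (A *m B') *m \adj (A *m B') = 0 by rewrite z mul0mx.
rewrite -mulmxA mul_mx_adj mul_mx_scalar => /rowP /(_ j); rewrite !mxE => e0.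
by rewrite -[e j]mul1r -hy mulrAC e0 mul0r.
Qed.

End LocalLinear.

(** * Locally free quotients of free modules *)

Section LocFree.
Variables (R : comNzRingType) (m q : nat).

(** Over $R_f$ the idempotent [E] factors as $X \cdot f^{-N} Y$ through $R_f^q$, and $f^{-N} Y X$ is
    the identity: its image is free of rank [q]. Powers of [f] clear the denominators. *)
Definition lf_at (E : 'M[R]_m) (f : R) := exists N (X : 'M[R]_(m, q)) (Y : 'M[R]_(q, m)),
  f ^+ N *: E = X *m Y /\ Y *m X = (f ^+ N)%:M.

Definition lf_proj (E : 'M[R]_m) := E *m E = E /\
  exists fs : seq R, ideal_gen [set` fs] 1 /\ forall f, f \in fs -> lf_at E f.

Definition lker (E : 'M[R]_m) : set 'rV[R]_m := [set v | v *m E = 0].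

Lemma lker_sm E : is_submodule (lker E).
Proof.
split=> [|a u v]; rewrite /lker /= ?mul0mx // => hu hv.
by rewrite mulmxDl -scalemxAl hu hv scaler0 addr0.
Qed.

Lemma lf_projP (E : 'M[R]_m) : lf_proj E -> locally_free setT (lker E) q.
Proof.
move=> [EE [fs [h1 hfs]]]; exists fs; split => // f ffs.
have [N [X [Y [e1 e2]]]] := hfs _ ffs.
exists (fun j => row j Y); split => //.
  move=> v _; exists N, (fun j => (v *m X) 0 j).
  rewrite (_ : \sum_j _ = v *m X *m Y); last by rewrite [RHS]mulmx_sum_row.
  rewrite /lker /= mulmxBl -[v *m X *m Y]mulmxA -e1 -scalemxAr -!scalemxAl.
  by rewrite -mulmxA EE subrr.
move=> c; rewrite (_ : \sum_j _ = \row_j c j *m Y); last first.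
  by rewrite mulmx_sum_row; apply: eq_bigr => j _; rewrite mxE.
rewrite /lker /= => h; exists (N + N)%N => j.
have : \row_j c j *m Y *m (f ^+ N *: E) *m X = 0 by rewrite -scalemxAr h scaler0 mul0mx.
rewrite e1 !mulmxA -[_ *m Y *m X]mulmxA e2 mul_mx_scalar -[_ *m Y *m X]mulmxA e2 mul_mx_scalar scalerA -exprD.
by move/rowP/(_ j); rewrite !mxE.
Qed.

(** A locally free quotient of $R^m$ is projective, hence split off by an idempotent. The idempotent
    is glued from local splittings $C Y$ by a partition of unity. *)
Lemma lf_proj_of (K : set 'rV[R]_m) : is_submodule K -> locally_free setT K q ->
  exists2 E, lf_proj E & K = lker E.
Proof.
move=> HK [fs [h1 hfs]].
have step1 f : f \in fs -> exists N (C : 'M[R]_(m, q)) (Y : 'M[R]_(q, m)),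
    [/\ forall i, K (row i ((f ^+ N)%:M - C *m Y)),
     forall c : 'rV_q, K (c *m Y) -> exists N0, f ^+ N0 *: c = 0 &
     forall v, K v -> exists N0, f ^+ N0 *: (v *m C) = 0].
  move=> /hfs [e [_ eS eI]].
  pose Y := \matrix_(j < q) e j.
  have sumE (c : 'I_q -> R) : \sum_j c j *: e j = \row_j c j *m Y.
    by rewrite mulmx_sum_row; apply: eq_bigr => j _; rewrite mxE rowK.
  have eI' (c : 'rV_q) : K (c *m Y) -> exists N0, f ^+ N0 *: c = 0.
    move=> h; case: (eI (c 0)) => [|N0 hN]; last by exists N0; apply/rowP => j; rewrite !mxE hN.
    by rewrite sumE (_ : \row_j c 0 j = c) //; apply/rowP => j; rewrite mxE.
  have [N hN] : exists N, forall i : 'I_m, exists c : 'rV_q, K (f ^+ N *: delta_mx 0 i - c *m Y).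
    apply: (finite_bound (P := fun i N => exists c : 'rV_q, K (f ^+ N *: delta_mx 0 i - c *m Y))).
      move=> i N N' NN' [c hc]; exists (f ^+ (N' - N) *: c).
      rewrite -{1}(subnK NN') exprD -scalerA -scalemxAl -scalerBr.
      exact: smZ.
    move=> i; have [N [c hc]] := eS (delta_mx 0 i) I.
    by exists N, (\row_j c j); rewrite -sumE.
  have [c hc] := choice hN.
  pose C := \matrix_(i < m) c i.
  have rowC i : K (row i ((f ^+ N)%:M - C *m Y)).
    rewrite linearB /= row_mul rowK (_ : row i _ = f ^+ N *: delta_mx 0 i) //.
    by apply/rowP => j; rewrite !mxE eqxx /= mulr_natr eq_sym.
  exists N, C, Y; split => // v Kv; apply: eI'.
  rewrite -mulmxA (_ : C *m Y = (f ^+ N)%:M - ((f ^+ N)%:M - C *m Y)); last by rewrite subKr.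
  rewrite mulmxBr mul_mx_scalar; apply: smB => //; first exact: smZ.
  by rewrite mulmx_sum_row; apply: sm_sum => // i _; apply: smZ.
have rowsK (A : 'M[R]_m) v : (forall i, K (row i A)) -> K (v *m A).
  by move=> h; rewrite mulmx_sum_row; apply: sm_sum => // i _; apply: smZ.
have step2 f : f \in fs -> exists N (C : 'M[R]_(m, q)) (Y : 'M[R]_(q, m)),
    [/\ forall i, K (row i ((f ^+ N)%:M - C *m Y)), Y *m C = (f ^+ N)%:M &
     forall v, K v -> v *m C = 0].
  move=> ffs; have [N [C [Y [h1' h2 h3]]]] := step1 _ ffs.
  (* One power of [f] must kill all of [K], which is not known to be finitely generated. Over each
     $R_g$ of the cover, however, it is generated by the rows of $g^{N_g} - C_g Y_g$. *)
  have [L hL] : exists L, forall v, K v -> f ^+ L *: (v *m C) = 0.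
    have : exists L, forall g, g \in fs -> forall v, K v ->
        exists N0, g ^+ N0 *: (f ^+ L *: (v *m C)) = 0.
      apply: (seq_bound (P := fun g L => forall v, K v ->
        exists N0, g ^+ N0 *: (f ^+ L *: (v *m C)) = 0)).
        move=> g L L' LL' hg v Kv; have [N0 e] := hg v Kv; exists N0.
        by rewrite -(subnK LL') exprD -[_ *: (v *m C)]scalerA scalerA mulrC -scalerA e scaler0.
      move=> g gfs; have [Ng [Cg [Yg [g1 g2 g3]]]] := step1 _ gfs.
      pose B := (g ^+ Ng)%:M - Cg *m Yg.
      have [L hL] : exists L, forall i : 'I_m, f ^+ L *: (row i B *m C) = 0.
        apply: (finite_bound (P := fun i L => f ^+ L *: (row i B *m C) = 0)).
          by move=> i L L' LL' e; rewrite -(subnK LL') exprD -scalerA e scaler0.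
        by move=> i; apply: h3; apply: g1.
      have hB : f ^+ L *: (B *m C) = 0.
        by apply/row_matrixP => i; rewrite linearZ /= row_mul hL row0.
      exists L => v Kv; have [M e] := g3 v Kv.
      exists (M + Ng)%N; rewrite exprD -scalerA.
      have -> : g ^+ Ng *: (f ^+ L *: (v *m C)) = f ^+ L *: ((v *m Cg) *m Yg *m C).
        have eg : g ^+ Ng *: (v *m C) = v *m (B + Cg *m Yg) *m C.
          by rewrite subrK mul_mx_scalar scalemxAl.
        rewrite scalerA mulrC -scalerA eg mulmxDr mulmxDl scalerDr -[v *m B *m C]mulmxA.
        by rewrite scalemxAr hB mulmx0 add0r !mulmxA.
      have eM : g ^+ M *: (v *m Cg *m Yg *m C) = 0.
        by rewrite 2!scalemxAl e !mul0mx.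
      by rewrite scalerA mulrC -scalerA eM scaler0.
    move=> [L hL]; exists L => v Kv; apply/rowP => j; rewrite [RHS]mxE.
    apply: (local_eq0 h1) => g gfs; have [N0 /rowP /(_ j)] := hL _ gfs _ Kv.
    by rewrite !mxE => e; exists N0.
  have [M hM] : exists M, f ^+ M *: ((f ^+ N)%:M - Y *m C) = 0.
    have [M hM] : exists M, forall j : 'I_q, f ^+ M *: row j ((f ^+ N)%:M - Y *m C) = 0.
      apply: (finite_bound (P := fun j M => f ^+ M *: row j ((f ^+ N)%:M - Y *m C) = 0)).
        by move=> i P P' PP' e; rewrite -(subnK PP') exprD -scalerA e scaler0.
      move=> j; apply: h2.
      have -> : row j ((f ^+ N)%:M - Y *m C) *m Y = row j Y *m ((f ^+ N)%:M - C *m Y).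
        rewrite -!row_mul mulmxBl mulmxBr mul_scalar_mx mul_mx_scalar.
        by rewrite mulmxA.
      exact: rowsK.
    by exists M; apply/row_matrixP => j; rewrite linearZ /= hM row0.
  exists (N + (L + M))%N, (f ^+ (L + M) *: C), Y; split.
  - move=> i; rewrite -scalemxAl exprD mulrC -scale_scalar_mx -scalerBr linearZ /=.
    exact: smZ.
  - rewrite -scalemxAr exprD -scalerA [f ^+ (N + _)]exprD mulrC exprD -mulrA -!scale_scalar_mx.
    congr (_ *: _); apply/eqP; rewrite eq_sym -subr_eq0; apply/eqP.
    by rewrite -scalerBr.
  - by move=> v Kv; rewrite -scalemxAr exprD mulrC -scalerA hL // scaler0.
have H f : exists d : nat * 'M[R]_(m, q) * 'M[R]_(q, m), f \in fs ->
     [/\ forall i, K (row i ((f ^+ d.1.1)%:M - d.1.2 *m d.2)),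
        d.2 *m d.1.2 = (f ^+ d.1.1)%:M & forall v, K v -> v *m d.1.2 = 0].
  have [ffs|nf] := boolP (f \in fs); last by exists (0%N, 0, 0).
  by have [N [C [Y H]]] := step2 _ ffs; exists (N, C, Y).
have [D hD] := choice H.
have h1' : ideal_gen [set` [seq f ^+ (D f).1.1 | f <- fs]] 1.
  apply: unit_ideal_powers h1 _; first exact: idgen_id.
  move=> f ffs; exists (D f).1.1; apply: idgen_sub => /=.
  exact: map_f.
have [a ha] := idgen_seqP h1'.
rewrite size_map in a ha.
(* Weights [a i] with $\sum_i a_i f_i^{N_i} = 1$: each $C Y$ kills [K] and is $f^N$ modulo [K], so
   [E] kills [K] and is the identity modulo [K]. *)
pose E := \sum_(i < size fs) a i *: ((D fs`_i).1.2 *m (D fs`_i).2).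
have KE v : K v -> v *m E = 0.
  move=> Kv; rewrite /E mulmx_sumr big1 // => i _.
  have [_ _ h] := hD fs`_i (mem_nth 0 (ltn_ord i)).
  by rewrite -scalemxAr mulmxA h // mul0mx scaler0.
have EK i : K (row i (1%:M - E)).
  rewrite (_ : 1%:M - E = \sum_(i < size fs) a i *: ((fs`_i ^+ (D fs`_i).1.1)%:M - (D fs`_i).1.2 *m (D fs`_i).2)).
    rewrite linear_sum /=; apply: sm_sum => // j _; rewrite linearZ /=; apply: smZ => //.
    by have [h _ _] := hD fs`_j (mem_nth 0 (ltn_ord j)).
  rewrite ha; under [RHS]eq_bigr do rewrite scalerBr; rewrite sumrB; congr (_ - _).
  rewrite raddf_sum /=; apply: eq_bigr => j _.
  by rewrite (nth_map 0) // scale_scalar_mx.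
have EE : (1%:M - E) *m E = 0.
  by apply/row_matrixP => i; rewrite row_mul KE // row0.
have EE' : E *m E = E by move: EE; rewrite mulmxBl mul1mx => /eqP; rewrite subr_eq0 => /eqP.
exists E; last first.
  apply/seteqP; split=> v /= h; first exact: KE.
  rewrite (_ : v = v *m (1%:M - E)); first exact: rowsK.
  by rewrite mulmxBr mulmx1 h subr0.
split => //; exists fs; split => // f ffs.
have [k1 k2 k3] := hD _ ffs.
exists (D f).1.1, (D f).1.2, ((D f).2 *m E); split.
  rewrite mulmxA -mul_scalar_mx.
  have -> : (f ^+ (D f).1.1)%:M *m E = ((f ^+ (D f).1.1)%:M - (D f).1.2 *m (D f).2) *m E + (D f).1.2 *m (D f).2 *m E.
    by rewrite mulmxBl subrK.
  rewrite (_ : _ *m E = 0) ?add0r //.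
  by apply/row_matrixP => i; rewrite row_mul KE // row0.
rewrite -mulmxA (_ : E *m (D f).1.2 = (D f).1.2) //.
apply/eqP; rewrite eq_sym -subr_eq0 -{1}[(D f).1.2]mul1mx -mulmxBl; apply/eqP.
by apply/row_matrixP => i; rewrite row_mul k3 // row0.
Qed.

End LocFree.

Section LocFreeBaseChange.
Variables (R R' : comNzRingType) (phi : {rmorphism R -> R'}) (m q : nat).

Lemma idgen_map (s : seq R) : ideal_gen [set` s] 1 -> ideal_gen [set` [seq phi x | x <- s]] 1.
Proof.
move=> /idgen_seqP [c e].
have -> : 1 = \sum_i phi (c i) * phi s`_i.
  by rewrite -(rmorph1 phi) e rmorph_sum; apply: eq_bigr => i _; rewrite rmorphM.
apply: (id_sum _ (idgen_id _)).
move=> i _; apply: (idM _ (idgen_id _)).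
by apply: idgen_sub => /=; apply: map_f; apply: mem_nth.
Qed.

Lemma lf_proj_map (E : 'M[R]_m) : lf_proj q E -> lf_proj q (map_mx phi E).
Proof.
move=> [EE [fs [h1 hfs]]]; split; first by rewrite -map_mxM EE.
exists [seq phi x | x <- fs]; split; first exact: idgen_map.
move=> _ /mapP [f /hfs [N [X [Y [e1 e2]]]] ->].
exists N, (map_mx phi X), (map_mx phi Y); rewrite -!map_mxM -e1 e2.
by rewrite map_mxZ map_scalar_mx !rmorphXn.
Qed.

(** The kernel of an idempotent is generated by the rows of $1 - E$, so its formation commutes with
    base change. *)
Lemma lker_map (E : 'M[R]_m) : E *m E = E ->
  span (map_mx phi @` lker E) = lker (map_mx phi E) :> set 'rV[R']_m.
Proof.
move=> EE; apply/seteqP; split.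
  apply: span_min; first exact: lker_sm.
  by move=> _ [v hv <-]; rewrite /lker /= -map_mxM hv map_mx0.
move=> v hv; rewrite (_ : v = v *m map_mx phi (1%:M - E)); last first.
  by rewrite map_mxB map_mx1 mulmxBr mulmx1 hv subr0.
rewrite mulmx_sum_row; apply: (sm_sum _ (span_sm _)) => i _.
apply: (smZ _ (span_sm _)); rewrite -map_row; apply: span_sub; exists (row i (1%:M - E)) => //.
by rewrite /lker /= -row_mul mulmxBl mul1mx EE subrr row0.
Qed.

End LocFreeBaseChange.

(** * Minors and the Fitting criterion for local freeness *)

Section Minors.
Variables (R : comNzRingType).

Lemma det_thin m p (A : 'M[R]_(p, m)) (B : 'M[R]_(m, p)) : (m < p)%N -> \det (A *m B) = 0.
Proof.
move=> lt; have [s ep] : exists s, p = (m + s.+1)%N by exists (p - m).-1; lia.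
subst p; have -> : A *m B = row_mx A (0 : 'M_(_, s.+1)) *m col_mx B 0.
  by rewrite mul_row_col mul0mx addr0.
rewrite det_mulmx (expand_det_col _ (rshift m ord0)) big1 ?mul0r // => i _.
by rewrite row_mxEr mxE mul0r.
Qed.

(** The vanishing of the Fitting ideal of index $m - k$ of $R^m/N$. *)
Definition minors_vanish m (N : set 'rV[R]_m) k := forall (M : 'M[R]_(k, m)) (g : 'I_k -> 'I_m),
  (forall i, N (row i M)) -> \det (colsub g M) = 0.

(** Stack $f^N M$ on [Y] and multiply by the columns of [G] and [X]. The product is block triangular
    with diagonal blocks $f^N M G$ and $f^N$, and it factors through $R^m$ with $m < k + q$, so its
    determinant is zero. *)
Lemma lf_minors_vanish m q (E : 'M[R]_m) k :
  lf_proj q E -> (m < k + q)%N -> minors_vanish (lker E) k.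
Proof.
move=> [EE [fs [h1 hfs]]] lt M g hM.
apply: (local_eq0 h1) => f /hfs [N [X [Y [e1 e2]]]].
have ME : M *m E = 0 by apply/row_matrixP => i; rewrite row_mul hM row0.
have MX : f ^+ N *: M *m X = 0.
  rewrite -scalemxAl scalemxAr -mul_mx_scalar -e2 !mulmxA.
  by rewrite -[M *m X *m Y]mulmxA -e1 -scalemxAr ME scaler0 mul0mx.
pose G : 'M[R]_(m, k) := \matrix_(i, j) (i == g j)%:R.
have colG (p : nat) (B : 'M[R]_(p, m)) : B *m G = colsub g B.
  apply/matrixP => i j; rewrite !mxE (bigD1 (g j)) //= mxE eqxx mulr1 big1 ?addr0 // => l /negPf h.
  by rewrite mxE h mulr0.
have := @det_thin m (k + q) (col_mx (f ^+ N *: M) Y) (row_mx G X) lt.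
rewrite mul_col_row MX e2 det_lblock det_scalar -scalemxAl colG detZ => e.
by exists (N * k + N * q)%N; rewrite exprD -e -!exprM; ring.
Qed.

Lemma det_noninj p (A : 'M[R]_p) (i j : 'I_p) : i != j -> (forall l, A l i = A l j) -> \det A = 0.
Proof.
move=> ij h; rewrite -det_tr; apply: (determinant_alternate ij) => l.
by rewrite !mxE.
Qed.

(** Where a minor [f] of size $m-q$ on the columns [g] is invertible, the basis vectors outside [g]
    form a basis of the quotient: Cramer's rule shows that they span, the vanishing of the bordered
    minors that they are independent. *)
Lemma locally_free_of_minors m q (N : set 'rV[R]_m) : is_submodule N -> (q <= m)%N ->
  minors_vanish N (m - q + 1) ->
  (forall (F : fieldType) (phi : {rmorphism R -> F}), is_residue_field phi ->
     exists (M : 'M[R]_(m - q, m)) (g : 'I_(m - q) -> 'I_m),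
       (forall i, N (row i M)) /\ phi (\det (colsub g M)) != 0) ->
  locally_free setT N q.
Proof.
move=> HN qm van res.
pose G : set R := [set x | exists (M : 'M[R]_(m - q, m)) (g : 'I_(m - q) -> 'I_m),
       (forall i, N (row i M)) /\ x = \det (colsub g M)].
have : ideal_gen G 1.
  apply: residue_ideal_unit; first exact: idgen_id.
  move=> F phi /res [M [g [h1 h2]]]; exists (\det (colsub g M)) => //.
  by apply: idgen_sub; exists M, g.
move=> /idgenP [s [c [x [xG e1]]]].
exists [seq x i | i : 'I_s]; split.
  rewrite e1; apply: (id_sum _ (idgen_id _)).
  move=> i _; apply: (idM _ (idgen_id _)).
  by apply: idgen_sub => /=; apply/mapP; exists i => //; rewrite mem_enum.
move=> _ /mapP [i _ ->]; have [M [g [hM ->]]] := xG i.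
set f := \det _.
(* For [f = 0] the localization is the zero ring, where every family is a basis. *)
have [f0|/eqP f0] := pselect (f = 0).
  exists (fun=> 0); split => //.
    move=> v _; exists 1%N, (fun=> 0); rewrite f0 expr1 scale0r big1 ?subr0; last by move=> *; rewrite scaler0.
    exact: sm0.
  by move=> c' _; exists 1%N => j; rewrite f0 expr1 mul0r.
have ginj : injective g.
  move=> a a' eg; apply/eqP/negPn/negP => na; case/eqP: f0.
  by apply: (det_noninj na) => l; rewrite !mxE eg.
pose Cset := ~: [set g j | j : 'I_(m - q)]%SET.
have cC : #|Cset| = q.
  by rewrite cardsCs finset.setCK card_imset // !card_ord subKn.
pose h (j : 'I_q) : 'I_m := enum_val (cast_ord (esym cC) j).
have hC j : h j \in Cset by apply: enum_valP.
have hinj : injective h by move=> a a' /enum_val_inj /cast_ord_inj.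
have sumh (w : 'rV[R]_m) : (forall j, w 0 (g j) = 0) ->
    w = \sum_j w 0 (h j) *: delta_mx 0 (h j).
  move=> w0; apply/rowP => l; rewrite summxE.
  have [lC|] := boolP (l \in Cset).
    have hl : h (cast_ord cC (enum_rank_in lC l)) = l.
      by rewrite /h cast_ordK enum_rankK_in.
    rewrite (bigD1 (cast_ord cC (enum_rank_in lC l))) //= hl !mxE !eqxx mulr1.
    rewrite big1 ?addr0 // => j hj; rewrite !mxE /=.
    have -> : (l == h j) = false; last by rewrite mulr0.
    by apply/negP => /eqP ej; case/eqP: hj; apply: hinj; rewrite hl.
  rewrite inE negbK => /imsetP [j _ ->]; rewrite w0 big1 // => j' _; rewrite !mxE /=.
  have -> : (g j == h j') = false; last by rewrite mulr0.
  by apply/negP => /eqP e; have := hC j'; rewrite -e inE imset_f.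
exists (fun j => delta_mx 0 (h j)); split => //.
  (* Subtracting $y M$ from $f v$ clears the coordinates in the columns [g]. *)
  move=> v _; pose y := colsub g v *m \adj (colsub g M).
  pose w := f *: v - y *m M.
  exists 1%N, (fun j => w 0 (h j)); rewrite expr1 -sumh.
    by rewrite /w subKr mulmx_sum_row; apply: sm_sum => // l _; apply: smZ.
  move=> j; have : colsub g w = 0.
    rewrite /w linearB /= linearZ /= -[colsub g (y *m M)]/(mxsub id g _).
    rewrite (_ : mxsub id g (y *m M) = y *m colsub g M); last first.
      by apply/matrixP => a b; rewrite !mxE; apply: eq_bigr => l _; rewrite !mxE.
    by rewrite -mulmxA mul_adj_mx mul_mx_scalar subrr.
  by move/rowP/(_ j); rewrite !mxE.
move=> c' hc; exists 1%N => j; rewrite expr1.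
pose u := \sum_j c' j *: delta_mx 0 (h j) : 'rV[R]_m.
have uh j' : u 0 (h j') = c' j'.
  rewrite /u summxE (bigD1 j') //= !mxE !eqxx mulr1 big1 ?addr0 // => l hl; rewrite !mxE /=.
  by rewrite (inj_eq hinj) eq_sym (negPf hl) mulr0.
have ug l : u 0 (g l) = 0.
  rewrite /u summxE big1 // => j' _; rewrite !mxE /=.
  have -> : (g l == h j') = false; last by rewrite mulr0.
  by apply/negP => /eqP e; have := hC j'; rewrite -e inE imset_f.
(* The minor bordered by the relation [u] and the column [h j] equals [f] times [c' j]. *)
pose g' (a : 'I_(m - q + 1)) := match fintype.split a with inl b => g b | inr _ => h j end.
have := van (col_mx M u) g'.
have -> : colsub g' (col_mx M u) = block_mx (colsub g M) (\col_b M b (h j)) 0 (c' j)%:M.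
  have gl b : g' (lshift 1 b) = g b by rewrite /g' -[lshift _ _]/(unsplit (inl b)) unsplitK.
  have gr b : g' (rshift (m - q) b) = h j by rewrite /g' -[rshift _ _]/(unsplit (inr b)) unsplitK.
  apply/matrixP => a b; rewrite mxE -(splitK a) -(splitK b).
  case: (fintype.split a) => a'; case: (fintype.split b) => b' /=; rewrite ?gl ?gr.
  - by rewrite col_mxEu block_mxEul !mxE.
  - by rewrite col_mxEu block_mxEur !mxE.
  - by rewrite col_mxEd block_mxEdl !mxE !ord1 ug.
  - by rewrite col_mxEd block_mxEdr !mxE !ord1 uh eqxx.
rewrite det_ublock det_scalar1; apply=> a.
by rewrite -(splitK a); case: (fintype.split a) => a' /=; rewrite ?rowKu ?rowKd ?ord1 ?row_id //= (_ : row 0 u = u) //; apply/rowP => ?; rewrite mxE.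
Qed.

End Minors.

Section Transport.
Variables (R : comNzRingType) (V : lmodType R) (m : nat) (vec : {linear 'rV[R]_m -> V}).
Variables (V0 N : set V).
Hypothesis (V0E : forall v, V0 v <-> exists w, v = vec w).

Lemma locally_free_vec q :
  locally_free V0 N q <-> locally_free setT [set w | N (vec w)] q.
Proof.
have V0v w : V0 (vec w) by apply/V0E; exists w.
have vecS p (c : 'I_p -> R) (x : 'I_p -> 'rV_m) : vec (\sum_j c j *: x j) = \sum_j c j *: vec (x j).
  by rewrite linear_sum; apply: eq_bigr => j _; rewrite linearZ.
split=> -[fs [h1 hfs]]; exists fs; split => // f /hfs [e [eV eS eI]].
  have [x hx] := choice (fun j => proj1 (V0E _) (eV j)).
  exists x; split => // [v _|c].
    have [N0 [c h]] := eS _ (V0v v); exists N0, c.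
    rewrite /= linearB linearZ vecS /=; by under eq_bigr do rewrite -hx.
  by rewrite /= vecS => h; apply: eI; move: h; under eq_bigr do rewrite -hx.
exists (fun j => vec (e j)); split => // [v /V0E [w ->]|c].
  have [N0 [c h]] := eS w I; exists N0, c.
  by move: h; rewrite /= linearB linearZ vecS.
by rewrite -vecS => h; apply: eI.
Qed.

End Transport.

(** * Dickson's lemma and Noetherian induction on monomial ideals *)

Section Dickson.
Variable n : nat.
Implicit Types (U : set 'X_{1..n}).

(** Each index is chosen where [a] attains its minimum over a tail of the sequence. *)
Lemma nondecreasing_subseq (a : nat -> nat) : exists g : nat -> nat,
  (forall i j, (i < j)%N -> (g i < g j)%N) /\ (forall i j, (i <= j)%N -> (a (g i) <= a (g j))%N).
Proof.
have H N : exists i, (N <= i)%N /\ forall j, (i <= j)%N -> (a i <= a j)%N.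
  have ex : exists v, `[< exists2 i, (N <= i)%N & a i = v >] by exists (a N); apply/asboolP; exists N.
  case: (ex_minnP ex) => v /asboolP [i Ni <-] hmin; exists i; split => // j ij.
  by apply: hmin; apply/asboolP; exists j => //; apply: leq_trans ij.
have [p hp] := choice H.
pose g := fix g k := if k is k'.+1 then p (g k').+1 else p 0%N.
have gp k : exists N, g k = p N by case: k => [|k]; [exists 0%N|exists (g k).+1].
have gS k : (g k < g k.+1)%N by have [] := hp (g k).+1.
have gm i j : (i <= j)%N -> (g i <= g j)%N.
  move=> /subnK <-; elim: (j - i)%N => // l IH; rewrite addSn.
  by apply: leq_trans IH (ltnW (gS _)).
exists g; split=> i j ij; first by apply: leq_trans (gS i) (gm _ _ ij).
by have [N e] := gp i; rewrite e; apply: (proj2 (hp N)); rewrite -e; apply: gm.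
Qed.

Lemma dickson_seq (f : nat -> 'X_{1..n}) : exists i j, (i < j)%N /\ (f i <= f j)%MM.
Proof.
have H (s : seq 'I_n) : exists g : nat -> nat, (forall i j, (i < j)%N -> (g i < g j)%N) /\
    forall c, c \in s -> forall i j, (i <= j)%N -> (f (g i) c <= f (g j) c)%N.
  elim: s => [|c s [g [g1 g2]]]; first by exists id.
  have [h [h1 h2]] := nondecreasing_subseq (fun i => f (g i) c).
  have hm i j : (i <= j)%N -> (h i <= h j)%N.
    by rewrite leq_eqVlt => /orP [/eqP->//|/h1 /ltnW].
  exists (g \o h); split=> [i j ij|c']; first by apply: g1; apply: h1.
  rewrite in_cons => /orP [/eqP-> i j ij|c's i j ij]; first exact: h2.
  by apply: g2 => //; apply: hm.
have [g [g1 g2]] := H (enum 'I_n); exists (g 0%N), (g 1%N); split; first exact: g1.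
by apply/mnm_lepP => c; apply: g2; rewrite ?mem_enum.
Qed.

(** Otherwise one can always pick an element of [U] divisible by none of those picked before, which
    contradicts [dickson_seq]. *)
Lemma dickson U : exists s : seq 'X_{1..n}, (forall m, m \in s -> U m) /\
  forall m, U m -> exists2 m', m' \in s & (m' <= m)%MM.
Proof.
apply: contrapT => no.
have H (s : seq 'X_{1..n}) : exists m, (forall m, m \in s -> U m) ->
    U m /\ forall m', m' \in s -> ~ (m' <= m)%MM.
  have [sU|] := pselect (forall m, m \in s -> U m); last by exists 0%MM.
  have [[m [Um hm]]|no'] := pselect (exists m, U m /\ forall m', m' \in s -> ~ (m' <= m)%MM).
    by exists m.
  case: no; exists s; split => // m Um; apply: contrapT => h; apply: no'; exists m; split => // m' m's le.
  by apply: h; exists m'.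
have [nx hnx] := choice H.
pose S := fix S k := if k is k'.+1 then nx (S k') :: S k' else [::].
have SU k : forall m, m \in S k -> U m.
  elim: k => [|k IH] m //=; rewrite in_cons => /orP [/eqP->|/IH //].
  by have [] := hnx _ IH.
have SS k l : (k < l)%N -> nx (S k) \in S l.
  elim: l => // l IH; rewrite ltnS leq_eqVlt => /orP [/eqP->|/IH h] /=.
    by rewrite mem_head.
  by rewrite in_cons h orbT.
have [i [j [ij]]] := dickson_seq (fun k => nx (S k)).
by have [_ h] := hnx _ (SU j); apply: h; apply: SS.
Qed.

(** The exponents of the monomials in a monomial ideal. *)
Definition upc U := forall m m', (m <= m')%MM -> U m -> U m'.

(** A counterexample would start an infinite strictly ascending chain; the finitely many generators
    of its union all occur at one stage. *)
Lemma noeth_ind (Pr : set 'X_{1..n} -> Prop) :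
  (forall U, upc U -> (forall U', upc U' -> U `<=` U' -> ~ U' `<=` U -> Pr U') -> Pr U) ->
  forall U, upc U -> Pr U.
Proof.
move=> IH U0 up0; apply: contrapT => bad0.
have step (x : {U | upc U /\ ~ Pr U}) : exists y : {U | upc U /\ ~ Pr U},
    sval x `<=` sval y /\ ~ sval y `<=` sval x.
  case: x => U [upU badU] /=; apply: contrapT => no; apply: badU; apply: IH => // U' upU' UU' nU'.
  apply: contrapT => bad'; apply: no.
  by exists (exist _ U' (conj upU' bad')).
have [nx hnx] := choice step.
pose C k := iter k nx (exist _ U0 (conj up0 bad0)).
have Cm k l : (k <= l)%N -> sval (C k) `<=` sval (C l).
  move=> /subnK <-; elim: (l - k)%N => // j IHj; rewrite addSn.
  by apply: subset_trans IHj _; case: (hnx (C (j + k)%N)).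
have [s [sU hs]] := dickson [set m | exists k, sval (C k) m].
have [N hN] : exists N, forall m, m \in s -> sval (C N) m.
  apply: (seq_bound (P := fun m N => sval (C N) m)) => //.
  by move=> m N N' NN'; apply: Cm.
have [_] := hnx (C N); apply=> m hm.
have [|m' m's le] := hs m; first by exists N.+1.
by have [up _] := svalP (C N); apply: up le _; apply: hN.
Qed.

End Dickson.

Section DegreeBound.
Variables (n : nat) (Dg : eqType) (mon : Dg -> seq 'X_{1..n}) (T : set Dg) (Q : Dg -> nat).
Implicit Types (U M : set 'X_{1..n}) (D : seq Dg).

Definition genD M D : set 'X_{1..n} :=
  [set m' | exists m p, [/\ M m, p \in D, m \in mon p & (m <= m')%MM]].

(** The number of standard monomials in degree [p]: the Hilbert function of the quotient by the
    monomial ideal [M]. *)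
Definition cnt p M := count (fun m => ~~ `[< M m >]) (mon p).

Lemma cnt_mono p M M' : M `<=` M' -> (cnt p M' <= cnt p M)%N.
Proof.
move=> MM'; apply: sub_count => m /=; apply: contra => /asboolP h.
by apply/asboolP; apply: MM'.
Qed.

(* Haiman-Sturmfels: finitely many degrees control monomial ideals. *)
Lemma degree_bound : exists D, (forall p, p \in D -> T p) /\
  forall M, upc M -> (forall p, p \in D -> cnt p M = Q p) ->
  forall p, T p -> (cnt p (genD M D) <= Q p)%N.
Proof.
(* Noetherian induction on [U], an ideal generated in the degrees [D0] that agrees with all the
   ideals [M] still under consideration in these degrees. *)
pose Pr U := forall D0, (forall p, p \in D0 -> T p) -> U `<=` genD U D0 ->
  exists D, [/\ {subset D0 <= D}, forall p, p \in D -> T p &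
    forall M, upc M -> (forall p m, p \in D0 -> m \in mon p -> M m <-> U m) ->
    (forall p, p \in D -> cnt p M = Q p) -> forall p, T p -> (cnt p (genD M D) <= Q p)%N].
suff H : forall U, upc U -> Pr U.
  have [//|//|//|D [_ DT hD]] := H set0 _ [::].
  by exists D; split => // M upM; apply: hD.
apply: noeth_ind => U upU IH D0 D0T Ugen.
have [le|] := pselect (forall p, T p -> (cnt p U <= Q p)%N).
  exists D0; split => // M upM MU _ p Tp; apply: leq_trans (le p Tp).
  apply: cnt_mono => m /Ugen [m0 [p0 [h1 h2 h3 h4]]]; exists m0, p0; split => //.
  by apply/(MU p0 m0).
(* In degree [p1] the ideal [U] is too small, so each [M] with the prescribed count there is
   strictly larger than [U]. Its monomials of degree [p1] form one of finitely many sets [X]; the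
   induction hypothesis is applied to each enlarged ideal [UX X], and the resulting degrees are
   collected. *)
move=> /existsNP [p1 /not_implyP [Tp1 /negP]]; rewrite -ltnNge => ltQ.
pose mp := mon p1; pose D1 := p1 :: D0.
have D1T p : p \in D1 -> T p by rewrite in_cons => /orP [/eqP->|/D0T].
pose UX (X : {set 'I_(size mp)}) : set 'X_{1..n} :=
  [set m | U m \/ exists2 i, i \in X & (nth 0%MM mp i <= m)%MM].
have UXup X : upc (UX X).
  move=> m m' le [/(upU _ _ le)|[i iX le']]; [by left|right; exists i => //].
  exact: lepm_trans le.
have HX X : exists DX, [/\ {subset D1 <= DX}, forall p, p \in DX -> T p &
    ~ UX X `<=` U -> forall M, upc M -> (forall p m, p \in D1 -> m \in mon p -> M m <-> UX X m) ->
    (forall p, p \in DX -> cnt p M = Q p) -> forall p, T p -> (cnt p (genD M DX) <= Q p)%N].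
  have [sub|nsub] := pselect (UX X `<=` U); first by exists D1; split.
  have UsubX : U `<=` UX X by move=> m; left.
  have [|DX [h1 h2 h3]] := IH (UX X) (UXup X) UsubX nsub D1 D1T.
    move=> m [/Ugen [m0 [p0 [k1 k2 k3 k4]]]|[i iX le]].
      by exists m0, p0; split => //; [left|rewrite in_cons k2 orbT].
    exists (nth 0%MM mp i), p1; split => //; last exact: mem_nth.
      by right; exists i => //; apply: lepm_refl.
    by rewrite mem_head.
  by exists DX; split.
have [DX hDX] := choice HX.
pose D := flatten [seq DX X | X <- enum {set 'I_(size mp)}].
have DXD X : {subset DX X <= D}.
  by move=> p pX; apply/flattenP; exists (DX X) => //; apply: map_f; rewrite mem_enum.
have D1D : {subset D1 <= D} by move=> p /(let: And3 h _ _ := hDX finset.set0 in h) /DXD.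
exists D; split.
- by move=> p pD; apply: D1D; rewrite in_cons pD orbT.
- by move=> p /flattenP [_ /mapP [X _ ->]] pX; case: (hDX X) => _ h _; apply: h.
move=> M upM MU MQ p Tp.
have UM : U `<=` M.
  move=> m /Ugen [m0 [p0 [k1 k2 k3 k4]]]; apply: upM k4 _.
  by apply/(MU p0).
pose X := [set i : 'I_(size mp) | `[< M (nth 0%MM mp i) >]]%SET.
have UXM : UX X `<=` M.
  move=> m [/UM //|[i]]; rewrite inE => /asboolP Mi le.
  exact: upM le _.
have MX m : m \in mp -> M m -> UX X m.
  move=> mm Mm; right; have hi := mm; rewrite -index_mem in hi.
  exists (Ordinal hi); last by rewrite /= nth_index // lepm_refl.
  by rewrite inE /= nth_index //; apply/asboolP.
have nsub : ~ UX X `<=` U.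
  move=> sub; have := MQ p1 (D1D _ (mem_head _ _)); apply/eqP; rewrite neq_ltn; apply/orP; right.
  apply: leq_trans ltQ _; rewrite /cnt -!size_filter.
  rewrite (_ : [seq m <- mon p1 | ~~ `[< M m >]] = [seq m <- mon p1 | ~~ `[< U m >]]) //.
  apply: eq_in_filter => m mm; congr (~~ _); apply/asboolP/asboolP => [Mm|/UM //].
  by apply: sub; apply: MX.
have [_ _ h] := hDX X.
apply: leq_trans (h nsub M upM _ _ p Tp); last 2 first.
- move=> p' m; rewrite in_cons => /orP [/eqP->|p'D0] mm; split=> [Mm|/UXM //].
    exact: MX.
  by left; apply/(MU p').
- by move=> p' /DXD /MQ.
apply: cnt_mono => m [m0 [p0 [k1 k2 k3 k4]]]; exists m0, p0; split => //.
exact: DXD k2.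
Qed.

End DegreeBound.

(** * Polynomials with prescribed support and their coordinates *)

Section SupportedPolys.
Variables (R : comNzRingType) (n : nat).
Implicit Types (ms : seq 'X_{1..n}) (f g : {mpoly R[n]}).

Definition inS ms : set {mpoly R[n]} := [set f | forall m, m \in msupp f -> m \in ms].

Lemma inSP ms f : inS ms f <-> forall m, m \notin ms -> f@_m = 0.
Proof.
split=> H m; last by apply: contraTT => /H h; rewrite mcoeff_msupp h eqxx.
by move=> mn; apply/eqP; rewrite mcoeff_eq0; apply: contra mn; apply: H.
Qed.

Lemma inS_sm ms : is_submodule (inS ms).
Proof.
split; first by apply/inSP => m _; rewrite mcoeff0.
move=> a u v /inSP hu /inSP hv; apply/inSP => m mn.
by rewrite mcoeffD mcoeffZ hu // hv // mulr0 addr0.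
Qed.

Lemma inS_X ms m : m \in ms -> inS ms 'X_[m].
Proof. by move=> h m'; rewrite msuppX inE => /eqP->. Qed.

Lemma mcoeffXM m g m' : ('X_[m] * g)@_m' = if (m <= m')%MM then g@_(m' - m) else 0.
Proof.
case: ifP => [le|nle]; first by rewrite mulrC -{1}(submK le) addmC mcoeffMX.
apply/eqP; rewrite mcoeff_eq0; apply/negP; rewrite mulrC => h.
have := (perm_mem (msuppMX g m)) m'; rewrite h => /esym /mapP [m0 _ e].
by rewrite e lem_addr in nle.
Qed.

Lemma inS_XM ms ms' m g : (forall m', m' \in ms -> (m + m')%MM \in ms') ->
  inS ms g -> inS ms' ('X_[m] * g).
Proof.
move=> H /inSP hg; apply/inSP => m' mn; rewrite mcoeffXM; case: ifP => // le.
by apply: hg; apply: contra mn => /H; rewrite addmC submK.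
Qed.

Definition vec ms (v : 'rV[R]_(size ms)) : {mpoly R[n]} :=
  \sum_i v 0 i *: 'X_[nth 0%MM ms i].

Lemma vec_linear ms : linear (@vec ms).
Proof.
move=> a u v; rewrite /vec scaler_sumr -big_split /=; apply: eq_bigr => i _.
by rewrite !mxE scalerDl scalerA.
Qed.

HB.instance Definition _ ms := GRing.isLinear.Build R 'rV[R]_(size ms) {mpoly R[n]} *:%R
  (@vec ms) (@vec_linear ms).

Definition crd ms f : 'rV[R]_(size ms) := \row_i f@_(nth 0%MM ms i).

Lemma mcoeff_vec ms v (i : 'I_(size ms)) : uniq ms -> (vec v)@_(nth 0%MM ms i) = v 0 i.
Proof.
move=> u; rewrite /vec raddf_sum /= (bigD1 i) //= mcoeffZ mcoeffX eqxx mulr1.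
rewrite big1 ?addr0 // => j ji; rewrite mcoeffZ mcoeffX nth_uniq //.
by rewrite (_ : (j == i :> nat) = false) ?mulr0 //; apply/negbTE.
Qed.

Lemma vec_inS ms v : inS ms (@vec ms v).
Proof.
apply: (sm_sum _ (inS_sm ms)) => i _; apply: (smZ _ (inS_sm ms)).
by apply: inS_X; apply: mem_nth.
Qed.

Lemma vecK ms v : uniq ms -> crd ms (vec v) = v.
Proof. by move=> u; apply/rowP => i; rewrite mxE mcoeff_vec. Qed.

Lemma crdK ms f : uniq ms -> inS ms f -> vec (crd ms f) = f.
Proof.
move=> u /inSP hf; apply/mpolyP => m.
have [mm|mn] := boolP (m \in ms); last by rewrite hf // (proj1 (inSP _ _) (@vec_inS ms _)).
have hi := mm; rewrite -index_mem in hi.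
by rewrite -(nth_index 0%MM mm) -[index m ms]/(nat_of_ord (Ordinal hi)) mcoeff_vec // mxE.
Qed.

Lemma inS_vec ms f : uniq ms -> inS ms f <-> exists w, f = @vec ms w.
Proof.
move=> u; split=> [h|[w ->]]; last exact: vec_inS.
by exists (crd ms f); rewrite crdK.
Qed.

End SupportedPolys.

Arguments inS {R n} ms.
Arguments vec {R n ms}.
Arguments inS_sm {R n} ms.
Arguments inS_X {R n ms m} _.
Arguments vec_inS {R n ms} v.
Arguments crd {R n} ms f.

Section InitialMonomials.
Variables (F : fieldType) (n : nat).
Implicit Types (ms : seq 'X_{1..n}) (f g : {mpoly F[n]}).

Definition leads (N : set {mpoly F[n]}) ms m :=
  exists f, [/\ N f, inS ms f, f != 0 & mlead f = m].

Lemma mlead_lt f m : f != 0 -> f@_m = 0 -> (forall m', m' \in msupp f -> (m' <= m)%O) ->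
  (mlead f < m)%O.
Proof.
move=> f0 e H; have h := mlead_supp f0.
rewrite lt_neqAle H // andbT; apply: contraTneq h => ->.
by rewrite mcoeff_msupp e eqxx.
Qed.

(** Macaulay's theorem: division with respect to the monomial order reduces every polynomial to
    monomials that are not leading ones, and no combination of those lies in [N]. *)
Lemma initial_basis (N : set {mpoly F[n]}) ms : uniq ms -> is_submodule N ->
  has_dim (inS ms) N (count (fun m => ~~ `[< leads N ms m >]) ms).
Proof.
move=> u HN; rewrite -size_filter; set st := filter _ ms.
have ust : uniq st by apply: filter_uniq.
have stms : {subset st <= ms} by move=> m; rewrite mem_filter => /andP [].
have sp v : inS ms v -> exists2 w, inS st w & N (v - w).
  move: {2}(mlead v) (erefl (mlead v)) => m.
  elim/(well_founded_ind (@ltom_wf n)): m v => m IH v e hv.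
  have [->|v0] := eqVneq v 0.
    by exists 0; [exact: (sm0 (inS_sm _))|rewrite subrr; exact: sm0].
  have mm : m \in ms by apply: hv; rewrite -e mlead_supp.
  have red (f : {mpoly F[n]}) c : inS ms f -> (forall m', m' \in msupp f -> (m' <= m)%O) ->
      v@_m = c * f@_m -> exists2 w, inS st w & N (v - c *: f - w).
    move=> hf hle ec; have hv' : inS ms (v - c *: f).
      by apply: (smB (inS_sm _)) => //; apply: (smZ _ (inS_sm _)).
    have [z|nz] := eqVneq (v - c *: f) 0.
      by exists 0; [exact: (sm0 (inS_sm _))|rewrite z subrr; exact: sm0].
    apply: (IH (mlead (v - c *: f))) => //; apply: mlead_lt => //.
      by rewrite mcoeffB mcoeffZ ec subrr.
    move=> m' /msuppB_le; rewrite mem_cat => /orP [h|h].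
      by rewrite -e; apply: msupp_le_mlead.
    by apply: hle; apply: (msuppZ_le h).
  have [/asboolP [f [Nf hf f0 ef]]|nl] := boolP `[< leads N ms m >].
    have [||w hw hN] := red f (v@_m / f@_m) hf.
    - by move=> m' h; rewrite -ef; apply: msupp_le_mlead.
    - by rewrite divfK // -ef -mcoeff_msupp mlead_supp.
    exists w => //; rewrite -(subrK ((v@_m / f@_m) *: f) v) addrAC.
    by apply: smD => //; apply: smZ.
  have [||w hw hN] := red 'X_[m] v@_m (inS_X mm).
  - by move=> m'; rewrite msuppX inE => /eqP->.
  - by rewrite mcoeffX eqxx mulr1.
  exists (v@_m *: 'X_[m] + w); last by rewrite opprD addrA.
  apply: (smD (inS_sm _)) => //; apply: (smZ _ (inS_sm _)); apply: inS_X.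
  by rewrite mem_filter nl.
exists (fun j => 'X_[nth 0%MM st j]); split.
- by move=> j; apply: inS_X; apply: stms; apply: mem_nth.
- move=> v /sp [w hw hN]; exists (crd st w 0).
  by rewrite -[\sum_j _]/(vec (crd st w)) crdK.
move=> c; pose v := \row_j c j : 'rV_(size st).
have -> : \sum_j c j *: 'X_[nth 0%MM st j] = vec v.
  by apply: eq_bigr => j _; rewrite mxE.
move=> hN j; have -> : c j = v 0 j by rewrite mxE.
have [e|nz] := eqVneq (vec v) 0; first by rewrite -[v]vecK // e mxE mcoeff0.
have := vec_inS v _ (mlead_supp nz); rewrite mem_filter => /andP [/asboolP []].
exists (vec v); split => // m /(vec_inS v); exact: stms.
Qed.

End InitialMonomials.

(** * Adjoining a generic parameter *)

(* Denominators D of polynomials in z, and A = D^-1 R[z]. *)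
Record zext (R A : comNzRingType) (iota : {rmorphism {poly R} -> A}) (D : set {poly R}) :
    Prop := ZExt {
  zD1 : D 1;
  zDM : forall c c', D c -> D c' -> D (c * c');
  zDu : forall c, D c -> exists y, iota c * y = 1;
  zfrac : forall a, exists c r, D c /\ iota c * a = iota r;
  zker : forall r, iota r = 0 -> exists2 c, D c & c * r = 0;
  zunit : forall c, D c -> exists i u, c`_i * u = 1 }.

Section ZExtension.
Variables (n : nat) (R A : comNzRingType) (iota : {rmorphism {poly R} -> A}) (D : set {poly R}).
Hypothesis (HZ : zext iota D).
Implicit Types (N : set {mpoly R[n]}) (ms : seq 'X_{1..n}).

Definition cfz i (f : {mpoly {poly R}[n]}) : {mpoly R[n]} := map_mpoly (coefp i) f.

Lemma mcoeff_cfz i f m : (cfz i f)@_m = (f@_m)`_i.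
Proof. by rewrite /cfz mcoeff_map_mpoly. Qed.

Lemma cfzD i f g : cfz i (f + g) = cfz i f + cfz i g.
Proof. by rewrite /cfz raddfD. Qed.

Lemma cfzZ i (p : {poly R}) f : cfz i (p *: f) = \sum_(j < i.+1) p`_j *: cfz (i - j) f.
Proof.
apply/mpolyP => m; rewrite mcoeff_cfz mcoeffZ coefM raddf_sum /=.
by apply: eq_bigr => j _; rewrite mcoeffZ mcoeff_cfz.
Qed.

Lemma cfzXM i m f : cfz i ('X_[m] * f) = 'X_[m] * cfz i f.
Proof.
apply/mpolyP => m'; rewrite mcoeff_cfz !mcoeffXM; case: ifP => _; last by rewrite coef0.
by rewrite mcoeff_cfz.
Qed.

Definition cst (f : {mpoly R[n]}) : {mpoly {poly R}[n]} := map_mpoly (@polyC R) f.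

Lemma cfz_cst i f : cfz i (cst f) = if i == 0%N then f else 0.
Proof.
apply/mpolyP => m; rewrite mcoeff_cfz mcoeff_map_mpoly coefC.
by case: ifP => //; rewrite mcoeff0.
Qed.

(** [coefN N] is $N[z]$; [ext N] below is its localization, the extension of [N] to [A]. Describing
    [ext N] by denominators makes arguments on the coefficients in [z] possible; [extE] identifies
    it with the span. *)
Definition coefN N : set {mpoly {poly R}[n]} := [set f | forall i, N (cfz i f)].

Lemma coefN_sm N : is_submodule N -> is_submodule (coefN N).
Proof.
move=> HN; split=> [i|a u v hu hv i].
  by rewrite /cfz raddf0; apply: sm0.
rewrite cfzD cfzZ; apply: smD => //; apply: sm_sum => // j _.
by apply: smZ.
Qed.

Definition ext N : set {mpoly A[n]} :=
  [set f | exists c f0, [/\ D c, coefN N f0 & iota c *: f = map_mpoly iota f0]].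

Lemma map_iotaZ (c : {poly R}) (f : {mpoly {poly R}[n]}) : map_mpoly iota (c *: f) = iota c *: map_mpoly iota f.
Proof. by rewrite map_mpolyZ. Qed.

Lemma map_iotaD (f g : {mpoly {poly R}[n]}) :
  map_mpoly iota (f + g) = map_mpoly iota f + map_mpoly iota g.
Proof. exact: raddfD. Qed.

Lemma map_iotaB (f g : {mpoly {poly R}[n]}) :
  map_mpoly iota (f - g) = map_mpoly iota f - map_mpoly iota g.
Proof. exact: raddfB. Qed.

Lemma map_iota_sum (I : Type) (r : seq I) P (F : I -> {mpoly {poly R}[n]}) :
  map_mpoly iota (\sum_(i <- r | P i) F i) = \sum_(i <- r | P i) map_mpoly iota (F i).
Proof. exact: raddf_sum. Qed.

Lemma ext_sm N : is_submodule N -> is_submodule (ext N).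
Proof.
move=> HN; have HC := coefN_sm HN; split.
  exists 1, 0; split; [exact: zD1 HZ|exact: sm0|by rewrite scaler0 raddf0].
move=> a u v [c [f [Dc hf e]]] [c' [f' [Dc' hf' e']]].
have [d [r [Dd er]]] := zfrac HZ a.
exists (d * (c * c')), (r * c' *: f + d * c *: f'); split.
- by apply: (zDM HZ) => //; apply: (zDM HZ).
- by apply: (smD HC); apply: (smZ _ HC).
- rewrite map_iotaD !map_iotaZ -e -e' scalerDr !scalerA !rmorphM /= -er; congr (_ *: _ + _ *: _).
    by ring.
  by ring.
Qed.

Lemma ext_coefN N f : is_submodule N -> coefN N f -> ext N (map_mpoly iota f).
Proof.
move=> HN hf; exists 1, f; split => //; first exact: zD1 HZ.
by rewrite rmorph1 scale1r.
Qed.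

Definition icst (f : {mpoly R[n]}) : {mpoly A[n]} := map_mpoly iota (cst f).

Lemma mcoeff_icst f m : (icst f)@_m = iota (f@_m)%:P.
Proof. by rewrite /icst /cst !mcoeff_map_mpoly. Qed.

Lemma icstX (m : 'X_{1..n}) : icst 'X_[m] = 'X_[m].
Proof. by rewrite /icst /cst !map_mpolyX. Qed.

Lemma icstM f g : icst (f * g) = icst f * icst g.
Proof. by rewrite /icst /cst !rmorphM. Qed.

Lemma icstB f g : icst (f - g) = icst f - icst g.
Proof. by rewrite /icst /cst !raddfB. Qed.

Lemma icst_sum (I : Type) (r : seq I) P (F : I -> {mpoly R[n]}) :
  icst (\sum_(i <- r | P i) F i) = \sum_(i <- r | P i) icst (F i).
Proof.
apply/mpolyP => m; rewrite mcoeff_icst !raddf_sum /=.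
by apply: eq_bigr => i _; rewrite mcoeff_icst.
Qed.

Lemma icstZ c f : icst (c *: f) = iota c%:P *: icst f.
Proof. by apply/mpolyP => m; rewrite mcoeffZ !mcoeff_icst mcoeffZ polyCM rmorphM. Qed.

Lemma ext_icst N f : is_submodule N -> N f -> ext N (icst f).
Proof.
move=> HN Nf; apply: ext_coefN => // i; rewrite cfz_cst; case: ifP => // _.
exact: sm0.
Qed.

(** A denominator [c] has a unit among its coefficients; the corresponding coefficient of $c f$ is
    that unit times [f]. *)
Lemma coefN_cancel N (c : {poly R}) f : is_submodule N -> D c -> coefN N (c *: cst f) -> N f.
Proof.
move=> HN Dc h; have [i [u e]] := zunit HZ Dc.
have := h i; rewrite cfzZ (bigD1 ord_max) //= subnn cfz_cst eqxx big1 ?addr0 => [hN|j hj].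
  by rewrite -[f]scale1r -e mulrC -scalerA; apply: smZ.
rewrite cfz_cst; case: eqP => [e0|_]; last by rewrite scaler0.
by case/eqP: hj; apply/val_inj => /=; have := ltn_ord j; lia.
Qed.

Lemma map_iota_eq0 (f : {mpoly {poly R}[n]}) : map_mpoly iota f = 0 -> exists2 c, D c & c *: f = 0.
Proof.
move=> e.
have [c Dc hc] : exists2 c, D c & forall m, m \in msupp f -> c * f@_m = 0.
  elim: (msupp f) => [|m s [c Dc hc]]; first by exists 1; [exact: zD1 HZ|].
  have [|c' Dc' hc'] := zker HZ (r := f@_m).
    by rewrite -mcoeff_map_mpoly e mcoeff0.
  exists (c * c'); first exact: (zDM HZ).
  move=> m'; rewrite in_cons => /orP [/eqP->|/hc h]; first by rewrite -mulrA hc' mulr0.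
  by rewrite mulrAC h mul0r.
exists c => //; apply/mpolyP => m; rewrite mcoeffZ mcoeff0.
have [/hc //|mn] := boolP (m \in msupp f).
by rewrite (memN_msupp_eq0 mn) mulr0.
Qed.

Lemma coefN_of_ext N f : is_submodule N -> ext N (map_mpoly iota f) ->
  exists2 c, D c & coefN N (c *: f).
Proof.
move=> HN [c [g [Dc hg e]]].
have [|c' Dc' h] := @map_iota_eq0 (c *: f - g).
  by rewrite map_iotaB map_iotaZ e subrr.
exists (c' * c); first exact: (zDM HZ).
rewrite -scalerA (_ : c *: f = (c *: f - g) + g); last by rewrite subrK.
rewrite scalerDr h add0r; apply: (smZ _ (coefN_sm HN)) => //.
Qed.

(** The extension to [A] is faithful: statements proved with the generic parameter come back to [R]
    through this lemma. *)
Lemma ext_descent N f : is_submodule N -> ext N (icst f) -> N f.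
Proof. by move=> HN /(coefN_of_ext HN) [c Dc h]; apply: coefN_cancel h. Qed.

Lemma clear_denom (f : {mpoly A[n]}) ms : inS ms f ->
  exists c f0, [/\ D c, inS ms f0 & iota c *: f = map_mpoly iota f0].
Proof.
move=> hf.
have [c Dc hc] : exists2 c, D c & forall m, m \in ms -> exists r, iota c * f@_m = iota r.
  elim: ms {hf} => [|m s [c Dc hc]]; first by exists 1; [exact: zD1 HZ|].
  have [d [r [Dd er]]] := zfrac HZ f@_m.
  exists (c * d); first exact: (zDM HZ).
  move=> m'; rewrite in_cons => /orP [/eqP->|/hc [r' h]].
    by exists (c * r); rewrite !rmorphM -mulrA er.
  by exists (d * r'); rewrite !rmorphM -h; ring.
have H m : exists r, m \in ms -> iota c * f@_m = iota r.
  by have [/hc [r h]|_] := boolP (m \in ms); [exists r|exists 0].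
have [r hr] := choice H.
have mc m : (\sum_(m <- undup ms) r m *: 'X_[m] : {mpoly {poly R}[n]})@_m = if m \in ms then r m else 0.
  rewrite raddf_sum /= -mem_undup; case: ifP => mm.
    rewrite (bigD1_seq m) ?undup_uniq //= mcoeffZ mcoeffX eqxx mulr1 big1 ?addr0 // => m' /negPf e.
    by rewrite mcoeffZ mcoeffX e mulr0.
  rewrite big_seq big1 // => m' mm'; rewrite mcoeffZ mcoeffX.
  by case: eqP => [e|_]; [rewrite e mm in mm'|rewrite mulr0].
exists c, (\sum_(m <- undup ms) r m *: 'X_[m]); split => //.
  by apply/inSP => m mn; rewrite mc (negPf mn).
apply/mpolyP => m; rewrite mcoeffZ mcoeff_map_mpoly mc; case: ifP => [/hr //|mn].
have -> : f@_m = 0 by move/inSP: hf; apply; rewrite mn.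
by rewrite mulr0 raddf0.
Qed.

Lemma unscale (N : set {mpoly A[n]}) c (f : {mpoly A[n]}) : is_submodule N -> D c -> N (iota c *: f) -> N f.
Proof.
move=> HN Dc h; have [y e] := zDu HZ Dc.
by rewrite -[f]scale1r -e mulrC -scalerA; apply: smZ.
Qed.

Lemma ext_inS N ms : N `<=` inS ms -> ext N `<=` inS ms.
Proof.
move=> Nms f [c [f0 [Dc hf e]]]; apply: (unscale (inS_sm ms) Dc); rewrite e.
apply/inSP => m mn; rewrite mcoeff_map_mpoly (_ : f0@_m = 0) ?raddf0 //.
apply/polyP => i; rewrite coef0 -mcoeff_cfz.
by have /inSP := Nms _ (hf i); apply.
Qed.

Lemma inS_cfz ms f i : inS ms f -> inS ms (cfz i f).
Proof. by move=> /inSP h; apply/inSP => m mn; rewrite mcoeff_cfz h // coef0. Qed.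

Lemma inS_icst ms f : inS ms f -> inS ms (icst f).
Proof. by move=> /inSP h; apply/inSP => m mn; rewrite mcoeff_icst h // polyC0 raddf0. Qed.

Lemma ext_span (N : set {mpoly R[n]}) (G : set {mpoly R[n]}) :
  is_submodule N -> G `<=` N -> span (icst @` G) `<=` ext N.
Proof.
move=> HN GN; apply: span_min; first exact: ext_sm.
by move=> _ [f /GN h <-]; apply: ext_icst.
Qed.

Lemma ext_sub_span N : is_submodule N -> ext N `<=` span (icst @` N).
Proof.
move=> HN f [c [f0 [Dc hf e]]]; apply: (unscale (span_sm _) Dc); rewrite e.
pose s := (\max_(m <- msupp f0) size f0@_m)%N.
have -> : map_mpoly iota f0 = \sum_(i < s) iota 'X^i *: icst (cfz i f0).
  apply/mpolyP => m; rewrite mcoeff_map_mpoly raddf_sum /=.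
  under eq_bigr do rewrite mcoeffZ mcoeff_icst mcoeff_cfz -rmorphM /=.
  rewrite -rmorph_sum /=; congr (iota _).
  have hs : (size f0@_m <= s)%N.
    have [mm|mn] := boolP (m \in msupp f0); last by rewrite (memN_msupp_eq0 mn) size_poly0.
    by apply: (@leq_bigmax_seq _ _ _ (fun m => size f0@_m)).
  rewrite -[LHS]coefK (poly_def (size f0@_m)).
  rewrite (big_ord_widen s (fun i => (f0@_m)`_i *: 'X^i) hs).
  rewrite [RHS](bigID (fun i : 'I_s => (i < size f0@_m)%N)) /= [X in _ + X]big1 ?addr0.
    by apply: eq_bigr => i _; rewrite mulrC mul_polyC.
  by move=> i; rewrite -leqNgt => h; rewrite nth_default // polyC0 mulr0.
apply: (sm_sum _ (span_sm _)) => i _; apply: (smZ _ (span_sm _)).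
by apply: span_sub; exists (cfz i f0) => //; apply: hf.
Qed.

Lemma extE N : is_submodule N -> ext N = span (icst @` N).
Proof.
by move=> HN; apply/seteqP; split; [apply: ext_sub_span|apply: ext_span].
Qed.

Lemma ext_basis_span N ms q (e : 'I_q -> {mpoly R[n]}) : is_submodule N ->
  (forall v, inS ms v -> exists c : 'I_q -> R, N (v - \sum_j c j *: e j)) ->
  forall v, inS ms v -> exists c : 'I_q -> A, ext N (v - \sum_j c j *: icst (e j)).
Proof.
move=> HN eS v hv.
pose W := [set v | exists c : 'I_q -> A, ext N (v - \sum_j c j *: icst (e j))].
have HE := ext_sm HN.
have HW : is_submodule W.
  split; first by exists (fun=> 0); rewrite big1 ?subr0; [exact: sm0|move=> *; rewrite scale0r].
  move=> a x y [c hc] [c' hc']; exists (fun j => a * c j + c' j).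
  under eq_bigr do rewrite scalerDl -scalerA.
  rewrite big_split /= -scaler_sumr opprD addrACA -scalerBr.
  by apply: smD => //; apply: smZ.
suff : W v by [].
have -> : v = \sum_(m <- msupp v) v@_m *: 'X_[m] by rewrite -mpolyE.
rewrite big_seq; apply: sm_sum => // m /hv mm; apply: smZ => //.
have [c hc] := eS _ (inS_X mm); exists (fun j => iota (c j)%:P).
have := ext_icst HN hc.
rewrite icstB icstX icst_sum.
by under eq_bigr do rewrite icstZ.
Qed.

(** Clear the denominators of the coefficients and compare the powers of [z] one at a time. *)
Lemma ext_basis_indep N q (e : 'I_q -> {mpoly R[n]}) : is_submodule N ->
  (forall c : 'I_q -> R, N (\sum_j c j *: e j) -> forall j, c j = 0) ->
  forall c : 'I_q -> A, ext N (\sum_j c j *: icst (e j)) -> forall j, c j = 0.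
Proof.
move=> HN eI c h.
have [d Dd hd] : exists2 d, D d & forall j, exists r, iota d * c j = iota r.
  have : exists2 d, D d & forall j, j \in enum 'I_q -> exists r, iota d * c j = iota r.
    elim: (enum 'I_q) => [|j s [d Dd hd]]; first by exists 1; [exact: zD1 HZ|].
    have [d' [r [Dd' er]]] := zfrac HZ (c j).
    exists (d * d'); first exact: (zDM HZ).
    move=> j'; rewrite in_cons => /orP [/eqP->|/hd [r' h']].
      by exists (d * r); rewrite !rmorphM -mulrA er.
    by exists (d' * r'); rewrite !rmorphM -h'; ring.
  by move=> [d Dd hd]; exists d => // j; apply: hd; rewrite mem_enum.
have [r hr] := choice hd.
have h2 : ext N (map_mpoly iota (\sum_j r j *: cst (e j))).
  rewrite map_iota_sum; under eq_bigr do rewrite map_iotaZ -hr -scalerA.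
  by rewrite -scaler_sumr; apply: smZ => //; apply: ext_sm.
have [d' Dd' h3] := coefN_of_ext HN h2.
have h4 j : d' * r j = 0.
  apply/polyP => i; rewrite coef0; apply: (eI (fun j => (d' * r j)`_i)).
  have := h3 i; rewrite scaler_sumr /cfz raddf_sum /=.
  under eq_bigr => l _ do rewrite scalerA -/(cfz _ _) cfzZ (bigD1 ord_max) //= subnn cfz_cst eqxx.
  under eq_bigr => l _.
    rewrite big1 ?addr0; first over.
    move=> a ha; rewrite cfz_cst; case: eqP => [e0|_]; last by rewrite scaler0.
    by case/eqP: ha; apply/val_inj => /=; have := ltn_ord a; lia.
  by [].
move=> j; have [y hy] := zDu HZ Dd; have [y' hy'] := zDu HZ Dd'.
have := hr j => e1; have : iota d' * (iota d * c j) = 0 by rewrite e1 -rmorphM h4 raddf0.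
move=> e2; rewrite -[c j]mul1r -hy -[_ * _]mul1r -hy'.
rewrite (_ : _ * _ = y' * y * (iota d' * (iota d * c j))); last by ring.
by rewrite e2 mulr0.
Qed.

End ZExtension.

Arguments icst {n R A} iota f.

(* McCoy: a polynomial in z with coefficients in V / I killed by the generic
   linear form vanishes, because I is saturated. *)
Section Families.
Variables (n : nat) (Gs : seq 'X_{1..n}) (mt : nat -> seq 'X_{1..n}).

(** The pieces, along one ray of degrees, of a homogeneous ideal; [Gs] stands for the monomials of
    the ample degree, and [fam_sat] is saturation with respect to them. *)
Record fam (R : comNzRingType) (I : nat -> set {mpoly R[n]}) : Prop := Fam {
  fam_sm : forall t, is_submodule (I t);
  fam_in : forall t, I t `<=` inS (mt t);
  fam_mul : forall t g f, g \in Gs -> I t f -> I t.+1 ('X_[g] * f);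
  fam_sat : forall t f, inS (mt t) f -> (forall g, g \in Gs -> I t.+1 ('X_[g] * f)) -> I t f }.

Hypothesis (GsV : forall t g m, g \in Gs -> m \in mt t -> (g + m)%MM \in mt t.+1).

Local Notation gj j := (nth 0%MM Gs j).

Lemma mccoy (R : comNzRingType) (I : nat -> set {mpoly R[n]}) : fam I ->
  forall N t (a : nat -> {mpoly R[n]}), (forall i, inS (mt t) (a i)) ->
  (forall i, (N <= i)%N -> I t (a i)) ->
  (forall k, I t.+1 (\sum_(j < size Gs | (j <= k)%N) 'X_[gj j] * a (k - j)%N)) ->
  forall i, I t (a i).
Proof.
move=> HI; elim=> [|N IH] t a ain aN conv; first by move=> i; apply: aN.
have Hs := fam_sm HI.
(* Descending in [j]. In the coefficient of $z^{j+N}$, the terms before [j] involve some $a_i$ with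
   $i > N$ and the terms after [j] are already known to lie in [I]; hence so does $g_j a_N$. The
   polynomial with coefficients $g_j a_i$ then has one coefficient less to treat. *)
have claim : forall s j, (size Gs - j <= s)%N -> (j < size Gs)%N -> forall i, I t.+1 ('X_[gj j] * a i).
  elim=> [|s IHs] j hj jG; first by lia.
  have gjG : gj j \in Gs by apply: mem_nth.
  have XN : I t.+1 ('X_[gj j] * a N).
    have := conv (j + N)%N; rewrite (bigD1 (Ordinal jG)) /= ?leq_addr // addKn => h.
    have h2 : I t.+1 (\sum_(i < size Gs | (i <= j + N)%N && (i != Ordinal jG))
        'X_[gj i] * a (j + N - i)%N).
      apply: sm_sum => // i /andP [i1 i2].
      have [lt|lt|e] := ltngtP i j.
      - by apply: (fam_mul HI); [apply: mem_nth|apply: aN; lia].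
      - by apply: IHs => //; lia.
      - by case/eqP: i2; apply/val_inj.
    by have := smB (Hs _) h h2; rewrite addrK.
  apply: (IH t.+1 (fun i => 'X_[gj j] * a i)).
  - by move=> i; apply: inS_XM (ain i) => m; apply: GsV.
  - move=> i; rewrite leq_eqVlt => /orP [/eqP<- //|Ni].
    by apply: (fam_mul HI) => //; apply: aN.
  - move=> k; have := fam_mul HI gjG (conv k); rewrite mulr_sumr.
    by under eq_bigr do rewrite mulrCA.
move=> i; apply: (fam_sat HI) => // g gG.
by rewrite -(nth_index 0%MM gG); apply: (claim (size Gs)); [lia|rewrite index_mem].
Qed.

Section FamilyExt.
Variables (R A : comNzRingType) (iota : {rmorphism {poly R} -> A}) (D : set {poly R}).
Hypothesis (HZ : zext iota D).
Variable (I : nat -> set {mpoly R[n]}).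
Hypothesis (HI : fam I).

(** The generic linear form. Powers of a single variable serve as coefficients instead of
    independent variables. *)
Definition ell0 : {mpoly {poly R}[n]} := \sum_(j < size Gs) 'X^j *: 'X_[gj j].
Definition ell : {mpoly A[n]} := map_mpoly iota ell0.

Lemma ellE : ell = \sum_(j < size Gs) iota 'X ^+ j *: 'X_[gj j].
Proof.
rewrite /ell /ell0 raddf_sum /=; apply: eq_bigr => j _.
by rewrite map_mpolyZ map_mpolyX rmorphXn.
Qed.

Lemma cfz_ellM k f : cfz k (ell0 * f) =
  \sum_(j < size Gs | (j <= k)%N) 'X_[gj j] * cfz (k - j) f.
Proof.
rewrite /ell0 mulr_suml /cfz raddf_sum /= [RHS]big_mkcond /=; apply: eq_bigr => j _.
rewrite -scalerAl -/(cfz _ _); apply/mpolyP => m; rewrite mcoeff_cfz mcoeffZ.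
rewrite coefXnM ltnNge; case: leqP => //= h; last by rewrite mcoeff0.
by rewrite -cfzXM mcoeff_cfz.
Qed.

Lemma inS_ell t f : inS (mt t) f -> inS (mt t.+1) (ell * f).
Proof.
move=> hf; rewrite ellE mulr_suml; apply: (sm_sum _ (inS_sm _)) => j _.
rewrite -scalerAl; apply: (smZ _ (inS_sm _)); apply: inS_XM hf => m.
by apply: GsV; apply: mem_nth.
Qed.

(** Once denominators are cleared, this is [mccoy] for the coefficients in [z]. *)
Lemma ell_regular t f : inS (mt t) f -> ext iota D (I t.+1) (ell * f) -> ext iota D (I t) f.
Proof.
move=> hf h; have [c [f0 [Dc f0in e]]] := clear_denom HZ hf.
have Hs := fam_sm HI.
have h2 : ext iota D (I t.+1) (map_mpoly iota (ell0 * f0)).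
  rewrite rmorphM /= -e -scalerAr; apply: (smZ _ (ext_sm HZ (Hs _))).
  exact: h.
have [d Dd h3] := coefN_of_ext HZ (Hs _) h2.
apply: (unscale HZ (c := d * c)); [exact: ext_sm|exact: (zDM HZ)|].
rewrite rmorphM /= -scalerA e -map_iotaZ; apply: ext_coefN => //.
have din : inS (mt t) (d *: f0) by apply: (smZ _ (inS_sm _)).
move=> i; apply: (mccoy HI (N := (\max_(m <- mt t) size (d *: f0)@_m)%N)
    (a := fun i => cfz i (d *: f0))).
- by move=> j; apply: inS_cfz.
- move=> j hj; rewrite (_ : cfz j _ = 0); first exact: sm0.
  apply/mpolyP => m; rewrite mcoeff_cfz mcoeff0.
  have [mm|mn] := boolP (m \in mt t); last by rewrite (proj1 (inSP _ _) din) // coef0.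
  rewrite nth_default //; apply: leq_trans hj.
  by apply: (@leq_bigmax_seq _ _ _ (fun m => size (d *: f0)@_m)).
- by move=> k; rewrite -cfz_ellM -scalerAr; apply: h3.
Qed.

Lemma ext_fam : fam (fun t => ext iota D (I t)).
Proof.
have Hs := fam_sm HI; split.
- by move=> t; apply: ext_sm.
- by move=> t; apply: ext_inS => //; apply: fam_in.
- move=> t g f gG [c [f0 [Dc h e]]]; exists c, ('X_[g] * f0); split => //.
    by move=> i; rewrite cfzXM; apply: (fam_mul HI).
  by rewrite scalerAr e rmorphM /= map_mpolyX.
- move=> t f hf h; have [c [f0 [Dc f0in e]]] := clear_denom HZ hf.
  have [d Dd hd] : exists2 d, D d & forall g, g \in Gs -> coefN (I t.+1) (d *: ('X_[g] * f0)).
    have : forall g, g \in Gs -> ext iota D (I t.+1) (map_mpoly iota ('X_[g] * f0)).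
      move=> g gG; rewrite rmorphM /= map_mpolyX -e -scalerAr.
      by apply: (smZ _ (ext_sm HZ (Hs _))); apply: h.
    elim: Gs => [|g s IHs] H; first by exists 1; [exact: zD1 HZ|].
    have [|d Dd hd] := IHs; first by move=> g' g's; apply: H; rewrite in_cons g's orbT.
    have [d' Dd' hd'] := coefN_of_ext HZ (Hs _) (H g (mem_head _ _)).
    exists (d * d'); first exact: (zDM HZ).
    move=> g'; rewrite in_cons => /orP [/eqP->|/hd hg'].
      by rewrite -scalerA; apply: (smZ _ (coefN_sm (Hs _))).
    by rewrite mulrC -scalerA; apply: (smZ _ (coefN_sm (Hs _))).
  apply: (unscale HZ (c := d * c)); [exact: ext_sm|exact: (zDM HZ)|].
  rewrite rmorphM /= -scalerA e -map_iotaZ; apply: ext_coefN => //.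
  move=> i; apply: (fam_sat HI); first by apply: inS_cfz; apply: (smZ _ (inS_sm _)).
  by move=> g gG; rewrite -cfzXM -scalerAr; apply: hd.
Qed.

End FamilyExt.

End Families.

Section GenericParameter.
Variables (R : comNzRingType) (F : fieldType) (phi : {rmorphism R -> F}).

(** Inverting the polynomials with nonzero image over [F]: for [R] local with residue field [F] this
    gives Nagata's ring $R(z)$, which is local with residue field $F(z)$ by [phiz_local]. *)
Definition zdata : fqdata {poly R}.
Proof.
refine (@FQData {poly R} [set 0] [set c | map_poly phi c != 0] _ _ _ _).
- by split=> // a x y -> -> /=; rewrite mulr0 addr0.
- by rewrite /= rmorph1 oner_neq0.
- by move=> x y /= hx hy; rewrite rmorphM mulf_neq0.
- by move=> x /= /eqP h e; apply: h; rewrite e rmorph0.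
Defined.

Definition Az : comNzRingType := fq zdata.
Definition iotaz : {rmorphism {poly R} -> Az} := fqi zdata.

Lemma Az_zext : (forall x, phi x != 0 -> exists y, x * y = 1) ->
  zext iotaz [set c | map_poly phi c != 0].
Proof.
move=> unitR; split.
- exact: (fqS1 zdata).
- exact: (@fqSM _ zdata).
- by move=> c Dc; apply: (@fqi_unit _ zdata).
- by move=> a; have [r [s h]] := @fq_frac _ zdata a; exists s, r.
- by move=> r /(@fqi_eq0 _ zdata r).
- move=> c /= h; suff [i hi] : exists i, phi c`_i != 0 by exists i; apply: unitR.
  apply: contrapT => no; case/eqP: h; apply/polyP => i; rewrite coef_map coef0.
  by apply/eqP/negPn/negP => hi; apply: no; exists i.
Qed.

End GenericParameter.

Section RationalFunctions.
Variable F : fieldType.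

Lemma Az_field (x : Az (@idfun F : {rmorphism F -> F})) : x <> 0 -> exists y, x * y = 1.
Proof.
have [r [s [Ss e]]] := fq_frac x => x0.
have Sr : fqS (zdata (@idfun F : {rmorphism F -> F})) r.
  rewrite /=; apply/eqP => r0; apply: x0.
  have {}r0 : r = 0 by apply/polyP => i; have := congr1 (fun p : {poly F} => p`_i) r0; rewrite coef_map !coef0.
  have [y hy] := fqi_unit Ss; rewrite -[x]mul1r -hy mulrAC e r0 rmorph0.
  by rewrite mul0r.
have [y hy] := fqi_unit Sr; exists (fqi _ s * y).
by rewrite mulrA [x * _]mulrC e.
Qed.

Lemma Fz_ex : exists K : {K : fieldType & {rmorphism {poly F} -> K}},
  zext (projT2 K) [set c | c != 0].
Proof.
pose i : {rmorphism {poly F} -> fieldify Az_field} := iotaz (@idfun F : {rmorphism F -> F}).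
have H : zext i [set c | map_poly (@idfun F : {rmorphism F -> F}) c != 0].
  apply: (@Az_zext F F (@idfun F : {rmorphism F -> F})) => x /= x0.
  by exists x^-1; rewrite divff.
exists (existT _ (fieldify Az_field : fieldType) i) => /=.
rewrite (_ : [set c | c != 0] = [set c | map_poly (@idfun F : {rmorphism F -> F}) c != 0]) //.
apply/seteqP; split=> c /=; rewrite (_ : map_poly _ c = c) //.
  by apply/polyP => l; rewrite coef_map.
by apply/polyP => l; rewrite coef_map.
Qed.

(** The field $F(z)$, hidden behind [cid]: it enters only through the properties in [Fz_zext]. *)
Definition Fz : fieldType := projT1 (projT1 (cid Fz_ex)).
Definition iotaF : {rmorphism {poly F} -> Fz} := projT2 (projT1 (cid Fz_ex)).

Lemma Fz_zext : zext iotaF [set c | c != 0].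
Proof. exact: (projT2 (cid Fz_ex)). Qed.

End RationalFunctions.

Section LocalGeneric.
Variables (R : comNzRingType) (F : fieldType) (phi : {rmorphism R -> F}).
Hypothesis (Hphi : local_map phi).

Definition polyphi : {rmorphism {poly R} -> Fz F} := iotaF F \o map_poly phi.

Lemma polyphiI x : fqI (zdata phi) x -> polyphi x = 0.
Proof. by move=> ->; rewrite raddf0. Qed.

Lemma polyphiS x : fqS (zdata phi) x -> exists y, polyphi x * y = 1.
Proof. by move=> h; apply: (zDu (Fz_zext F)). Qed.

Definition phiz : {rmorphism Az phi -> Fz F} := fqliftR polyphiI polyphiS.

Lemma phiz_iota c : phiz (iotaz phi c) = iotaF F (map_poly phi c).
Proof. exact: fqliftR_i. Qed.

Lemma phiz_local : local_map phiz.
Proof.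
have HR := Az_zext (proj2 Hphi); have HF := Fz_zext F.
have surj (p : {poly F}) : exists p', map_poly phi p' = p.
  have [c hc] := local_lift_fun Hphi (fun i => p`_i).
  exists (\poly_(i < size p) c i); apply/polyP => i; rewrite coef_map coef_poly.
  by case: ltnP => h; [exact: hc|rewrite [RHS]nth_default //; exact: raddf0].
split.
  move=> z; have [c [r [Dc e]]] := zfrac HF z.
  have [c' ec] := surj c; have [r' er] := surj r.
  have [|y hy] := zDu HR (c := c'); first by rewrite /= ec.
  exists (iotaz phi r' * y); rewrite rmorphM phiz_iota er -e.
  have := congr1 phiz hy; rewrite rmorphM phiz_iota ec rmorph1 => h.
  by rewrite mulrAC h mul1r.
move=> x x0; have [c [r [Dc e]]] := zfrac HR x.
have Dr : [set c | map_poly phi c != 0] r.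
  rewrite /=; apply/eqP => r0; have := congr1 phiz e; rewrite rmorphM !phiz_iota r0 raddf0.
  have [y hy] := zDu HF Dc; move=> /(congr1 (fun u => u * y)); rewrite mul0r mulrAC hy mul1r.
  by move/eqP: x0.
have [y hy] := zDu HR Dr; exists (iotaz phi c * y).
by rewrite mulrA [x * _]mulrC e.
Qed.

End LocalGeneric.

(** * Uniform regularity *)

Section Saturation.
Variables (n : nat) (Gs : seq 'X_{1..n}) (mt : nat -> seq 'X_{1..n}).
Hypothesis (mtU : forall t, uniq (mt t)).
Hypothesis (GsV : forall t g m, g \in Gs -> m \in mt t -> (g + m)%MM \in mt t.+1).

Definition wd (w : seq 'X_{1..n}) : 'X_{1..n} := (\sum_(g <- w) g)%MM.
Definition word s (w : seq 'X_{1..n}) := size w = s /\ {subset w <= Gs}.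

Hypothesis (mt_div : forall t t' m m', m \in mt t -> m' \in mt t' -> (m <= m')%MM ->
  (t <= t')%N -> exists2 w, word (t' - t) w & m' = (m + wd w)%MM).

Record gfam (R : comNzRingType) (I : nat -> set {mpoly R[n]}) : Prop := GFam {
  gfam_sm : forall t, is_submodule (I t);
  gfam_in : forall t, I t `<=` inS (mt t);
  gfam_mul : forall t g f, g \in Gs -> I t f -> I t.+1 ('X_[g] * f) }.

Lemma wd_cons g w : wd (g :: w) = (g + wd w)%MM.
Proof. by rewrite /wd big_cons. Qed.

Lemma wd_cat w w' : wd (w ++ w') = (wd w + wd w')%MM.
Proof. by rewrite /wd big_cat. Qed.

Section Ring.
Variables (R : comNzRingType) (N : nat -> set {mpoly R[n]}).
Hypothesis (HN : gfam N).

Lemma gfam_word s w t f : word s w -> N t f -> N (t + s)%N ('X_[wd w] * f).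
Proof.
elim: w s f => [|g w IH] s f [/= es sub].
  by rewrite -es addn0 /wd big_nil mpolyX0 mul1r.
case: s es => // s [es] Nf; rewrite addnS wd_cons mpolyXD -mulrA.
apply: (gfam_mul HN); first by apply: sub; rewrite mem_head.
by apply: IH => //; split => // x xw; apply: sub; rewrite in_cons xw orbT.
Qed.

Lemma inS_word s w t (f : {mpoly R[n]}) : word s w -> inS (mt t) f -> inS (mt (t + s)) ('X_[wd w] * f).
Proof.
elim: w s f => [|g w IH] s f [/= es sub].
  by rewrite -es addn0 /wd big_nil mpolyX0 mul1r.
case: s es => // s [es] Nf; rewrite addnS wd_cons mpolyXD -mulrA.
apply: (inS_XM (ms := mt (t + s))).
  by move=> m; apply: GsV; apply: sub; rewrite mem_head.
by apply: IH => //; split => // x xw; apply: sub; rewrite in_cons xw orbT.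
Qed.

Definition satN t : set {mpoly R[n]} := [set f | inS (mt t) f /\
  exists s, forall w, word s w -> N (t + s)%N ('X_[wd w] * f)].

Lemma word_split s s' w : (s <= s')%N -> word s' w ->
  exists w1 w2, [/\ w = w1 ++ w2, word s w1 & word (s' - s) w2].
Proof.
move=> le [es sub]; exists (take s w), (drop s w); rewrite cat_take_drop; split => //.
  split; first by rewrite size_takel // es.
  by move=> x /mem_take /sub.
split; first by rewrite size_drop es.
by move=> x /mem_drop /sub.
Qed.

Lemma satN_mono t f s s' : (s <= s')%N -> (forall w, word s w -> N (t + s)%N ('X_[wd w] * f)) ->
  forall w, word s' w -> N (t + s')%N ('X_[wd w] * f).
Proof.
move=> le H w /(word_split le) [w1 [w2 [-> h1 h2]]].
rewrite wd_cat addmC mpolyXD -mulrA -(subnKC le) addnA.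
by apply: gfam_word => //; apply: H.
Qed.

Lemma satN_sub t : N t `<=` satN t.
Proof.
move=> f Nf; split; first exact: (gfam_in HN).
by exists 0%N => w hw; apply: gfam_word.
Qed.

Lemma satN_fam : fam Gs mt satN.
Proof.
have Hs := gfam_sm HN; split.
- move=> t; split.
    by apply: satN_sub; apply: sm0.
  move=> a u v [hu [s Hu]] [hv [s' Hv]]; split.
    by apply: (smD (inS_sm _)) => //; apply: (smZ _ (inS_sm _)).
  exists (maxn s s') => w hw; rewrite mulrDr -scalerAr.
  apply: (smD (Hs _)); first apply: (smZ _ (Hs _)).
    by apply: satN_mono Hu w hw; rewrite leq_maxl.
  by apply: satN_mono Hv w hw; rewrite leq_maxr.
- by move=> t f [].
- move=> t g f gG [hf [s Hf]]; split; first by apply: inS_XM hf => m; apply: GsV.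
  exists s => w hw; rewrite mulrCA addSn; apply: (gfam_mul HN) => //.
  exact: Hf.
- move=> t f hf H; split => //.
  have [s hs] : exists s, forall g, g \in Gs -> forall w, word s w -> N (t.+1 + s)%N ('X_[wd w] * ('X_[g] * f)).
    apply: (seq_bound (P := fun g s => forall w, word s w -> N (t.+1 + s)%N ('X_[wd w] * ('X_[g] * f)))).
      by move=> g s s' le; apply: satN_mono.
    by move=> g /H [_ [s hs]]; exists s.
  exists s.+1 => w [ew sub]; case: w ew sub => // g w [ew] sub.
  rewrite wd_cons addmC mpolyXD -mulrA addnS -addSn; apply: hs; first by apply: sub; rewrite mem_head.
  by split => // x xw; apply: sub; rewrite in_cons xw orbT.
Qed.

End Ring.

Lemma mpolyX_neq0 (R : comNzRingType) (m : 'X_{1..n}) : 'X_[m] != 0 :> {mpoly R[n]}.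
Proof. by rewrite -msupp_eq0 msuppX. Qed.

Lemma mlead_XM (F : fieldType) m (f : {mpoly F[n]}) : f != 0 -> mlead ('X_[m] * f) = (m + mlead f)%MM.
Proof. by move=> f0; rewrite mleadM ?mleadXm // mpolyX_neq0. Qed.

(** The two quotients have the same standard monomials, hence the same dimension, and one submodule
    contains the other. *)
Lemma leads_eq (F : fieldType) (N N' : set {mpoly F[n]}) ms : uniq ms -> is_submodule N -> is_submodule N' ->
  N `<=` N' -> (forall m, m \in ms -> leads N' ms m -> leads N ms m) ->
  forall f, inS ms f -> N' f -> N f.
Proof.
move=> u HN HN' NN' H.
have e : count (fun m => ~~ `[< leads N ms m >]) ms = count (fun m => ~~ `[< leads N' ms m >]) ms.
  apply: eq_in_count => m mm; congr (~~ _); apply/asboolP/asboolP; last exact: H.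
  by move=> [f [h1 h2 h3 h4]]; exists f; split => //; apply: NN'.
have [_ h] := has_dim_le (inS_sm ms) HN (fun v _ => NN' v) (initial_basis u HN) (initial_basis u HN').
exact: h.
Qed.

(** By Dickson's lemma finitely many leading monomials of the saturation divide all others. Their
    representatives enter [N] after multiplication by words of bounded length, so beyond [t1] the
    family and its saturation have the same leading monomials. *)
Lemma satN_noeth (F : fieldType) (N : nat -> set {mpoly F[n]}) : gfam N ->
  exists t1, forall t, (t1 <= t)%N -> forall f, satN N t f -> N t f.
Proof.
move=> HN; have HS := satN_fam HN.
have [s [sU hs]] := dickson [set m | exists t, m \in mt t /\ leads (satN N t) (mt t) m].
have [t1 ht1] : exists t1, forall m, m \in s -> exists t f k,
    [/\ satN N t f, f != 0, mlead f = m, m \in mt t &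
     (t + k <= t1)%N /\ forall w, word k w -> N (t + k)%N ('X_[wd w] * f)].
  apply: (seq_bound (P := fun m t1 => exists t f k, [/\ satN N t f, f != 0, mlead f = m, m \in mt t &
     (t + k <= t1)%N /\ forall w, word k w -> N (t + k)%N ('X_[wd w] * f)])).
    move=> m a a' le [t [f [k [h1 h2 h3 h4 [h5 h6]]]]]; exists t, f, k; split => //; split => //.
    exact: leq_trans le.
  move=> m /sU [t [mm [f [h1 h2 h3 h4]]]]; have [_ [k hk]] := h1.
  by exists (t + k)%N, t, f, k.
exists t1 => t le f Sf.
apply: (leads_eq (mtU t) (gfam_sm HN t) (fam_sm HS t)) (Sf); last exact: (fam_in HS).
- exact: satN_sub.
move=> m mm lm; have [|m' m's le'] := hs m; first by exists t.
have [t' [g [k [h1 h2 h3 h4 [h5 h6]]]]] := ht1 _ m's.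
have [|w hw em] := mt_div h4 mm le'; first by lia.
exists ('X_[wd w] * g); split.
- have {1}-> : t = (t' + (t - t'))%N by lia.
  by apply: (satN_mono HN _ h6 hw); lia.
- have {1}-> : t = (t' + (t - t'))%N by lia.
  by apply: inS_word => //; apply: (fam_in HS).
- by rewrite mulf_neq0 // mpolyX_neq0.
- by rewrite mlead_XM // h3 em addmC.
Qed.

End Saturation.

Lemma zmod_cancel (V : zmodType) (v w x y z : V) :
  v - (x - y) = v - (w + x) - (z - (w + y)) + z.
Proof.
rewrite !opprB -[RHS]addrA subrK opprD -[RHS]addrA addrACA addNr add0r.
by rewrite [- x + y]addrC.
Qed.

(** * Regularity bounds by induction on generic hyperplane sections *)

Section Mumford.
Variables (n : nat) (Gs : seq 'X_{1..n}) (mt : nat -> seq 'X_{1..n}).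
Hypothesis (mtU : forall t, uniq (mt t)).
Hypothesis (GsV : forall t g m, g \in Gs -> m \in mt t -> (g + m)%MM \in mt t.+1).
Hypothesis (VGs : forall t m, m \in mt t.+1 ->
  exists g m', [/\ g \in Gs, m' \in mt t & m = (g + m')%MM]).
Hypothesis (mt_div : forall t t' m m', m \in mt t -> m' \in mt t' -> (m <= m')%MM ->
  (t <= t')%N -> exists2 w, word Gs (t' - t) w & m' = (m + wd w)%MM).

Local Notation V t := (inS (mt t)).

Definition GsM (R : comNzRingType) (N : set {mpoly R[n]}) : set {mpoly R[n]} :=
  [set x | exists g f, [/\ g \in Gs, N f & x = 'X_[g] * f]].

Definition gen_at (R : comNzRingType) (I : nat -> set {mpoly R[n]}) t :=
  I t.+1 `<=` span (GsM (I t)).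

Section Hyperplane.
Variables (R A : comNzRingType) (iota : {rmorphism {poly R} -> A}) (D : set {poly R}).
Hypothesis (HZ : zext iota D).
Variable (I : nat -> set {mpoly R[n]}).
Hypothesis (HI : fam Gs mt I).
Local Notation l := (ell Gs iota).

(** The ideal $I_t + \ell V_{t-1}$ of the generic hyperplane section, not yet saturated; $V_{-1}$ is
    zero. *)
Definition hypN t : set {mpoly A[n]} :=
  if t is t'.+1 then smadd (ext iota D (I t)) ((fun v => l * v) @` V t')
  else ext iota D (I 0%N).

Lemma ellV_sm t : is_submodule ((fun v => l * v) @` V t).
Proof.
split; first by exists 0; [exact: (sm0 (inS_sm _))|rewrite mulr0].
move=> a u v [x hx <-] [y hy <-]; exists (a *: x + y); last by rewrite mulrDr scalerAr.
by apply: (smD (inS_sm _)) => //; apply: (smZ _ (inS_sm _)).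
Qed.

Lemma hypN_gfam : gfam Gs mt hypN.
Proof.
have HE := ext_fam HZ HI; split.
- case=> [|t]; first exact: (fam_sm HE).
  by apply: smadd_sm; [apply: (fam_sm HE)|apply: ellV_sm].
- case=> [|t]; first exact: (fam_in HE).
  move=> f [u hu [v hv e]]; rewrite -(subrK u f) -e; apply: (smD (inS_sm _)).
    exact: inS_ell.
  exact: (fam_in HE) hu.
- case=> [|t] g f gG.
    move=> h; apply: smadd_l; first exact: ellV_sm.
    exact: (fam_mul HE gG h).
  move=> [u hu [v hv e]]; exists ('X_[g] * u); first exact: (fam_mul HE gG hu).
  exists ('X_[g] * v); first by apply: inS_XM hv => m; apply: GsV.
  by rewrite mulrCA e mulrBr.
Qed.

Lemma ext_hypN t : ext iota D (I t) `<=` hypN t.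
Proof. by case: t => [|t] // f; apply: smadd_l; apply: ellV_sm. Qed.

End Hyperplane.

Section FieldCase.
Variable F : fieldType.
Implicit Types (I : nat -> set {mpoly F[n]}).

Local Notation iota := (iotaF F).
Local Notation D := [set c : {poly F} | c != 0].
Local Notation HZ := (Fz_zext F).
Local Notation l := (ell Gs iota).

Definition hyp I : nat -> set {mpoly (Fz F)[n]} := hypN iota D I.

(** The hyperplane section needs no saturation in degree $t+1$. This plays the part of the vanishing
    of a first cohomology group of the ideal sheaf. *)
Definition hsat I t := satN Gs mt (hyp I) t.+1 `<=` hyp I t.+1.

(** Modulo the family, the elements of [Gs] act through the span of [c] polynomials. The number [c]
    is the induction parameter: a hyperplane section lowers it by one. *)
Definition small c I := exists lam : 'I_c -> {mpoly F[n]}, forall g, g \in Gs ->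
  exists a : 'I_c -> F, forall t f, V t f -> I t.+1 (('X_[g] - \sum_i a i *: lam i) * f).

Definition full I := forall t, V t `<=` I t.

Lemma inS_span (R : comNzRingType) (ms : seq 'X_{1..n}) (N : set {mpoly R[n]}) :
  is_submodule N -> (forall m, m \in ms -> N 'X_[m]) -> inS ms `<=` N.
Proof.
move=> HN H f hf; rewrite [f]mpolyE big_seq; apply: sm_sum => // m /hf /H.
exact: smZ.
Qed.

Lemma full_dim I t : fam Gs mt I -> full I -> has_dim (V t) (I t) 0.
Proof.
move=> HI fI; exists (fun=> 0); split=> [[]//|v hv|c _ []//].
by exists (fun=> 0); rewrite big_ord0 subr0; apply: fI.
Qed.

Lemma full_concl I t : fam Gs mt I -> full I -> gen_at I t /\ hsat I t.
Proof.
move=> HI fI; split.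
  move=> f /(fam_in HI); apply: inS_span; first exact: span_sm.
  move=> m /VGs [g [m' [gG mm' ->]]]; apply: span_sub; exists g, 'X_[m']; split => //.
    by apply: fI; apply: inS_X.
  by rewrite mpolyXD.
move=> f [hf _]; apply: ext_hypN => //.
move: f hf; apply: inS_span; first exact: (ext_sm HZ (fam_sm HI _)).
move=> m mm; rewrite -(icstX iota); apply: (ext_icst HZ); first exact: (fam_sm HI).
by apply: fI; apply: inS_X.
Qed.

Lemma annih_ext I p t f : fam Gs mt I -> (forall t f, V t f -> I t.+1 (p * f)) ->
  V t f -> ext iota D (I t.+1) (icst iota p * f).
Proof.
move=> HI H hf; have HE := ext_sm HZ (fam_sm HI t.+1).
pose N := [set f | ext iota D (I t.+1) (icst iota p * f)].
apply: (@inS_span _ (mt t) N _ _ f hf).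
  split; rewrite /N /=; first by rewrite mulr0; apply: (sm0 HE).
  move=> a u v hu hv; rewrite mulrDr -scalerAr; apply: (smD HE) => //.
  exact: (smZ _ HE).
move=> m mm; rewrite /N /= -(icstX iota) -icstM; apply: (ext_icst HZ); first exact: (fam_sm HI).
by apply: H; apply: inS_X.
Qed.

(** Modulo [I], $\ell$ is a combination of the [lam i]. If it is zero, then $\ell$ kills the
    quotient, which vanishes because $\ell$ is regular; otherwise some [lam i0] occurs in it and can
    be eliminated on the hyperplane. *)
Lemma hyp_small c I : fam Gs mt I -> small c.+1 I -> full I \/
  exists lam : 'I_c -> {mpoly (Fz F)[n]}, forall g, g \in Gs ->
  exists a : 'I_c -> Fz F, forall t f, V t f -> hyp I t.+1 (('X_[g] - \sum_i a i *: lam i) * f).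
Proof.
move=> HI [lam hlam].
have Hs := fam_sm HI.
have [a ha] : {a : 'X_{1..n} -> 'I_c.+1 -> F | forall g, g \in Gs ->
    forall t f, V t f -> I t.+1 (('X_[g] - \sum_i a g i *: lam i) * f)}.
  have H g : exists a : 'I_c.+1 -> F, g \in Gs ->
      forall t f, V t f -> I t.+1 (('X_[g] - \sum_i a i *: lam i) * f).
    by have [/hlam [a ha]|ng] := boolP (g \in Gs); [exists a|exists (fun=> 0)].
  by have [a ha] := choice H; exists a.
(* The coefficients of $\ell$ on the [lam i], modulo polynomials that annihilate the quotients. *)
pose b i : Fz F := \sum_(j < size Gs) iota 'X ^+ j * iota (a (nth 0%MM Gs j) i)%:P.
have hb t f : V t f -> ext iota D (I t.+1) ((l - \sum_i b i *: icst iota (lam i)) * f).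
  move=> hf; have -> : l - \sum_i b i *: icst iota (lam i) = \sum_(j < size Gs)
      iota 'X ^+ j *: icst iota ('X_[nth 0%MM Gs j] - \sum_i a (nth 0%MM Gs j) i *: lam i).
    rewrite ellE; under [RHS]eq_bigr do rewrite icstB icstX icst_sum scalerBr scaler_sumr.
    rewrite sumrB; congr (_ - _); rewrite exchange_big /=; apply: eq_bigr => i _.
    by rewrite /b scaler_suml; apply: eq_bigr => j _; rewrite icstZ scalerA.
  rewrite mulr_suml; apply: (sm_sum _ (ext_sm HZ (Hs _))) => j _; rewrite -scalerAl.
  apply: (smZ _ (ext_sm HZ (Hs _))); apply: annih_ext => // t' f' hf'.
  by apply: ha => //; apply: mem_nth.
have [[i0 bi0]|nb] := pselect (exists i, b i != 0); last first.
  left=> t f hf; apply: (ext_descent HZ) => //.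
  apply: (ell_regular GsV HZ HI); first exact: inS_icst.
  have -> : l = l - \sum_i b i *: icst iota (lam i).
    rewrite big1 ?subr0 // => i _; have [->|bi] := eqVneq (b i) 0; first by rewrite scale0r.
    by case: nb; exists i.
  by apply: hb; apply: inS_icst.
right; exists (fun i => icst iota (lam (fintype.lift i0 i))) => g gG.
pose ag i : Fz F := iota (a g i)%:P.
exists (fun i => ag (fintype.lift i0 i) - ag i0 / b i0 * b (fintype.lift i0 i)) => t f hf.
have -> : 'X_[g] - \sum_i (ag (fintype.lift i0 i) - ag i0 / b i0 * b (fintype.lift i0 i)) *: icst iota (lam (fintype.lift i0 i)) =
   ('X_[g] - \sum_i ag i *: icst iota (lam i)) - (ag i0 / b i0) *: (l - \sum_i b i *: icst iota (lam i))
   + (ag i0 / b i0) *: l.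
  rewrite !(bigD1_ord i0) //= scalerBr scalerDr scalerA divfK // [_ *: \sum_(i < c) _]scaler_sumr.
  under eq_bigr do rewrite scalerBl -scalerA.
  by rewrite sumrB; apply: zmod_cancel.
have HH := hypN_gfam HZ HI.
rewrite mulrDl; apply: (smD (gfam_sm HH _)); last first.
  apply: smadd_r; first exact: (ext_sm HZ).
  exists ((ag i0 / b i0) *: f); first exact: (smZ _ (inS_sm _)).
  by rewrite -scalerAl -scalerAr.
apply: ext_hypN; rewrite mulrBl; apply: (smB (ext_sm HZ (Hs _))); last first.
  by rewrite -scalerAl; apply: (smZ _ (ext_sm HZ (Hs _))); apply: hb.
rewrite (_ : 'X_[g] - _ = icst iota ('X_[g] - \sum_i a g i *: lam i)).
  by apply: annih_ext => //; apply: ha.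
by rewrite icstB icstX icst_sum; under [in RHS]eq_bigr do rewrite icstZ.
Qed.

Lemma ext_dim I t q : fam Gs mt I -> has_dim (V t) (I t) q ->
  has_dim (V t) (ext iota D (I t)) q.
Proof.
move=> HI [e [eV eS eI]]; exists (fun j => icst iota (e j)); split.
- by move=> j; apply: inS_icst.
- by apply: (ext_basis_span HZ) => //; apply: (fam_sm HI).
- by apply: (ext_basis_indep HZ) => //; apply: (fam_sm HI).
Qed.

(** Since $\ell$ is regular, $0 \to V_t/I_t \to V_{t+1}/I_{t+1} \to V_{t+1}/(I_{t+1} + \ell V_t) \to
    0$ is exact over $F(z)$. *)
Lemma hyp_dim I t q q3 : fam Gs mt I -> has_dim (V t) (I t) q ->
  has_dim (V t.+1) (hyp I t.+1) q3 -> has_dim (V t.+1) (I t.+1) (q + q3).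
Proof.
move=> HI hq h3; have Hs := fam_sm HI.
have h : has_dim (V t.+1) (ext iota D (I t.+1)) (q + q3).
  apply: (@has_dim_exact _ _ _ (fun v => l * v) (V t) (ext iota D (I t))) h3; try exact: inS_sm;
    try exact: (ext_sm HZ).
  - by move=> a u v; rewrite mulrDr scalerAr.
  - by move=> v; apply: inS_ell.
  - move=> v hv; split; first exact: (ell_regular GsV HZ HI).
    move=> h; rewrite ellE mulr_suml; apply: (sm_sum _ (ext_sm HZ (Hs _))) => j _.
    rewrite -scalerAl; apply: (smZ _ (ext_sm HZ (Hs _))).
    by apply: (fam_mul (ext_fam HZ HI)) => //; apply: mem_nth.
  - exact: ext_dim.
have h' := initial_basis (mtU t.+1) (Hs t.+1).
by rewrite -(has_dim_uniq (inS_sm _) (ext_sm HZ (Hs _)) (ext_dim HI h') h).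
Qed.

(** An element of $I_{t+1}$ is generated by $I_t$ up to a term $\ell v$. This term lies in the
    ideal, so regularity puts [v] in $I_t$ and the term is itself generated by $I_t$. *)
Lemma gen_descent I t : fam Gs mt I ->
  hsat I t -> (satN Gs mt (hyp I) t.+1 `<=` span (GsM (hyp I t))) -> (t > 0)%N -> gen_at I t.
Proof.
move=> HI _ H t0 f If; have Hs := fam_sm HI.
have HG : is_submodule (span (GsM (I t))) by exact: span_sm.
apply: (ext_descent HZ HG).
have HE := ext_fam HZ HI.
have : span (GsM (hyp I t)) (icst iota f).
  apply: H; apply: (satN_sub (hypN_gfam HZ HI)); apply: ext_hypN.
  exact: (ext_icst HZ).
have GE : forall g u, g \in Gs -> ext iota D (I t) u -> ext iota D (span (GsM (I t))) ('X_[g] * u).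
  move=> g u gG [c [f0 [Dc h e]]]; exists c, ('X_[g] * f0); split; first exact: Dc.
    by move=> i; rewrite cfzXM; apply: span_sub; exists g, (cfz i f0).
  by rewrite scalerAr e rmorphM /= map_mpolyX.
have lE : forall v, ext iota D (I t) v -> ext iota D (span (GsM (I t))) (l * v).
  move=> v hv; rewrite ellE mulr_suml; apply: (sm_sum _ (ext_sm HZ HG)) => j _.
  rewrite -scalerAl; apply: (smZ _ (ext_sm HZ HG)).
  by apply: GE => //; apply: mem_nth.
have : span (GsM (hyp I t)) `<=`
    smadd (ext iota D (span (GsM (I t)))) ((fun v => l * v) @` V t).
  apply: span_min; first by apply: smadd_sm; [exact: (ext_sm HZ)|exact: ellV_sm].
  case: t t0 {H If HG} GE lE => // t _ GE lE x [g [u [gG [w hw [v hv e]] ->]]].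
  exists ('X_[g] * w); first exact: GE.
  exists ('X_[g] * v); first by apply: inS_XM hv => m; apply: GsV.
  by rewrite mulrCA e mulrBr.
move=> sub /sub [w hw [v hv e]].
rewrite -(subrK w (icst iota f)); apply: (smD (ext_sm HZ HG)) => //.
rewrite -e; apply: lE; apply: (ell_regular GsV HZ HI) => //.
rewrite e; apply: (smB (ext_sm HZ (Hs _))); first exact: (ext_icst HZ).
apply: (_ : ext iota D (span (GsM (I t))) `<=` _) hw => y [c [f0 [Dc h e']]].
exists c, f0; split => // i; apply: (span_min (Hs _)) (h i) => z [g [u [gG Iu ->]]].
exact: (fam_mul HI).
Qed.

End FieldCase.

(** Let [Hf] be the Hilbert function. Past the bound for the saturated hyperplane section, $H_f - Q$
    is nondecreasing and eventually zero, so $H_f \le Q$. It is stationary at a step exactly when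
    the hyperplane section is saturated there; since the saturated section is generated by its
    previous piece, it is then stationary for good. As $Q - H_f$ starts at most at $Q(m')$, this
    happens within $Q(m')$ steps, a bound independent of the field and of the family. *)
Theorem mumford c : forall Q : nat -> nat, exists t0, forall (F : fieldType) (I : nat -> set {mpoly F[n]}),
  fam Gs mt I -> small c I -> (exists t1, forall t, (t1 <= t)%N -> has_dim (V t) (I t) (Q t)) ->
  forall t, (t0 <= t)%N -> [/\ has_dim (V t) (I t) (Q t), gen_at I t & hsat I t].
Proof.
(* A threshold that depends on [Pr] alone: which eventual properties [Q] has is revealed only by a
   family, but the bound must be fixed before the family is given. *)
have Tau (Pr : nat -> Prop) : exists tau, (exists tau, forall t, (tau <= t)%N -> Pr t) ->
    forall t, (tau <= t)%N -> Pr t.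
  by have [[tau h]|no] := pselect (exists tau, forall t, (tau <= t)%N -> Pr t); [exists tau|exists 0%N].
have Hfull (Q : nat -> nat) tau0 (F : fieldType) (I : nat -> set {mpoly F[n]}) :
    ((exists tau, forall t, (tau <= t)%N -> Q t = 0%N) -> forall t, (tau0 <= t)%N -> Q t = 0%N) ->
    fam Gs mt I -> full I -> (exists t1, forall t, (t1 <= t)%N -> has_dim (V t) (I t) (Q t)) ->
    forall t, (tau0 <= t)%N -> [/\ has_dim (V t) (I t) (Q t), gen_at I t & hsat I t].
  move=> h0 HI fI [t1 ht1] t le; have [g hs] := full_concl t HI fI; split => //.
  rewrite h0 //; first exact: full_dim.
  exists t1 => t' le'; apply: has_dim_uniq (ht1 _ le') (full_dim t' HI fI); first exact: inS_sm.
  exact: (fam_sm HI).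
elim: c => [|c IH] Q.
  have [tau0 h0] := Tau (fun t => Q t = 0%N).
  exists tau0 => F I HI [lam hlam] H; apply: (Hfull Q tau0) => //.
  move=> t f hf; apply: (fam_sat HI) => // g gG; have [a ha] := hlam _ gG.
  by have := ha _ _ hf; rewrite big_ord0 subr0.
have [tau0 h0] := Tau (fun t => Q t = 0%N).
(* Beyond [tau1] the function [Q] is nondecreasing, so that the truncated difference used for the
   hyperplane section is a true difference. *)
have [tau1 h1] := Tau (fun t => (Q t <= Q t.+1)%N).
have [t0' IH'] := IH (fun t => Q t - Q t.-1)%N.
pose m' := maxn tau1 t0'.
exists (maxn tau0 (m' + Q m').+2) => F I HI sm H t le.
have [fI|sm'] := hyp_small HI sm.
  by apply: (Hfull Q tau0) => //; rewrite (leq_trans _ le) // leq_maxl.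
have HH := hypN_gfam (Fz_zext F) HI.
have HS := satN_fam GsV HH.
pose Hf t := count (fun m => ~~ `[< leads (I t) (mt t) m >]) (mt t).
have hH t' : has_dim (V t') (I t') (Hf t') := initial_basis (mtU t') (fam_sm HI t').
pose q3 t := count (fun m => ~~ `[< leads (hyp I t) (mt t) m >]) (mt t).
have h3 t' : has_dim (V t') (hyp I t') (q3 t') := initial_basis (mtU t') (gfam_sm HH t').
pose q' t := count (fun m => ~~ `[< leads (satN Gs mt (hyp I) t) (mt t) m >]) (mt t).
have h' t' : has_dim (V t') (satN Gs mt (hyp I) t') (q' t') := initial_basis (mtU t') (fam_sm HS t').
have Hstep t' : Hf t'.+1 = (Hf t' + q3 t'.+1)%N.
  exact: has_dim_uniq (inS_sm _) (fam_sm HI _) (hH _) (hyp_dim HI (hH _) (h3 _)).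
have sub3 t' : hyp I t' `<=` satN Gs mt (hyp I) t' by apply: satN_sub.
have le3 t' : (q' t' <= q3 t')%N /\ (q3 t' = q' t' -> satN Gs mt (hyp I) t' `<=` hyp I t').
  have [a b] := has_dim_le (inS_sm _) (gfam_sm HH t') (fun v _ => sub3 t' v) (h3 t') (h' t').
  by split => // e f Sf; apply: b => //; [exact: (fam_sm HS)|exact: (fam_in HS) Sf].
have ev3 t' : satN Gs mt (hyp I) t' `<=` hyp I t' -> q3 t' = q' t'.
  move=> sub; apply: has_dim_uniq (inS_sm _) (gfam_sm HH t') (h3 t') _.
  by apply: has_dim_ext (h' t'); [exact: inS_sm|move=> v _; split; [apply: sub|apply: sub3]].
have [t1 ht1] := H.
have HQ t' : (t1 <= t')%N -> Hf t' = Q t'.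
  by move=> l1; apply: has_dim_uniq (inS_sm _) (fam_sm HI _) (hH _) (ht1 _ l1).
have Qmono t' : (tau1 <= t')%N -> (Q t' <= Q t'.+1)%N.
  move=> l1; apply: (h1 _ t' l1); exists t1 => s ls.
  by rewrite -!HQ ?Hstep ?leq_addr // ltnW.
have [t2 ht2] := satN_noeth mtU GsV mt_div HH.
have Iq : forall t, (t0' <= t)%N -> [/\ has_dim (V t) (satN Gs mt (hyp I) t) (Q t - Q t.-1)%N,
    gen_at (satN Gs mt (hyp I)) t & hsat (satN Gs mt (hyp I)) t].
  apply: IH' => //.
    have [lam hlam] := sm'; exists lam => g gG; have [a ha] := hlam g gG.
    by exists a => t' f hf; apply: sub3; apply: ha.
  exists (maxn t1 t2).+1 => -[|s] // ls; rewrite /=.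
  rewrite -(HQ s) -?(HQ s.+1) ?Hstep ?addKn; try by lia.
  by rewrite ev3 //; apply: ht2; lia.
have q'E s : (t0' <= s)%N -> q' s = (Q s - Q s.-1)%N.
  by move=> /Iq [h _ _]; apply: has_dim_uniq (inS_sm _) (fam_sm HS _) (h' s) h.
have stepge s : (m' <= s)%N -> (Hf s + Q s.+1 <= Hf s.+1 + Q s)%N.
  move=> ls; have l1 : (tau1 <= s)%N by rewrite /m' in ls; lia.
  have l2 : (t0' <= s.+1)%N by rewrite /m' in ls; lia.
  by have := Qmono s l1; have := (le3 s.+1).1; rewrite Hstep (q'E _ l2) /=; lia.
have HleQ s : (m' <= s)%N -> (Hf s <= Q s)%N.
  move=> ls; have : forall k, (Hf s + Q (s + k) <= Hf (s + k) + Q s)%N.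
    elim=> [|k IHk]; first by rewrite addn0.
    have lk : (m' <= s + k)%N by lia.
    by have := stepge _ lk; rewrite addnS; lia.
  by move=> /(_ t1); rewrite (HQ (s + t1)%N) ?leq_addl //; lia.
(* Equality of the increments of [Hf] and [Q], equivalent to saturation of the hyperplane section in
   degree $s+1$ by [Esub] and [subE]. *)
pose E s := (Hf s + Q s.+1 = Hf s.+1 + Q s)%N.
have Esub s : (m' <= s)%N -> E s -> satN Gs mt (hyp I) s.+1 `<=` hyp I s.+1.
  move=> ls; have l1 : (tau1 <= s)%N by rewrite /m' in ls; lia.
  have l2 : (t0' <= s.+1)%N by rewrite /m' in ls; lia.
  rewrite /E Hstep => e; apply: (le3 s.+1).2.
  by have := Qmono s l1; rewrite (q'E _ l2) /=; lia.
have subE s : (m' <= s)%N -> satN Gs mt (hyp I) s.+1 `<=` hyp I s.+1 -> E s.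
  move=> ls; have l1 : (tau1 <= s)%N by rewrite /m' in ls; lia.
  have l2 : (t0' <= s.+1)%N by rewrite /m' in ls; lia.
  by move=> /ev3; rewrite /E Hstep => ->; have := Qmono s l1; rewrite (q'E _ l2) /=; lia.
have genS s : (m' <= s)%N -> E s -> satN Gs mt (hyp I) s.+2 `<=` span (GsM (hyp I s.+1)).
  move=> ls Es f Sf; have [_ g _] : [/\ has_dim (V s.+1) (satN Gs mt (hyp I) s.+1) (Q s.+1 - Q s)%N,
    gen_at (satN Gs mt (hyp I)) s.+1 & hsat (satN Gs mt (hyp I)) s.+1] by apply: Iq; rewrite /m' in ls; lia.
  apply: (span_min (span_sm _)) (g _ Sf) => x [y [u [yG Su ->]]].
  by apply: span_sub; exists y, u; split => //; apply: (Esub s).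
have Enext s : (m' <= s)%N -> E s -> E s.+1.
  move=> ls Es; apply: subE; first by lia.
  move=> f /(genS s ls Es); apply: (span_min (gfam_sm HH _)) => x [g [u [gG hu ->]]].
  exact: (gfam_mul HH).
have Eall s s' : (m' <= s)%N -> (s <= s')%N -> E s -> E s'.
  move=> ls /subnK <- Es; elim: (s' - s)%N => // k IHk; rewrite addSn; apply: Enext => //.
  by lia.
(* Without such an [s], the difference $H_f - Q$ would rise by more than $Q(m')$ and become
   positive. *)
have [s [ls1 ls2 Es]] : exists s, [/\ (m' <= s)%N, (s <= m' + Q m')%N & E s].
  apply: contrapT => no.
  have : forall k, (k <= (Q m').+1)%N -> (Hf (m' + k) + Q m' >= Q (m' + k) + Hf m' + k)%N.
    elim=> [|k IHk] lk; first by rewrite !addn0 addnC.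
    have := IHk (ltnW lk); rewrite !addnS.
    have lk' : (m' <= m' + k)%N by lia.
    have nE : ~ E (m' + k)%N.
      by move=> Ek; apply: no; exists (m' + k)%N; split => //; lia.
    by rewrite /E in nE; have := stepge _ lk'; lia.
  move=> /(_ (Q m').+1 (leqnn _)).
  have lk' : (m' <= m' + (Q m').+1)%N by lia.
  by have := HleQ _ lk'; lia.
have Ege u : (s <= u)%N -> E u by move=> lu; apply: Eall lu Es.
have HQs u : (s <= u)%N -> Hf u = Q u.
  move=> lu; have : forall k, (Hf u + Q (u + k) = Hf (u + k) + Q u)%N.
    elim=> [|k IHk]; first by rewrite addn0.
    have lk : (s <= u + k)%N by lia.
    by have := Ege _ lk; rewrite /E addnS; lia.
  by move=> /(_ t1); rewrite (HQ (u + t1)%N) ?leq_addl //; lia.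
have lt : (m' + Q m' < t)%N by rewrite (leq_trans _ le) // leq_max ltnS leqnSn orbT.
have hs : hsat I t by apply: Esub; [lia|apply: Ege; lia].
split => //; first by rewrite -HQs; [exact: hH|lia].
apply: gen_descent => //; last by lia.
have -> : t = t.-1.+1 by lia.
by apply: genS; [lia|apply: Ege; lia].
Qed.

End Mumford.

(** * Lifting the ideal of the closed fibre over a local ring *)

Lemma inS_map (n : nat) (R R' : comNzRingType) (phi : {rmorphism R -> R'}) ms (f : {mpoly R[n]}) :
  inS ms f -> inS ms (map_mpoly phi f).
Proof. by move=> /inSP h; apply/inSP => m mn; rewrite mcoeff_map_mpoly h // raddf0. Qed.

Section LocalPolys.
Variables (n : nat) (R : comNzRingType) (F : fieldType) (phi : {rmorphism R -> F}).
Hypothesis (Hphi : local_map phi).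

Lemma lift_inS ms (f : {mpoly F[n]}) : inS ms f ->
  exists2 g : {mpoly R[n]}, inS ms g & map_mpoly phi g = f.
Proof.
move=> hf; have [c hc] := local_lift_fun Hphi (fun z : F => z).
exists (\sum_(m <- msupp f) c f@_m *: 'X_[m]).
  rewrite big_seq; apply: (sm_sum _ (inS_sm _)) => m mm; apply: (smZ _ (inS_sm _)).
  by apply: inS_X; apply: hf.
rewrite raddf_sum /= [RHS]mpolyE; apply: eq_bigr => m _.
by rewrite map_mpolyZ map_mpolyX hc.
Qed.

(** Nakayama's lemma for the free module on [ms]: it suffices to reach each monomial over the
    residue field. *)
Lemma nak_inS ms (W : set {mpoly R[n]}) : uniq ms -> is_submodule W ->
  (forall m, m \in ms -> exists w, [/\ W w, inS ms w & map_mpoly phi w = 'X_[m]]) ->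
  inS ms `<=` W.
Proof.
move=> u HW H.
have H' (i : 'I_(size ms)) : exists w, [/\ W w, inS ms w & map_mpoly phi w = 'X_[nth 0%MM ms i]].
  by apply: H; apply: mem_nth.
have [w hw] := choice H'.
have X i : W 'X_[nth 0%MM ms (i : 'I_(size ms))].
  apply: (local_nakayama Hphi (N := W) (x := fun i : 'I_(size ms) => 'X_[nth 0%MM ms i])
     (mu := fun i j => (i == j)%:R - (w i)@_(nth 0%MM ms j))) => //.
    move=> a b; have [_ _ e] := hw a; rewrite rmorphB rmorph_nat -mcoeff_map_mpoly e mcoeffX.
    by rewrite nth_uniq // subrr.
  move=> a; have [h1 h2 _] := hw a; rewrite (_ : _ - _ = w a) //.
  under eq_bigr do rewrite scalerBl; rewrite sumrB.
  rewrite (bigD1 a) //= eqxx scale1r big1 ?addr0; last by move=> b ba; rewrite eq_sym (negPf ba) scale0r.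
  rewrite subKr -[RHS](crdK u h2); apply: eq_bigr => b _; by rewrite mxE.
move=> f hf; rewrite -(crdK u hf); apply: sm_sum => // i _.
exact: smZ.
Qed.

End LocalPolys.

Section LocalLifting.
Variables (n : nat) (Gs : seq 'X_{1..n}) (mt : nat -> seq 'X_{1..n}).
Hypothesis (mtU : forall t, uniq (mt t)).
Hypothesis (GsV : forall t g m, g \in Gs -> m \in mt t -> (g + m)%MM \in mt t.+1).
Variables (R : comNzRingType) (F : fieldType) (phi : {rmorphism R -> F}).
Hypothesis (Hphi : local_map phi).
Variables (I : nat -> set {mpoly R[n]}) (J : nat -> set {mpoly F[n]}).
Hypothesis (HI : fam Gs mt I) (HJ : fam Gs mt J).
Hypothesis (L0 : forall t f, I t f -> J t (map_mpoly phi f)).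

(** What flatness of the quotients contributes: families independent over the residue field are
    independent over [R]. *)
Definition indep_at t := forall q (e : 'I_q -> {mpoly R[n]}), (forall j, inS (mt t) (e j)) ->
  (forall c : 'I_q -> F, J t (\sum_j c j *: map_mpoly phi (e j)) -> forall j, c j = 0) ->
  forall c : 'I_q -> R, I t (\sum_j c j *: e j) -> forall j, c j = 0.

(** Surjectivity of the base change map from $I_t$ to the ideal of the fibre. *)
Definition lift_at t := forall f, J t f -> exists2 g, I t g & map_mpoly phi g = f.

Hypothesis (L2 : forall t, indep_at t).

Local Notation V t := (inS (mt t)).
Local Notation K := (Fz F).
Variables (A : comNzRingType) (iR : {rmorphism {poly R} -> A}) (ph : {rmorphism A -> K}).
Local Notation iF := (iotaF F).
Local Notation DR := [set c : {poly R} | map_poly phi c != 0].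
Local Notation DF := [set c : {poly F} | c != 0].
Hypothesis (ZR : zext iR DR) (Hz : local_map ph).
Hypothesis (ph_iota : forall c, ph (iR c) = iotaF F (map_poly phi c)).
Let ZF : zext iF DF := Fz_zext F.
Local Notation pz := (map_mpoly ph).
Local Notation eI t := (ext iR DR (I t)).
Local Notation eJ t := (ext iF DF (J t)).
Local Notation lR := (ell Gs iR).
Local Notation lF := (ell Gs iF).

Lemma pz_icst (f : {mpoly R[n]}) : pz (icst iR f) = icst iF (map_mpoly phi f).
Proof.
apply/mpolyP => m; rewrite mcoeff_map_mpoly !mcoeff_icst mcoeff_map_mpoly.
by apply: etrans (ph_iota _) _; rewrite map_polyC.
Qed.

Lemma pzD (f g : {mpoly A[n]}) : pz (f + g) = pz f + pz g. Proof. exact: raddfD. Qed.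
Lemma pzB (f g : {mpoly A[n]}) : pz (f - g) = pz f - pz g. Proof. exact: raddfB. Qed.
Lemma pzM (f g : {mpoly A[n]}) : pz (f * g) = pz f * pz g. Proof. exact: rmorphM. Qed.
Lemma pzZ a (f : {mpoly A[n]}) : pz (a *: f) = ph a *: pz f.
Proof. by rewrite map_mpolyZ. Qed.
Lemma pzS (T : Type) (r : seq T) (P : pred T) (f : T -> {mpoly A[n]}) :
  pz (\sum_(i <- r | P i) f i) = \sum_(i <- r | P i) pz (f i).
Proof. exact: raddf_sum. Qed.
Lemma pz_sum q (c : 'I_q -> A) (e : 'I_q -> {mpoly A[n]}) :
  pz (\sum_j c j *: e j) = \sum_j ph (c j) *: pz (e j).
Proof. by rewrite pzS; apply: eq_bigr => j _; rewrite pzZ. Qed.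

Lemma pz_ell : pz lR = lF.
Proof.
rewrite !ellE pzS; apply: eq_bigr => j _; rewrite pzZ map_mpolyX rmorphXn; congr (_ ^+ _ *: _).
by rewrite ph_iota map_polyX.
Qed.

Lemma eI_sm t : is_submodule (eI t). Proof. exact: (ext_sm ZR (fam_sm HI t)). Qed.
Lemma eJ_sm t : is_submodule (eJ t). Proof. exact: (ext_sm ZF (fam_sm HJ t)). Qed.

Lemma eI_eJ t f : eI t f -> eJ t (pz f).
Proof.
rewrite (extE ZR (fam_sm HI t)).
apply: (@span_min _ _ _ [set f | eJ t (pz f)]).
  split=> /=; first by rewrite raddf0; apply: sm0 (eJ_sm t).
  move=> a u v hu hv; rewrite pzD pzZ; apply: (smD (eJ_sm t)) => //.
  exact: (smZ _ (eJ_sm t)).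
move=> _ [g Ig <-] /=; rewrite pz_icst; apply: (ext_icst ZF); first exact: (fam_sm HJ).
exact: L0.
Qed.

Lemma lift_z t y : lift_at t -> eJ t y -> exists2 y', eI t y' & pz y' = y.
Proof.
move=> lt; rewrite (extE ZF (fam_sm HJ t)) => /spanP [q [c [g [hg ->]]]].
have H i : exists x, I t x /\ icst iF (map_mpoly phi x) = g i.
  by have [f Jf <-] := hg i; have [x Ix <-] := lt _ Jf; exists x.
have [x hx] := choice H; have [c' hc'] := local_lift_fun Hz c.
exists (\sum_i c' i *: icst iR (x i)).
  apply: (sm_sum _ (eI_sm t)) => i _; apply: (smZ _ (eI_sm t)).
  by apply: (ext_icst ZR); [exact: (fam_sm HI)|case: (hx i)].
rewrite pz_sum; apply: eq_bigr => i _; rewrite pz_icst hc'.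
by have [_ ->] := hx i.
Qed.

Definition spanI q (e : 'I_q -> {mpoly A[n]}) t : set {mpoly A[n]} :=
  [set v | exists c : 'I_q -> A, eI t (v - \sum_j c j *: e j)].

Lemma spanI_sm q e t : is_submodule (@spanI q e t).
Proof.
have HE := eI_sm t; split.
  by exists (fun=> 0); rewrite big1 ?subr0; [exact: sm0|move=> *; rewrite scale0r].
move=> a x y [c hc] [c' hc']; exists (fun j => a * c j + c' j).
under eq_bigr do rewrite scalerDl -scalerA.
rewrite big_split /= -scaler_sumr opprD addrACA -scalerBr.
by apply: smD => //; apply: smZ.
Qed.

Lemma span_lift q (e : 'I_q -> {mpoly A[n]}) t : lift_at t -> (forall j, V t (e j)) ->
  (forall v, V t v -> exists c : 'I_q -> K, eJ t (v - \sum_j c j *: pz (e j))) ->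
  V t `<=` spanI e t.
Proof.
move=> lt eV H; apply: (nak_inS Hz (mtU t)); first exact: spanI_sm.
move=> m mm; have [c hc] := H _ (inS_X mm).
have [y' Iy' ey] := lift_z lt hc; have [c' hc'] := local_lift_fun Hz c.
exists (\sum_j c' j *: e j + y'); split.
- by exists c'; rewrite addrAC subrr add0r.
- apply: (smD (inS_sm _)); last by apply: ext_inS Iy' => //; apply: (fam_in HI).
  by apply: (sm_sum _ (inS_sm _)) => j _; apply: (smZ _ (inS_sm _)).
- by rewrite pzD ey pz_sum; under eq_bigr do rewrite hc'; rewrite addrC subrK.
Qed.

(** [L2] speaks of families defined over [R] only. A basis of $V_t/J_t$ lifts to a basis of
    $V_t/I_t$ over [R], which stays one over $R(z)$; the coordinates of [e] in it have independent
    rows over the residue field, so [local_row_free] applies. *)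
Lemma indep_z t : lift_at t -> forall q (e : 'I_q -> {mpoly A[n]}), (forall j, V t (e j)) ->
  (forall c : 'I_q -> K, eJ t (\sum_j c j *: pz (e j)) -> forall j, c j = 0) ->
  forall c : 'I_q -> A, eI t (\sum_j c j *: e j) -> forall j, c j = 0.
Proof.
move=> lt q e eV eInd c hc.
have [b [bV bS bI]] := initial_basis (mtU t) (fam_sm HJ t).
set p := count _ _ in b bV bS bI.
have H j : exists x : {mpoly R[n]}, V t x /\ map_mpoly phi x = b j.
  by have [x h1 h2] := lift_inS Hphi (bV j); exists x.
have [x hx] := choice H.
have xind : forall c : 'I_p -> R, I t (\sum_j c j *: x j) -> forall j, c j = 0.
  apply: L2; first by move=> j; case: (hx j).
  move=> d hd; apply: bI; have <- : \sum_j d j *: map_mpoly phi (x j) = \sum_j d j *: b j.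
    by apply: eq_bigr => j _; case: (hx j) => _ ->.
  exact: hd.
have xspan : V t `<=` spanI (fun j => icst iR (x j)) t.
  apply: span_lift => //; first by move=> j; apply: inS_icst; case: (hx j).
  move=> v hv; have [d hd] := ext_basis_span ZF (fam_sm HJ t) bS hv.
  exists d; rewrite (_ : \sum_j d j *: pz (icst iR (x j)) = \sum_j d j *: icst iF (b j)).
    exact: hd.
  by apply: eq_bigr => j _; rewrite pz_icst; case: (hx j) => _ ->.
have xind' := ext_basis_indep ZR (fam_sm HI t) xind.
have [a ha] := choice (fun j => xspan _ (eV j)).
have HE := eI_sm t.
apply: (local_row_free Hz (a := a)).
  move=> d hd; apply: eInd.
  rewrite (_ : \sum_j _ = \sum_j d j *: pz (e j - \sum_k a j k *: icst iR (x k))).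
    apply: (sm_sum _ (eJ_sm t)) => j _; apply: (smZ _ (eJ_sm t)).
    exact: eI_eJ.
  under [RHS]eq_bigr do rewrite pzB pz_sum scalerBr [_ *: \sum_(l < _) _]scaler_sumr.
  rewrite sumrB exchange_big /= [X in _ = _ - X]big1 ?subr0 // => k _.
  under eq_bigr do rewrite scalerA; by rewrite -scaler_suml hd scale0r.
move=> k; move: k; apply: xind'.
rewrite (_ : \sum_k _ = \sum_j c j *: e j - \sum_j c j *: (e j - \sum_k a j k *: icst iR (x k))).
  by apply: smB => //; apply: sm_sum => // j _; apply: smZ.
rewrite -sumrB; under [RHS]eq_bigr do rewrite -scalerBr subKr [_ *: \sum_(l < _) _]scaler_sumr.
rewrite exchange_big /=; apply: eq_bigr => k _; rewrite scaler_suml.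
by apply: eq_bigr => j _; rewrite scalerA.
Qed.

Lemma eI_ell t v : eI t v -> eI t.+1 (lR * v).
Proof.
move=> hv; rewrite ellE mulr_suml; apply: (sm_sum _ (eI_sm _)) => j _.
rewrite -scalerAl; apply: (smZ _ (eI_sm _)).
by apply: (fam_mul (ext_fam ZR HI)) => //; apply: mem_nth.
Qed.

Lemma eJ_ell t v : eJ t v -> eJ t.+1 (lF * v).
Proof.
move=> hv; rewrite ellE mulr_suml; apply: (sm_sum _ (eJ_sm _)) => j _.
rewrite -scalerAl; apply: (smZ _ (eJ_sm _)).
by apply: (fam_mul (ext_fam ZF HJ)) => //; apply: mem_nth.
Qed.

Definition catf (T : Type) p q (x : 'I_p -> T) (y : 'I_q -> T) (i : 'I_(p + q)) :=
  match fintype.split i with inl j => x j | inr j => y j end.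

Lemma catf_sum (S : nzRingType) (W : lmodType S) p q (x : 'I_p -> W) (y : 'I_q -> W) (c : 'I_(p + q) -> S) :
  \sum_i c i *: catf x y i = \sum_j c (lshift q j) *: x j + \sum_j c (rshift p j) *: y j.
Proof.
rewrite big_split_ord /=; congr (_ + _); apply: eq_bigr => j _; rewrite /catf.
  by rewrite -{2}[lshift _ _]/(unsplit (inl j)) unsplitK.
by rewrite -{2}[rshift _ _]/(unsplit (inr j)) unsplitK.
Qed.

Lemma catf_cat (S : nzRingType) (W : lmodType S) p q (x : 'I_p -> W) (y : 'I_q -> W) (c : 'I_p -> S) (d : 'I_q -> S) :
  \sum_i catf c d i *: catf x y i = \sum_j c j *: x j + \sum_j d j *: y j.
Proof.
rewrite catf_sum; congr (_ + _); apply: eq_bigr => j _; rewrite /catf.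
  by rewrite -[lshift _ _]/(unsplit (inl j)) unsplitK.
by rewrite -[rshift _ _]/(unsplit (inr j)) unsplitK.
Qed.

(* b : a basis of V_t / J_t over F; w : a basis of V_(t+1) / (J_(t+1) + l V_t) over F(z);
   the l b and the w lift to a generating family over R(z), a basis if t+1 is regular. *)
Section Frame.
Variables (t p q : nat) (b : 'I_p -> {mpoly R[n]}) (w : 'I_q -> {mpoly A[n]}).
Hypothesis (lift1 : lift_at t.+1).
Hypothesis (bV : forall j, V t (b j)) (wV : forall j, V t.+1 (w j)).
Hypothesis (bS : forall v, V t v -> exists c : 'I_p -> F, J t (v - \sum_j c j *: map_mpoly phi (b j))).
Hypothesis (wS : forall v, V t.+1 v -> exists c : 'I_q -> K, hyp Gs mt J t.+1 (v - \sum_j c j *: pz (w j))).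

Definition frame : 'I_(p + q) -> {mpoly A[n]} := catf (fun j => lR * icst iR (b j)) w.

Lemma frame_in i : V t.+1 (frame i).
Proof.
rewrite /frame /catf; case: (fintype.split i) => j //.
by apply: inS_ell => //; apply: inS_icst.
Qed.

Lemma pz_frame i : pz (frame i) = catf (fun j => lF * icst iF (map_mpoly phi (b j))) (fun j => pz (w j)) i.
Proof. by rewrite /frame /catf; case: (fintype.split i) => j //; rewrite pzM pz_ell pz_icst. Qed.

Lemma frame_span : V t.+1 `<=` spanI frame t.+1.
Proof.
apply: span_lift => //; first exact: frame_in.
move=> v hv; have [c [u hu [v' hv' e]]] := wS hv.
have [d hd] := ext_basis_span ZF (fam_sm HJ t) bS hv'.
exists (catf d c); under eq_bigr do rewrite pz_frame.
rewrite catf_cat (_ : _ - _ = u + lF * (v' - \sum_j d j *: icst iF (map_mpoly phi (b j)))).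
  by apply: (smD (eJ_sm _)) => //; apply: eJ_ell.
rewrite mulrBr e (_ : lF * \sum_(j < p) _ = \sum_j d j *: (lF * icst iF (map_mpoly phi (b j)))).
  by rewrite [RHS]addrA [u + _]addrC subrK opprD addrA addrAC.
by rewrite [_ * \sum_(l < _) _]mulr_sumr; apply: eq_bigr => j _; rewrite -scalerAr.
Qed.

Hypothesis (bI : forall c : 'I_p -> F, J t (\sum_j c j *: map_mpoly phi (b j)) -> forall j, c j = 0).
Hypothesis (wI : forall c : 'I_q -> K, hyp Gs mt J t.+1 (\sum_j c j *: pz (w j)) -> forall j, c j = 0).

Lemma frame_indep (c : 'I_(p + q) -> A) : eI t.+1 (\sum_i c i *: frame i) -> forall i, c i = 0.
Proof.
apply: (indep_z lift1) => //; first exact: frame_in.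
move=> d; under eq_bigr do rewrite pz_frame; rewrite catf_sum => h.
have hin : V t (\sum_j d (lshift q j) *: icst iF (map_mpoly phi (b j))).
  apply: (sm_sum _ (inS_sm _)) => j _; apply: (smZ _ (inS_sm _)); apply: inS_icst.
  by apply: inS_map; apply: bV.
have sumE : \sum_j d (lshift q j) *: (lF * icst iF (map_mpoly phi (b j))) =
    lF * \sum_j d (lshift q j) *: icst iF (map_mpoly phi (b j)).
  by rewrite [_ * \sum_(l < _) _]mulr_sumr; apply: eq_bigr => j _; rewrite -scalerAr.
rewrite sumE in h.
have dw : forall j, d (rshift p j) = 0.
  apply: wI; exists (lF * (\sum_j d (lshift q j) *: icst iF (map_mpoly phi (b j))) +
      \sum_j d (rshift p j) *: pz (w j)) => //.
  exists (- \sum_j d (lshift q j) *: icst iF (map_mpoly phi (b j))); first exact: (smN (inS_sm _)).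
  by rewrite mulrN opprD addrCA subrr addr0.
have db : forall j, d (lshift q j) = 0.
  apply: (ext_basis_indep ZF (fam_sm HJ t) bI).
  apply: (ell_regular GsV ZF HJ) => //.
  by move: h; rewrite [X in _ + X]big1 ?addr0 // => j _; rewrite dw scale0r.
by move=> i; rewrite -(splitK i); case: (fintype.split i) => j /=.
Qed.

End Frame.

Lemma J_frame t : exists p q (b : 'I_p -> {mpoly R[n]}) (w : 'I_q -> {mpoly A[n]}),
  [/\ (forall j, V t (b j)) /\ (forall j, V t.+1 (w j)),
   forall v, V t v -> exists c : 'I_p -> F, J t (v - \sum_j c j *: map_mpoly phi (b j)),
   forall v, V t.+1 v -> exists c : 'I_q -> K, hyp Gs mt J t.+1 (v - \sum_j c j *: pz (w j)),
   forall c : 'I_p -> F, J t (\sum_j c j *: map_mpoly phi (b j)) -> forall j, c j = 0 &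
   forall c : 'I_q -> K, hyp Gs mt J t.+1 (\sum_j c j *: pz (w j)) -> forall j, c j = 0].
Proof.
have [b [bV bS bI]] := initial_basis (mtU t) (fam_sm HJ t).
have HH := hypN_gfam GsV ZF HJ.
have [w [wV wS wI]] := initial_basis (mtU t.+1) (gfam_sm HH t.+1).
set p := count _ _ in b bV bS bI; set q := count _ _ in w wV wS wI.
have H j : exists x : {mpoly R[n]}, V t x /\ map_mpoly phi x = b j.
  by have [x h1 h2] := lift_inS Hphi (bV j); exists x.
have [x hx] := choice H.
have H' j : exists y : {mpoly A[n]}, V t.+1 y /\ pz y = w j.
  by have [y h1 h2] := lift_inS Hz (wV j); exists y.
have [y hy] := choice H'.
have eb (c : 'I_p -> F) : \sum_j c j *: map_mpoly phi (x j) = \sum_j c j *: b j.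
  by apply: eq_bigr => j _; case: (hx j) => _ ->.
have ew (c : 'I_q -> K) : \sum_j c j *: pz (y j) = \sum_j c j *: w j.
  by apply: eq_bigr => j _; case: (hy j) => _ ->.
exists p, q, x, y; split.
- by split=> j; [case: (hx j)|case: (hy j)].
- by move=> v /bS [c hc]; exists c; rewrite eb.
- by move=> v /wS [c hc]; exists c; rewrite ew.
- by move=> c; rewrite eb; apply: bI.
- by move=> c; rewrite ew; apply: wI.
Qed.

(** Consider, in degree $t+2$, the coordinates on [w] of all products $g e_j$. Their rows are
    independent over $F(z)$: a combination of the [e j] with zero coordinates is carried by every
    [g] into the hyperplane ideal, and [hs] removes the [g]. A relation over $R(z)$ is a relation
    between these rows, hence trivial. *)
Lemma hyp_indep t q (e : 'I_q -> {mpoly A[n]}) : lift_at t.+1 -> lift_at t.+2 -> hsat Gs mt J t ->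
  (forall j, V t.+1 (e j)) ->
  (forall c : 'I_q -> K, hyp Gs mt J t.+1 (\sum_j c j *: pz (e j)) -> forall j, c j = 0) ->
  forall c : 'I_q -> A, hypN Gs mt iR DR I t.+1 (\sum_j c j *: e j) -> forall j, c j = 0.
Proof.
move=> l1 l2 hs eV eInd c [u hu [g hg eg]].
have [p' [q' [b [w [[bV wV] bS wS bI wI]]]]] := J_frame t.+1.
have fS := frame_span l2 bV wV bS wS.
have fI := frame_indep l2 bV wV bI wI.
have bS' : V t.+1 `<=` spanI (fun j => icst iR (b j)) t.+1.
  apply: span_lift => //; first by move=> j; apply: inS_icst.
  move=> v hv; have [d hd] := ext_basis_span ZF (fam_sm HJ t.+1) bS hv.
  by exists d; under eq_bigr do rewrite pz_icst.
have XV (g0 : 'I_(size Gs)) (S : comNzRingType) s (f : {mpoly S[n]}) : V s f -> V s.+1 ('X_[nth 0%MM Gs g0] * f).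
  by apply: inS_XM => m; apply: GsV; apply: mem_nth.
have Ha (x : 'I_(size Gs) * 'I_q) : exists a : 'I_(p' + q') -> A,
    eI t.+2 ('X_[nth 0%MM Gs x.1] * e x.2 - \sum_i a i *: frame b w i).
  by apply: fS; apply: XV.
have [a ha] := choice Ha.
apply: (local_row_free Hz (K := ('I_(size Gs) * 'I_q')%type)
  (a := fun j x => a (x.1, j) (rshift p' x.2))).
  move=> d hd; apply: eInd; apply: hs; split.
    apply: (sm_sum _ (inS_sm _)) => j _; apply: (smZ _ (inS_sm _)).
    by apply: inS_map; apply: eV.
  exists 1%N => wo [ew sub]; case: wo ew sub => [//|g0 [|//]] _ sub; have g0G : g0 \in Gs by apply: sub; rewrite mem_head.
  rewrite addn1 wd_cons /wd big_nil addm0.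
  have hi := g0G; rewrite -index_mem in hi; pose i0 := Ordinal hi.
  have ei0 : nth 0%MM Gs i0 = g0 by rewrite /= nth_index.
  exists (\sum_j d j *: pz ('X_[g0] * e j - \sum_i a (i0, j) i *: frame b w i)).
    apply: (sm_sum _ (eJ_sm _)) => j _; apply: (smZ _ (eJ_sm _)); apply: eI_eJ.
    by rewrite -ei0; apply: (ha (i0, j)).
  exists (\sum_j d j *: \sum_l ph (a (i0, j) (lshift q' l)) *: icst iF (map_mpoly phi (b l))).
    apply: (sm_sum _ (inS_sm _)) => j _; apply: (smZ _ (inS_sm _)).
    apply: (sm_sum _ (inS_sm _)) => l _; apply: (smZ _ (inS_sm _)); apply: inS_icst.
    by apply: inS_map; apply: bV.
  have e1 j : pz ('X_[g0] * e j - \sum_i a (i0, j) i *: frame b w i) =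
     'X_[g0] * pz (e j) - (\sum_l ph (a (i0, j) (lshift q' l)) *: (lF * icst iF (map_mpoly phi (b l)))
        + \sum_l ph (a (i0, j) (rshift p' l)) *: pz (w l)).
    rewrite pzB pzM map_mpolyX pz_sum; congr (_ - _).
    by under eq_bigr do rewrite pz_frame; rewrite catf_sum.
  under [X in _ = _ - X]eq_bigr do rewrite e1 scalerBr scalerDr.
  rewrite sumrB big_split /= [X in _ = _ - (_ - (_ + X))](_ : _ = 0); last first.
    under eq_bigr do rewrite [_ *: \sum_(l < _) _]scaler_sumr; rewrite exchange_big big1 //= => l _.
    under eq_bigr do rewrite scalerA; rewrite -scaler_suml.
    by rewrite (hd (i0, l)) scale0r.
  rewrite addr0 ![_ * \sum_(l < _) _]mulr_sumr; under [X in _ = X - _]eq_bigr do rewrite -scalerAr.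
  rewrite opprB addrCA subrr addr0; apply: eq_bigr => j _.
  by rewrite -scalerAr [_ * \sum_(l < _) _]mulr_sumr; congr (_ *: _); apply: eq_bigr => l _; rewrite -scalerAr.
move=> [i0 k] /=; set g0 := nth 0%MM Gs i0.
have [d hd] := bS' _ (XV i0 _ _ _ hg).
suff H : eI t.+2 (\sum_i (catf (fun l => (\sum_j c j * a (i0, j) (lshift q' l)) - d l)
    (fun l => \sum_j c j * a (i0, j) (rshift p' l)) i) *: frame b w i).
  have := fI _ H (rshift p' k).
  by rewrite /catf -[rshift _ _]/(unsplit (inr k)) unsplitK.
have HE := eI_sm t.+2.
have h1 : eI t.+2 ('X_[g0] * u) by apply: (fam_mul (ext_fam ZR HI)) => //; apply: mem_nth.
have h2 : eI t.+2 (lR * ('X_[g0] * g - \sum_j d j *: icst iR (b j))) by apply: eI_ell.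
have h3 : eI t.+2 (\sum_j c j *: ('X_[g0] * e j - \sum_i a (i0, j) i *: frame b w i)).
  by apply: sm_sum => // j _; apply: smZ => //; apply: (ha (i0, j)).
have := smB HE (smD HE h1 h2) h3.
have e1 : 'X_[g0] * u + lR * ('X_[g0] * g - \sum_j d j *: icst iR (b j)) =
    \sum_j c j *: ('X_[g0] * e j) - \sum_l d l *: (lR * icst iR (b l)).
  rewrite mulrBr mulrCA eg mulrBr ![_ * \sum_(l < _) _]mulr_sumr addrA [_ + (_ - _)]addrC subrK.
  by congr (_ - _); apply: eq_bigr => j _; rewrite -scalerAr.
have e3 : \sum_j c j *: ('X_[g0] * e j - \sum_i a (i0, j) i *: frame b w i) =
    \sum_j c j *: ('X_[g0] * e j) -
    (\sum_l (\sum_j c j * a (i0, j) (lshift q' l)) *: (lR * icst iR (b l)) +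
     \sum_l (\sum_j c j * a (i0, j) (rshift p' l)) *: w l).
  under eq_bigr do rewrite scalerBr catf_sum scalerDr.
  rewrite sumrB big_split /=; congr (_ - (_ + _)).
    under eq_bigr do rewrite [_ *: \sum_(l < _) _]scaler_sumr; rewrite exchange_big /=; apply: eq_bigr => l _.
    by rewrite scaler_suml; apply: eq_bigr => j _; rewrite scalerA.
  under eq_bigr do rewrite [_ *: \sum_(l < _) _]scaler_sumr; rewrite exchange_big /=; apply: eq_bigr => l _.
  by rewrite scaler_suml; apply: eq_bigr => j _; rewrite scalerA.
have conv (X Y : {mpoly A[n]}) : X = Y -> eI t.+2 X -> eI t.+2 Y by move=> ->.
rewrite e1 e3; apply: conv; rewrite /frame catf_cat; under [X in _ = X + _]eq_bigr do rewrite scalerBl.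
by rewrite sumrB opprB [LHS]addrC subrKA addrAC.
Qed.

(* One step of the descending induction: lift l f, correct the lift so that it is divisible by l. *)
Lemma lift_step t : lift_at t.+1 -> lift_at t.+2 -> hsat Gs mt J t -> lift_at t.
Proof.
move=> l1 l2 hs f Jf.
have [f' hf' ef'] := lift_inS Hphi (fam_in HJ Jf).
have H (j : 'I_(size Gs)) : exists x, I t.+1 x /\ map_mpoly phi x = 'X_[nth 0%MM Gs j] * f.
  have [|x hx ex] := l1 ('X_[nth 0%MM Gs j] * f); last by exists x.
  by apply: (fam_mul HJ) => //; apply: mem_nth.
have [x hx] := choice H.
(* [F'] lies in the ideal and lifts $\ell f$, but it need not be a multiple of $\ell$. *)
pose F' := \sum_(j < size Gs) iR 'X ^+ j *: icst iR (x j).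
have IF' : eI t.+1 F'.
  apply: (sm_sum _ (eI_sm _)) => j _; apply: (smZ _ (eI_sm _)).
  by apply: (ext_icst ZR); [exact: (fam_sm HI)|case: (hx j)].
have pF' : pz F' = lF * icst iF f.
  rewrite pz_sum ellE mulr_suml; apply: eq_bigr => j _; have [_ e] := hx j.
  rewrite pz_icst e icstM icstX -scalerAl rmorphXn; congr (_ ^+ _ *: _).
  by rewrite ph_iota map_polyX.
have [p [q [b [w [[bV wV] bS wS bI wI]]]]] := J_frame t.
have fS := frame_span l1 bV wV bS wS.
pose v := F' - lR * icst iR f'.
have Vv : V t.+1 v.
  apply: (smB (inS_sm _)); first by apply: ext_inS IF' => //; apply: (fam_in HI).
  by apply: inS_ell => //; apply: inS_icst.
have pv m : ph v@_m = 0.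
  by rewrite -mcoeff_map_mpoly pzB pF' pzM pz_ell pz_icst ef' subrr mcoeff0.
(* The error $F' - \ell f'$ vanishes over $F(z)$, so its coordinates in the frame can be taken in
   the maximal ideal; correcting [f'] by those on [b] does not change its reduction. *)
have [d [hd dk]] : exists d : 'I_(p + q) -> A, eI t.+1 (v - \sum_i d i *: frame b w i) /\
    forall i, ph (d i) = 0.
  have HX m : exists c : 'I_(p + q) -> A, m \in mt t.+1 -> eI t.+1 ('X_[m] - \sum_i c i *: frame b w i).
    have [mm|_] := boolP (m \in mt t.+1); last by exists (fun=> 0).
    by have [c hc] := fS _ (inS_X mm); exists c.
  have [c hc] := choice HX.
  exists (fun i => \sum_(m <- msupp v) v@_m * c m i); split; last first.
    by move=> i; apply: etrans (rmorph_sum ph _ _ _) _; rewrite big1 // => m _; apply: etrans (rmorphM ph _ _) _; rewrite pv mul0r.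
  rewrite {1}[v]mpolyE; under [X in _ - X]eq_bigr do rewrite scaler_suml.
  rewrite [X in _ - X]exchange_big /= -sumrB big_seq; apply: (sm_sum _ (eI_sm _)) => m mm.
  under eq_bigr do rewrite -scalerA; rewrite -scaler_sumr -scalerBr; apply: (smZ _ (eI_sm _)).
  by apply: hc; apply: Vv.
pose G := icst iR f' + \sum_j d (lshift q j) *: icst iR (b j).
have GV : V t G.
  apply: (smD (inS_sm _)); first exact: inS_icst.
  by apply: (sm_sum _ (inS_sm _)) => j _; apply: (smZ _ (inS_sm _)); apply: inS_icst.
have vE : v - \sum_i d i *: frame b w i = F' - lR * G - \sum_j d (rshift p j) *: w j.
  rewrite catf_sum /v /G mulrDr [_ * \sum_(l < _) _]mulr_sumr; under [X in _ - (X + _)]eq_bigr do rewrite scalerAr.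
  by rewrite !opprD !addrA.
rewrite vE in hd.
(* The part of the error on [w] lies in the hyperplane ideal of [I], since both [F'] and the
   remainder are in [I]. *)
have d0 : forall j, d (rshift p j) = 0.
  apply: (hyp_indep l1 l2 hs wV wI).
  exists (F' - (F' - lR * G - \sum_j d (rshift p j) *: w j)); first exact: (smB (eI_sm _)).
  exists (- G); first exact: (smN (inS_sm _)).
  by rewrite mulrN -addrA -opprD subKr opprD addrCA subrr addr0.
have IG : eI t G.
  apply: (ell_regular GsV ZR HI) => //.
  move: hd; rewrite [X in _ - X]big1 ?subr0; last by move=> j _; rewrite d0 scale0r.
  by move=> hd; have := smB (eI_sm _) IF' hd; rewrite subKr.
have pG : pz G = icst iF f.
  rewrite pzD pz_icst ef' pz_sum big1 ?addr0 // => j _.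
  by rewrite dk scale0r.
(* [G] lifts [f] only over $R(z)$. The reductions of $I_t$ form a submodule [P] over [F], and
   membership in [P] descends from $F(z)$. *)
pose P : set {mpoly F[n]} := [set map_mpoly phi g | g in I t].
have HP : is_submodule P.
  split; first by exists 0; [exact: (sm0 (fam_sm HI t))|rewrite raddf0].
  move=> a _ _ [g1 h1 <-] [g2 h2 <-]; have [a' ha'] := (proj1 Hphi) a.
  exists (a' *: g1 + g2); last by rewrite raddfD /= map_mpolyZ ha'.
  by apply: (smD (fam_sm HI t)) => //; apply: (smZ _ (fam_sm HI t)).
suff : P f by move=> [g Ig <-]; exists g.
apply: (ext_descent ZF HP); rewrite -pG.
move: IG; rewrite (extE ZR (fam_sm HI t)).
have HE := ext_sm ZF HP.
apply: (@span_min _ _ _ [set g | ext iF DF P (pz g)]).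
  split=> /=; first by rewrite raddf0; apply: (sm0 HE).
  move=> a u1 u2 hu1 hu2; rewrite pzD pzZ; apply: (smD HE) => //.
  exact: (smZ _ HE).
move=> _ [g Ig <-] /=; rewrite pz_icst; apply: (ext_icst ZF) => //.
by exists g.
Qed.

End LocalLifting.

Section LocalLiftingThm.
Variables (n : nat) (Gs : seq 'X_{1..n}) (mt : nat -> seq 'X_{1..n}).
Hypothesis (mtU : forall t, uniq (mt t)).
Hypothesis (GsV : forall t g m, g \in Gs -> m \in mt t -> (g + m)%MM \in mt t.+1).

(** Each degree follows from the next two, so lifting descends from any degree [t1] where it is
    known down to the bound [t0], which depends on the fibre only through the saturation of its
    hyperplane sections. *)
Theorem local_lifting (R : comNzRingType) (F : fieldType) (phi : {rmorphism R -> F})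
    (I : nat -> set {mpoly R[n]}) (J : nat -> set {mpoly F[n]}) t0 t1 :
  local_map phi -> fam Gs mt I -> fam Gs mt J ->
  (forall t f, I t f -> J t (map_mpoly phi f)) ->
  (forall t, indep_at mt phi I J t) ->
  (forall t, (t0 <= t)%N -> hsat Gs mt J t) ->
  (forall t, (t1 <= t)%N -> lift_at phi I J t) ->
  forall t, (t0 <= t)%N -> lift_at phi I J t.
Proof.
move=> Hphi HI HJ L0 L2 hs l1.
have step t : (t0 <= t)%N -> lift_at phi I J t.+1 -> lift_at phi I J t.+2 -> lift_at phi I J t.
  move=> lt h1 h2.
  apply: (lift_step mtU GsV Hphi HI HJ L0 L2 (Az_zext (proj2 Hphi)) (phiz_local Hphi)) => //.
    exact: phiz_iota.
  exact: hs.
have : forall k t, (t0 <= t)%N -> (t1 - t <= k)%N -> lift_at phi I J t.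
  elim=> [|k IH] t lt hk; first by apply: l1; lia.
  by apply: step => //; apply: IH; lia.
by move=> H t lt; apply: (H t1) => //; lia.
Qed.

End LocalLiftingThm.

(** * Toric geometry *)

Section SmallPoly.
Variable RR : realType.
Implicit Type p : {poly RR}.

(** A sequence tending to zero. Points perturbed by [eps] have polynomial coordinates, and a
    property of infinitely many of them passes to the limit. *)
Definition eps (k : nat) : RR := k.+1%:R^-1.

Definition infinitely (P : set nat) := forall N, exists2 k, (N <= k)%N & P k.

Lemma eps_gt0 k : 0 < eps k. Proof. by rewrite invr_gt0 ltr0Sn. Qed.

Lemma poly_small_lt0 p : p.[0] < 0 -> exists K, forall k, (K <= k)%N -> p.[eps k] < 0.
Proof.
move=> h; have [|dl d0 hd] := @polyrcf.poly_cont RR 0 p (- p.[0]); first by rewrite oppr_gt0.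
have := archi_boundP (ltW (x := 0) (y := dl^-1) ltac:(by rewrite invr_gt0)).
set K := Num.Def.archi_bound _ => hK; exists K => k Kk.
have := hd (eps k); rewrite subr0 gtr0_norm ?eps_gt0 //.
have -> : eps k < dl.
  rewrite /eps -[dl]invrK ltf_pV2 ?posrE ?invr_gt0 ?ltr0Sn //.
  by apply: lt_le_trans hK _; rewrite ler_nat; apply: leq_trans (leqnSn _).
by move=> /(_ isT) /(le_lt_trans (ler_norm _)); rewrite ltrBlDr addNr.
Qed.

Lemma poly_small_ge0 p : infinitely [set k | 0 <= p.[eps k]] -> 0 <= p.[0].
Proof.
move=> H; rewrite leNgt; apply/negP => /poly_small_lt0 [K hK].
by have [k /hK /lt_geF /= h /=] := H K; rewrite h.
Qed.

Lemma poly_small_eq0 p : infinitely [set k | p.[eps k] = 0] -> p = 0.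
Proof.
elim/poly_ind: p => [//|p c IH] H.
have c0 : c = 0.
  have e q : infinitely [set k | q.[eps k] = 0] -> 0 <= q.[0].
    by move=> Hq; apply: poly_small_ge0 => N; have [k Nk /= e] := Hq N; exists k => //=; rewrite e.
  have h1 := e _ H; have h2 : 0 <= (- (p * 'X + c%:P)).[0].
    by apply: e => N; have [k Nk /= ek] := H N; exists k => //=; rewrite hornerN ek oppr0.
  by apply/le_anti; move: h1 h2; rewrite hornerN !hornerE oppr_ge0 => -> ->.
rewrite c0 addr0 in H *; rewrite IH ?mul0r // => N.
have [k Nk /= e] := H N; exists k => //=; move: e; rewrite hornerMX => /eqP.
by rewrite mulf_eq0 (gt_eqF (eps_gt0 k)) orbF => /eqP.
Qed.

Lemma infinitely_pigeon (T : finType) (f : nat -> T) : exists x, infinitely [set k | f k = x].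
Proof.
apply: contrapT => no.
have H x : exists N, forall k, (N <= k)%N -> f k <> x.
  apply: contrapT => h; apply: no; exists x => N; apply: contrapT => h'; apply: h.
  by exists N => k Nk e; apply: h'; exists k.
have [N hN] := choice H.
by apply: (hN (f (\max_x N x))) (erefl _); apply: leq_bigmax.
Qed.

End SmallPoly.

Section Fan.
Variables (RR : realType) (d n : nat) (b : 'M[int]_(d, n)) (Delta : {set {set 'I_n}}).
Hypothesis Hfan : smooth_projective_fan RR b Delta.

Definition pr (m : 'cV[int]_d) i : int := (b^T *m m) i 0.

Lemma prD m m' i : pr (m + m') i = pr m i + pr m' i.
Proof. by rewrite /pr mulmxDr mxE. Qed.
Lemma prN m i : pr (- m) i = - pr m i.
Proof. by rewrite /pr mulmxN mxE. Qed.
Lemma pr0 i : pr 0 i = 0.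
Proof. by rewrite /pr mulmx0 mxE. Qed.

Local Notation bR i := (map_mx (intr : int -> RR) (col i b)).

Definition dot (y : 'rV[RR]_d) (v : 'cV[RR]_d) : RR := (y *m v) 0 0.

Lemma dotD y u v : dot y (u + v) = dot y u + dot y v.
Proof. by rewrite /dot mulmxDr mxE. Qed.
Lemma dotN y v : dot y (- v) = - dot y v.
Proof. by rewrite /dot mulmxN mxE. Qed.
Lemma dotZ y a v : dot y (a *: v) = a * dot y v.
Proof. by rewrite /dot -scalemxAr mxE. Qed.
Lemma dot_sum y (I : Type) (s : seq I) (P : pred I) (F : I -> 'cV[RR]_d) :
  dot y (\sum_(i <- s | P i) F i) = \sum_(i <- s | P i) dot y (F i).
Proof. by rewrite /dot mulmx_sumr summxE. Qed.

Lemma dot_pr m i : dot (map_mx intr m^T) (bR i) = (pr m i)%:~R.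
Proof.
rewrite /dot /pr !mxE rmorph_sum; apply: eq_bigr => j _.
by rewrite !mxE rmorphM mulrC.
Qed.

(** By completeness $-m$ lies in some cone, hence $\langle m, -m \rangle \ge 0$. *)
Lemma pr_ge0 m : (forall i, 0 <= pr m i) -> m = 0.
Proof.
move=> H; have [s sD [c c0 e]] := fan_complete Hfan (- map_mx intr m).
have : dot (map_mx intr m^T) (- map_mx intr m) >= 0.
  rewrite e dot_sum; apply: sumr_ge0 => i _; rewrite dotZ dot_pr.
  by apply: mulr_ge0 => //; rewrite ler0z.
rewrite dotN oppr_ge0 /dot mxE => h.
have h0 : \sum_j (map_mx intr m^T) 0 j * (map_mx (intr : int -> RR) m) j 0 = 0.
  by apply/le_anti; rewrite h; apply: sumr_ge0 => j _; rewrite !mxE -expr2 sqr_ge0.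
apply/colP => j; rewrite mxE.
have /eqP : (m j 0)%:~R * (m j 0)%:~R = 0 :> RR.
  have := psumr_eq0P _ h0 (i := j) isT; rewrite !mxE; apply => i _.
  by rewrite !mxE -expr2 sqr_ge0.
by rewrite mulf_eq0 orbb intr_eq0 => /eqP.
Qed.

(** By smoothness the rays of [s] are among the columns of an invertible [U]; the rows of its
    inverse are dual coordinates on the cone. *)
Lemma fan_coord s : s \in Delta -> exists (U : 'M[int]_d) (h : 'I_n -> 'I_d),
  [/\ U \in unitmx, {in s &, injective h}, {in s, forall i, col i b = col (h i) U} &
   forall i j, i \in s -> dot (row j (map_mx intr (invmx U))) (bR i) = (j == h i)%:R].
Proof.
move=> sD; have [U Uu [h hi hU]] := fan_smooth Hfan sD; exists U, h; split => // i j si.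
rewrite hU // /dot -map_row -map_mxM -row_mul colE mulmxA mulVmx // mul1mx !mxE eqxx andbT.
by case: (_ == _).
Qed.

Lemma dot_cone (s : {set 'I_n}) U (h : 'I_n -> 'I_d) : {in s &, injective h} ->
  (forall i j, i \in s -> dot (row j (map_mx intr (invmx U))) (bR i) = (j == h i)%:R) ->
  forall (c : 'I_n -> RR) i, i \in s ->
  dot (row (h i) (map_mx intr (invmx U))) (\sum_(i in s) c i *: bR i) = c i.
Proof.
move=> hi hd c i si; rewrite dot_sum (bigD1 i) //= dotZ hd // eqxx mulr1 big1 ?addr0 //.
move=> j /andP [sj ji]; rewrite dotZ hd // (inj_in_eq hi) // eq_sym (negbTE ji).
by rewrite mulr0.
Qed.

(* Perturb the sum of the rays of s towards - b_i, generically: infinitely many of these points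
   lie in the same cone s', which is then maximal, contains s and avoids i. *)
Lemma fan_pure s i : s \in Delta ->
  exists2 s', s' \in Delta & [/\ #|s'| = d, s \subset s' & i \notin s -> i \notin s'].
Proof.
move=> sD; pose v0 := \sum_(j in s) (1 : RR) *: bR j.
(* The terms of order at least two make the point generic, since no nonzero linear form vanishes on
   all of them; to first order the point moves along $-b_i$. *)
pose v (e : RR) := v0 + e *: (- bR i) + \sum_(l < d) e ^+ l.+2 *: delta_mx l 0.
pose py y := (dot y v0)%:P + (dot y (- bR i)) *: 'X + \sum_(l < d) (y 0 l) *: 'X^(l.+2).
have pyE y e : (py y).[e] = dot y (v e).
  rewrite /py /v !hornerE horner_sum !dotD dotZ [dot y (\sum_(l < d) _)]dot_sum [dot y (- _) * e]mulrC.
  congr (_ + _); apply: eq_bigr => l _; rewrite dotZ hornerZ hornerXn mulrC; congr (_ * _).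
  rewrite /dot mxE (bigD1 l) //= mxE !eqxx mulr1 big1 ?addr0 // => j jl.
  by rewrite mxE (negbTE jl) mulr0.
have H k : exists s', s' \in Delta /\ cone RR b s' (v (eps RR k)).
  by have [s' h1 h2] := fan_complete Hfan (v (eps RR k)); exists s'.
have [f hf] := choice H; have [s' hs'] := infinitely_pigeon f.
have s'D : s' \in Delta by have [k _ <-] := hs' 0%N; case: (hf k).
exists s' => //.
have hs : infinitely (fun k => cone RR b s' (v (eps RR k))).
  by move=> N; have [k Nk /= e] := hs' N; exists k => //; rewrite -e; case: (hf k).
have [U [h [Uu hi hU hd]]] := fan_coord s'D; pose y j := row j (map_mx (intr : int -> RR) (invmx U)).
have UI : map_mx (intr : int -> RR) U *m map_mx intr (invmx U) = 1%:M.
  by rewrite -map_mxM mulmxV // map_scalar_mx.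
have dotU j j' : dot (y j) (col j' (map_mx intr U)) = (j == j')%:R.
  rewrite /dot -row_mul colE mulmxA -map_mxM mulVmx // map_scalar_mx mul1mx !mxE eqxx andbT.
  by case: (_ == _).
have cge j k : cone RR b s' (v (eps RR k)) -> 0 <= (py (y j)).[eps RR k].
  move=> [c c0 e]; rewrite pyE e dot_sum; apply: sumr_ge0 => l sl.
  by rewrite dotZ hd // mulr_ge0 // ler0n.
(* Were [j] missed, the coordinate [y j] would vanish at infinitely many of the points, hence as a
   polynomial in the parameter, so [y j] would be zero. *)
have hT : h @: s' = [set: 'I_d]%SET.
  apply/eqP; rewrite -finset.subTset; apply/fintype.subsetP => j _; apply: contrapT => /negP nj.
  have : py (y j) = 0.
    apply: poly_small_eq0 => N; have [k Nk [c c0 e]] := hs N; exists k => //=.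
    rewrite pyE e dot_sum big1 // => l sl; rewrite dotZ hd //.
    by case: eqP nj => [->|_ _]; rewrite ?mulr0 // imset_f.
  move=> /polyP py0; have : dot (y j) (col j (map_mx intr U)) = 0.
    rewrite /dot mxE big1 // => l _; have := py0 l.+2.
    rewrite coef0 !coefD coefC coefZ coefX /= mulr0 !add0r coef_sum (bigD1 l) //=.
    rewrite coefZ coefXn eqxx mulr1 big1 ?addr0 => [->|l' ll']; first by rewrite mul0r.
    by rewrite coefZ coefXn !eqSS (inj_eq val_inj) eq_sym (negbTE ll') mulr0.
  by rewrite dotU eqxx => /eqP; rewrite oner_eq0.
have v0E : v0 = \sum_(l in s') dot (y (h l)) v0 *: bR l.
  transitivity (\sum_(j in h @: s') dot (y j) v0 *: col j (map_mx intr U)).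
    rewrite hT -[LHS]mul1mx -UI -mulmxA; apply/colP => l; rewrite !mxE summxE.
    apply: eq_big => [j|j _]; first by rewrite finset.inE.
    rewrite [RHS]mxE [RHS]mulrC; congr (_ * _); first by rewrite !mxE.
    by rewrite /dot -row_mul [RHS]mxE.
  by rewrite big_imset //=; apply: eq_bigr => l sl; rewrite hU // map_col.
have v0s' : cone RR b s' v0.
  exists (fun l => dot (y (h l)) v0) => // l.
  have := @poly_small_ge0 _ (py (y (h l))).
  rewrite {2}/py !hornerE horner_sum big1 ?addr0; last by move=> l' _; rewrite hornerZ hornerXn expr0n mulr0.
  by apply => N; have [k Nk hk] := hs N; exists k => //; apply: cge.
have ss' : s \subset s'.
  have : cone RR b (s :&: s')%SET v0.
    by rewrite -(fan_meet Hfan) //; split => //; exists (fun=> 1) => // l; rewrite ler01.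
  move=> [c c0 e]; apply/fintype.subsetP => j sj.
  have [V [g [_ gi _ gd]]] := fan_coord sD.
  have := dot_cone gi gd (fun=> 1) sj; rewrite -/v0 e dot_sum => e1.
  apply: contrapT => /negP js'; move: e1; rewrite big1 => [/eqP|l].
    by rewrite eq_sym oner_eq0.
  rewrite finset.inE => /andP [sl s'l]; rewrite dotZ gd // (inj_in_eq gi) //.
  by case: eqP => [e2|_]; [rewrite e2 s'l in js'|rewrite mulr0].
split => //; first by rewrite -(card_in_imset hi) hT cardsT card_ord.
move=> ns; apply/negP => is'.
(* Were [i] in [s'], the coordinate along $b_i$ would be [q] times the parameter, with $q(0) = -1$,
   although it is nonnegative on the cone. *)
pose q : {poly RR} := (-1)%:P + \sum_(l < d) (y (h i) 0 l) *: 'X^(l.+1).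
have pq : py (y (h i)) = q * 'X.
  rewrite /py dotN (hd i (h i)) // eqxx.
  have -> : dot (y (h i)) v0 = 0.
    rewrite dot_sum big1 // => j sj; have s'j := fintype.subsetP ss' _ sj.
    rewrite dotZ hd // (inj_in_eq hi) //.
    by case: eqP => [e|_]; [rewrite e sj in ns|rewrite mulr0].
  rewrite add0r mulrDl mulr_suml mul_polyC mulr1n; congr (_ + _).
  by apply: eq_bigr => l _; rewrite -scalerAl -exprSr.
have := @poly_small_ge0 _ q; rewrite {2}/q !hornerE horner_sum big1 ?addr0; last first.
  by move=> l' _; rewrite hornerZ hornerXn expr0n mulr0.
rewrite lerNr oppr0 ler10 => H'; suff : false by [].
apply: H' => N; have [k Nk hk] := hs N; exists k => //=.
by have := cge (h i) k hk; rewrite pq hornerMX pmulr_lge0 ?eps_gt0.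
Qed.

End Fan.

(** * Monomials, degrees and the ample class *)

Section Degrees.
Variables (RR : realType) (d n r : nat) (b : 'M[int]_(d, n)) (Delta : {set {set 'I_n}}).
Variable (A : 'M[int]_(r, n)).
Hypotheses (Hfan : smooth_projective_fan RR b Delta) (Hex : short_exact b A).
Local Notation deg := (mdegree A).
Implicit Types (u w : 'X_{1..n}) (s : {set 'I_n}).

Lemma mdeg_add u w : deg (u + w)%MM = deg u + deg w.
Proof.
by rewrite /mdegree -mulmxDr; congr (_ *m _); apply/colP => i; rewrite !mxE mnmDE PoszD.
Qed.

Lemma mdeg_zero : deg 0%MM = 0.
Proof. by rewrite /mdegree; apply/colP => i; rewrite mxE big1 ?mxE // => j _; rewrite mxE mnm0E mulr0. Qed.

Lemma mdeg_muln u k : deg (u *+ k)%MM = deg u *+ k.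
Proof. by elim: k => [|k IH]; rewrite ?mulm0n ?mdeg_zero // mulmS mdeg_add IH mulrS. Qed.

Lemma mdeg_sub u w : (w <= u)%MM -> deg (u - w)%MM = deg u - deg w.
Proof. by move=> le; rewrite -{2}(submK le) mdeg_add addrK. Qed.

(** Exactness in the middle: a quotient of two monomials of the same degree is a character. *)
Lemma mdeg_eq u w : deg u = deg w <-> exists m, forall i, (u i)%:Z = (w i)%:Z + pr b m i.
Proof.
case: Hex => _ ker _; pose z u : 'cV[int]_n := \col_i (u i)%:Z.
have -> : (deg u = deg w) = (A *m (z u - z w) = 0).
  rewrite mulmxBr; apply/propext; split=> [e|/eqP]; first by rewrite -[A *m z u]/(deg u) e subrr.
  by rewrite subr_eq0 => /eqP.
split=> [/(proj1 (ker _)) [m e]|[m e]].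
  by exists m => i; rewrite /pr -e !mxE addrCA subrr addr0.
apply/(proj2 (ker _)); exists m; apply/colP => i; rewrite !mxE e.
by rewrite addrC addKr /pr !mxE.
Qed.

(** The character [w / u] is nonnegative on all rays, so it is trivial: a complete toric variety has
    no other global characters. *)
Lemma mdeg_le_eq u w : deg u = deg w -> (u <= w)%MM -> u = w.
Proof.
move=> /esym /(proj1 (mdeg_eq _ _)) [m e] le.
have m0 : m = 0.
  apply: (pr_ge0 Hfan) => i; move: le => /mnm_lepP /(_ i); rewrite -lez_nat e.
  by rewrite lerDl.
by apply/mnmP => i; apply/eqP; rewrite -eqz_nat e m0 pr0 addr0.
Qed.

(** Distinct monomials of one degree do not divide each other, so Dickson's lemma leaves only
    finitely many. *)
Lemma mon_ex p : exists ms : seq 'X_{1..n}, uniq ms /\ forall u, (u \in ms) = (deg u == p).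
Proof.
have [s [sU hs]] := dickson [set u | deg u = p]; exists (undup s); split; first exact: undup_uniq.
move=> u; rewrite mem_undup; apply/idP/eqP => [/sU //|e].
have [w ws le] := hs u e; rewrite -(mdeg_le_eq _ le) //.
by rewrite e; apply: sU.
Qed.

Definition off s u := forall i, i \in s -> u i = 0%N.

Lemma off_add s u w : off s u -> off s w -> off s (u + w)%MM.
Proof. by move=> hu hw i si; rewrite mnmDE hu // hw. Qed.

Lemma off_muln s u k : off s u -> off s (u *+ k)%MM.
Proof. by move=> hu i si; rewrite mulmnE hu. Qed.

Lemma off_sub s u w : off s u -> off s (u - w)%MM.
Proof. by move=> hu i si; rewrite mnmBE hu. Qed.

Lemma off_sum_exact s p : s \in Delta -> exists2 z : 'cV[int]_n, A *m z = p & forall i, i \in s -> z i 0 = 0.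
Proof.
move=> sD; case: Hex => _ ker sur; have [z <-] := sur p.
have [U Uu [h hi hU]] := fan_smooth Hfan sD.
pose w := \col_j (odflt 0 (omap (fun i => z i 0) [pick i in s | h i == j])) : 'cV[int]_d.
pose m := (invmx U)^T *m w; exists (z - b^T *m m).
  have k0 : A *m (b^T *m m) = 0 by apply/ker; exists m.
  by rewrite mulmxBr k0 subr0.
move=> i si; rewrite !mxE; apply/eqP; rewrite subr_eq0; apply/eqP.
transitivity ((U^T *m m) (h i) 0).
  rewrite /m mulmxA -trmx_mul mulVmx // trmx1 mul1mx mxE.
  case: pickP => [j /andP [sj /eqP /hi ->]//|/(_ i)]; by rewrite si eqxx.
rewrite !mxE; apply: eq_bigr => j _; congr (_ * _); rewrite !mxE.
by have := hU _ si => /colP /(_ j); rewrite !mxE => ->.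
Qed.

(** Line bundles are trivial on the chart of [s]: every degree is that of a Laurent monomial
    $x^u/x^w$ in the variables invertible there. *)
Lemma off_rep s p : s \in Delta -> exists u w, [/\ off s u, off s w & deg u = p + deg w].
Proof.
move=> sD; have [z <- z0] := off_sum_exact p sD.
exists [multinom absz (Num.max (z i 0) 0)%R | i < n], [multinom absz (Num.max (- z i 0) 0)%R | i < n].
split=> [i si|i si|]; rewrite ?mnmE ?z0 ?oppr0 //.
rewrite /mdegree -mulmxDr; congr (_ *m _); apply/colP => i; rewrite !mxE !mnmE.
have [hz|/ltW hz] := lerP 0 (z i 0).
  by rewrite (max_idPr _) ?oppr_le0 // gez0_abs // addr0.
by rewrite absz0 (max_idPl _) ?oppr_ge0 // gez0_abs ?oppr_ge0 // subrr.
Qed.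

(** For a maximal cone, strict convexity of the support function gives a monomial of the ample
    degree vanishing exactly off the chart. Smaller cones are intersections of maximal ones by
    [fan_pure]. *)
Lemma ample_ex : exists h (mu : {set 'I_n} -> 'X_{1..n}), forall s, s \in Delta ->
  deg (mu s) = h /\ forall i, (mu s i == 0%N) = (i \in s).
Proof.
have [h hP] := fan_projective Hfan.
have C s : exists c : 'X_{1..n}, s \in Delta -> #|s| = d ->
    deg c = A *m (\col_i h i) /\ forall i, (c i == 0%N) = (i \in s).
  have [/andP [sD /eqP sd]|no] := boolP ((s \in Delta) && (#|s| == d)); last first.
    by exists 0%MM => h1 h2; rewrite h1 h2 eqxx in no.
  have [m [m1 m2]] := hP s sD sd.
  have ge i : 0 <= (b^T *m m) i 0 + h i.
    have [/m1 ->|/m2] := boolP (i \in s); first by rewrite addNr.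
    by move=> /ltW; rewrite -subr_ge0 opprK.
  exists [multinom absz ((b^T *m m) i 0 + h i)%R | i < n] => _ _; split.
    case: Hex => _ ker _; have Hm : A *m (b^T *m m) = 0 by apply/ker; exists m.
    rewrite -[RHS]add0r -Hm -mulmxDr /mdegree; congr (_ *m _); apply/colP => i.
    by rewrite [LHS]mxE mnmE gez0_abs // [RHS]mxE; congr (_ + _); rewrite mxE.
  move=> i; rewrite mnmE absz_eq0; have [/m1 ->|/m2] := boolP (i \in s).
    by rewrite addNr eqxx.
  by rewrite -subr_gt0 opprK => /gt_eqF.
have [c hc] := choice C.
have X (x : {set 'I_n} * 'I_n) : exists s', x.1 \in Delta -> [/\ s' \in Delta, #|s'| = d, x.1 \subset s' &
    x.2 \notin x.1 -> x.2 \notin s'].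
  have [sD|no] := boolP (x.1 \in Delta); last by exists x.1.
  by have [s' h1 [h2 h3 h4]] := fan_pure Hfan x.2 sD; exists s' => _; split.
have [f hf] := choice X.
(* One factor for each [i], from a maximal cone that contains [s], and avoids [i] when [s] does;
   this accounts for the multiple [n] of the degree. *)
exists (A *m (\col_i h i) *+ n), (fun s => \sum_(i < n) c (f (s, i)))%MM => s sD; split.
  transitivity (\sum_(i < n) A *m (\col_i h i)); last by rewrite sumr_const card_ord.
  have H (I : seq 'I_n) : deg (\sum_(i <- I) c (f (s, i)))%MM = \sum_(i <- I) A *m (\col_i h i).
    elim: I => [|i I IH]; first by rewrite !big_nil mdeg_zero.
    rewrite !big_cons mdeg_add IH; congr (_ + _).
    by have [h1 h2 _ _] := hf (s, i) sD; case: (hc _ h1 h2).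
  exact: H.
move=> i; rewrite mnm_sumE sum_nat_eq0; apply/forallP/idP => [/(_ i)|si j].
  have [h1 h2 _ h4] := hf (s, i) sD; have [_ ->] := hc _ h1 h2.
  by apply: contraTT => /h4.
have [h1 h2 /fintype.subsetP h3 _] := hf (s, j) sD; have [_ ->] := hc _ h1 h2.
by apply: h3.
Qed.

Section Ample.
Variables (h : 'cV[int]_r) (mu : {set 'I_n} -> 'X_{1..n}).
Hypothesis Hmu : forall s, s \in Delta -> deg (mu s) = h /\ forall i, (mu s i == 0%N) = (i \in s).

Lemma mu_deg s : s \in Delta -> deg (mu s) = h. Proof. by case/Hmu. Qed.
Lemma mu_off s : s \in Delta -> off s (mu s).
Proof. by case/Hmu => _ H i si; apply/eqP; rewrite H. Qed.
Lemma mu_gt0 s i : s \in Delta -> i \notin s -> (0 < mu s i)%N.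
Proof. by case/Hmu => _ H si; rewrite lt0n H. Qed.

Lemma off_le_mu s u : s \in Delta -> off s u -> exists N, forall N', (N <= N')%N -> (u <= mu s *+ N')%MM.
Proof.
move=> sD hu; exists (\max_(i < n) u i)%N => N' hN; apply/mnm_lepP => i.
have [si|si] := boolP (i \in s); first by rewrite hu.
rewrite mulmnE; apply: leq_trans (leq_bigmax (F := fun i => u i) i) _.
by apply: leq_trans hN _; apply: leq_pmull; apply: mu_gt0.
Qed.

(* Pair u - j mu_s, which is a character, with the sum of the rays in the zero set of u. *)
Lemma zero_set j u : (0 < j)%N -> deg u = h *+ j -> [set i | u i == 0%N]%SET \in Delta.
Proof.
move=> j0 e; set E := [set i | _]%SET.
have [s sD [c c0 ec]] := fan_complete Hfan (\sum_(i in E) map_mx intr (col i b)).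
have [dm0 mu0] := Hmu sD.
have /mdeg_eq [m hm] : deg u = deg (mu s *+ j)%MM by rewrite mdeg_muln dm0.
pose y := map_mx (intr : int -> RR) m^T.
have prE i : pr b m i = (u i)%:Z - (mu s i * j)%N%:Z by rewrite hm mulmnE addrC addKr.
have H0 : \sum_(i in E) ((mu s i * j)%:R : RR) = 0.
  apply/le_anti/andP; split; last by apply: sumr_ge0 => i _; apply: ler0n.
  rewrite -oppr_ge0 -sumrN.
  have -> : \sum_(i in E) - ((mu s i * j)%:R : RR) = dot y (\sum_(i in E) map_mx intr (col i b)).
    rewrite dot_sum; apply: eq_bigr => i; rewrite finset.inE => /eqP u0.
    by rewrite dot_pr prE u0 sub0r rmorphN /=.
  rewrite ec dot_sum; apply: sumr_ge0 => i si; rewrite dotZ dot_pr; apply: mulr_ge0 => //.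
  by rewrite prE (eqP (etrans (mu0 i) si)) mul0n subr0 ler0z.
apply: (fan_face Hfan sD); apply/fintype.subsetP => i iE; rewrite -mu0.
have := psumr_eq0P (fun i _ => ler0n _ _) H0 iE => /eqP.
by rewrite pnatr_eq0 muln_eq0 [j == 0%N]eqn0Ngt j0 orbF.
Qed.

(** Truncating exponents at [C] leaves finitely many classes of monomials. Let [E] be the set of
    variables with exponent below [C]. If [E] is not a cone, the class is bounded in [t]: dividing
    by a minimal member of smaller degree would give a monomial of degree a positive multiple of [h]
    whose zero set contains [E]. If [E] is a cone, all exponents off [E] reach [C]. *)
Lemma pig p N : exists tau, forall t u, (tau <= t)%N -> deg u = p + h *+ t ->
  exists2 E, E \in Delta & (mu E *+ N <= u)%MM.
Proof.
pose C := (N * \max_(s : {set 'I_n}) \max_(i < n) mu s i)%N.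
have muC s i : (mu s i * N <= C)%N.
  rewrite mulnC leq_mul //; apply: leq_trans (leq_bigmax (F := fun s => \max_(i < n) mu s i)%N s).
  exact: (leq_bigmax (F := fun i => mu s i)).
pose E (e : {ffun 'I_n -> 'I_C.+1}) := [set i | (e i < C)%N]%SET.
pose U (e : {ffun 'I_n -> 'I_C.+1}) := [set u : 'X_{1..n} | (forall i, minn (u i) C = e i) /\ exists t, deg u = p + h *+ t].
have B e : exists tau, E e \notin Delta -> forall t u, U e u -> deg u = p + h *+ t -> (t < tau)%N.
  have [gs [gU hg]] := dickson (U e).
  have [tau ht] : exists tau, forall g, g \in gs -> exists2 t, (t < tau)%N & deg g = p + h *+ t.
    apply: (seq_bound (P := fun g tau => exists2 t, (t < tau)%N & deg g = p + h *+ t)).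
      by move=> g m m' le [t lt e']; exists t => //; apply: leq_trans le.
    by move=> g /gU [_ [t e']]; exists t.+1, t.
  exists tau => nE t u Uu eu; rewrite ltnNge; apply/negP => le.
  have [g ggs lg] := hg u Uu; have [t' lt' eg] := ht g ggs.
  have lt : (t' < t)%N by apply: leq_trans le.
  have d0 : deg (u - g)%MM = h *+ (t - t').
    by rewrite mdeg_sub // eu eg opprD addrACA subrr add0r mulrnBr // ltnW.
  have := zero_set _ d0; rewrite subn_gt0 => /(_ lt) zD.
  move/negP: nE; apply; apply: (fan_face Hfan zD); apply/fintype.subsetP => i.
  rewrite !finset.inE mnmBE => ei; have [hu _] := Uu; have [hg' _] := gU _ ggs.
  have := hu i; have := hg' i; move: ei; move: (nat_of_ord (e i)) => x; lia.
have [tau ht] := choice B; exists (\max_e tau e)%N => t u le eu.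
pose e := [ffun i => inord (minn (u i) C)] : {ffun 'I_n -> 'I_C.+1}.
have ee i : minn (u i) C = e i by rewrite ffunE inordK // ltnS geq_minr.
have Uu : U e u by split => //; exists t.
exists (E e).
  apply/negPn/negP => nE; have := ht e nE t u Uu eu; rewrite ltnNge => /negP; apply.
  by apply: leq_trans le; apply: leq_bigmax.
have [EeD|nE] := boolP (E e \in Delta); last first.
  have := ht e nE t u Uu eu; rewrite ltnNge => /negP; case.
  by apply: leq_trans le; apply: leq_bigmax.
apply/mnm_lepP => i; rewrite mulmnE; have [iE|] := boolP (i \in E e).
  by rewrite (mu_off EeD iE).
rewrite finset.inE -leqNgt -ee leq_min leqnn andbT => h'.
exact: leq_trans (muC _ _) h'.
Qed.

Lemma nef_off t : nef_monoid A Delta t <-> forall s, s \in Delta -> exists2 u, off s u & deg u = t.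
Proof.
have E s (c : 'I_n -> nat) : deg [multinom if i \in s then 0%N else c i | i < n] =
    \sum_(i | i \notin s) col i A *+ c i.
  apply/colP => l; rewrite mxE summxE [RHS]big_mkcond; apply: eq_bigr => i _.
  rewrite mxE mnmE; case: (i \in s) => /=; first by rewrite mulr0.
  by rewrite mulmxnE mxE -mulr_natr natz.
split=> H s sD.
  have [c ->] := H s sD; exists [multinom if i \in s then 0%N else c i | i < n]; last exact: E.
  by move=> i si; rewrite mnmE si.
have [u hu <-] := H s sD; exists (fun i => u i); rewrite -E; congr deg.
by apply/mnmP => i; rewrite mnmE; case: ifP => // /hu.
Qed.

Lemma nef_h : nef_monoid A Delta h.
Proof. by apply/nef_off => s sD; exists (mu s); [apply: mu_off|apply: mu_deg]. Qed.

Lemma nefD p q : nef_monoid A Delta p -> nef_monoid A Delta q -> nef_monoid A Delta (p + q).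
Proof.
move=> /nef_off hp /nef_off hq; apply/nef_off => s sD.
have [u hu <-] := hp s sD; have [w hw <-] := hq s sD.
by exists (u + w)%MM; rewrite ?mdeg_add //; apply: off_add.
Qed.

Lemma nef0 : nef_monoid A Delta 0.
Proof. by apply/nef_off => s sD; exists 0%MM; [move=> i _; rewrite mnm0E|rewrite mdeg_zero]. Qed.

Lemma nefMn p k : nef_monoid A Delta p -> nef_monoid A Delta (p *+ k).
Proof. by move=> hp; elim: k => [|k IH]; rewrite ?mulr0n ?mulrS; [exact: nef0|exact: nefD]. Qed.

Lemma nef_deep p : exists N, forall t, (N <= t)%N -> nef_monoid A Delta (p + h *+ t).
Proof.
have H s : exists N, s \in Delta -> forall t, (N <= t)%N -> exists2 u, off s u & deg u = p + h *+ t.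
  have [sD|_] := boolP (s \in Delta); last by exists 0%N.
  have [u [w [hu hw e]]] := off_rep p sD; have [N hN] := off_le_mu sD hw; exists N => _ t /hN le.
  exists (u + (mu s *+ t - w))%MM; first by apply: off_add => //; apply: off_sub; apply: off_muln; apply: mu_off.
  by rewrite mdeg_add mdeg_sub // mdeg_muln mu_deg // e addrACA subrr addr0.
have [N hN] := choice H; exists (\max_s N s)%N => t le; apply/nef_off => s sD.
by apply: hN => //; apply: leq_trans le; apply: leq_bigmax.
Qed.

End Ample.

(** Passing to a multiple [tau] of the ample degree makes the section ring generated in degree one:
    beyond [tau0], monomials of the old degree can be split off one at a time by [pig]. *)
Lemma veronese : exists h (mu : {set 'I_n} -> 'X_{1..n}),
  (forall s, s \in Delta -> deg (mu s) = h /\ forall i, (mu s i == 0%N) = (i \in s)) /\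
  forall j u, deg u = h *+ j -> exists2 w : seq 'X_{1..n}, size w = j /\ (forall g, g \in w -> deg g = h) &
    u = (\sum_(g <- w) g)%MM.
Proof.
have [h [mu Hmu]] := ample_ex; have [tau0 ht] := pig Hmu 0 1.
pose tau := tau0.+1; exists (h *+ tau), (fun s => (mu s *+ tau)%MM); split.
  move=> s sD; rewrite mdeg_muln; have [-> H] := Hmu s sD; split => // i.
  by rewrite mulmnE muln_eq0 orbF.
have sub k t u : (tau <= t)%N -> deg u = h *+ (t + k) -> exists g u', [/\ deg g = h *+ k, deg u' = h *+ t & u = (g + u')%MM].
  elim: k u => [|k IH] u le e; first by exists 0%MM, u; rewrite mdeg_zero e addn0 mulr0n add0m.
  have [||E ED] := ht (t + k.+1)%N u; [by lia|by rewrite add0r|].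
  rewrite mulm1n => leE; have dE := mu_deg Hmu ED.
  have [|g [u' [e1 e2 e3]]] := IH (u - mu E)%MM le.
    by rewrite mdeg_sub // e dE addnS mulrS [h + _]addrC addrK.
  exists (mu E + g)%MM, u'; split => //; first by rewrite mdeg_add e1 dE mulrS.
  by rewrite -addmA -e3 addmC submK.
elim=> [|j IH] u e.
  exists [::] => //; rewrite big_nil; symmetry; apply: mdeg_le_eq; last by apply/mnm_lepP => i; rewrite mnm0E.
  by rewrite e mdeg_zero mulr0n.
case: j IH e => [|j] IH e; first by exists [:: u]; rewrite ?big_seq1 //; split => // g; rewrite inE => /eqP ->.
have [||g [u' [e1 e2 ->]]] := sub tau (tau * j.+1)%N u.
- by rewrite leq_pmulr.
- by rewrite e -mulrnA; congr (_ *+ _); rewrite [in RHS]addnC -mulnS.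
have [|w [sw hw] ->] := IH u'; first by rewrite e2 mulrnA.
exists (g :: w); last by rewrite big_cons.
by split=> [/=|g']; rewrite ?sw // inE => /orP [/eqP ->|/hw].
Qed.

End Degrees.

(** * Charts and homogeneous ideals *)

Section Laurent.
Variables (d : nat).

Lemma lext (R : comNzRingType) (g g' : laurent R d) : (forall m, coeff m g = coeff m g') -> g = g'.
Proof. by move=> H; apply/eqP/freeg_eqP. Qed.

Lemma coeff_sum (R : comNzRingType) m (I : Type) (s : seq I) (P : pred I) (F : I -> laurent R d) :
  coeff m (\sum_(i <- s | P i) F i) = \sum_(i <- s | P i) coeff m (F i).
Proof. exact: raddf_sum. Qed.

Lemma coeff_dom_sum (R R' : comNzRingType) (g : laurent R d) (f : R -> R') (h : 'cV[int]_d -> 'cV[int]_d) m x :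
  f 0 = 0 -> injective h -> h x = m ->
  coeff m (\sum_(y <- dom g) << f (coeff y g) *g h y >> : laurent R' d) = f (coeff x g).
Proof.
move=> f0 hi e; rewrite coeff_sum; have [xd|xd] := boolP (x \in dom g).
  rewrite (bigD1_seq x) ?uniq_dom //= coeffU e eqxx mulr1 big1 ?addr0 // => y yx.
  by rewrite coeffU -e (inj_eq hi) (negbTE yx) mulr0.
rewrite (coeff_outdom xd) f0 big_seq big1 // => y yd; rewrite coeffU -e (inj_eq hi).
by case: eqP => [ey|]; rewrite ?mulr0 // -ey yd in xd *.
Qed.

Lemma coeff_translate (R : comNzRingType) m (g : laurent R d) x : coeff x (translate m g) = coeff (x - m) g.
Proof.
have e : m + (x - m) = x by rewrite addrC subrK.
exact: (@coeff_dom_sum _ _ g id (fun y => m + y) x (x - m) erefl (@addrI _ m) e).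
Qed.

Definition mapL (R R' : comNzRingType) (phi : R -> R') (g : laurent R d) : laurent R' d :=
  \sum_(x <- dom g) << phi (coeff x g) *g x >>.

Lemma coeff_mapL (R R' : comNzRingType) (phi : {rmorphism R -> R'}) g m : coeff m (mapL phi g) = phi (coeff m g).
Proof. by apply: (@coeff_dom_sum _ _ g phi id) => //; rewrite raddf0. Qed.

Lemma mapL_lin (R R' : comNzRingType) (phi : {rmorphism R -> R'}) a g g' :
  mapL phi (a *: g + g') = phi a *: mapL phi g + mapL phi g'.
Proof.
by apply: lext => m; rewrite coeffD coeffZ !coeff_mapL coeffD coeffZ rmorphD rmorphM.
Qed.

Lemma mapL0 (R R' : comNzRingType) (phi : {rmorphism R -> R'}) : mapL phi 0 = 0.
Proof. by apply: lext => m; rewrite coeff_mapL !coeff0 raddf0. Qed.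

Lemma base_changeE (n : nat) (Delta : {set {set 'I_n}}) (R R' : comNzRingType) (phi : {rmorphism R -> R'})
    (Y : chart_ideals R d Delta) : subscheme_base_change phi Y = fun s => span (mapL phi @` Y s).
Proof.
apply: funext => s; congr (span _); apply/seteqP; split=> [g' [g Yg e]|_ [g Yg <-]].
  by exists g => //; apply: lext => m; rewrite coeff_mapL e.
by exists g => // m; rewrite coeff_mapL.
Qed.

End Laurent.

Section Charts.
Variables (RR : realType) (d n r : nat) (b : 'M[int]_(d, n)) (Delta : {set {set 'I_n}}).
Variable (A : 'M[int]_(r, n)).
Hypotheses (Hfan : smooth_projective_fan RR b Delta) (Hex : short_exact b A).
Variables (h : 'cV[int]_r) (mu : {set 'I_n} -> 'X_{1..n}).
Local Notation deg := (mdegree A).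
Hypothesis Hmu : forall s, s \in Delta -> deg (mu s) = h /\ forall i, (mu s i == 0%N) = (i \in s).
Implicit Types (u v w a : 'X_{1..n}) (m c : 'cV[int]_d).
Local Notation chart := {s : {set 'I_n} | s \in Delta}.

Lemma pr_inj m m' : pr b m =1 pr b m' -> m = m'.
Proof. by case: Hex => inj _ _ e; apply: inj; apply/colP => i; apply: e. Qed.

Section Dehomogenize.
Variable R : comNzRingType.
Implicit Types (f : {mpoly R[n]}) (g : laurent R d).

Lemma mcoeff_component p f w : (component A p f)@_w = if deg w == p then f@_w else 0.
Proof.
rewrite /component raddf_sum /=; have [wf|wf] := boolP (w \in msupp f); last first.
  rewrite (memN_msupp_eq0 wf) if_same big1_seq // => w' /andP [_ wf']; rewrite mcoeffZ mcoeffX.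
  by case: eqP => [e|]; rewrite ?mulr0 // -e wf' in wf *.
rewrite big_mkcond (bigD1_seq w) ?msupp_uniq //= big1 ?addr0 => [|w' ww'].
  by case: ifP => // _; rewrite mcoeffZ mcoeffX eqxx mulr1.
by case: ifP => // _; rewrite mcoeffZ mcoeffX (negbTE ww') mulr0.
Qed.

Lemma graded_pieceP p f : graded_piece A p f <-> forall w, deg w != p -> f@_w = 0.
Proof.
split=> H w.
  by move=> ne; apply: memN_msupp_eq0; apply: contra ne => /H; rewrite inE.
by rewrite inE; apply: contraTT => /H e; rewrite mcoeff_msupp e eqxx.
Qed.

Lemma graded_component p f : graded_piece A p (component A p f).
Proof. by apply/graded_pieceP => w /negbTE ne; rewrite mcoeff_component ne. Qed.

Lemma component_id p f : graded_piece A p f -> component A p f = f.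
Proof.
move=> /graded_pieceP H; apply/mpolyP => w; rewrite mcoeff_component.
by case: eqP => // /eqP /H.
Qed.

Lemma component_ne p q f : graded_piece A p f -> p != q -> component A q f = 0.
Proof.
move=> /graded_pieceP H ne; apply/mpolyP => w; rewrite mcoeff_component mcoeff0.
by case: eqP => // e; apply: H; rewrite e eq_sym.
Qed.

Lemma componentZD p (x : R) f f' : component A p (x *: f + f') = x *: component A p f + component A p f'.
Proof.
apply/mpolyP => w; rewrite mcoeffD mcoeffZ !mcoeff_component mcoeffD mcoeffZ.
by case: ifP; rewrite ?mulr0 ?addr0.
Qed.

Lemma component_sum f : f = \sum_(p <- undup (map deg (msupp f))) component A p f.
Proof.
apply/mpolyP => w; rewrite raddf_sum /=; have [wf|wf] := boolP (w \in msupp f).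
  rewrite (bigD1_seq (deg w)) ?undup_uniq ?mem_undup ?map_f //= mcoeff_component eqxx.
  by rewrite big1 ?addr0 // => p /negbTE ne; rewrite mcoeff_component eq_sym ne.
rewrite (memN_msupp_eq0 wf) big1 // => p _; rewrite mcoeff_component (memN_msupp_eq0 wf).
by rewrite if_same.
Qed.

Lemma componentXM p w f : component A (p + deg w) ('X_[w] * f) = 'X_[w] * component A p f.
Proof.
apply/mpolyP => v; rewrite mcoeff_component !mcoeffXM.
have [le|_] := boolP (w <= v)%MM; last by rewrite if_same.
by rewrite mcoeff_component mdeg_sub // subr_eq.
Qed.

Lemma graded_sm p : is_submodule (@graded_piece R n r A p).
Proof.
split; first by apply/graded_pieceP => w _; rewrite mcoeff0.
move=> a f f' /graded_pieceP hf /graded_pieceP hf'; apply/graded_pieceP => w ne.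
by rewrite mcoeffD mcoeffZ hf // hf' // mulr0 addr0.
Qed.

Lemma gradedXM p w f : graded_piece A p f -> graded_piece A (p + deg w) ('X_[w] * f).
Proof.
by move=> hf; rewrite -(component_id hf) -componentXM; apply: graded_component.
Qed.

Lemma gradedX w : graded_piece A (deg w) ('X_[w] : {mpoly R[n]}).
Proof. by move=> m; rewrite msuppX inE => /eqP ->; rewrite inE. Qed.

(** The Laurent monomial $x^{a+v-u}$ is the character [m]. *)
Definition shf u a m v := forall i, (v i)%:Z + (a i)%:Z = (u i)%:Z + pr b m i.

Lemma shf_inj u a m v v' : shf u a m v -> shf u a m v' -> v = v'.
Proof.
by move=> h1 h2; apply/mnmP => i; apply/eqP; rewrite -eqz_nat -(inj_eq (addIr (a i)%:Z)) h1 h2.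
Qed.

Lemma shf_inj_m u a m m' v : shf u a m v -> shf u a m' v -> m = m'.
Proof. by move=> h1 h2; apply: pr_inj => i; apply: (addrI (u i)%:Z); rewrite -h1 -h2. Qed.

Lemma shf_deg u a m v : shf u a m v -> deg v + deg a = deg u.
Proof. by move=> H; rewrite -mdeg_add; apply/(mdeg_eq Hex); exists m => i; rewrite mnmDE PoszD. Qed.

Lemma deg_shf u a v : deg v + deg a = deg u -> exists m, shf u a m v.
Proof. by rewrite -mdeg_add => /(mdeg_eq Hex) [m H]; exists m => i; rewrite -H mnmDE PoszD. Qed.

(** $f/x^u$ as a function of [f]; monomials whose degree is not that of $x^u$ are discarded. *)
Definition dh u f : laurent R d :=
  \sum_(w <- msupp f | `[< exists m, shf u 0%MM m w >]) << f@_w *g xget 0 [set m | shf u 0%MM m w] >>.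

Lemma dh_chr u w m : shf u 0%MM m w -> xget 0 [set m | shf u 0%MM m w] = m.
Proof. by move=> H; have := xgetPex 0 (ex_intro [set m | shf u 0%MM m w] m H); move/shf_inj_m => /(_ _ H). Qed.

Lemma dh_coef0 u f m : (forall w, ~ shf u 0%MM m w) -> coeff m (dh u f) = 0.
Proof.
move=> no; rewrite coeff_sum big1 // => w /asboolP [m' hm']; rewrite coeffU (dh_chr hm').
by case: eqP => [e|]; rewrite ?mulr0 //; case: (no w); rewrite -e.
Qed.

Lemma dh_coef1 u f m w : shf u 0%MM m w -> coeff m (dh u f) = f@_w.
Proof.
move=> H; rewrite coeff_sum; have [wf|wf] := boolP (w \in msupp f).
  have hw : `[< exists m, shf u 0%MM m w >] by apply/asboolP; exists m.
  rewrite big_mkcond (bigD1_seq w) ?msupp_uniq //= hw coeffU (dh_chr H) eqxx mulr1 big1 ?addr0 //.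
  move=> w' ne; case: asboolP => // -[m' hm']; rewrite coeffU (dh_chr hm').
  case: eqP => [e|]; rewrite ?mulr0 //; rewrite e in hm'.
  by rewrite (shf_inj hm' H) eqxx in ne.
rewrite (memN_msupp_eq0 wf) big_seq_cond big1 // => w' /andP [wf' /asboolP [m' hm']].
rewrite coeffU (dh_chr hm'); case: eqP => [e|]; rewrite ?mulr0 //; rewrite e in hm'.
by rewrite (shf_inj hm' H) (negbTE wf) in wf'.
Qed.

Lemma dhX_coef1 u a f m v : shf u a m v -> coeff m (dh u ('X_[a] * f)) = f@_v.
Proof.
move=> H; rewrite (@dh_coef1 _ _ _ (a + v)%MM) ?mcoeffXM ?lem_addr ?addmK //; last first.
  by move=> i; rewrite mnm0E addr0 mnmDE PoszD addrC H.
by rewrite [(a + v)%MM]addmC addmK.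
Qed.

Lemma dhX_coef0 u a f m : (forall v, ~ shf u a m v) -> coeff m (dh u ('X_[a] * f)) = 0.
Proof.
move=> no; have [[w H]|no'] := pselect (exists w, shf u 0%MM m w); last first.
  by rewrite dh_coef0 // => w H; apply: no'; exists w.
rewrite (dh_coef1 _ H) mcoeffXM; case: ifP => // le; case: (no (w - a)%MM) => i.
by have := H i; rewrite mnm0E addr0 => <-; rewrite mnmBE -PoszD subnK //; move/mnm_lepP: le.
Qed.

Lemma dehomP u f g : dehomogenizes b u f g <-> g = dh u f.
Proof.
have H m : coeff m (dh u f) = if [forall i, 0 <= (b^T *m m) i 0 + (u i)%:Z]
    then f@_[multinom absz ((b^T *m m) i 0 + (u i)%:Z)%R | i < n] else 0.
  case: forallP => [ge|no]; [apply: dh_coef1|apply: dh_coef0] => [i|w hw].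
    by rewrite mnmE mnm0E addr0 gez0_abs ?ge // addrC.
  by apply: no => i; have := hw i; rewrite mnm0E addr0 addrC => <-.
split=> [hg|-> m]; last exact: H.
by apply: lext => m; rewrite hg -H.
Qed.

Lemma dh_trans u a u1 a1 c f : (forall i, (a i)%:Z + (u1 i)%:Z = (u i)%:Z + (a1 i)%:Z + pr b c i) ->
  dh u ('X_[a] * f) = translate c (dh u1 ('X_[a1] * f)).
Proof.
move=> H; apply: lext => m; rewrite coeff_translate.
have E v : shf u a m v <-> shf u1 a1 (m - c) v.
  split=> hv i; have := H i; have := hv i; rewrite prD prN; lia.
have [[v hv]|no] := pselect (exists v, shf u a m v).
  by rewrite (dhX_coef1 _ hv) (dhX_coef1 _ (proj1 (E v) hv)).
by rewrite !dhX_coef0 // => v hv; apply: no; exists v => //; apply/E.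
Qed.

Lemma translate0 g : translate 0 g = g.
Proof. by apply: lext => m; rewrite coeff_translate subr0. Qed.

Lemma dh_mulX u w f : dh (u + w) ('X_[w] * f) = dh u f.
Proof.
rewrite -[in RHS](mul1r f) -mpolyX0 (@dh_trans _ _ u 0%MM 0) ?translate0 // => i.
by rewrite mnm0E mnmDE pr0 !addr0 PoszD addrC.
Qed.

Lemma dh_lin u (x : R) f f' : dh u (x *: f + f') = x *: dh u f + dh u f'.
Proof.
apply: lext => m; rewrite coeffD coeffZ.
have [[w H]|no] := pselect (exists w, shf u 0%MM m w).
  by rewrite !(dh_coef1 _ H) mcoeffD mcoeffZ.
by rewrite !dh_coef0 ?mulr0 ?addr0 // => w H; apply: no; exists w.
Qed.

HB.instance Definition _ u := GRing.isLinear.Build R {mpoly R[n]} (laurent R d) *:%R (dh u) (@dh_lin u).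

Lemma dh_inj u f f' : graded_piece A (deg u) f -> graded_piece A (deg u) f' -> dh u f = dh u f' -> f = f'.
Proof.
move=> /graded_pieceP hf /graded_pieceP hf' e; apply/mpolyP => w.
have [/eqP ew|ne] := boolP (deg w == deg u); last by rewrite hf // hf'.
have [|m H] := @deg_shf u 0%MM w; first by rewrite mdeg_zero addr0.
by rewrite -(dh_coef1 f H) e (dh_coef1 f' H).
Qed.

Lemma dh_chart (s : {set 'I_n}) u f : off s u -> chart_ring b s (dh u f).
Proof.
move=> hu m; have [[w H] _ i si|no] := pselect (exists w, shf u 0%MM m w).
  by have := H i; rewrite mnm0E addr0 hu // add0r => e; rewrite -[(_ *m _) i 0]/(pr b m i) -e.
by rewrite dh_coef0 ?eqxx // => w H; apply: no; exists w.
Qed.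

Lemma dual_le (s : {set 'I_n}) m : s \in Delta -> dual_monoid b s m ->
  exists N, forall N', (N <= N')%N -> exists2 w, shf (mu s *+ N') 0%MM m w & deg w = h *+ N'.
Proof.
move=> sD hm; exists (\max_(i < n) absz (pr b m i))%N => N' le.
have ge i : 0 <= ((mu s *+ N')%MM i)%:Z + pr b m i.
  have [si|si] := boolP (i \in s); first by apply: addr_ge0 => //; apply: hm.
  have := leq_trans (leq_bigmax (F := fun i => absz (pr b m i)) i) le; rewrite mulmnE.
  have := mu_gt0 Hmu sD si; move: (mu s i) (pr b m i) => x y; nia.
have H : shf (mu s *+ N') 0%MM m [multinom absz (((mu s *+ N')%MM i)%:Z + pr b m i)%R | i < n].
  by move=> i; rewrite mnmE mnm0E addr0 gez0_abs.
exists [multinom absz (((mu s *+ N')%MM i)%:Z + pr b m i)%R | i < n] => //.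
by have := shf_deg H; rewrite mdeg_zero addr0 mdeg_muln (mu_deg Hmu sD).
Qed.

(** The chart of [s] is the locus where the monomial [mu s] is invertible, so its functions are
    quotients by powers of [mu s]. *)
Lemma dh_surj (s : {set 'I_n}) g : s \in Delta -> chart_ring b s g ->
  exists N, forall N', (N <= N')%N -> exists2 f, graded_piece A (h *+ N') f & g = dh (mu s *+ N') f.
Proof.
move=> sD hg.
have [|m|N hN] := @seq_bound _ (dom g) (fun m N => forall N', (N <= N')%N ->
    exists2 w, shf (mu s *+ N') 0%MM m w & deg w = h *+ N').
- by move=> m N N' le H N'' le'; apply: H; apply: leq_trans le'.
- by rewrite mem_dom => /hg; apply: dual_le.
exists N => N' le.
have H m : exists w, m \in dom g -> shf (mu s *+ N') 0%MM m w /\ deg w = h *+ N'.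
  have [md|_] := boolP (m \in dom g); last by exists 0%MM.
  by have [w h1 h2] := hN m md N' le; exists w.
have [w hw] := choice H.
exists (\sum_(m <- dom g) coeff m g *: 'X_[w m]).
  rewrite big_seq; apply: (sm_sum _ (graded_sm _)) => m md; apply: (smZ _ (graded_sm _)).
  by have [_ <-] := hw m md; apply: gradedX.
rewrite raddf_sum -[LHS]freeg_sumE; apply: eq_big_seq => m md /=; have [hs _] := hw m md.
apply: lext => x; rewrite linearZ coeffZ coeffU; congr (_ * _).
have [[v hv]|no] := pselect (exists v, shf (mu s *+ N') 0%MM x v).
  rewrite (dh_coef1 _ hv) mcoeffX; congr ((_ : bool)%:R); apply/eqP/eqP => e.
    by apply: (shf_inj _ hv); rewrite -e.
  by apply: (shf_inj_m (v := v)) hv; rewrite -e.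
rewrite dh_coef0 => [|v hv]; last by apply: no; exists v.
by case: eqP => // e; case: no; exists (w m); rewrite -e.
Qed.

End Dehomogenize.

Lemma mapL_dh (R R' : comNzRingType) (phi : {rmorphism R -> R'}) u (f : {mpoly R[n]}) :
  mapL phi (dh u f) = dh u (map_mpoly phi f).
Proof.
apply: lext => m; rewrite coeff_mapL.
have [[w H]|no] := pselect (exists w, shf u 0%MM m w).
  by rewrite !(dh_coef1 _ H) mcoeff_map_mpoly.
by rewrite !dh_coef0 ?raddf0 // => w H; apply: no; exists w.
Qed.

Section IdealOfSubscheme.
Variable R : comNzRingType.
Implicit Types (f : {mpoly R[n]}) (Y : chart_ideals R d Delta).

(** Sections of the ideal sheaf twisted by [p]. On each chart the line bundle is trivialized by a
    Laurent monomial $x^u/x^w$, because [p] itself need not be the degree of a monomial invertible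
    there. *)
Definition Ip Y p : set {mpoly R[n]} := [set f | graded_piece A p f /\
  forall (s : chart) u w, off (val s) u -> off (val s) w -> deg u = p + deg w -> Y s (dh u ('X_[w] * f))].

Definition IY Y : set {mpoly R[n]} := [set f | forall p, Ip Y p (component A p f)].

Lemma Ip_graded Y p : Ip Y p `<=` graded_piece A p. Proof. by move=> f []. Qed.

Variable Y : chart_ideals R d Delta.
Hypothesis HY : forall s, is_chart_ideal b (val s) (Y s).
Let Ysm s : is_submodule (Y s). Proof. by case: (HY s). Qed.

(* One presentation of f as a section on a chart suffices: two presentations differ by a character. *)
Lemma chart_indep (s : chart) u w u1 w1 f : off (val s) u1 -> off (val s) w1 -> off (val s) u ->
  deg (u + w1)%MM = deg (u1 + w)%MM -> Y s (dh u1 ('X_[w1] * f)) -> Y s (dh u ('X_[w] * f)).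
Proof.
move=> h1 h2 h3 /esym /(mdeg_eq Hex) [c hc] H.
have cd i : pr b c i = (u1 i)%:Z + (w i)%:Z - (u i)%:Z - (w1 i)%:Z.
  by have := hc i; rewrite !mnmDE; lia.
rewrite (@dh_trans _ _ _ u1 w1 c); last by move=> i; rewrite cd; lia.
case: (HY s) => _ _; apply=> // i si.
by rewrite -[(_ *m _) i 0]/(pr b c i) cd h1 // h2 // h3 //; lia.
Qed.

Lemma Ip_mu p t f : graded_piece A p f -> p = h *+ t ->
  (forall s : chart, Y s (dh (mu (val s) *+ t) f)) -> Ip Y p f.
Proof.
move=> hf ep H; split=> // s u w hu hw e.
apply: (@chart_indep s u w (mu (val s) *+ t)%MM 0%MM) => //.
- by apply: off_muln; apply: (mu_off Hmu); apply: valP.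
- by move=> i _; rewrite mnm0E.
- by rewrite addm0 e mdeg_add mdeg_muln (mu_deg Hmu (valP s)) ep.
by rewrite mpolyX0 mul1r.
Qed.

Lemma Ip_mul p w f : Ip Y p f -> Ip Y (p + deg w) ('X_[w] * f).
Proof.
move=> [gf H]; split; first exact: gradedXM.
move=> s u v hu hv e; rewrite mulrA -mpolyXD.
have [u1 [w1 [h1 h2 e1]]] := off_rep Hfan Hex p (valP s).
apply: (chart_indep h1 h2 hu); last exact: H.
by rewrite !mdeg_add e e1 [LHS](ACl (1*4*(3*2))).
Qed.

Lemma Ip_sm p : is_submodule (Ip Y p).
Proof.
split.
  split; first exact: (sm0 (graded_sm _ _)).
  by move=> s u w _ _ _; rewrite mulr0 raddf0; apply: sm0.
move=> a f f' [gf H] [gf' H']; split.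
  by apply: (smD (graded_sm _ _)) => //; apply: (smZ _ (graded_sm _ _)).
move=> s u w hu hw e; rewrite mulrDr -scalerAr dh_lin.
by apply: (smD (Ysm s)); [apply: (smZ _ (Ysm s)); apply: H|apply: H'].
Qed.

Lemma Ip_sat p f (v : {set 'I_n} -> 'X_{1..n}) : graded_piece A p f ->
  (forall s, s \in Delta -> off s (v s) /\ Ip Y (p + deg (v s)) ('X_[v s] * f)) -> Ip Y p f.
Proof.
move=> gf H; split => // s u w hu hw e; have [h1 [_ h2]] := H _ (valP s).
rewrite -(@dh_mulX _ u (v (val s))) mulrA -mpolyXD [(v _ + w)%MM]addmC mpolyXD -mulrA; apply: h2 => //.
  exact: off_add.
by rewrite mdeg_add e addrAC.
Qed.

Lemma IY_Ip p f : graded_piece A p f -> IY Y f <-> Ip Y p f.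
Proof.
move=> gf; split=> [/(_ p)|H q]; first by rewrite component_id.
have [<-|ne] := eqVneq p q; first by rewrite component_id.
by rewrite (component_ne gf ne); apply: (sm0 (Ip_sm _)).
Qed.

Lemma IY_sm : is_submodule (IY Y).
Proof.
split=> [p|a f f' H H' p].
  by rewrite component_id; [apply: (sm0 (Ip_sm _))|apply: (sm0 (graded_sm _ _))].
by rewrite componentZD; apply: (smD (Ip_sm _)); [apply: (smZ _ (Ip_sm _))|apply: H'].
Qed.

Lemma IY_XM w f : IY Y f -> IY Y ('X_[w] * f).
Proof.
by move=> H p; rewrite -[p](subrK (deg w)) componentXM; apply: Ip_mul.
Qed.

Lemma IY_ideal : is_ideal (IY Y).
Proof.
split; first exact: (sm0 IY_sm).
move=> f x y hx hy; apply: (smD IY_sm) => //; rewrite [f]mpolyE mulr_suml.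
by apply: (sm_sum _ IY_sm) => m _; rewrite -scalerAl; apply: (smZ _ IY_sm); apply: IY_XM.
Qed.

Lemma IY_graded : is_graded A (IY Y).
Proof.
move=> p f H q; have gf := @graded_component R p f; have [<-|ne] := eqVneq p q.
  by rewrite (component_id gf); apply: H.
by rewrite (component_ne gf ne); apply: (sm0 (Ip_sm _)).
Qed.

Definition irr (s : {set 'I_n}) : 'X_{1..n} := [multinom (i \notin s : nat) | i < n].

Lemma irrE s : irrelevant_gen R s = 'X_[irr s].
Proof.
rewrite /irrelevant_gen mpolyXE_id big_mkcond; apply: eq_bigr => i _; rewrite mnmE.
by case: (i \in s).
Qed.

Lemma off_irr s : off s (irr s). Proof. by move=> i si; rewrite mnmE si. Qed.

Lemma IY_saturated : is_saturated Delta (IY Y).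
Proof.
move=> f [N H] p; apply: (@Ip_sat _ _ (fun s => irr s *+ N)%MM); first exact: graded_component.
move=> s sD; split; first by apply: off_muln; apply: off_irr.
rewrite -componentXM; have := H [tuple of nseq N s].
have -> : \prod_(s0 <- [tuple of nseq N s]) irrelevant_gen R s0 = 'X_[(irr s *+ N)%MM].
  by rewrite /= big_nseq iter_mulr_1 irrE mpolyXn.
by apply=> s' /nseqP [->].
Qed.

Hypothesis HYg : forall s t : chart, val t \subset val s -> Y t = smallest (@is_chart_ideal R d n b (val t)) (Y s).

(** Extension of sections: a function in the ideal on one chart, multiplied by a high power of
    [mu s], becomes a global section of the twisted ideal sheaf. As there are finitely many charts,
    one power serves for all. *)
Lemma chart_lift (s : chart) g : Y s g ->
  exists N, forall N', (N <= N')%N -> exists2 f, Ip Y (h *+ N') f & g = dh (mu (val s) *+ N') f.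
Proof.
move=> Yg; have sub : Y s `<=` chart_ring b (val s) by case: (HY s).
have [N hN] := dh_surj (valP s) (sub _ Yg); have [f gf eg] := hN N (leqnn _).
have muX (s' : chart) : exists c, forall i, pr b c i = (mu (val s) i)%:Z - (mu (val s') i)%:Z.
  have /(mdeg_eq Hex) [c hc] : deg (mu (val s)) = deg (mu (val s')).
    by rewrite (mu_deg Hmu (valP s)) (mu_deg Hmu (valP s')).
  by exists c => i; rewrite hc; lia.
(* [c s'] is the character $\mu_s/\mu_{s'}$, regular on the chart of [s'] and invertible on the
   intersection with that of [s]. *)
have [c hc] := choice muX.
have prc (s' : chart) k i : pr b (c s' *+ k) i = ((mu (val s) i)%:Z - (mu (val s') i)%:Z) * k%:Z.
  by elim: k => [|k IH]; rewrite ?mulr0n ?pr0 ?mulr0 // mulrS prD IH hc; lia.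
have cs' (s' : chart) k : dual_monoid b (val s') (c s' *+ k).
  move=> i si; rewrite -[(_ *m _) i 0]/(pr b _ i) prc.
  by rewrite (mu_off Hmu (valP s') si) subr0 mulr_ge0.
have tr m m' (g' : laurent R d) : translate m (translate m' g') = translate (m + m') g'.
  by apply: lext => x; rewrite !coeff_translate; congr coeff; rewrite opprD addrA.
have M (s' : chart) : exists M, forall M', (M <= M')%N ->
    Y s' (translate (c s' *+ M') (dh (mu (val s') *+ N) f)).
  have tD : (val s :&: val s')%SET \in Delta by apply: (fan_face Hfan (valP s)); apply: finset.subsetIl.
  pose t : chart := exist (fun s : {set 'I_n} => s \in Delta) _ tD.
  have Yt : Y t (dh (mu (val s') *+ N) f).
    rewrite -[f]mul1r -mpolyX0 (@dh_trans _ _ _ (mu (val s) *+ N)%MM 0%MM (c s' *+ N)); last first.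
      by move=> i; rewrite mnm0E add0r addr0 prc !mulmnE !PoszM mulrBl addrC subrK.
    case: (HY t) => _ _; apply.
      move=> i /setIP [si s'i]; rewrite -[(_ *m _) i 0]/(pr b _ i) prc.
      by rewrite (mu_off Hmu (valP s) si) (mu_off Hmu (valP s') s'i) subrr mul0r.
    rewrite mpolyX0 mul1r -eg (HYg (s := s)) ?finset.subsetIl // => Z [_]; exact.
  move: Yt; rewrite (HYg (s := s')) ?finset.subsetIr //.
  (* The functions on the intersection that enter the ideal of [s'] after multiplication by high
     powers of [c s']. They form an ideal containing [Y s'], hence the ideal of the intersection. *)
  pose Z := [set g' | chart_ring b (val t) g' /\ exists M, forall M', (M <= M')%N ->
    Y s' (translate (c s' *+ M') g')].
  have H : is_chart_ideal b (val t) Z.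
    split; first by move=> g' [].
      split.
        split; first by move=> m; rewrite coeff0 eqxx.
        exists 0%N => M' _; rewrite (_ : translate _ 0 = 0); first exact: sm0.
        by apply: lext => m; rewrite coeff_translate !coeff0.
      move=> x g1 g2 [h1 [M1 H1]] [h2 [M2 H2]]; split.
        move=> m; apply: contra_neqP => no; rewrite coeffD coeffZ.
        have e g' : chart_ring b (val t) g' -> coeff m g' = 0.
          by move=> h'; apply/eqP; apply: contra_notT no => /h'.
        by rewrite !e // mulr0 addr0.
      exists (maxn M1 M2) => M'; rewrite geq_max => /andP [l1 l2].
      rewrite (_ : translate _ _ = x *: translate (c s' *+ M') g1 + translate (c s' *+ M') g2).
        by apply: (smD (Ysm s')); [apply: (smZ _ (Ysm s')); apply: H1|apply: H2].
      by apply: lext => m; rewrite coeffD coeffZ !coeff_translate coeffD coeffZ.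
    move=> m g' hm [h1 [M1 H1]]; split.
      move=> x; rewrite coeff_translate => /h1 h2 i ti; have := h2 i ti; have := hm i ti.
      rewrite -![(_ *m _) i 0]/(pr b _ i) prD prN; lia.
    exists (M1 + \max_(i < n) absz (pr b m i))%N => M' le.
    rewrite tr -(subnKC (leq_trans (leq_addr _ _) le)) mulrnDr -addrA addrC -tr.
    set M0 := (M' - M1)%N; have leM0 : (\max_(i < n) absz (pr b m i) <= M0)%N by rewrite /M0; lia.
    have := H1 M1 (leqnn _); move: (translate _ g') => g1 Yg1.
    case: (HY s') => _ _; apply=> // i si.
    rewrite -[(_ *m _) i 0]/(pr b _ i) prD addrC prc (mu_off Hmu (valP s') si) subr0.
    have := leq_trans (leq_bigmax (F := fun i => absz (pr b m i)) i) leM0.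
    have [ssi|ssi] := boolP (i \in val s).
      move=> _; apply: addr_ge0; last by rewrite mulr_ge0.
      by apply: hm; rewrite /= finset.inE ssi si.
    have := mu_gt0 Hmu (valP s) ssi; move: (mu (val s) i) (pr b m i) => x y; nia.
  move=> /(_ Z); case=> //; split => // g' Yg'; split.
    case: (HY s') => /(_ _ Yg') h1 _ _ m /h1 h2 i; rewrite finset.inE => /andP [_]; exact: h2.
  by exists 0%N => M' _; case: (HY s') => _ _; apply.
have [M0 hM0] := @finite_bound chart (fun s' M => forall M', (M <= M')%N ->
    Y s' (translate (c s' *+ M') (dh (mu (val s') *+ N) f)))
  (fun s' N N' le H M' le' => H M' (leq_trans le le')) M.
exists (N + M0)%N => N' le; have le1 : (N <= N')%N := leq_trans (leq_addr _ _) le.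
exists ('X_[(mu (val s) *+ (N' - N))%MM] * f).
  apply: Ip_mu => [|//|s'].
    have := (@gradedXM _ _ (mu (val s) *+ (N' - N))%MM _ gf).
    by rewrite mdeg_muln (mu_deg Hmu (valP s)) -mulrnDr subnKC.
  rewrite (@dh_trans _ _ _ (mu (val s') *+ N)%MM 0%MM (c s' *+ (N' - N))).
    by rewrite mpolyX0 mul1r; apply: hM0; lia.
  by move=> i; rewrite mnm0E addr0 prc !mulmnE !PoszM; move: (mu _ i) (mu _ i) => x y; nia.
rewrite eg -(@dh_mulX _ _ (mu (val s) *+ (N' - N))%MM); congr dh.
by apply/mnmP => i; rewrite mnmDE !mulmnE -mulnDr subnKC.
Qed.

Lemma IY_charts s : Y s = chart_of_ideal b A (IY Y) (val s).
Proof.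
apply/seteqP; split=> [g Yg|g [u [f [hu If gf /dehomP ->]]]].
  have [N /(_ N (leqnn _)) [f If eg]] := chart_lift Yg; exists (mu (val s) *+ N)%MM, f.
  have dmu : deg (mu (val s) *+ N)%MM = h *+ N by rewrite mdeg_muln (mu_deg Hmu (valP s)).
  split; [|by apply/(IY_Ip (Ip_graded If))|by rewrite dmu; apply: Ip_graded If|exact/dehomP].
  by apply: off_muln; apply: (mu_off Hmu (valP s)).
have [_ /(_ s u 0%MM hu)] := proj1 (IY_Ip gf) If; rewrite mpolyX0 mul1r; apply.
  by move=> i _; rewrite mnm0E.
by rewrite mdeg_zero addr0.
Qed.

Lemma IY_ideal_of : is_saturated_ideal_of b A Y (IY Y).
Proof. by split; [exact: IY_ideal|exact: IY_graded|exact: IY_saturated|exact: IY_charts]. Qed.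

End IdealOfSubscheme.

Lemma saturated_pow (R : comNzRingType) (I : set {mpoly R[n]}) f : is_ideal I -> is_saturated Delta I ->
  (forall s, s \in Delta -> exists v, off s v /\ I ('X_[v] * f)) -> I f.
Proof.
move=> HI sat H; apply: sat.
have [N hN] : exists N, forall s, s \in Delta -> I ('X_[(irr s *+ N)%MM] * f).
  have [|s|N hN] := @finite_bound {set 'I_n} (fun s N => s \in Delta -> forall N', (N <= N')%N ->
      I ('X_[(irr s *+ N')%MM] * f)).
  - by move=> s N N' le h1 sD N'' le'; apply: h1 => //; apply: leq_trans le'.
  - have [sD|_] := boolP (s \in Delta); last by exists 0%N.
    have [v [hv Iv]] := H s sD; exists (\max_(i < n) v i)%N => _ N' le.
    have lv : (v <= irr s *+ N')%MM.
      apply/mnm_lepP => i; rewrite mulmnE mnmE; have [si|si] /= := boolP (i \in s); first by rewrite hv.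
      by rewrite mul1n; apply: leq_trans le; apply: (leq_bigmax (F := fun i => v i)).
    by rewrite -(submK lv) mpolyXD -mulrA; apply: idM.
  by exists N => s sD; apply: hN.
(* With more than [N] factors for each subset, every tuple repeats some cone at least [N] times. *)
exists (\sum_(s : {set 'I_n}) N)%N.+1 => t ht.
have [s sD le] : exists2 s, s \in Delta & (N <= count_mem s t)%N.
  apply: contrapT => no; have : (size t <= \sum_(s : {set 'I_n}) N)%N.
    have -> : size t = (\sum_(s : {set 'I_n}) count_mem s t)%N.
      have : all predT t by apply/allP.
      elim: (tval t) => [|x t' IH] //=; first by rewrite big1.
      by rewrite big_split /= => /IH <-; rewrite (bigD1 x) //= eqxx big1 // => y /negbTE; rewrite eq_sym => ->.
    apply: leq_sum => s _; rewrite leqNgt; apply/negP => lt; apply: no; exists s; last exact: ltnW.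
    by apply: ht; rewrite -has_pred1 has_count; apply: leq_ltn_trans lt.
  by rewrite size_tuple ltnn.
have H2 (t' : seq {set 'I_n}) k : (k <= count_mem s t')%N -> exists p, \prod_(s' <- t') irrelevant_gen R s' = p * 'X_[(irr s *+ k)%MM].
  elim: t' k => [|x t' IH] k /=; first by rewrite leqn0 => /eqP ->; exists 1; rewrite big_nil mulm0n mpolyX0 mul1r.
  rewrite big_cons; case: eqP => [->|_] /=; last by move=> /IH [p ->]; exists (irrelevant_gen R x * p); rewrite mulrA.
  case: k => [|k] lek; first by have [p ->] := IH 0%N isT; exists (irrelevant_gen R s * p); rewrite mulrA.
  by have [p ->] := IH k lek; exists p; rewrite irrE mulrCA -mpolyXD mulmS.
have [p ->] := H2 t N le; rewrite -mulrA; apply: idM => //.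
exact: hN.
Qed.

(** Equality of functions on a chart, with denominators cleared, is an identity $x^{w+u'} f = x^u
    f'$ with $f'$ in [I]; saturation then removes the monomials. *)
Lemma saturated_ideal_uniq (R : comNzRingType) (Y : chart_ideals R d Delta) I :
  is_saturated_ideal_of b A Y I -> (forall s, is_chart_ideal b (val s) (Y s)) -> I = IY Y.
Proof.
move=> [HI gI sI cI] HY; apply/seteqP; split=> f.
  move=> If p; split; first exact: graded_component.
  move=> s u w hu hw e; rewrite cI; exists u, ('X_[w] * component A p f); split => //.
  - by apply: (idM _ HI); apply: gI.
  - by rewrite e; apply: gradedXM; apply: graded_component.
  exact/dehomP.
move=> H; rewrite [f]component_sum; apply: (id_sum _ HI) => p _.
apply: saturated_pow => // s sD; pose s' : chart := exist (fun s : {set 'I_n} => s \in Delta) _ sD.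
have [u [w [hu hw e]]] := off_rep Hfan Hex p sD.
have [gf /(_ s' u w hu hw e)] := H p; rewrite cI => -[u' [f' [hu' If' gf' /dehomP e2]]].
exists (w + u')%MM; split; first exact: off_add.
suff -> : 'X_[(w + u')%MM] * component A p f = 'X_[u] * f' by apply: (idM _ HI).
apply: (@dh_inj _ (u + u')%MM).
- by rewrite mdeg_add e -addrA -mdeg_add; apply: gradedXM; apply: graded_component.
- by rewrite mdeg_add addrC; apply: gradedXM.
rewrite [in RHS]addmC dh_mulX -e2 [(w + u')%MM]addmC mpolyXD -mulrA dh_mulX.
by [].
Qed.

End Charts.

(** * Hilbert functions *)

Section HilbertFunctions.
Variables (RR : realType) (d n r : nat) (b : 'M[int]_(d, n)) (Delta : {set {set 'I_n}}).
Variable (A : 'M[int]_(r, n)).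
Hypotheses (Hfan : smooth_projective_fan RR b Delta) (Hex : short_exact b A).
Variables (h : 'cV[int]_r) (mu : {set 'I_n} -> 'X_{1..n}).
Local Notation deg := (mdegree A).
Hypothesis Hmu : forall s, s \in Delta -> deg (mu s) = h /\ forall i, (mu s i == 0%N) = (i \in s).
Variable mon : 'cV[int]_r -> seq 'X_{1..n}.
Hypotheses (mon_uniq : forall p, uniq (mon p)) (monE : forall p u, (u \in mon p) = (deg u == p)).
Local Notation K := (nef_monoid A Delta).
Implicit Types (f g : 'cV[int]_r -> rat) (M : set 'X_{1..n}).

Lemma graded_inS (R : comNzRingType) p : @graded_piece R n r A p = inS (mon p).
Proof.
by apply/seteqP; split=> f H m /H; rewrite monE inE.
Qed.

Variable KS : seq 'cV[int]_r.
Hypothesis KS_nef : forall k, k \in KS -> K k.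

(** Vanishing on the nef degrees beyond some multiple of the ample one. *)
Definition deepz f := exists c, forall t, K (t - h *+ c) -> f t = 0.

(** All [e]-fold differences in directions of [KS] vanish deep in the nef cone. Polynomials satisfy
    this for some [e], and it is the only feature of Hilbert functions used to identify them. *)
Fixpoint dvan e f := if e is e'.+1 then forall k, k \in KS -> dvan e' (fun t => f (t + k) - f t) else deepz f.

Lemma deep_le t c c' : (c <= c')%N -> K (t - h *+ c') -> K (t - h *+ c).
Proof.
move=> le H; rewrite (_ : t - h *+ c = (t - h *+ c') + h *+ (c' - c)).
  by apply: nefD => //; apply: nefMn; apply: nef_h Hmu.
by rewrite mulrnBr // addrA subrK.
Qed.

Lemma dvan_zero e : dvan e (fun=> 0).
Proof.
elim: e => [|e IH]; first by exists 0%N.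
by move=> k _ /=; rewrite (_ : (fun _ => _) = fun=> 0) //; apply: funext => t; rewrite subrr.
Qed.

Lemma dvanD e f g : dvan e f -> dvan e g -> dvan e (fun t => f t + g t).
Proof.
elim: e f g => [|e IH] f g /=.
  move=> [c hc] [c' hc']; exists (maxn c c') => t H.
  by rewrite hc ?hc' ?addr0 //; apply: deep_le H; rewrite ?leq_maxl ?leq_maxr.
move=> hf hg k kS; have := IH _ _ (hf k kS) (hg k kS); congr dvan.
by apply: funext => t; rewrite opprD addrACA.
Qed.

Lemma dvan_shift e f p : dvan e f -> dvan e (fun t => f (t + p)).
Proof.
elim: e f => [|e IH] f /=.
  move=> [c hc]; have [N hN] := nef_deep Hfan Hex Hmu p; exists (c + N)%N => t H; apply: hc.
  rewrite (_ : t + p - h *+ c = (t - h *+ (c + N)) + (p + h *+ N)).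
    by apply: nefD => //; apply: hN.
  by rewrite mulrnDr opprD [RHS]addrACA subrK.
move=> hf k kS; have := IH _ (hf k kS); congr dvan; apply: funext => t.
by rewrite [t + k + p]addrAC.
Qed.

Lemma dvan_mulc e f c : dvan e f -> dvan e (fun t => c * f t).
Proof.
elim: e f => [|e IH] f /=; first by move=> [N hN]; exists N => t /hN ->; rewrite mulr0.
by move=> hf k kS; have := IH _ (hf k kS); congr dvan; apply: funext => t; rewrite mulrBr.
Qed.

Lemma dvanB e f g : dvan e f -> dvan e g -> dvan e (fun t => f t - g t).
Proof.
move=> hf hg; have := dvanD hf (dvan_mulc (-1) hg); congr dvan.
by apply: funext => t; rewrite mulN1r.
Qed.

Lemma dvanS e f : dvan e f -> dvan e.+1 f.
Proof. by move=> hf k kS /=; apply: dvanB => //; apply: dvan_shift. Qed.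

Lemma dvan_le e e' f : (e <= e')%N -> dvan e f -> dvan e' f.
Proof. by move=> /subnK <- hf; elim: (_ - _)%N => [|k IH] //; rewrite addSn; apply: dvanS. Qed.

Lemma dvanM e e' f g : dvan e f -> dvan e' g -> dvan (e + e') (fun t => f t * g t).
Proof.
have [N le] := ubnP (e + e')%N; elim: N => // N IH in e e' f g le *.
case: e le => [|e] le.
  by move=> [c hc] _; apply: (dvan_le (e := 0)) => //; exists c => t /hc ->; rewrite mul0r.
case: e' le => [|e'] le.
  by move=> _ [c hc]; apply: (dvan_le (e := 0)) => //; exists c => t /hc ->; rewrite mulr0.
move=> hf hg k kS /=.
have h1 := IH e e'.+1 _ _ _ (hf k kS) (dvan_shift k hg).
have h2 := IH e.+1 e' _ _ _ hf (hg k kS).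
have h3 : dvan (e + e'.+1) (fun t => f t * (g (t + k) - g t)) by rewrite addnS -addSn; apply: h2; lia.
have := dvanD (h1 ltac:(lia)) h3; congr dvan; apply: funext => t.
by rewrite mulrBl mulrBr addrA subrK.
Qed.

Lemma dvan_sum (I : eqType) (s : seq I) (F : I -> 'cV[int]_r -> rat) :
  (forall i, i \in s -> exists e, dvan e (F i)) -> exists e, dvan e (fun t => \sum_(i <- s) F i t).
Proof.
elim: s => [|i s IH] H; first by exists 0%N, 0%N => t _; rewrite big_nil.
have [e he] := H i (mem_head _ _); have [|e' he'] := IH; first by move=> j js; apply: H; rewrite inE js orbT.
exists (e + e')%N; rewrite (_ : (fun t => _) = fun t => F i t + \sum_(j <- s) F j t).
  by apply: dvanD; [apply: dvan_le he|apply: dvan_le he']; rewrite ?leq_addr ?leq_addl.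
by apply: funext => t; rewrite big_cons.
Qed.

Lemma dvan_const c : dvan 1 (fun=> c).
Proof. by move=> k _; exists 0%N => t _; rewrite subrr. Qed.

Lemma dvan_eval (P : {mpoly rat[r]}) : exists e, dvan e (eval_at P).
Proof.
have := @dvan_sum _ (msupp P) (fun m t => P@_m * \prod_i (t i 0)%:~R ^+ m i) _.
case=> [m _|e he]; last by exists e; move: he; congr dvan; apply: funext => t; rewrite /eval_at mevalE.
have H (s : seq 'I_r) : exists e, dvan e (fun t => \prod_(i <- s) (t i 0)%:~R ^+ m i).
  elim: s => [|i s [e he]].
    exists 1%N; rewrite (_ : (fun _ => _) = fun=> 1); first exact: dvan_const.
    by apply: funext => t; rewrite big_nil.
  have [e' he'] : exists e', dvan e' (fun t => (t i 0)%:~R ^+ m i).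
    elim: (m i) => [|k [e' he']]; first by exists 1%N; apply: dvan_const.
    have hi : dvan 2 (fun t : 'cV_r => (t i 0)%:~R).
      move=> k1 _; rewrite (_ : (fun _ => _) = fun=> (k1 i 0)%:~R); first exact: dvan_const.
      by apply: funext => t; rewrite mxE intrD addrAC subrr add0r.
    by exists (2 + e')%N; have := dvanM hi he'; congr dvan; apply: funext => t; rewrite exprS.
  by exists (e' + e)%N; have := dvanM he' he; congr dvan; apply: funext => t; rewrite big_cons.
have [e he] := H (index_enum 'I_r); exists e; exact: dvan_mulc.
Qed.

Local Notation HC := (cnt mon).

(** Dimension count for multiplication by $x_i$ on the quotient by [M]: its kernel and cokernel are
    governed by the colon ideal $M : x_i$ and by $M + (x_i)$. *)
Lemma cnt_split t i M : HC (t + deg U_(i)) M =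
  (HC t [set u | M (u + U_(i))%MM] + HC (t + deg U_(i))%R [set u | M u \/ (0 < u i)%N])%N.
Proof.
rewrite /cnt; pose a (u : 'X_{1..n}) := (0 < u i)%N.
have spl (p : pred 'X_{1..n}) s : count p s = (count p (filter a s) + count (fun u => p u && ~~ a u) s)%N.
  elim: s => //= u s ->; case: (a u) => /=; rewrite ?andbF ?andbT; lia.
rewrite spl; congr (_ + _)%N; last first.
  apply: eq_count => u; rewrite -negb_or; congr negb; apply/orP/asboolP => [[/asboolP h1|h1]|[h1|h1]].
  - by left.
  - by right.
  - by left; apply/asboolP.
  - by right.
have pe : perm_eq (filter a (mon (t + deg U_(i)))) [seq (u + U_(i))%MM | u <- mon t].
  apply: uniq_perm; first by rewrite filter_uniq.
    by rewrite map_inj_uniq // => u u' /(congr1 (fun m => m - U_(i))%MM); rewrite !addmK.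
  move=> u; rewrite mem_filter monE; apply/andP/mapP => [[au /eqP e]|[u' + ->]].
    have le : (U_(i) <= u)%MM.
      by apply/mnm_lepP => j; rewrite mnm1E; case: eqP => [<-|].
    by exists (u - U_(i))%MM; rewrite ?submK // monE mdeg_sub // e addrK.
  by rewrite monE => /eqP <-; rewrite mdeg_add eqxx /a mnmDE mnm1E eqxx addn1.
rewrite (permP pe) count_map; apply: eq_count => u /=.
by congr (~~ _); apply/asboolP/asboolP.
Qed.

Lemma cnt_ext t M M' : (forall u, M u <-> M' u) -> HC t M = HC t M'.
Proof. by move=> H; apply: eq_count => u; congr (~~ _); apply/asboolP/asboolP => /H. Qed.

Definition van (s : {set 'I_n}) : set 'X_{1..n} := [set u | exists2 i, i \in s & (0 < u i)%N].

Definition cq M t : rat := (HC t M)%:R.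

(** Deep nef degrees are ample, so [zero_set] applies to them with multiple one: a standard monomial
    would have a zero set that is a cone containing [s]. *)
Lemma van_nonface s : s \notin Delta -> dvan 0 (cq (van s)).
Proof.
move=> sD; exists 1%N => t Kt; rewrite /cq /cnt (eqP (_ : count _ _ == 0%N)) //.
rewrite -leqn0 leqNgt -has_count; apply/hasP => -[u]; rewrite monE => /eqP eu /asboolP nu.
have Hnu s' : exists v, s' \in Delta -> deg v = t /\ forall i, (v i == 0%N) = (i \in s').
  have [s'D|_] := boolP (s' \in Delta); last by exists 0%MM.
  have [v hv ev] := proj1 (nef_off _ _ _) Kt s' s'D; exists (mu s' + v)%MM => _; split.
    by rewrite mdeg_add ev (mu_deg Hmu s'D) mulr1n addrC subrK.
  move=> i; rewrite mnmDE addn_eq0; have [_ ->] := Hmu s'D.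
  by case: (boolP (i \in s')) => // /hv ->.
have [nu' hnu] := choice Hnu.
have := @zero_set _ _ _ _ _ _ _ Hfan Hex t nu' hnu 1 u isT; rewrite mulr1n => /(_ eu) zD.
move/negP: sD; apply; apply: (fan_face Hfan zD); apply/fintype.subsetP => i si; rewrite finset.inE.
by rewrite eqn0Ngt; apply/negP => gt; apply: nu; exists i.
Qed.

(** Each direction in [KS] is the degree of a monomial in variables outside [s], which are
    nonzerodivisors modulo the prime. Multiplying by one variable $x_i$ at a time changes the count
    by that of the larger prime [van (i |: s)]. *)
Lemma dvan_van (s : {set 'I_n}) : dvan (n - #|s|).+1 (cq (van s)).
Proof.
have [N le] := ubnP (n - #|s|)%N; elim: N => // N IH in s le *.
have [sD|sD] := boolP (s \in Delta); last by apply: (dvan_le (e := 0)) => //; apply: van_nonface.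
move=> k kS; have [u hu <-] := proj1 (nef_off _ _ _) (KS_nef kS) s sD.
have H w : off s w -> dvan (n - #|s|) (fun t => cq (van s) (t + deg w) - cq (van s) t).
  have [N' le'] := ubnP (mdeg w); elim: N' => // N' IH' in w le' *; move=> hw.
  have [/eqP w0|] := boolP (w == 0%MM).
    rewrite w0 mdeg_zero (_ : (fun t => _) = fun=> 0); first exact: dvan_zero.
    by apply: funext => t; rewrite addr0 subrr.
  move=> wn; have [i wi] : exists i, (0 < w i)%N.
    apply: contrapT => no; move/negP: wn; apply; apply/eqP/mnmP => i; rewrite mnm0E.
    by apply/eqP; rewrite eqn0Ngt; apply/negP => gt; apply: no; exists i.
  have is' : i \notin s by apply/negP => /hw e; rewrite e in wi.
  have lw : (U_(i) <= w)%MM by apply/mnm_lepP => j; rewrite mnm1E; case: eqP => [<-|].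
  pose w' := (w - U_(i))%MM; have ew : w = (w' + U_(i))%MM by rewrite submK.
  have hw' : dvan (n - #|s|) (fun t => cq (van s) (t + deg w') - cq (van s) t).
    by apply: IH' => [|j js]; [rewrite -ltnS; apply: leq_trans le'; rewrite ltnS ew mdegD mdeg1 addn1|rewrite mnmBE hw].
  have hs : dvan (n - #|s|) (cq (van (i |: s)%SET)).
    have c1 : #|i |: s|%SET = #|s|.+1 by rewrite cardsU1 is'.
    have c2 : (#|i |: s|%SET <= n)%N by rewrite -[X in (_ <= X)%N]card_ord max_card.
    have := IH (i |: s)%SET; rewrite c1 in c2 *; rewrite (_ : (n - #|s|.+1).+1 = n - #|s|)%N; last by lia.
    by apply; lia.
  have := dvanD (dvan_shift (deg w) hs) hw'; congr dvan; apply: funext => t.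
  have e := @cnt_split (t + deg w') i (van s).
  rewrite (@cnt_ext _ [set u | van s (u + U_(i))%MM] (van s)) in e; last first.
    move=> v; split=> -[j js hj]; exists j => //; move: hj; rewrite mnmDE mnm1E; last by lia.
    by case: eqP js is' => [-> ->|]; rewrite ?addn0.
  rewrite (@cnt_ext _ [set u | van s u \/ (0 < u i)%N] (van (i |: s)%SET)) in e; last first.
    move=> v; split=> [[[j js hj]|hi]|[j]].
    - by exists j => //; rewrite finset.inE js orbT.
    - by exists i => //; rewrite finset.inE finset.in_set1 eqxx.
    - by rewrite finset.inE finset.in_set1 => /orP [/eqP ->|js] hj; [right|left; exists j].
  by rewrite ew mdeg_add [t + (_ + _)]addrA /cq e natrD; ring.
exact: H.
Qed.

(** If some variable outside [M] is a zerodivisor modulo [M], then $M : x_i$ and $M + (x_i)$ are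
    strictly larger and [cnt_split] applies. Otherwise [M] is the unit ideal or generated by
    variables. *)
Lemma dvan_cnt M : upc M -> dvan n.+1 (cq M).
Proof.
move: M; apply: noeth_ind => M up IH.
have [[i [ni [u [Mu nu]]]]|no] := pselect (exists i, ~ M U_(i)%MM /\ exists u, M (u + U_(i))%MM /\ ~ M u).
  pose M1 := [set u | M (u + U_(i))%MM]; pose M2 := [set u | M u \/ (0 < u i)%N].
  have up1 : upc M1 by move=> m m' /mnm_lepP le; apply: up; apply/mnm_lepP => j; rewrite !mnmDE leq_add2r.
  have up2 : upc M2.
    move=> m m' le [h1|h1]; first by left; apply: up h1.
    by right; apply: leq_trans h1 _; move/mnm_lepP: le.
  have h1 : dvan n.+1 (cq M1).
    apply: IH => // [v Mv|sub]; last by apply: nu; apply: sub.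
    by apply: up Mv; apply: lem_addr.
  have h2 : dvan n.+1 (cq M2).
    apply: IH => // [v Mv|sub]; first by left.
    by apply: ni; apply: sub; right; rewrite mnm1E eqxx.
  have := dvanD (dvan_shift (- deg U_(i)) h1) h2; congr dvan; apply: funext => t.
  by rewrite -[in RHS](subrK (deg U_(i)) t) /cq cnt_split natrD subrK.
have [M0|n0] := pselect (M 0%MM).
  rewrite (_ : cq M = fun=> 0); first exact: dvan_zero.
  apply: funext => t; rewrite /cq (_ : HC t M = 0%N) //; apply/eqP; rewrite -leqn0 leqNgt -has_count.
  by apply/hasP => -[u _ /asboolP]; apply; apply: up M0; apply/mnm_lepP => i; rewrite mnm0E.
pose s := [set i | `[< M U_(i)%MM >]]%SET.
have E u : M u <-> van s u.
  split=> [|[i]]; last first.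
    rewrite finset.inE => /asboolP Mi ui; apply: up Mi.
    by apply/mnm_lepP => j; rewrite mnm1E; case: eqP => [<-|].
  have [N le] := ubnP (mdeg u); elim: N => // N IHN in u le *; move=> Mu.
  apply: contrapT => nv.
  have [i ui] : exists i, (0 < u i)%N.
    apply: contrapT => no'; apply: n0; rewrite (_ : 0%MM = u) //; apply/mnmP => i; rewrite mnm0E.
    by apply/esym/eqP; rewrite eqn0Ngt; apply/negP => gt; apply: no'; exists i.
  have ni : ~ M U_(i)%MM by move=> Mi; apply: nv; exists i => //; rewrite finset.inE; apply/asboolP.
  have lw : (U_(i) <= u)%MM by apply/mnm_lepP => j; rewrite mnm1E; case: eqP => [<-|].
  have Mu' : M (u - U_(i))%MM.
    apply: contrapT => nM; apply: no; exists i; split => //; exists (u - U_(i))%MM; split => //.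
    by rewrite submK.
  have [|j js hj] := IHN (u - U_(i))%MM _ Mu'.
    by rewrite -ltnS; apply: leq_trans le; rewrite ltnS -{2}(submK lw) mdegD mdeg1 addn1.
  by apply: nv; exists j => //; move: hj; rewrite mnmBE; lia.
rewrite (_ : cq M = cq (van s)); last by apply: funext => t; rewrite /cq (cnt_ext _ E).
by apply: dvan_le (dvan_van s); rewrite ltnS leq_subr.
Qed.

Hypothesis KS_gen : forall p, exists l l' : seq 'cV[int]_r,
  [/\ {subset l <= KS}, {subset l' <= KS} & p + \sum_(k <- l) k = \sum_(k <- l') k].

(** Sums of fewer than [e] elements of [KS]: enough starting points to detect a function whose
    [e]-fold differences vanish. *)
Fixpoint grid e : seq 'cV[int]_r :=
  if e is e'.+1 then 0 :: [seq x + k | x <- grid e', k <- KS] else [::].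

Lemma grid_add e x k : x \in grid e -> k \in KS -> x + k \in grid e.+1.
Proof. by move=> xe kS; rewrite /= inE; apply/orP; right; apply/allpairsP; exists (x, k). Qed.

Lemma gridP e x : x \in grid e.+1 -> x = 0 \/ exists y k, [/\ y \in grid e, k \in KS & x = y + k].
Proof.
rewrite /= inE => /orP [/eqP ->|/allpairsP [[y k] /= [ye kS ->]]]; first by left.
by right; exists y, k.
Qed.

Lemma grid_sub e : {subset grid e <= grid e.+1}.
Proof.
elim: e => // e IH x /gridP [->|[y [k [ye kS ->]]]]; first exact: mem_head.
by apply: grid_add => //; apply: IH.
Qed.

(** By induction the first differences vanish deep in the cone, so there the function is invariant
    under [KS]. By [KS_gen] it equals its values on the ray through zero, which vanish. *)
Lemma dvan_grid e f t1 : dvan e f ->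
  (forall x t, x \in grid e -> (t1 <= t)%N -> f (x + h *+ t) = 0) -> deepz f.
Proof.
elim: e f => [|e IH] f; first by [].
move=> hf H.
have Hk k : k \in KS -> deepz (fun t => f (t + k) - f t).
  move=> kS; apply: IH; first exact: hf.
  move=> x t xe le; rewrite [x + _ + k]addrAC !H ?subrr //; last exact: grid_sub.
  exact: grid_add.
have [c hc] : exists c, forall k, k \in KS -> forall t, K (t - h *+ c) -> f (t + k) - f t = 0.
  apply: (@seq_bound _ KS (fun k c => forall t, K (t - h *+ c) -> f (t + k) - f t = 0)).
    by move=> k c c' le Hc t Ht; apply: Hc; apply: deep_le Ht.
  by move=> k /Hk.
have inv l t : {subset l <= KS} -> K (t - h *+ c) -> f (t + \sum_(k <- l) k) = f t.
  elim: l t => [|k l IHl] t lS Kt; first by rewrite big_nil addr0.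
  have kS : k \in KS by apply: lS; rewrite mem_head.
  rewrite big_cons addrA IHl; first by apply/eqP; rewrite -subr_eq0 hc.
    by move=> x xl; apply: lS; rewrite inE xl orbT.
  by rewrite addrAC; apply: nefD => //; apply: KS_nef.
exists c => t Kt; pose t2 := maxn c t1.
have [l [l' [lS l'S e']]] := KS_gen (t - h *+ t2).
rewrite -(inv l) // -[t in LHS](subrK (h *+ t2)) addrAC e' addrC inv //.
  by rewrite -[h *+ t2]add0r H ?leq_maxr // mem_head.
apply: (@deep_le _ _ t2); first exact: leq_maxl.
by rewrite subrr; apply: nef0.
Qed.

(** The leading monomials in all degrees form a monomial ideal with the same Hilbert function, to
    which [dvan_cnt] applies. *)
Lemma hilbert_poly_grid e (P : {mpoly rat[r]}) (F : fieldType) (I : set {mpoly F[n]}) t1 :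
  dvan e (eval_at P) -> (n < e)%N ->
  is_submodule I -> (forall (w : 'X_{1..n}) (f : {mpoly F[n]}), I f -> I ('X_[w] * f)) ->
  (forall x t, x \in grid e -> (t1 <= t)%N -> exists2 q : nat,
     has_dim (@graded_piece F n r A (x + h *+ t)) I q & eval_at P (x + h *+ t) = q%:R) ->
  is_hilbert_poly A Delta I P.
Proof.
move=> hP ne HI IM H.
pose M := [set m | leads I (mon (deg m)) m].
have upM : upc M.
  move=> m m' le [f [If fS f0 lf]]; exists ('X_[(m' - m)%MM] * f); split.
  - exact: IM.
  - apply: inS_XM fS => w; rewrite !monE mdeg_add => /eqP ->.
    by rewrite -mdeg_add submK.
  - by rewrite mulf_eq0 negb_or mpolyX_neq0 f0.
  - by rewrite mlead_XM // lf submK.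
have dim t : has_dim (@graded_piece F n r A t) I (HC t M).
  rewrite graded_inS; have := initial_basis (mon_uniq t) HI; congr has_dim.
  apply: eq_in_count => m; rewrite monE => /eqP em; congr (~~ _).
  by rewrite /M /= em.
have [|x t xe le|c hc] := @dvan_grid e (fun t => cq M t - eval_at P t) t1.
- by apply: dvanB => //; apply: dvan_le (dvan_cnt upM).
- have [q hq ->] := H x t xe le; by rewrite /cq (has_dim_uniq (graded_sm _ _ _) HI hq (dim _)) subrr.
exists [:: h *+ c] => t Ht; exists (HC t M); first exact: dim.
by apply/esym/eqP; rewrite -subr_eq0; apply/eqP/hc; apply: Ht; rewrite mem_head.
Qed.

End HilbertFunctions.

(** The generators are [h] and the degrees of the variables shifted by a multiple of [h] that makes
    them nef; differences of their sums give every degree. *)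
Lemma nef_gens (RR : realType) (d n r : nat) (b : 'M[int]_(d, n)) (Delta : {set {set 'I_n}}) (A : 'M[int]_(r, n))
    (h : 'cV[int]_r) (mu : {set 'I_n} -> 'X_{1..n}) :
  smooth_projective_fan RR b Delta -> short_exact b A ->
  (forall s, s \in Delta -> mdegree A (mu s) = h /\ forall i, (mu s i == 0%N) = (i \in s)) ->
  exists KS : seq 'cV[int]_r, (forall k, k \in KS -> nef_monoid A Delta k) /\
    forall p, exists l l' : seq 'cV[int]_r,
      [/\ {subset l <= KS}, {subset l' <= KS} & p + \sum_(k <- l) k = \sum_(k <- l') k].
Proof.
move=> Hfan Hex Hmu.
have [N hN] : exists N, forall i : 'I_n, nef_monoid A Delta (mdegree A U_(i)%MM + h *+ N).
  have [i N N' le H N'' le'|i|N hN] := @finite_bound 'I_n (fun i N => forall N', (N <= N')%N ->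
    nef_monoid A Delta (mdegree A U_(i)%MM + h *+ N')).
  - by apply: H; apply: leq_trans le'.
  - exact: (nef_deep Hfan Hex Hmu).
  by exists N => i; apply: hN.
pose ki (i : 'I_n) := mdegree A U_(i)%MM + h *+ N.
exists (h :: [seq ki i | i <- enum 'I_n]); split.
  by move=> k; rewrite inE => /orP [/eqP ->|/mapP [i _ ->]]; [exact: nef_h Hmu|exact: hN].
set KS := _ :: _.
have one (w : 'X_{1..n}) : exists l l' : seq 'cV[int]_r, [/\ {subset l <= KS}, {subset l' <= KS} &
    mdegree A w + \sum_(k <- l) k = \sum_(k <- l') k].
  exists (nseq (\sum_(i < n) w i * N) h), (flatten [seq nseq (w i) (ki i) | i <- enum 'I_n]); split.
  - by move=> x /nseqP [-> _]; rewrite mem_head.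
  - move=> x /flattenP [y /mapP [i _ ->] /nseqP [-> _]]; rewrite inE; apply/orP; right.
    by apply: map_f; rewrite mem_enum.
  have W : mdegree A w = \sum_(i < n) mdegree A U_(i)%MM *+ w i.
    have e : w = (\sum_(i < n) U_(i) *+ w i)%MM.
      apply/mnmP => j; rewrite mnm_sumE (bigD1 j) //= mulmnE mnm1E eqxx mul1n big1 ?addn0 // => i ij.
      by rewrite mulmnE mnm1E (negbTE ij).
    rewrite {1}e; have L (s : seq 'I_n) : mdegree A (\sum_(i <- s) U_(i) *+ w i)%MM = \sum_(i <- s) mdegree A U_(i)%MM *+ w i.
      by elim: s => [|i s IH]; rewrite ?big_nil ?mdeg_zero // !big_cons mdeg_add mdeg_muln IH.
    exact: L.
  rewrite big_flatten /= big_map W big_nseq iter_addr_0 -sumrMnr; rewrite big_enum -big_split /=.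
  apply: eq_bigr => i _; rewrite big_nseq iter_addr_0 mulrnDl -mulrnA; congr (_ + _ *+ _).
  exact: mulnC.
move=> p; have [u [w [_ _ e]]] := off_rep Hfan Hex p (fan_set0 Hfan).
have [l1 [l1' [s1 s1' e1]]] := one u; have [l2 [l2' [s2 s2' e2]]] := one w.
exists (l1 ++ l2'), (l1' ++ l2); split.
- by move=> x; rewrite mem_cat => /orP [/s1|/s2'].
- by move=> x; rewrite mem_cat => /orP [/s1'|/s2].
rewrite !big_cat /= -e1 -e2 e.
by rewrite -!addrA; congr (_ + _); rewrite addrCA.
Qed.

(** * Families of submodules in the degrees of a finite union of rays *)

Section Setup.
Variables (RR : realType) (d n r : nat) (b : 'M[int]_(d, n)) (Delta : {set {set 'I_n}}).
Variables (A : 'M[int]_(r, n)) (h : 'cV[int]_r) (mu : {set 'I_n} -> 'X_{1..n}).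
Variable (mon : 'cV[int]_r -> seq 'X_{1..n}).
Local Notation deg := (mdegree A).

Record toric_setup : Prop := ToricSetup {
  ts_fan : smooth_projective_fan RR b Delta;
  ts_ex : short_exact b A;
  ts_mu : forall s, s \in Delta -> deg (mu s) = h /\ forall i, (mu s i == 0%N) = (i \in s);
  ts_ver : forall j u, deg u = h *+ j -> exists2 w : seq 'X_{1..n},
    size w = j /\ (forall g, g \in w -> deg g = h) & u = (\sum_(g <- w) g)%MM;
  ts_uniq : forall p, uniq (mon p);
  ts_monE : forall p u, (u \in mon p) = (deg u == p) }.

Definition ray p t := mon (p + h *+ t).

(** The rays start at the points of [pts], pushed so far out that the regularity bounds hold from
    index zero on. [T_hilb] recognizes [P] from the eventual values on the rays. *)
Record ray_setup (P : {mpoly rat[r]}) (pts : seq 'cV[int]_r) (t0 : nat) (Qf : 'cV[int]_r -> nat) : Prop := RaySetup {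
  T_ray0 : h *+ t0 \in pts;
  T_mum : forall p (F : fieldType) (I : nat -> set {mpoly F[n]}), p \in pts -> fam (mon h) (ray p) I ->
    (exists t1, forall t, (t1 <= t)%N -> has_dim (inS (ray p t)) (I t) (Qf (p + h *+ t))) ->
    forall t, [/\ has_dim (inS (ray p t)) (I t) (Qf (p + h *+ t)), gen_at (mon h) I t & hsat (mon h) (ray p) I t];
  T_poly : forall p t, p \in pts -> eval_at P (p + h *+ t) = (Qf (p + h *+ t))%:R;
  T_hilb : forall (F : fieldType) (I : set {mpoly F[n]}), is_submodule I ->
    (forall (w : 'X_{1..n}) (f : {mpoly F[n]}), I f -> I ('X_[w] * f)) ->
    (exists t1, forall p t, p \in pts -> (t1 <= t)%N ->
       has_dim (@graded_piece F n r A (p + h *+ t)) I (Qf (p + h *+ t))) ->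
    is_hilbert_poly A Delta I P }.

Section Rays.
Hypothesis TS : toric_setup.
Let Hfan := ts_fan TS.
Let Hex := ts_ex TS.
Let Hmu := ts_mu TS.
Let monU := ts_uniq TS.
Let monE := ts_monE TS.

Lemma ray_mul p t g m : g \in mon h -> m \in ray p t -> (g + m)%MM \in ray p t.+1.
Proof. by rewrite !monE => /eqP eg /eqP em; rewrite mdeg_add eg em mulrS addrCA. Qed.

Lemma ray_div p t t' m m' : m \in ray p t -> m' \in ray p t' -> (m <= m')%MM -> (t <= t')%N ->
  exists2 w, word (mon h) (t' - t) w & m' = (m + wd w)%MM.
Proof.
rewrite !monE => /eqP em /eqP em' le lt.
have [|w [sw hw] ew] := @ts_ver TS (t' - t)%N (m' - m)%MM.
  by rewrite mdeg_sub // em em' opprD addrACA subrr add0r mulrnBr.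
exists w; first by split => // g gw; rewrite monE hw.
by rewrite /wd -ew addmC submK.
Qed.

Lemma word_deg N w : word (mon h) N w -> deg (wd w) = h *+ N.
Proof.
move=> [<- sub]; elim: w sub => [|g w IH] sub; first by rewrite /wd big_nil mdeg_zero.
rewrite wd_cons mdeg_add IH => [|x xw]; last by apply: sub; rewrite inE xw orbT.
have := sub g (mem_head _ _); rewrite monE => /eqP ->.
by rewrite /= mulrS.
Qed.

Lemma ray_gen p : exists tau, forall t, (tau <= t)%N -> forall m, m \in ray p t.+1 ->
  exists g m', [/\ g \in mon h, m' \in ray p t & m = (g + m')%MM].
Proof.
have [tau ht] := pig Hfan Hex Hmu p 1; exists tau => t le m; rewrite monE => /eqP em.
have [||E ED] := ht t.+1 m => //; first exact: leq_trans le _.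
rewrite mulm1n => leE; exists (mu E), (m - mu E)%MM; rewrite !monE (mu_deg Hmu ED) eqxx; split => //.
  by rewrite mdeg_sub // em (mu_deg Hmu ED) mulrS [h + _]addrC addrA addrK.
by rewrite addmC submK.
Qed.

Lemma ray_setup_ex (k : fieldType) P : multigraded_hilbert_poly k b A Delta P ->
  exists pts t0 Qf, ray_setup P pts t0 Qf.
Proof.
move=> [_ _ [I0 _ [vs hvs]]].
have [KS [KSn KSg]] := nef_gens Hfan Hex Hmu.
have [e0 he0] := dvan_eval Hfan Hex Hmu KS P.
have {he0} he := dvan_le Hfan Hex Hmu (leq_addr n.+1 e0) he0.
set e := (e0 + n.+1)%N in he.
(* On the rays the value of [P] is a natural number, recovered as the numerator. *)
pose Qf p := absz (numq (eval_at P p)).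
have QfE p q : eval_at P p = q%:R -> Qf p = q by rewrite /Qf => ->; rewrite -[q%:R]/((q%:Z)%:~R) numq_int.
have X x : exists N, [/\ forall t, (N <= t)%N -> eval_at P (x + h *+ t) = (Qf (x + h *+ t))%:R &
    forall (F : fieldType) (I : nat -> set {mpoly F[n]}), fam (mon h) (ray (x + h *+ N)) I ->
    (exists t1, forall t, (t1 <= t)%N -> has_dim (inS (ray (x + h *+ N) t)) (I t) (Qf (x + h *+ N + h *+ t))) ->
    forall t, [/\ has_dim (inS (ray (x + h *+ N) t)) (I t) (Qf (x + h *+ N + h *+ t)),
      gen_at (mon h) I t & hsat (mon h) (ray (x + h *+ N)) I t]].
  have [N1 hN1] : exists N1, forall v, v \in vs -> forall t, (N1 <= t)%N -> nef_monoid A Delta (x + h *+ t - v).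
    apply: (@seq_bound _ vs (fun v N1 => forall t, (N1 <= t)%N -> nef_monoid A Delta (x + h *+ t - v))).
      by move=> v N N' le H t le'; apply: H; apply: leq_trans le'.
    move=> v _; have [N hN] := nef_deep Hfan Hex Hmu (x - v); exists N => t /hN.
    by rewrite addrAC.
  have [tau ht] := ray_gen x; pose N2 := maxn N1 tau.
  have rE N t : ray (x + h *+ N) t = ray x (N + t) by rewrite /ray -addrA -mulrnDr.
  have [||||t0 ht0] := @mumford n (mon h) (ray (x + h *+ N2)) _ _ _ _ (size (mon h)) (fun t => Qf (x + h *+ N2 + h *+ t)).
  - by move=> t; apply: monU.
  - by move=> t g m; apply: ray_mul.
  - move=> t m; rewrite !rE addnS; apply: ht; apply: leq_trans (leq_maxr _ _) (leq_addr _ _).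
  - exact: ray_div.
  exists (N2 + t0)%N; split.
    move=> t le; have [|q _ eq] := hvs (x + h *+ t); last by rewrite eq (QfE _ _ eq).
    by move=> v /hN1; apply; rewrite /N2 in le; lia.
  move=> F I HI [t1 ht1].
  have eN t : x + h *+ (N2 + t0) + h *+ t = x + h *+ N2 + h *+ (t0 + t) by rewrite -!addrA -!mulrnDr addnA.
  have er t : ray (x + h *+ (N2 + t0)) t = ray (x + h *+ N2) (t0 + t) by rewrite /ray eN.
  (* The bound [t0] refers to families starting at [N2], whereas [I] starts at [N2 + t0]. It is
     extended downwards as the largest saturated family, so that the bound applies to all of [I]. *)
  pose I' t := if (t < t0)%N then [set f : {mpoly F[n]} | inS (ray (x + h *+ N2) t) f /\
    forall w, word (mon h) (t0 - t) w -> I 0%N ('X_[wd w] * f)] else I (t - t0)%N.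
  have I'0 t : I' (t0 + t)%N = I t by rewrite /I' ltnNge leq_addr addKn.
  have HI' : fam (mon h) (ray (x + h *+ N2)) I'.
    split.
    - move=> t; rewrite /I'; case: ifP => _; last exact: (fam_sm HI).
      split; first by split; [exact: (sm0 (inS_sm _))|move=> w _; rewrite mulr0; apply: (sm0 (fam_sm HI _))].
      move=> a f f' [h1 h2] [h1' h2']; split.
        by apply: (smD (inS_sm _)) => //; apply: (smZ _ (inS_sm _)).
      move=> w hw; rewrite mulrDr -scalerAr; apply: (smD (fam_sm HI _)); last exact: h2'.
      by apply: (smZ _ (fam_sm HI _)); apply: h2.
    - move=> t f; rewrite /I'; case: ifP => [_ []//|/negbT]; rewrite -leqNgt => le /(fam_in HI).
      by rewrite er subnKC.
    - move=> t g f gG; rewrite /I'; have [lt|] := ltnP t t0; last first.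
        by move=> le; rewrite ltnNge (leqW le) /= subSn //; apply: (fam_mul HI).
      move=> [h1 h2]; case: ifP => [lt1|/negbT]; last first.
        rewrite -leqNgt => le; have -> : (t.+1 - t0 = 0)%N by lia.
        have := h2 [:: g]; rewrite /wd big_seq1; apply; split; first by rewrite /=; lia.
        by move=> y; rewrite inE => /eqP ->.
      split; first by apply: inS_XM h1 => m; apply: ray_mul.
      move=> w [sw hw]; rewrite mulrA -mpolyXD addmC -wd_cons; apply: h2; split; first by rewrite /= sw; lia.
      by move=> y; rewrite inE => /orP [/eqP ->|/hw].
    - move=> t f fS; rewrite /I'; have [lt|] := ltnP t t0; last first.
        move=> le; rewrite ltnNge (leqW le) /= subSn // => H; apply: (fam_sat HI) => //.
        by rewrite er subnKC.
      move=> H; split=> // w; case: w => [|g w] [/= sw hw]; first by lia.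
      have gG : g \in mon h by apply: hw; rewrite mem_head.
      rewrite wd_cons addmC mpolyXD -mulrA; have := H g gG; case: ifP => [lt1 [_]|/negbT].
        by apply; split; [lia|move=> y yw; apply: hw; rewrite inE yw orbT].
      rewrite -leqNgt => le; have -> : (t.+1 - t0 = 0)%N by lia.
      have /size0nil -> : size w = 0%N by lia.
      by rewrite /wd big_nil mpolyX0 mul1r.
  have sm : small (mon h) (ray (x + h *+ N2)) (size (mon h)) I'.
    exists (fun i => 'X_[nth 0%MM (mon h) i]) => g gG; have ig : (index g (mon h) < size (mon h))%N by rewrite index_mem.
    exists (fun i => (i == Ordinal ig)%:R) => t f _.
    rewrite (bigD1 (Ordinal ig)) //= eqxx scale1r nth_index // big1 ?addr0 ?subrr ?mul0r => [|i /negbTE ->].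
      exact: (sm0 (fam_sm HI' _)).
    by rewrite scale0r.
  move=> t; have := ht0 F I' HI' sm _ (t0 + t)%N (leq_addr _ _); rewrite -er -eN.
  case=> [|h1 h2 h3].
    exists (t0 + t1)%N => t' le'; rewrite -(subnKC (leq_trans (leq_addr _ _) le')) -er -eN I'0.
    by apply: ht1; lia.
  split; first by rewrite -I'0.
    by move: h2; rewrite /gen_at -addnS !I'0.
  move: h3; rewrite /hsat -addnS.
  have hE s : hyp (mon h) (ray (x + h *+ N2)) I' (t0 + s.+1) = hyp (mon h) (ray (x + h *+ (N2 + t0))) I s.+1.
    by rewrite /hyp /hypN addnS /= -addnS I'0 -er.
  rewrite hE => H f [fS [s hs]]; apply: H; split; first by rewrite -er.
  by exists s => w hw; have := hs w hw; rewrite -addnA addSn hE -addSn.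
have [N hN] := choice X.
have e0' : 0 \in grid KS e by rewrite /e addnS /= mem_head.
exists [seq x + h *+ N x | x <- grid KS e], (N 0), Qf; split.
- by apply/mapP; exists 0 => //; rewrite add0r.
- by move=> p F I /mapP [x xg ->]; have [_] := hN x; apply.
- move=> p t /mapP [x xg ->]; have [H _] := hN x; rewrite -addrA -mulrnDr; apply: H.
  exact: leq_addr.
move=> F I HI IM [t1 H].
have ne : (n < e)%N by rewrite /e addnS ltnS leq_addl.
refine (@hilbert_poly_grid _ _ _ _ _ _ _ Hfan Hex _ _ Hmu mon monU monE KS KSn KSg e P F I
  (t1 + \max_(i < size (grid KS e)) N (nth 0%R (grid KS e) i))%N he ne HI IM _).
move=> x t xg le.
have leN : (t1 + N x <= t)%N.
  apply: leq_trans le; rewrite leq_add2l; have ix : (index x (grid KS e) < size (grid KS e))%N by rewrite index_mem.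
  have := leq_bigmax (F := fun i : 'I_(size (grid KS e)) => N (nth 0 (grid KS e) i)) (Ordinal ix).
  by rewrite /= nth_index.
have -> : x + h *+ t = x + h *+ N x + h *+ (t - N x) by rewrite -addrA -mulrnDr subnKC //; lia.
exists (Qf (x + h *+ N x + h *+ (t - N x))).
  by apply: H; [apply/mapP; exists x|lia].
by rewrite -addrA -mulrnDr subnKC; [have [Hx _] := hN x; apply: Hx|]; lia.
Qed.

End Rays.

End Setup.

Lemma toric_setup_ex (RR : realType) (d n r : nat) (b : 'M[int]_(d, n)) (Delta : {set {set 'I_n}}) (A : 'M[int]_(r, n)) :
  smooth_projective_fan RR b Delta -> short_exact b A -> exists h mu mon, toric_setup RR b Delta A h mu mon.
Proof.
move=> Hfan Hex; have [h [mu [Hmu ver]]] := veronese Hfan Hex.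
have [mon hmon] := choice (mon_ex Hfan Hex).
by exists h, mu, mon; split => // p; case: (hmon p).
Qed.

Section FieldDim.
Variables (F : fieldType) (V : lmodType F).

Lemma free_at_has_dim (V0 N : set V) q f : is_submodule N -> f != 0 -> free_at V0 N q f -> has_dim V0 N q.
Proof.
move=> HN f0 [e [e1 e2 e3]]; exists e; split => // [v hv|c hc j].
  have [N0 [c hc]] := e2 v hv; exists (fun j => (f ^+ N0)^-1 * c j).
  have := smZ (f ^+ N0)^-1 HN hc; rewrite scalerBr scalerA mulVf ?expf_neq0 // scale1r scaler_sumr.
  by under eq_bigr do rewrite scalerA.
have [N0 /(_ j) /eqP] := e3 c hc.
by rewrite mulf_eq0 (negbTE (expf_neq0 _ f0)) => /eqP.
Qed.
End FieldDim.

Lemma unit_ideal_image (R : comNzRingType) (F : fieldType) (phi : {rmorphism R -> F}) (fs : seq R) :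
  ideal_gen [set` fs] 1 -> exists2 f, f \in fs & phi f != 0.
Proof.
move=> H; apply: contrapT => no.
suff /eqP : phi 1 = 0 by rewrite rmorph1 oner_eq0.
have : ideal_gen [set` fs] `<=` [set x | phi x = 0]; last exact.
apply: idgen_min; first split=> [|a x y /= hx hy]; rewrite /= ?raddf0 //.
  by rewrite rmorphD rmorphM hx hy mulr0 addr0.
by move=> x xs /=; apply/eqP; apply: contrapT => /negP h; apply: no; exists x.
Qed.

Lemma locally_free_has_dim (F : fieldType) (V : lmodType F) (V0 N : set V) q :
  is_submodule N -> locally_free V0 N q -> has_dim V0 N q.
Proof.
move=> HN [fs [h1 h2]]; have [f ff f0] := unit_ideal_image idfun h1.
exact: free_at_has_dim f0 (h2 f ff).
Qed.

Lemma has_dim_locally_free (F : fieldType) (V : lmodType F) (V0 N : set V) q :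
  has_dim V0 N q -> locally_free V0 N q.
Proof.
move=> [e [e1 e2 e3]]; exists [:: 1]; split; first by apply: idgen_sub => /=; rewrite mem_head.
move=> f; rewrite inE => /eqP ->; exists e; split => // [v /e2 [c hc]|c /e3 hc].
  by exists 0%N, c; rewrite expr0 scale1r.
by exists 0%N => j; rewrite hc mulr0.
Qed.

Section Projector.
Variables (n : nat) (ms : seq 'X_{1..n}).
Hypothesis msU : uniq ms.

Lemma vecE (R : comNzRingType) (v : {mpoly R[n]}) : inS ms v <-> exists w, v = @vec R n ms w.
Proof. exact: inS_vec. Qed.

Lemma proj_of (R : comNzRingType) (N : set {mpoly R[n]}) q : is_submodule N -> locally_free (inS ms) N q ->
  exists2 E : 'M[R]_(size ms), lf_proj q E & forall w, N (vec w) <-> w *m E = 0.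
Proof.
move=> HN /(locally_free_vec _ (@vecE R)) lf.
have [|E hE eE] := lf_proj_of _ lf.
  split=> /=; first by rewrite raddf0; apply: sm0.
  by move=> a u v hu hv; rewrite linearP; apply: (smD HN) => //; apply: (smZ _ HN).
by exists E => // w; have /seteqP [h1 h2] := eE; split=> [/h1|/h2].
Qed.

Lemma of_proj (R : comNzRingType) (N : set {mpoly R[n]}) q (E : 'M[R]_(size ms)) : lf_proj q E ->
  (forall w, N (vec w) <-> w *m E = 0) -> locally_free (inS ms) N q.
Proof.
move=> hE H; apply/(locally_free_vec _ (@vecE R)); have := lf_projP hE; congr locally_free.
by apply/seteqP; split=> w /H.
Qed.

Lemma map_vec (R R' : comNzRingType) (phi : {rmorphism R -> R'}) w :
  map_mpoly phi (@vec R n ms w) = vec (map_mx phi w).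
Proof.
rewrite /vec raddf_sum; apply: eq_bigr => i _.
by rewrite /= map_mpolyZ map_mpolyX mxE.
Qed.

Lemma proj_map (R R' : comNzRingType) (phi : {rmorphism R -> R'}) (N : set {mpoly R[n]}) (E : 'M[R]_(size ms)) :
  N `<=` inS ms -> E *m E = E -> (forall w, N (vec w) <-> w *m E = 0) ->
  forall w, span (map_mpoly phi @` N) (vec w) <-> w *m map_mx phi E = 0.
Proof.
move=> NS EE H w.
have e : [set w | span (map_mpoly phi @` N) (vec w)] = lker (map_mx phi E).
  rewrite -(lker_map phi EE); apply/seteqP; split=> v /=; last first.
    apply: (@span_min _ _ _ [set v | span (map_mpoly phi @` N) (vec v)]).
      split=> /=; first by rewrite raddf0; apply: (sm0 (span_sm _)).
      by move=> a x y hx hy; rewrite linearP; apply: (smD (span_sm _)) => //; apply: (smZ _ (span_sm _)).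
    move=> _ [x hx <-] /=; apply: span_sub; exists (vec x); first exact/H.
    exact: map_vec.
  rewrite -{2}(vecK v msU); apply: (@span_min _ _ _ [set f | span (map_mx phi @` lker E) (crd ms f)]).
    split=> /=; first by rewrite (_ : crd ms 0 = 0); [exact: (sm0 (span_sm _))|apply/rowP => i; rewrite !mxE mcoeff0].
    move=> a f f' hf hf'; rewrite (_ : crd ms _ = a *: crd ms f + crd ms f').
      by apply: (smD (span_sm _)) => //; apply: (smZ _ (span_sm _)).
    by apply/rowP => i; rewrite !mxE mcoeffD mcoeffZ.
  move=> _ [f Nf <-] /=; have fS := NS _ Nf; apply: span_sub; exists (crd ms f).
    by apply/H; rewrite crdK.
  by rewrite -{2}(crdK msU fS) map_vec vecK.
by split=> [hw|hw]; [rewrite -[_ = 0]/(lker _ w) -e|rewrite -[span _ _]/([set w | span (map_mpoly phi @` N) (vec w)] w) e].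
Qed.

End Projector.

(** * Flat families obtained from locally free pieces on the rays *)

Section HT.
Variables (RR : realType) (d n r : nat) (b : 'M[int]_(d, n)) (Delta : {set {set 'I_n}}).
Variables (A : 'M[int]_(r, n)) (h : 'cV[int]_r) (mu : {set 'I_n} -> 'X_{1..n}).
Variable (mon : 'cV[int]_r -> seq 'X_{1..n}).
Hypothesis TS : toric_setup RR b Delta A h mu mon.
Variables (P : {mpoly rat[r]}) (pts : seq 'cV[int]_r) (t0 : nat) (Qf : 'cV[int]_r -> nat).
Hypothesis RS : ray_setup Delta A h mon P pts t0 Qf.
Local Notation deg := (mdegree A).
Local Notation chart := {s : {set 'I_n} | s \in Delta}.
Let Hfan := ts_fan TS.
Let Hex := ts_ex TS.
Let Hmu := ts_mu TS.
Let monU := ts_uniq TS.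
Let monE := ts_monE TS.
Let gS := graded_inS monE.

Lemma dh_0 (R : comNzRingType) u : dh b u (0 : {mpoly R[n]}) = 0.
Proof. by rewrite /dh msupp0 big_nil. Qed.

Definition inT p := exists2 p0, p0 \in pts & exists t, p = p0 + h *+ t.

Lemma inT_h N : (t0 <= N)%N -> inT (h *+ N).
Proof. by move=> le; exists (h *+ t0); [exact: (T_ray0 RS)|exists (N - t0)%N; rewrite -mulrnDr subnKC]. Qed.

Lemma inT_add p N : inT p -> inT (p + h *+ N).
Proof. by move=> [p0 hp [t ->]]; exists p0 => //; exists (t + N)%N; rewrite -addrA -mulrnDr. Qed.

Lemma mu_degN s N : s \in Delta -> deg (mu s *+ N)%MM = h *+ N.
Proof. by move=> sD; rewrite mdeg_muln (mu_deg Hmu sD). Qed.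

Lemma mu_offN s N : s \in Delta -> off s (mu s *+ N)%MM.
Proof. by move=> sD; apply: off_muln; apply: (mu_off Hmu sD). Qed.

Lemma fam_Ip (R : comNzRingType) (Y : chart_ideals R d Delta) p :
  (forall s, is_chart_ideal b (val s) (Y s)) -> fam (mon h) (ray h mon p) (fun t => Ip b A Y (p + h *+ t)).
Proof.
move=> HY; split.
- by move=> t; apply: Ip_sm.
- by move=> t f [gf _]; rewrite /ray -gS.
- move=> t g f; rewrite monE => /eqP eg If.
  have -> : p + h *+ t.+1 = p + h *+ t + deg g by rewrite eg mulrS [h + _]addrC addrA.
  exact: (Ip_mul Hfan Hex HY).
move=> t f fS H; apply: (@Ip_sat _ _ _ _ _ _ Hex _ _ _ _ mu); first by rewrite gS.
move=> s sD; split; first exact: (mu_off Hmu sD).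
rewrite (mu_deg Hmu sD) -addrA [_ + h]addrC -mulrS; apply: H.
by rewrite monE (mu_deg Hmu sD).
Qed.

Section OverRing.
Variable R : comNzRingType.
Implicit Types (f : {mpoly R[n]}).

Record HT0 (L : 'cV[int]_r -> set {mpoly R[n]}) : Prop := MkHT0 {
  HT_sm : forall p, inT p -> is_submodule (L p);
  HT_in : forall p, inT p -> L p `<=` graded_piece A p;
  HT_mul : forall p q m f, inT p -> inT q -> deg m = q - p -> L p f -> L q ('X_[m] * f) }.

(** The points of the Haiman-Sturmfels functor for the infinite set of degrees on the rays; base
    change and comparison with subschemes are simpler here than for a finite set. *)
Record HT (L : 'cV[int]_r -> set {mpoly R[n]}) : Prop := MkHT {
  HT_0 :> HT0 L;
  HT_lf : forall p, inT p -> locally_free (graded_piece A p) (L p) (Qf p) }.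

(** Multiples of [h] suffice to define the chart ideals, since these degrees are trivialized on the
    chart of [s] by powers of [mu s]. *)
Definition YL (L : 'cV[int]_r -> set {mpoly R[n]}) : chart_ideals R d Delta :=
  fun s => [set g | exists N f, [/\ (t0 <= N)%N, L (h *+ N) f & g = dh b (mu (val s) *+ N) f]].

Variable L : 'cV[int]_r -> set {mpoly R[n]}.
Hypothesis HL : HT0 L.

Lemma YL_lift s g : YL L s g ->
  exists N, forall N', (N <= N')%N -> exists2 f, L (h *+ N') f & g = dh b (mu (val s) *+ N') f.
Proof.
move=> [N [f [le Lf ->]]]; exists N => N' le'; exists ('X_[(mu (val s) *+ (N' - N))%MM] * f).
  apply: (HT_mul HL) Lf; try by apply: inT_h; lia.
  by rewrite (mu_degN _ (valP s)) mulrnBr.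
have -> : (mu (val s) *+ N')%MM = (mu (val s) *+ N + mu (val s) *+ (N' - N))%MM.
  by apply/mnmP => i; rewrite mnmDE !mulmnE -mulnDr subnKC.
by rewrite (dh_mulX Hex).
Qed.

Lemma YL_chart s : is_chart_ideal b (val s) (YL L s).
Proof.
split.
- by move=> g [N [f [_ _ ->]]]; apply: (dh_chart Hex); apply: (mu_offN _ (valP s)).
- split.
    exists t0, 0; split=> //; first by apply: (sm0 (HT_sm HL _)); apply: inT_h.
    by rewrite dh_0.
  move=> a g g' /YL_lift [N hN] /YL_lift [N' hN'].
  pose N0 := (N + N' + t0)%N.
  have [|f Lf ->] := hN N0; first by rewrite /N0; lia.
  have [|f' Lf' ->] := hN' N0; first by rewrite /N0; lia.
  exists N0, (a *: f + f'); split; [by rewrite /N0; lia| |by rewrite (dh_lin Hex)].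
  have HS : is_submodule (L (h *+ N0)) by apply: (HT_sm HL); apply: inT_h; rewrite /N0; lia.
  by apply: (smD HS) => //; apply: (smZ _ HS).
move=> m g hm [N [f [le Lf ->]]].
have [N1 /(_ N1 (leqnn _)) [w hw dw]] := dual_le Hex Hmu (valP s) hm.
exists (N + N1)%N, ('X_[w] * f); split; first by lia.
  apply: (HT_mul HL) Lf; try by apply: inT_h; lia.
  by rewrite dw mulrnDr addrC addKr.
rewrite (@dh_trans _ _ _ _ _ Hex _ _ w (mu (val s) *+ N)%MM 0%MM m) ?mpolyX0 ?mul1r // => i.
have := hw i; rewrite !mnm0E !addr0 => ->; rewrite !mulmnE mulnDr PoszD.
by rewrite addrAC [_ + (mu _ i * N1)%N%:Z]addrC -addrA addrC.
Qed.

Lemma YL_glue (s t : chart) : val t \subset val s ->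
  YL L t = smallest (@is_chart_ideal R d n b (val t)) (YL L s).
Proof.
move=> sub; apply/seteqP; split.
  move=> g [N [f [le Lf ->]]] Z [[_ _ HZ] sZ].
  have /(mdeg_eq Hex) [c hc] : deg (mu (val s) *+ N)%MM = deg (mu (val t) *+ N)%MM.
    by rewrite (mu_degN _ (valP s)) (mu_degN _ (valP t)).
  rewrite -[f]mul1r -mpolyX0 (@dh_trans _ _ _ _ _ Hex _ _ _ (mu (val s) *+ N)%MM 0%MM c); last first.
    by move=> i; rewrite !mnm0E add0r addr0 hc.
  apply: HZ; last by apply: sZ; exists N, f; rewrite mpolyX0 mul1r.
  move=> i ti; have := hc i; rewrite -[(_ *m _) i 0]/(pr b c i) !mulmnE.
  rewrite (mu_off Hmu (valP t) ti) (mu_off Hmu (valP s)) ?(fintype.subsetP sub) //.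
  by rewrite add0r => <-.
move=> g; apply; split; first exact: YL_chart.
move=> g' [N [f [le Lf ->]]].
have [|N1 hN1] := @off_le_mu _ _ _ _ _ _ Hmu (val t) (mu (val s) *+ N)%MM (valP t).
  by move=> i ti; apply: (mu_offN _ (valP s)); apply: (fintype.subsetP sub).
pose N' := (N1 + N)%N; have le1 := hN1 N' (leq_addr _ _).
exists N', ('X_[(mu (val t) *+ N' - mu (val s) *+ N)%MM] * f); split; first by rewrite /N'; lia.
  apply: (HT_mul HL) Lf; try by apply: inT_h; rewrite /N'; lia.
  by rewrite mdeg_sub // (mu_degN _ (valP s)) (mu_degN _ (valP t)).
by rewrite -{1}(submK le1) addmC (dh_mulX Hex).
Qed.

Lemma L_sub_Ip p f : inT p -> L p f -> Ip b A (YL L) p f.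
Proof.
move=> Tp Lf; split; first exact: (HT_in HL).
move=> s u w hu hw e; have [N1 hN1] := off_le_mu Hmu (valP s) hu.
pose M := (N1 + t0)%N; have le1 := hN1 M (leq_addr _ _).
exists M, ('X_[(mu (val s) *+ M - u + w)%MM] * f); split; first by rewrite /M; lia.
  apply: (HT_mul HL) Lf => //; first by apply: inT_h; rewrite /M; lia.
  by rewrite mdeg_add mdeg_sub // (mu_degN _ (valP s)) e opprD -addrA subrK.
by rewrite mpolyXD -mulrA -{1}(submK le1) addmC (dh_mulX Hex).
Qed.

(** On each chart a power of [mu s] carries [f] into [L]. By [pig], every monomial of large degree
    $hN$ is divisible by one of these powers. *)
Lemma Ip_YL_word p f : inT p -> Ip b A (YL L) p f ->
  exists N0, forall N w, (N0 <= N)%N -> deg w = h *+ N -> L (p + h *+ N) ('X_[w] * f).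
Proof.
move=> Tp [gf If].
have H (s : chart) : exists M, forall M', (M <= M')%N -> L (p + h *+ M') ('X_[(mu (val s) *+ M')%MM] * f).
  have [u [w [hu hw e]]] := off_rep Hfan Hex p (valP s).
  have [N [f' [le Lf' e2]]] := If s u w hu hw e.
  have e3 : 'X_[(w + mu (val s) *+ N)%MM] * f = 'X_[u] * f'.
    apply: (@dh_inj _ _ _ _ _ Hex _ (u + mu (val s) *+ N)%MM).
    - by rewrite mdeg_add e -addrA -mdeg_add; apply: gradedXM.
    - by rewrite mdeg_add (mu_degN _ (valP s)) addrC; apply: gradedXM; apply: (HT_in HL) Lf'; apply: inT_h.
    by rewrite [in RHS]addmC (dh_mulX Hex) -e2 [(w + _)%MM]addmC mpolyXD -mulrA (dh_mulX Hex).
  have [|M hM] := @off_le_mu _ _ _ _ _ _ Hmu (val s) (w + mu (val s) *+ N)%MM (valP s).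
    by apply: off_add => //; apply: (mu_offN _ (valP s)).
  exists M => M' /hM le1.
  rewrite -(submK le1) mpolyXD -mulrA e3 mulrA -mpolyXD; apply: (HT_mul HL) Lf'; try exact: inT_h.
    exact: inT_add.
  rewrite mdeg_add mdeg_sub // mdeg_add !(mu_degN _ (valP s)) e opprD.
  by rewrite [LHS](AC ((1*2)*2) (((4*1)*3)*(2*5))) /= addNr addr0.
have [M hM] := @finite_bound chart _ (fun s N N' le H M' le' => H M' (leq_trans le le')) H.
have [tau ht] := pig Hfan Hex Hmu 0 M; exists (tau + M)%N => N w le ew.
have [||E ED leE] := ht N w; [lia|by rewrite add0r|].
rewrite -(submK leE) mpolyXD -mulrA.
apply: (HT_mul HL) (hM (exist (fun s : {set 'I_n} => s \in Delta) E ED) M (leqnn _)) => /=.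
- exact: inT_add.
- exact: inT_add.
by rewrite mdeg_sub // ew (mu_degN _ ED) opprD addrACA subrr add0r.
Qed.

Lemma word_Ip_YL p f N : inT p -> graded_piece A p f ->
  (forall w, deg w = h *+ N -> L (p + h *+ N) ('X_[w] * f)) -> Ip b A (YL L) p f.
Proof.
move=> Tp gf H; apply: (@Ip_sat _ _ _ _ _ _ Hex _ _ _ _ (fun s => mu s *+ N)%MM) => // s sD.
split; first exact: mu_offN.
rewrite (mu_degN _ sD); apply: L_sub_Ip; first exact: inT_add.
by apply: H; apply: mu_degN.
Qed.

End OverRing.

Lemma IY_hilb (F : fieldType) (Y : chart_ideals F d Delta) : (forall s, is_chart_ideal b (val s) (Y s)) ->
  (exists t1, forall p t, p \in pts -> (t1 <= t)%N ->
    has_dim (@graded_piece F n r A (p + h *+ t)) (Ip b A Y (p + h *+ t)) (Qf (p + h *+ t))) ->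
  is_hilbert_poly A Delta (IY b A Y) P.
Proof.
move=> HY [t1 H]; apply: (T_hilb RS).
- exact: IY_sm.
- by move=> w f; apply: (IY_XM Hfan Hex).
exists t1 => p t hp le; have := H p t hp le; apply: has_dim_ext; first exact: graded_sm.
by move=> v gv; apply: iff_sym; apply: (IY_Ip Hex HY gv).
Qed.

(** Far out on each ray [L] agrees with its saturation, so the saturated ideal has Hilbert function
    [Qf] there. By [T_mum] it has it on the whole ray, and equality follows by dimension. *)
Lemma HT_field (F : fieldType) (L : 'cV[int]_r -> set {mpoly F[n]}) : HT L ->
  (forall p, inT p -> Ip b A (YL L) p `<=` L p) /\ is_hilbert_poly A Delta (IY b A (YL L)) P.
Proof.
move=> HL; have HY := YL_chart HL.
have Tp p0 t : p0 \in pts -> inT (p0 + h *+ t) by move=> hp; exists p0 => //; exists t.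
have dimL p : inT p -> has_dim (@graded_piece F n r A p) (L p) (Qf p).
  by move=> hp; apply: locally_free_has_dim; [apply: (HT_sm HL)|apply: (HT_lf HL)].
have key p0 : p0 \in pts -> forall t, has_dim (@graded_piece F n r A (p0 + h *+ t))
    (Ip b A (YL L) (p0 + h *+ t)) (Qf (p0 + h *+ t)).
  move=> hp; have HI := fam_Ip p0 HY.
  have HN : gfam (mon h) (ray h mon p0) (fun t => L (p0 + h *+ t)).
    split.
    - by move=> t; apply: (HT_sm HL); apply: Tp.
    - by move=> t f; rewrite /ray -gS; apply: (HT_in HL); apply: Tp.
    move=> t g f; rewrite monE => /eqP eg; apply: (HT_mul HL); try exact: Tp.
    by rewrite eg mulrS opprD addrACA subrr add0r addrK.
  have [t1 ht1] := satN_noeth (fun t => monU _) (@ray_mul _ _ _ _ _ _ _ _ _ _ TS p0) (@ray_div _ _ _ _ _ _ _ _ _ _ TS p0) HN.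
  have H := T_mum RS hp HI.
  suff hx : exists t1, forall t, (t1 <= t)%N -> has_dim (inS (ray h mon p0 t)) (Ip b A (YL L) (p0 + h *+ t)) (Qf (p0 + h *+ t)).
    by move=> t; rewrite gS; have [] := H hx t.
  exists t1 => t le; rewrite /ray -gS; apply: has_dim_ext (dimL _ (Tp _ _ hp)); first exact: graded_sm.
  move=> v gv; split; first by apply: (L_sub_Ip HL); apply: Tp.
  move=> Iv; apply: ht1 => //; split; first by rewrite /ray -gS.
  have [N0 hN0] := Ip_YL_word HL (Tp _ t hp) Iv; exists N0 => w hw.
  have := hN0 N0 (wd w) (leqnn _); rewrite -addrA -mulrnDr; apply.
  exact: (word_deg TS hw).
split=> [p [p0 hp [t ->]] f If|].
  have Tpt := Tp _ t hp.
  have [_] := has_dim_le (graded_sm _ _ _) (HT_sm HL Tpt) (fun v _ => L_sub_Ip HL Tpt) (dimL _ Tpt) (key _ hp t).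
  by apply=> //; [apply: Ip_sm|case: If].
by apply: IY_hilb => //; exists 0%N => p t hp _; apply: key.
Qed.

Definition mapT (R R' : comNzRingType) (phi : R -> R') (L : 'cV[int]_r -> set {mpoly R[n]}) p : set {mpoly R'[n]} :=
  span (map_mpoly phi @` L p).

Lemma HT0_map (R R' : comNzRingType) (phi : {rmorphism R -> R'}) L : HT0 L -> HT0 (mapT phi L).
Proof.
move=> HL; split.
- by move=> p _; apply: span_sm.
- move=> p Tp; apply: span_min; first exact: graded_sm.
  move=> _ [f Lf <-]; apply/graded_pieceP => w ne.
  by rewrite mcoeff_map_mpoly (proj1 (graded_pieceP _ _ _) (HT_in HL Tp Lf)) // raddf0.
move=> p q m f Tp Tq em; apply: (@span_min _ _ _ [set f | mapT phi L q ('X_[m] * f)]).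
  split=> /=; first by rewrite mulr0; apply: (sm0 (span_sm _)).
  move=> a u v hu hv; rewrite mulrDr -scalerAr; apply: (smD (span_sm _)) => //.
  exact: (smZ _ (span_sm _)).
move=> _ [g Lg <-] /=; apply: span_sub; exists ('X_[m] * g); first exact: (HT_mul HL) Lg.
by rewrite rmorphM /= map_mpolyX.
Qed.

Lemma HT_map (R R' : comNzRingType) (phi : {rmorphism R -> R'}) L : HT L -> HT (mapT phi L).
Proof.
move=> HL; split; first exact: (HT0_map phi HL).
move=> p Tp; rewrite gS; have [|E hE HE] := proj_of (monU p) (HT_sm HL Tp) (q := Qf p).
  by rewrite -gS; apply: (HT_lf HL).
apply: (of_proj (monU p) (lf_proj_map phi hE)); apply: (proj_map (monU p)) => //; last by case: hE.
by rewrite -gS; apply: (HT_in HL).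
Qed.

Lemma YL_map (R R' : comNzRingType) (phi : {rmorphism R -> R'}) L : HT0 L ->
  YL (mapT phi L) = subscheme_base_change phi (YL L).
Proof.
move=> HL; rewrite base_changeE; apply: funext => s; apply/seteqP; split.
  move=> g [N [f [le Lf ->]]]; move: f Lf.
  apply: (@span_min _ _ _ [set f | span (mapL phi @` YL L s) (dh b (mu (val s) *+ N) f)]).
    split=> /=; first by rewrite dh_0; apply: (sm0 (span_sm _)).
    by move=> a u v hu hv; rewrite (dh_lin Hex); apply: (smD (span_sm _)) => //; apply: (smZ _ (span_sm _)).
  move=> _ [f Lf <-] /=; apply: span_sub; exists (dh b (mu (val s) *+ N) f); first by exists N, f.
  exact: (mapL_dh Hex).
apply: span_min; first by case: (YL_chart (HT0_map phi HL) s).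
move=> _ [g [N [f [le Lf ->]]] <-]; exists N, (map_mpoly phi f); split => //.
  by apply: span_sub; exists f.
exact: (mapL_dh Hex).
Qed.

Lemma crd_sum (R : comNzRingType) ms (I : Type) (s : seq I) (Q : pred I) (G : I -> {mpoly R[n]}) :
  crd ms (\sum_(i <- s | Q i) G i) = \sum_(i <- s | Q i) crd ms (G i).
Proof. by apply/rowP => j; rewrite mxE raddf_sum summxE; apply: eq_bigr => i _; rewrite mxE. Qed.

Lemma crdZ (R : comNzRingType) ms a (f : {mpoly R[n]}) : crd ms (a *: f) = a *: crd ms f.
Proof. by apply/rowP => j; rewrite !mxE mcoeffZ. Qed.

(* The comparison map S_p / L_p -> prod_w S_(p+Nh) / L_(p+Nh) is injective at every residue field,
   hence injective since its source is locally free. *)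
Lemma HT_Ip (R : comNzRingType) (L : 'cV[int]_r -> set {mpoly R[n]}) p : HT L -> inT p ->
  Ip b A (YL L) p = L p.
Proof.
move=> HL Tp; apply/seteqP; split; last by move=> f; apply: (L_sub_Ip HL).
move=> f If; have [N /(_ N _ (leqnn _)) hN] := Ip_YL_word HL Tp If.
set q := p + h *+ N; have Tq : inT q by apply: inT_add.
have pr_ p' : inT p' -> exists2 E : 'M[R]_(size (mon p')), lf_proj (Qf p') E & forall w, L p' (vec w) <-> w *m E = 0.
  by move=> Tp'; apply: (proj_of (monU p') (HT_sm HL Tp')); rewrite -gS; apply: (HT_lf HL).
have [E hE HE] := pr_ p Tp; have [E' hE' HE'] := pr_ q Tq.
have EE : E *m E = E by case: hE.
have inq w g : deg w = h *+ N -> graded_piece A p g -> inS (mon q) ('X_[w] * g).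
  by move=> ew gg; rewrite -gS /q -ew; apply: gradedXM.
have fS : inS (mon p) f by rewrite -gS; case: If.
(* [v] represents the class of [f] in $S_p/L_p$, identified with the image of the idempotent [E]. *)
pose v := crd (mon p) f *m E.
have Lv : L p (f - vec v).
  rewrite -{1}(crdK (monU p) fS) -raddfB; apply/HE.
  by rewrite mulmxBl -mulmxA EE subrr.
suff v0 : v = 0 by move: Lv; rewrite v0 raddf0 subr0.
have Xv w : deg w = h *+ N -> L q ('X_[w] * vec v).
  move=> ew; have := smB (HT_sm HL Tq) (hN w ew) (HT_mul HL Tp Tq (etrans ew _) Lv).
  by rewrite mulrBr subKr; apply; rewrite /q addrC addKr.
apply/rowP => i0; rewrite [RHS]mxE; apply: residue_eq0 => F phi Hphi.
have [fs [fs1 fsE]] := proj2 hE; have [g gfs g0] := unit_ideal_image phi fs1.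
have [N1 [X [Y [eXY eYX]]]] := fsE g gfs.
pose c := v *m X.
have ec : c *m Y = g ^+ N1 *: v by rewrite /c -mulmxA -eXY -scalemxAr /v -mulmxA EE.
pose K := ('I_(size (mon (h *+ N))) * 'I_(size (mon q)))%type.
pose wK (x : K) := nth 0%MM (mon (h *+ N)) x.1.
have wKd x : deg (wK x) = h *+ N by apply/eqP; rewrite -monE mem_nth.
(* The matrix of the comparison map in the local basis given by the rows of [Y]. *)
pose a (j : 'I_(Qf p)) (x : K) : R := (crd (mon q) ('X_[wK x] * vec (row j Y)) *m E') 0 x.2.
have vrow (R' : comNzRingType) (c' : 'rV[R']_(Qf p)) (Y' : 'M[R']_(Qf p, size (mon p))) :
    vec (c' *m Y') = \sum_j c' 0 j *: vec (row j Y').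
  by rewrite mulmx_sum_row linear_sum; apply: eq_bigr => j _; exact: linearZ.
have grv (R' : comNzRingType) (y : 'rV[R']_(size (mon p))) : graded_piece A p (vec y).
  by rewrite gS; apply: vec_inS.
have Lmx (R' : comNzRingType) (L' : set {mpoly R'[n]}) (B : 'M[R']_(size (mon q))) (g' : {mpoly R'[n]}) :
    (forall w, L' (vec w) <-> w *m B = 0) -> inS (mon q) g' -> L' g' <-> crd (mon q) g' *m B = 0.
  by move=> H gi; rewrite -{1}(crdK (monU q) gi).
have acomb (R' : comNzRingType) (c' : 'rV[R']_(Qf p)) (Y' : 'M[R']_(Qf p, size (mon p))) (B : 'M[R']_(size (mon q))) x :
    \sum_j c' 0 j * (crd (mon q) ('X_[wK x] * vec (row j Y')) *m B) 0 x.2 =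
    (crd (mon q) ('X_[wK x] * vec (c' *m Y')) *m B) 0 x.2.
  rewrite vrow mulr_sumr crd_sum mulmx_suml summxE; apply: eq_bigr => j _.
  by rewrite -scalerAr crdZ -scalemxAl [in RHS]mxE.
have H0 x : \sum_j c 0 j * a j x = 0.
  have := acomb _ c Y E' x; rewrite /a => ->.
  rewrite ec linearZ -scalerAr crdZ -scalemxAl mxE.
  have /(Lmx _ _ _ _ HE') -> := Xv _ (wKd x); first by rewrite mxE mulr0.
  exact: inq.
pose psi := loci phi.
have c0 : forall j, psi (c 0 j) = 0.
  apply: (local_row_free (phi := locphi phi) (a := fun j x => psi (a j x)) (locphi_local Hphi)); last first.
    move=> x; transitivity (psi (\sum_j c 0 j * a j x)); last by rewrite H0; apply: (rmorph0 psi).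
    apply: esym; apply: etrans (rmorph_sum psi _ _ _) _; apply: eq_bigr => j _.
    exact: (rmorphM psi).
  (* Injectivity over the residue field: a vector in the kernel is a section of the ideal sheaf of
     the fibre, and [HT_field] places it in the fibre of $L_p$. *)
  move=> c' Hc'; pose cr := \row_j c' j; pose Yf := map_mx phi Y.
  have HLf := HT_map phi HL; have [subL _] := HT_field HLf.
  have HE1 : forall w, mapT phi L p (vec w) <-> w *m map_mx phi E = 0.
    by apply: (proj_map (monU p)) => //; rewrite -gS; apply: (HT_in HL).
  have HE2 : forall w, mapT phi L q (vec w) <-> w *m map_mx phi E' = 0.
    by apply: (proj_map (monU q)) => //; [rewrite -gS; apply: (HT_in HL)|case: hE'].
  have Lc : mapT phi L p (vec (cr *m Yf)).
    apply: (subL _ Tp); apply: (@word_Ip_YL _ _ HLf _ _ N Tp (grv F _)).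
    move=> w ew; apply/(Lmx _ _ _ _ HE2); first by apply: inq => //; apply: grv.
    have wm : w \in mon (h *+ N) by rewrite monE ew.
    have iw := wm; rewrite -index_mem in iw.
    apply/rowP => i; rewrite [RHS]mxE; pose x0 : K := (Ordinal iw, i).
    have ew' : wK x0 = w by rewrite /wK /= nth_index.
    rewrite -[in LHS]ew' -[i]/(x0.2) -acomb -[RHS](Hc' x0); apply: eq_bigr => j _.
    rewrite mxE; congr (_ * _); rewrite locphi_i /a.
    transitivity (map_mx phi (crd (mon q) ('X_[wK x0] * vec (row j Y)) *m E') 0 x0.2); last by rewrite mxE.
    rewrite map_mxM; congr ((_ *m _) 0 _); apply/rowP => l; rewrite !mxE -mcoeff_map_mpoly; congr mcoeff.
    by rewrite rmorphM /= map_mpolyX map_vec map_row.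
  move: Lc => /HE1 e0.
  have eXY' : phi g ^+ N1 *: map_mx phi E = map_mx phi X *m Yf.
    by rewrite -map_mxM -eXY; apply/matrixP => i j; rewrite !mxE rmorphM rmorphXn.
  have eYX' : Yf *m map_mx phi X = (phi g ^+ N1)%:M by rewrite -map_mxM eYX map_scalar_mx rmorphXn.
  have : phi g ^+ N1 *: (phi g ^+ N1 *: cr) = 0.
    have := congr1 (fun M => (phi g ^+ N1) *: (M *m map_mx phi X)) e0; rewrite mul0mx scaler0.
    by rewrite scalemxAl scalemxAr eXY' !mulmxA -(mulmxA cr) eYX' -(mulmxA _ Yf) eYX' !mul_mx_scalar.
  move=> /eqP; rewrite !scaler_eq0 (negbTE (expf_neq0 _ g0)) /= => /eqP cr0 j.
  by have := congr1 (fun M : 'rV_ _ => M 0 j) cr0; rewrite !mxE.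
have Hs j : exists s, phi s != 0 /\ s * c 0 j = 0.
  by have /loci_eq0 [s s0 e] := c0 j; exists s.
have [s hs] := choice Hs.
exists (\prod_j s j * g ^+ N1).
  rewrite rmorphM rmorph_prod rmorphXn mulf_neq0 ?expf_neq0 //; apply/prodf_neq0 => j _.
  by case: (hs j).
have := congr1 (fun M : 'rV_ _ => M 0 i0) ec; rewrite [in RHS]mxE -mulrA => <-.
rewrite mxE mulr_sumr big1 // => j _; rewrite (bigD1 j) //= -mulrA mulrCA.
by have [_ e] := hs j; rewrite [s j * _]mulrA e mul0r mulr0.
Qed.

(** The ring of the chart modulo its ideal is the union of the images of the locally free modules
    $S_{hN}/L_{hN}$. A vanishing tensor involves finitely many elements, hence a single [N], where
    the idempotent of the projective quotient reduces the question to coordinates in [W]. *)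
Lemma YL_flat (R : comNzRingType) (L : 'cV[int]_r -> set {mpoly R[n]}) : HT L -> flat_over_base b (YL L).
Proof.
move=> HL s W W' g ginj sq hsq tz Z beta bl br bk.
(* Laurent polynomials tensored with [W'] are modelled by functions on the characters with values in
   [W'], and [Q] is the part coming from [YL L s]; this is the bilinear map on which the vanishing
   hypothesis is tested. *)
pose G (y : laurent R d) (w : W') : 'cV[int]_d -> W' := fun m => coeff m y *: w.
pose Q : set ('cV[int]_d -> W') := span [set u | exists y w, YL L s y /\ u = G y w].
have HQ : is_submodule Q by apply: span_sm.
have GD a y y' w : G (a *: y + y') w = a *: G y w + G y' w.
  by apply: funext => m; rewrite /G coeffD coeffZ scalerDl -scalerA.
have := tz (qm HQ) (fun y w => qmi HQ (G y w)) _ _ _; rewrite big_map /= => tz'.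
have {tz'} : Q (\sum_(x <- sq) G x.1 (g x.2)).
  apply/(qmi_eq0 HQ); rewrite qmi_sum; apply: tz'.
  - by move=> a y y' w _ _; rewrite GD qmi_linear.
  - move=> a y w w' _; rewrite -qmi_linear; congr qmi; apply: funext => m.
    by rewrite -[RHS]/(a *: G y w m + G y w' m) /G scalerDr !scalerA mulrC.
  - by move=> y w _ Yy; apply/(qmi_eq0 HQ); apply: span_sub; exists y, w.
move=> /spanP [q [c [gk [hgk eG]]]].
have Hk i : exists x : laurent R d * W', YL L s x.1 /\ gk i = G x.1 x.2.
  by have [y [w [h1 h2]]] := hgk i; exists (y, w).
have [yw hyw] := choice Hk.
have [N1 hN1] : exists N1, forall x, x \in sq -> forall N', (N1 <= N')%N ->
    exists2 f, graded_piece A (h *+ N') f & x.1 = dh b (mu (val s) *+ N') f.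
  apply: (@seq_bound _ sq (fun x N1 => forall N', (N1 <= N')%N ->
    exists2 f, graded_piece A (h *+ N') f & x.1 = dh b (mu (val s) *+ N') f)).
    by move=> x N N' le H N'' le'; apply: H; apply: leq_trans le'.
  by move=> x /hsq hx; apply: (dh_surj Hex Hmu (valP s) hx).
have [N2 hN2] := @finite_bound 'I_q (fun i N => forall N', (N <= N')%N ->
    exists2 f, L (h *+ N') f & (yw i).1 = dh b (mu (val s) *+ N') f)
  (fun i N N' le H M' le' => H M' (leq_trans le le')) (fun i => YL_lift HL (proj1 (hyw i))).
pose N := (N1 + N2 + t0)%N; pose u := (mu (val s) *+ N)%MM; pose p := h *+ N.
have Tp : inT p by apply: inT_h; rewrite /N; lia.
have [E hE HE] : exists2 E : 'M[R]_(size (mon p)), lf_proj (Qf p) E & forall w, L p (vec w) <-> w *m E = 0.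
  by apply: (proj_of (monU p) (HT_sm HL Tp)); rewrite -gS; apply: (HT_lf HL).
have Hx x : exists f : {mpoly R[n]}, x \in sq -> graded_piece A p f /\ x.1 = dh b u f.
  have [xs|_] := boolP (x \in sq); last by exists 0.
  by have [|f h1 h2] := hN1 x xs N; [rewrite /N; lia|exists f].
have [f hf] := choice Hx.
have Hl i : exists l : {mpoly R[n]}, L p l /\ (yw i).1 = dh b u l.
  by have [|l h1 h2] := hN2 i N; [rewrite /N; lia|exists l].
have [l hl] := choice Hl.
have coefE w : deg w = p -> \sum_(x <- sq) (f x)@_w *: g x.2 = \sum_i c i *: ((l i)@_w *: (yw i).2).
  move=> ew; have [|m hm] := @deg_shf _ _ _ _ _ Hex u 0%MM w.
    by rewrite mdeg_zero addr0 ew /u (mu_degN _ (valP s)).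
  have := congr1 (fun F : 'cV_d -> W' => F m) eG; rewrite !fct_sumE => eGm.
  transitivity (\sum_(x <- sq) G x.1 (g x.2) m).
    by apply: eq_big_seq => x xs; have [_ ex] := hf x xs; rewrite /G ex (dh_coef1 Hex _ hm).
  rewrite eGm; apply: eq_bigr => i _; have [_ ->] := hyw i; have [_ el] := hl i.
  by rewrite -[LHS]/(c i *: G _ _ m) /G el (dh_coef1 Hex _ hm).
pose om (i : 'I_(size (mon p))) : W := \sum_(x <- sq) (crd (mon p) (f x) *m E) 0 i *: x.2.
have mn j : deg (nth 0%MM (mon p) j : 'X_{1..n}) = p \/ (size (mon p) <= j)%N.
  by have [lt|] := ltnP j (size (mon p)); [left; apply/eqP; rewrite -monE mem_nth|right].
have om0 i : om i = 0.
  apply: ginj; rewrite raddf0 /om raddf_sum /=.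
  transitivity (\sum_j E j i *: \sum_(x <- sq) (f x)@_(nth 0%MM (mon p) j) *: g x.2).
    rewrite (eq_bigr (fun x => \sum_j (E j i * (f x)@_(nth 0%MM (mon p) j)) *: g x.2)).
      by rewrite exchange_big; apply: eq_bigr => j _; rewrite scaler_sumr; apply: eq_bigr => x _; rewrite scalerA.
    by move=> x _; rewrite linearZ_LR mxE scaler_suml; apply: eq_bigr => j _; rewrite mxE mulrC.
  transitivity (\sum_k (c k * (crd (mon p) (l k) *m E) 0 i) *: (yw k).2).
    rewrite (eq_bigr (fun j => \sum_k (E j i * (c k * (l k)@_(nth 0%MM (mon p) j))) *: (yw k).2)).
      rewrite exchange_big; apply: eq_bigr => k _; rewrite mxE mulr_sumr scaler_suml; apply: eq_bigr => j _.
      by rewrite mxE mulrCA [E j i * _]mulrC.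
    move=> j _; have [ej|] := mn j; last by rewrite leqNgt ltn_ord.
    by rewrite coefE // scaler_sumr; apply: eq_bigr => k _; rewrite !scalerA mulrA.
  rewrite big1 // => k _; have [Lk _] := hl k.
  have : crd (mon p) (l k) *m E = 0.
    by apply/HE; rewrite crdK // -gS; apply: (HT_in HL).
  by move=> ->; rewrite mxE mulr0 scale0r.
have uo : off (val s) u by apply: (mu_offN _ (valP s)).
have cr (f' : {mpoly R[n]}) : chart_ring b (val s) (dh b u f') by apply: (dh_chart Hex).
have b0 w : beta 0 w = 0.
  have c0 : chart_ring b (val s) (0 : laurent R d) by move=> m; rewrite coeff0 eqxx.
  by have := bl (-1) 0 0 w c0 c0; rewrite scaler0 addr0 scaleN1r addNr.
have b0' v : chart_ring b (val s) v -> beta v 0 = 0.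
  by move=> hv; have := br (-1) v 0 0 hv; rewrite scaler0 addr0 scaleN1r addNr.
have bsum (y : 'rV[R]_(size (mon p))) w : beta (dh b u (vec y)) w =
    \sum_i y 0 i *: beta (dh b u 'X_[nth 0%MM (mon p) i]) w.
  rewrite /vec; elim: (index_enum _) => [|i s' IH]; first by rewrite !big_nil dh_0 b0.
  by rewrite !big_cons (dh_lin Hex) bl // IH.
have bred x : x \in sq -> beta x.1 x.2 = beta (dh b u (vec (crd (mon p) (f x) *m E))) x.2.
  move=> xs; have [gf ex] := hf x xs; rewrite ex.
  have fS : inS (mon p) (f x) by rewrite -gS.
  have := bl (-1) (dh b u (vec (crd (mon p) (f x) *m E))) (dh b u (f x)) x.2 (cr _) (cr _).
  rewrite -(dh_lin Hex) (bk _ x.2) ?scaleN1r //; first by move=> /esym /eqP; rewrite addrC subr_eq0 => /eqP.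
  exists N, (- vec (crd (mon p) (f x) *m E) + f x); split; [by rewrite /N; lia| |by []].
  rewrite -{2}(crdK (monU p) fS) addrC -raddfB; apply/HE.
  by case: hE => EE _; rewrite mulmxBl -mulmxA EE subrr.
rewrite (eq_big_seq _ bred); under eq_bigr do rewrite bsum.
rewrite exchange_big big1 // => i _.
transitivity (beta (dh b u 'X_[nth 0%MM (mon p) i]) (om i)); last by rewrite om0 b0'.
rewrite /om; elim: (sq) => [|x s' IH]; first by rewrite !big_nil b0'.
by rewrite !big_cons br // IH.
Qed.

Lemma field_residue_hilb (R : comNzRingType) (L : 'cV[int]_r -> set {mpoly R[n]}) (F : fieldType)
    (phi : {rmorphism R -> F}) : HT L -> has_hilbert_poly b A (subscheme_base_change phi (YL L)) P.
Proof.
move=> HL; rewrite -(YL_map phi HL); have HLf := HT_map phi HL.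
exists (IY b A (YL (mapT phi L))); last by have [_] := HT_field HLf.
apply: (IY_ideal_of Hfan Hex Hmu (YL_chart HLf)).
by move=> s t; apply: (YL_glue HLf).
Qed.

Lemma YL_point (k : fieldType) (R : comAlgType k) (L : 'cV[int]_r -> set {mpoly R[n]}) : HT L ->
  points (f := Hilb k b A Delta P) (YL L).
Proof.
move=> HL; split.
- by split; [exact: (YL_chart HL)|move=> s t; apply: (YL_glue HL)].
- exact: YL_flat.
by move=> F phi _; apply: field_residue_hilb.
Qed.

End HT.

(** * From flat families to locally free graded pieces *)

Section MkLinear.
Variables (R : nzRingType) (V W : lmodType R) (g : V -> W) (H : linear g).
HB.instance Definition _ := GRing.isLinear.Build R V W *:%R g H.
Definition mk_linear : {linear V -> W} := g.
End MkLinear.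

Section FlatIndep.
Variables (R : comNzRingType) (F : fieldType) (phi : {rmorphism R -> F}).
Hypothesis Hres : is_residue_field phi.

(* Nakayama: unless some x outside ker phi kills all the c_j, one of them stays nonzero in a quotient
   of the localization where all are multiples of it modulo ker phi; this embeds F into that quotient. *)
Lemma residue_embedding q (c : 'I_q -> R) : (forall x, phi x != 0 -> exists j, x * c j <> 0) ->
  exists (i0 : 'I_q) (lam : 'I_q -> F) (W' : lmodType R) (w1 : W') (g : {linear rs phi F^o -> W'}),
    [/\ injective g, lam i0 = 1 & forall j, g (lam j) = c j *: w1].
Proof.
move=> Hc.
(* The ideal generated by the [c j] with [j] in [B] and by the products of all [c j] with the kernel
   of [phi]. *)
pose bB (B : {set 'I_q}) : set R := [set x | exists a : 'I_q -> R,
  (forall j, j \notin B -> phi (a j) = 0) /\ x = \sum_j a j * c j].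
have bBid B : is_ideal (bB B).
  split; first by exists (fun=> 0); split=> [j _|]; rewrite ?raddf0 // big1 // => j _; rewrite mul0r.
  move=> a x y [a1 [h1 ->]] [a2 [h2 ->]]; exists (fun j => a * a1 j + a2 j); split=> [j jB|].
    by rewrite rmorphD rmorphM h1 // h2 // mulr0 addr0.
  by rewrite mulr_sumr -big_split; apply: eq_bigr => j _; rewrite mulrDl mulrA.
have bBc (B : {set 'I_q}) j a : j \in B \/ phi a = 0 -> bB B (a * c j).
  move=> H; exists (fun i => if i == j then a else 0); split=> [i iB|].
    by case: eqP => [e|_]; [case: H => // jB; rewrite e jB in iB|rewrite raddf0].
  by rewrite (bigD1 j) //= eqxx big1 ?addr0 // => i /negbTE ->; rewrite mul0r.
pose bL B x := exists y, phi y != 0 /\ bB B (y * x).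
pose Pr B := ~ forall j, bL B (c j).
(* For empty [B] this is Nakayama's lemma: otherwise a determinant outside the kernel of [phi] would
   kill all the [c j]. *)
have P0 : Pr finset.set0.
  move=> H; have H' j : exists ya : R * ('I_q -> R), [/\ phi ya.1 != 0, forall k, phi (ya.2 k) = 0 &
      ya.1 * c j = \sum_k ya.2 k * c k].
    have [y [y0 [a [ha e]]]] := H j; exists (y, a); split => //= k.
    by apply: ha; rewrite finset.inE.
  have [ya hya] := choice H'.
  pose M : 'M[R]_q := \matrix_(j, k) ((ya j).1 *+ (j == k) - (ya j).2 k).
  have Mc i : [set 0 : R^o] (\det M *: (c i : R^o)).
    apply: (@adj_module R R^o [set 0] q M c) => [|j].
      by split=> // a u v /= -> ->; rewrite scaler0 addr0.
    rewrite /= -[RHS](subrr ((ya j).1 * c j)); have [_ _ {2}->] := hya j.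
    rewrite (eq_bigr (fun k => (ya j).1 *+ (j == k) * c k - (ya j).2 k * c k)).
      rewrite sumrB (bigD1 j) //= eqxx big1 ?addr0 // => k jk.
      by rewrite eq_sym (negbTE jk) mul0r.
    by move=> k _; rewrite mxE -mulrBl.
  have [|j hj] := Hc (\det M); last by apply: hj; apply: Mc.
  rewrite -det_map_mx (_ : map_mx phi M = diag_mx (\row_j phi (ya j).1)).
    by rewrite det_diag; apply/prodf_neq0 => j _; rewrite mxE; case: (hya j).
  apply/matrixP => j k; rewrite !mxE rmorphB rmorphMn; have [_ -> _] := hya j.
  by rewrite subr0; case: eqP => // ->.
(* For a maximal [B], adding any missing index [i0] brings every [c j] into the ideal after
   localization; so, modulo [bB B], all are multiples of [c i0]. *)
have [B /asboolP PB maxB] : exists2 B, `[< Pr B >] & forall B', `[< Pr B' >] -> (#|B'| <= #|B|)%N.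
  by case: (@arg_maxnP _ finset.set0 (fun B => `[< Pr B >]) (fun B => #|B|)); [exact/asboolP|move=> B h1 h2; exists B].
have [i0 ni0] : exists i0, ~ bL B (c i0) by apply/existsNP.
have i0B : i0 \notin B.
  apply/negP => h; apply: ni0; exists 1; rewrite rmorph1 oner_eq0 mul1r -[c i0]mul1r; split => //.
  by apply: bBc; left.
have nPB : ~ Pr (i0 |: B)%SET by move/asboolP/maxB; rewrite cardsU1 i0B ltnn.
have /contrapT Hj := nPB.
have H' j : exists ya : R * R, phi ya.1 != 0 /\ bB B (ya.1 * c j - ya.2 * c i0).
  have [y [y0 [a [ha e]]]] := Hj j; exists (y, a i0); split => //=.
  exists (fun k => if k == i0 then 0 else a k); split=> [k kB|].
    case: eqP => [_|/eqP ne]; first exact: raddf0.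
    by apply: ha; rewrite finset.inE finset.in_set1 negb_or ne.
  rewrite e [in RHS](bigD1 i0) //= eqxx mul0r add0r [in LHS](bigD1 i0) //= addrAC subrr add0r.
  by apply: eq_bigr => k /negbTE ->.
have [ya hya] := choice H'.
have XS x : phi x != 0 -> ~ bB B x.
  by move=> x0 hx; apply: ni0; exists x; split => //; apply: (idMr _ (bBid B)).
pose X : fqdata R := @FQData R (bB B) [set x | phi x != 0] (bBid B)
  (introT negP (fun e => negP (oner_neq0 F) (eq_ind _ (fun z => z == 0) e _ (rmorph1 phi))))
  (fun x y hx hy => eq_ind_r (fun z => z != 0) (mulf_neq0 hx hy) (rmorphM phi x y)) XS.
pose io : {rmorphism R -> fq X} := fqi X.
have io0 x : bB B x -> io x = 0.
  by move=> hx; apply/fqi_eq0; exists 1; rewrite ?mul1r //= rmorph1 oner_neq0.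
have ioU y : phi y != 0 -> exists v, io y * v = 1 by move=> hy; apply: fqi_unit.
have ioc x y : phi x = phi y -> io x * io (c i0) = io y * io (c i0).
  move=> e; apply/eqP; rewrite -subr_eq0 -mulrBl -rmorphB -rmorphM; apply/eqP/io0.
  by apply: bBc; right; rewrite rmorphB e subrr.
have cancel y u v : phi y != 0 -> io y * u = io y * v -> u = v.
  by move=> /ioU [z hz] e; rewrite -[u]mul1r -[v]mul1r -hz [io y * z]mulrC -!mulrA e.
have gex (z : F) : exists w : fq X, forall x y, phi y != 0 -> z * phi y = phi x -> io y * w = io x * io (c i0).
  have [x1 [y1 [y10 ez]]] := Hres z; have [v hv] := ioU y1 y10.
  exists (io x1 * io (c i0) * v) => x y y0 ex; apply: (cancel y1) => //.
  transitivity (io (y * x1) * io (c i0) * (io y1 * v)); first by rewrite rmorphM; ring.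
  rewrite hv mulr1 [RHS]mulrA -[io y1 * io x]rmorphM; apply: ioc.
  by rewrite !rmorphM -ex ez; field.
have [g hg] := choice gex.
have glin : linear (g : rs phi F^o -> rs io (fq X)^o).
  move=> a u v; have [x1 [y1 [y10 e1]]] := Hres u; have [x2 [y2 [y20 e2]]] := Hres v.
  have h1 := hg u x1 y1 y10 ltac:(by rewrite e1; field).
  have h2 := hg v x2 y2 y20 ltac:(by rewrite e2; field).
  have y0 : phi (y1 * y2) != 0 by rewrite rmorphM mulf_neq0.
  apply: (cancel (y1 * y2)) => //.
  rewrite (hg _ (a * x1 * y2 + x2 * y1)) //; last first.
    by rewrite !rmorphD !rmorphM /= rsscaleE e1 e2 -[_ *: _]/(_ * _); field; rewrite y10 y20.
  rewrite [X in _ = _ * (X + _)]rsscaleE -[_ *: _]/(_ * _) mulrDr.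
  have -> : io (y1 * y2) * (io a * g u) = io a * io y2 * (io y1 * g u) by rewrite rmorphM; ring.
  have -> : io (y1 * y2) * g v = io y1 * (io y2 * g v) by rewrite rmorphM; ring.
  by rewrite h1 h2 !rmorphD !rmorphM; ring.
pose G : {linear rs phi F^o -> rs io (fq X)^o} := mk_linear glin.
have gy x y : phi y != 0 -> io y * g (phi x / phi y) = io x * io (c i0).
  by move=> y0; apply: hg => //; rewrite mulfVK.
have c0 : io (c i0) <> 0.
  by move=> /fqi_eq0 [y y0 hy]; apply: ni0; exists y.
have Ginj : injective G.
  move=> u v /eqP; rewrite -subr_eq0 -raddfB => /eqP; set z := (u - v) => gz.
  apply/eqP; rewrite -subr_eq0 -/z; apply/eqP.
  have [x [y [y0 ez]]] := Hres (z : F); have := gy x y y0; rewrite -ez.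
  have -> : g z = 0 by [].
  rewrite mulr0 => /esym e; rewrite ez; have [->|x0] := eqVneq (phi x) 0; first by rewrite mul0r.
  by case: c0; apply: (cancel x) => //; rewrite mulr0.
exists i0, (fun j => if j == i0 then 1 else phi (ya j).2 / phi (ya j).1), (rs io (fq X)^o), (1 : fq X), G; split => //.
  by rewrite eqxx.
move=> j; have -> : c j *: (1 : rs io (fq X)^o) = io (c j) by rewrite rsscaleE -[_ *: _]/(_ * _) mulr1.
case: eqP => [->|_].
  have := hg 1 1 1; rewrite rmorph1 oner_eq0 mulr1 => /(_ isT erefl).
  by rewrite rmorph1 !mul1r.
have [y0 hb] := hya j; apply: (cancel (ya j).1) => //; rewrite -[G _]/(g _) gy // -!rmorphM.
by apply/eqP; rewrite eq_sym -subr_eq0 -rmorphB; apply/eqP; apply: io0.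
Qed.

(** In the tensor product with [W'], $\sum_j v_j \otimes g(\lambda_j) = (\sum_j c_j v_j) \otimes w_1
    = 0$. Flatness along the injection [g] gives $\sum_j v_j \otimes \lambda_j = 0$ over the residue
    field, whatever the coefficients [c] become there. *)
Lemma flat_residue (V : lmodType R) (VF : lmodType F) (V0 N : set V) (NF : set VF) (m : V -> VF) q
    (c : 'I_q -> R) (lam : 'I_q -> F) (W' : lmodType R) (w1 : W') (g : {linear rs phi F^o -> W'}) :
  injective g -> (forall j, g (lam j) = c j *: w1) ->
  is_submodule V0 -> is_flat V0 N -> is_submodule NF ->
  (forall a u v, m (a *: u + v) = phi a *: m u + m v) -> (forall v, N v -> NF (m v)) ->
  forall v : 'I_q -> V, (forall j, V0 (v j)) -> N (\sum_j c j *: v j) -> NF (\sum_j lam j *: m (v j)).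
Proof.
move=> gi ge HV flat HNF ml mN v hv hN.
pose sq := [seq (v j, lam j : rs phi F^o) | j <- enum 'I_q].
have H1 x : x \in sq -> V0 x.1 by move=> /mapP [j _ ->]; apply: hv.
have H2 : tensor_zero V0 N [seq (x.1, g x.2) | x <- sq].
  move=> Z beta b1 b2 b3; rewrite -map_comp big_map /= big_enum /=.
  have b0 w : beta 0 w = 0 by have := b1 (-1) 0 0 w (sm0 HV) (sm0 HV); rewrite scaler0 addr0 scaleN1r addNr.
  have b0' x : V0 x -> beta x 0 = 0 by move=> hx; have := b2 (-1) x 0 0 hx; rewrite scaler0 addr0 scaleN1r addNr.
  have bZ x a w : V0 x -> beta x (a *: w) = a *: beta x w.
    by move=> hx; rewrite -[a *: w]addr0 b2 // b0' // addr0.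
  transitivity (beta (\sum_j c j *: v j) w1); last by apply: b3 => //; apply: (sm_sum _ HV) => j _; apply: (smZ _ HV).
  elim: (index_enum _) => [|j s IH]; first by rewrite !big_nil b0.
  rewrite !big_cons b1 //; first by rewrite ge bZ // IH.
  by apply: (sm_sum _ HV) => i _; apply: (smZ _ HV).
have := flat _ _ g gi sq H1 H2 (rs phi (qm HNF)) (fun x w => qmi HNF ((w : F) *: m x)).
rewrite big_map /= big_enum /= => H; apply/(qmi_eq0 HNF); rewrite qmi_sum; apply: H.
- move=> a x x' w _ _; rewrite ml rsscaleE -qmi_linear; congr qmi.
  by rewrite scalerDr !scalerA mulrC.
- move=> a x w w' _; rewrite !rsscaleE -qmi_linear; congr qmi.
  by rewrite -[_ *: (w : F^o)]/(_ * _) scalerDl scalerA.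
by move=> x w _ hx; apply/(qmi_eq0 HNF); apply: (smZ _ HNF); apply: mN.
Qed.

End FlatIndep.

Section SpanFinite.
Variables (F : fieldType) (n : nat) (ms : seq 'X_{1..n}).
Hypothesis msU : uniq ms.

Lemma span_finite (N : set {mpoly F[n]}) : is_submodule N -> N `<=` inS ms ->
  exists2 gs : seq {mpoly F[n]}, (forall g, g \in gs -> N g) & N `<=` span [set` gs].
Proof.
move=> HN NS.
have H m : exists f, leads N ms m -> [/\ N f, inS ms f, f != 0 & mlead f = m].
  by have [[f hf]|no] := pselect (leads N ms m); [exists f|exists 0].
have [f hf] := choice H.
exists [seq f m | m <- ms & `[< leads N ms m >]].
  by move=> g /mapP [m]; rewrite mem_filter => /andP [/asboolP lm _] ->; case: (hf m lm).
have sub : [set` [seq f m | m <- ms & `[< leads N ms m >]]] `<=` N.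
  by move=> g /= /mapP [m]; rewrite mem_filter => /andP [/asboolP lm _] ->; case: (hf m lm).
move=> g Ng; apply: (leads_eq msU (span_sm _) HN) (NS _ Ng) Ng; first exact: span_min.
move=> m mm lm; have [h1 h2 h3 h4] := hf m lm; exists (f m); split => //.
by apply: span_sub => /=; apply: map_f; rewrite mem_filter mm andbT; apply/asboolP.
Qed.

Lemma codim_minor (N : set {mpoly F[n]}) q : is_submodule N -> has_dim (inS ms) N q ->
  (q <= size ms)%N /\ exists M : 'M[F]_(size ms - q, size ms), row_free M /\ forall i, N (vec (row i M)).
Proof.
move=> HN /has_dim_locally_free lf; have [E [EE [fs [fs1 fsE]]] HE] := proj_of msU HN lf.
have [f ff f0] := unit_ideal_image idfun fs1; have [N0 [X [Y [eXY eYX]]]] := fsE f ff.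
have rE : \rank E = q.
  have fN : f ^+ N0 != 0 by apply: expf_neq0.
  apply/eqP; rewrite eqn_leq; apply/andP; split.
    have -> : \rank E = \rank (f ^+ N0 *: E) by rewrite mxrank_scale_nz.
    by rewrite eXY (leq_trans (mxrankM_maxr _ _)) // rank_leq_row.
  have : \rank (Y *m (f ^+ N0 *: E) *m X) = q.
    rewrite eXY !mulmxA -mulmxA eYX -scalar_mxM -scalemx1 mxrank_scale_nz ?mxrank1 //.
    by rewrite mulf_neq0.
  move=> {1}<-; rewrite -scalemxAr -scalemxAl mxrank_scale_nz //.
  by apply: leq_trans (mxrankM_maxl _ _) _; apply: mxrankM_maxr.
split; first by rewrite -rE rank_leq_row.
have -> : (size ms - q = \rank (kermx E))%N by rewrite mxrank_ker rE.
exists (row_base (kermx E)); split; first exact: row_base_free.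
move=> i; apply/HE; have /sub_kermxP : (row_base (kermx E) <= kermx E)%MS by rewrite eq_row_base.
by rewrite -row_mul => ->; rewrite row0.
Qed.

End SpanFinite.

Section HilbToHT.
Variables (RR : realType) (d n r : nat) (b : 'M[int]_(d, n)) (Delta : {set {set 'I_n}}).
Variables (A : 'M[int]_(r, n)) (h : 'cV[int]_r) (mu : {set 'I_n} -> 'X_{1..n}).
Variable (mon : 'cV[int]_r -> seq 'X_{1..n}).
Hypothesis TS : toric_setup RR b Delta A h mu mon.
Variables (P : {mpoly rat[r]}) (pts : seq 'cV[int]_r) (t0 : nat) (Qf : 'cV[int]_r -> nat).
Hypothesis RS : ray_setup Delta A h mon P pts t0 Qf.
Local Notation deg := (mdegree A).
Local Notation chart := {s : {set 'I_n} | s \in Delta}.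
Let Hfan := ts_fan TS.
Let Hex := ts_ex TS.
Let Hmu := ts_mu TS.
Let monU := ts_uniq TS.
Let monE := ts_monE TS.
Let gS := graded_inS monE.

Lemma base_change_chart (R R' : comNzRingType) (phi : {rmorphism R -> R'}) (Y : chart_ideals R d Delta) :
  (forall s, is_chart_ideal b (val s) (Y s)) ->
  forall s, is_chart_ideal b (val s) (subscheme_base_change phi Y s).
Proof.
move=> HY s; rewrite base_changeE; have [h1 h2 h3] := HY s.
have crs : is_submodule (@chart_ring R' d n b (val s)).
  split=> [m|a u v hu hv m]; first by rewrite coeff0 eqxx.
  apply: contra_neqP => no; rewrite coeffD coeffZ.
  have e g' : chart_ring b (val s) g' -> coeff m g' = 0 by move=> h'; apply/eqP; apply: contra_notT no => /h'.
  by rewrite !e // mulr0 addr0.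
split; [apply: span_min => //| exact: span_sm|].
  move=> _ [g Yg <-] m; rewrite coeff_mapL; apply: contra_neqP => no.
  by have [->|/(h1 _ Yg)] := eqVneq (coeff m g) 0; rewrite ?raddf0.
move=> m g hm; move: g; apply: (@span_min _ _ _ [set g | span (mapL phi @` Y s) (translate m g)]).
  split=> /=.
    by rewrite (_ : translate m 0 = 0); [exact: (sm0 (span_sm _))|apply: lext => x; rewrite coeff_translate !coeff0].
  move=> a u v hu hv; rewrite (_ : translate m _ = a *: translate m u + translate m v).
    by apply: (smD (span_sm _)) => //; apply: (smZ _ (span_sm _)).
  by apply: lext => x; rewrite coeffD coeffZ !coeff_translate coeffD coeffZ.
move=> _ [g Yg <-] /=; apply: span_sub; exists (translate m g); first exact: h3.
by apply: lext => x; rewrite coeff_mapL !coeff_translate coeff_mapL.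
Qed.

Lemma base_change_comp (R R' R'' : comNzRingType) (phi : {rmorphism R -> R'}) (psi : {rmorphism R' -> R''})
    (chi : {rmorphism R -> R''}) (Y : chart_ideals R d Delta) : (forall x, chi x = psi (phi x)) ->
  subscheme_base_change chi Y = subscheme_base_change psi (subscheme_base_change phi Y).
Proof.
move=> e; rewrite !base_changeE; apply: funext => s.
have em g : mapL chi g = mapL psi (mapL phi g) by apply: lext => x; rewrite !coeff_mapL e.
apply/seteqP; split; apply: span_min; try exact: span_sm.
  by move=> _ [g Yg <-]; apply: span_sub; exists (mapL phi g); [apply: span_sub; exists g|rewrite em].
move=> _ [g + <-]; move: g.
apply: (@span_min _ _ _ [set g | span (mapL chi @` Y s) (mapL psi g)]).
  split=> /=; first by rewrite mapL0; apply: (sm0 (span_sm _)).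
  by move=> a u v hu hv; rewrite mapL_lin; apply: (smD (span_sm _)) => //; apply: (smZ _ (span_sm _)).
by move=> _ [g Yg <-] /=; apply: span_sub; exists g => //; rewrite em.
Qed.

Lemma Ip_map (R R' : comNzRingType) (phi : {rmorphism R -> R'}) (Y : chart_ideals R d Delta) p f :
  Ip b A Y p f -> Ip b A (subscheme_base_change phi Y) p (map_mpoly phi f).
Proof.
move=> [gf H]; split.
  apply/graded_pieceP => w ne; rewrite mcoeff_map_mpoly.
  by rewrite (proj1 (graded_pieceP _ _ _) gf) ?raddf0.
move=> s u w hu hw e; rewrite base_changeE; apply: span_sub; exists (dh b u ('X_[w] * f)); first exact: H.
by rewrite (mapL_dh Hex) rmorphM /= map_mpolyX.
Qed.

Lemma Ip_HT0 (R : comNzRingType) (Y : chart_ideals R d Delta) :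
  (forall s, is_chart_ideal b (val s) (Y s)) -> HT0 A h pts (Ip b A Y).
Proof.
move=> HY; split=> [p _|p _|p q m f _ _ em If]; first exact: (Ip_sm Hex HY).
  by move=> f [].
by rewrite -[q](subrK p) -em addrC; apply: (Ip_mul Hfan Hex HY).
Qed.

Lemma YL_Ip (R : comNzRingType) (Y : chart_ideals R d Delta) : is_closed_subscheme b Y -> YL b h mu t0 (Ip b A Y) = Y.
Proof.
move=> [HY HYg]; apply: funext => s; apply/seteqP; split=> g.
  move=> [N [f [_ [gf If] ->]]]; have := If s (mu (val s) *+ N)%MM 0%MM.
  rewrite mpolyX0 mul1r; apply; first exact: (mu_offN TS _ (valP s)).
    by move=> i _; rewrite mnm0E.
  by rewrite mdeg_zero addr0 (mu_degN TS _ (valP s)).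
move=> /(chart_lift Hfan Hex Hmu HY HYg) [N hN]; have [f If ->] := hN (N + t0)%N (leq_addr _ _).
by exists (N + t0)%N, f; rewrite leq_addl.
Qed.

(** Membership is a condition on finitely many charts, with one trivialization each, so finitely
    many denominators are cleared. *)
Lemma Ip_loc (R T : comNzRingType) (F : fieldType) (phi : {rmorphism R -> F}) (io : {rmorphism R -> T})
    (Y : chart_ideals R d Delta) p f :
  (forall a, exists x y, phi y != 0 /\ io y * a = io x) ->
  (forall x, io x = 0 -> exists2 y, phi y != 0 & y * x = 0) ->
  (forall s, is_chart_ideal b (val s) (Y s)) -> graded_piece A p f ->
  Ip b A (subscheme_base_change io Y) p (map_mpoly io f) ->
  exists y, phi y != 0 /\ Ip b A Y p (y *: f).
Proof.
move=> iofrac ioeq0 HY gf [_ H].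
have Hs (s : chart) : exists y, phi y != 0 /\ forall u w, off (val s) u -> off (val s) w -> deg u = p + deg w ->
    Y s (dh b u ('X_[w] * (y *: f))).
  have [u [w [hu hw e]]] := off_rep Hfan Hex p (valP s).
  have Ys : is_submodule (Y s) by case: (HY s).
  have := H s u w hu hw e; rewrite -(map_mpolyX io) -rmorphM /= -(mapL_dh Hex) base_changeE.
  set v0 := dh b u _ => Hv.
  have [y [y0 [g Yg eg]]] : exists y, phi y != 0 /\ exists2 g, Y s g & io y *: mapL io v0 = mapL io g.
    move: Hv; apply: (@span_min _ _ _ [set v | exists y, phi y != 0 /\ exists2 g, Y s g & io y *: v = mapL io g]).
      split; first by exists 1; rewrite rmorph1 oner_neq0; split => //; exists 0; [exact: sm0|rewrite mapL0 scaler0].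
      move=> a v1 v2 [y1 [y10 [g1 Y1 e1]]] [y2 [y20 [g2 Y2 e2]]].
      have [ra [sa [sa0 ea]]] := iofrac a.
      exists (sa * y1 * y2); rewrite !rmorphM !mulf_neq0 //; split => //.
      exists ((ra * y2) *: g1 + (sa * y1) *: g2).
        by apply: (smD Ys); apply: (smZ _ Ys).
      rewrite mapL_lin -[_ *: g2]addr0 mapL_lin mapL0 addr0 -e1 -e2 scalerDr !scalerA !rmorphM.
      by congr (_ *: _ + _); rewrite -ea; ring.
    by move=> _ [g Yg <-]; exists 1; rewrite rmorph1 oner_neq0; split => //; exists g; rewrite ?rmorph1 ?scale1r.
  have [y' [y'0 hy']] : exists y', phi y' != 0 /\ forall m, y' * coeff m (y *: v0 - g) = 0.
    have Hm m : exists y', phi y' != 0 /\ y' * coeff m (y *: v0 - g) = 0.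
      have /ioeq0 [y' h1 h2] : io (coeff m (y *: v0 - g)) = 0.
        by rewrite coeffB coeffZ rmorphB rmorphM -!(coeff_mapL io) -coeffZ eg subrr.
      by exists y'.
    have [yy hyy] := choice Hm.
    exists (\prod_(m <- dom (y *: v0 - g)) yy m); split.
      by rewrite rmorph_prod prodf_seq_neq0; apply/allP => m _; case: (hyy m).
    move=> m; have [md|md] := boolP (m \in dom (y *: v0 - g)); last by rewrite (coeff_outdom md) mulr0.
    rewrite (bigD1_seq m) ?uniq_dom //= mulrAC; have [_ ->] := hyy m; exact: mul0r.
  exists (y' * y); rewrite rmorphM mulf_neq0 //; split => // u1 w1 hu1 hw1 e1'.
  apply: (chart_indep Hex HY hu hw hu1); first by rewrite !mdeg_add e e1' addrAC.
  rewrite -scalerAr -[_ *: _]addr0 (dh_lin Hex) dh_0 addr0 -/v0 -scalerA.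
  have -> : y' *: (y *: v0) = y' *: g; last exact: (smZ _ Ys).
  apply/eqP; rewrite -subr_eq0 -scalerBr; apply/eqP; apply: lext => m.
  by rewrite coeffZ hy' coeff0.
have [yy hyy] := choice Hs.
exists (\prod_s yy s); split; first by rewrite rmorph_prod; apply/prodf_neq0 => s _; case: (hyy s).
split; first by apply: (smZ _ (graded_sm _ _ _)).
move=> s u w hu hw e; have [_ /(_ u w hu hw e)] := hyy s; have Ys : is_submodule (Y s) by case: (HY s).
rewrite (bigD1 s) //= [yy s * _]mulrC -scalerA => Hy.
rewrite -scalerAr -[_ *: _]addr0 (dh_lin Hex) dh_0 addr0.
exact: (smZ _ Ys).
Qed.

End HilbToHT.

Lemma chart_ring_sm (R : comNzRingType) (d n : nat) (b : 'M[int]_(d, n)) s : is_submodule (@chart_ring R d n b s).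
Proof.
split=> [m|a u v hu hv m]; first by rewrite coeff0 eqxx.
apply: contra_neqP => no; rewrite coeffD coeffZ.
have e g' : chart_ring b s g' -> coeff m g' = 0 by move=> h'; apply/eqP; apply: contra_notT no => /h'.
by rewrite !e // mulr0 addr0.
Qed.

Lemma clear_poly (R T : comNzRingType) (F : fieldType) (phi : {rmorphism R -> F}) (io : {rmorphism R -> T})
    (n : nat) (ms : seq 'X_{1..n}) (f : {mpoly T[n]}) :
  (forall a, exists x y, phi y != 0 /\ io y * a = io x) -> inS ms f ->
  exists y f0, [/\ phi y != 0, inS ms f0 & io y *: f = map_mpoly io f0].
Proof.
move=> iofrac fS.
pose N := [set f : {mpoly T[n]} | exists y f0, [/\ phi y != 0, inS ms f0 & io y *: f = map_mpoly io f0]].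
have HN : is_submodule N.
  split; first by exists 1, 0; split; [rewrite rmorph1 oner_neq0|exact: (sm0 (inS_sm _))|rewrite scaler0 raddf0].
  move=> a u v [y1 [f1 [h1 s1 e1]]] [y2 [f2 [h2 s2 e2]]]; have [x [y [y0 e]]] := iofrac a.
  exists (y * y1 * y2), ((x * y2) *: f1 + (y * y1) *: f2); split.
  - by rewrite !rmorphM !mulf_neq0.
  - by apply: (smD (inS_sm _)); apply: (smZ _ (inS_sm _)).
  rewrite [RHS]raddfD /= !map_mpolyZ -e1 -e2 scalerDr !scalerA !rmorphM.
  by congr (_ *: _ + _); rewrite -e; ring.
have : N f; last by [].
rewrite [f]mpolyE big_seq; apply: (sm_sum _ HN) => m mf; apply: (smZ _ HN).
exists 1, 'X_[m]; rewrite !rmorph1 oner_neq0 scale1r map_mpolyX; split => //.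
by apply: inS_X; apply: fS.
Qed.

Section HilbToHT2.
Variables (RR : realType) (d n r : nat) (b : 'M[int]_(d, n)) (Delta : {set {set 'I_n}}).
Variables (A : 'M[int]_(r, n)) (h : 'cV[int]_r) (mu : {set 'I_n} -> 'X_{1..n}).
Variable (mon : 'cV[int]_r -> seq 'X_{1..n}).
Hypothesis TS : toric_setup RR b Delta A h mu mon.
Variables (P : {mpoly rat[r]}) (pts : seq 'cV[int]_r) (t0 : nat) (Qf : 'cV[int]_r -> nat).
Hypothesis RS : ray_setup Delta A h mon P pts t0 Qf.
Local Notation deg := (mdegree A).
Local Notation chart := {s : {set 'I_n} | s \in Delta}.
Let Hfan := ts_fan TS.
Let Hex := ts_ex TS.
Let Hmu := ts_mu TS.
Let monU := ts_uniq TS.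
Let monE := ts_monE TS.
Let gS := graded_inS monE.

Section AtResidueField.
Variables (R : comNzRingType) (Y : chart_ideals R d Delta).
Hypotheses (HY : forall s, is_chart_ideal b (val s) (Y s)) (flat : flat_over_base b Y).
Variables (F : fieldType) (phi : {rmorphism R -> F}).
Hypothesis Hres : is_residue_field phi.
Let YF := subscheme_base_change phi Y.
Let HYF := base_change_chart phi HY.

(** Otherwise [residue_embedding] provides coefficients [lam] with [lam i0 = 1], and flatness on
    every chart turns the relation with coefficients [c] into one over the residue field with
    coefficients [lam]. *)
Lemma residue_indep p q (e : 'I_q -> {mpoly R[n]}) (c : 'I_q -> R) : (forall j, graded_piece A p (e j)) ->
  (forall c : 'I_q -> F, Ip b A YF p (\sum_j c j *: map_mpoly phi (e j)) -> forall j, c j = 0) ->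
  Ip b A Y p (\sum_j c j *: e j) -> exists x, phi x != 0 /\ forall j, x * c j = 0.
Proof.
move=> ge ind [_ Ic]; apply: contrapT => no.
have [|i0 [lam [W' [w1 [g [gi l1 gE]]]]]] := @residue_embedding R F phi Hres q c.
  move=> x x0; apply: contrapT => no'; apply: no; exists x; split => // j.
  by apply: contrapT => h'; apply: no'; exists j.
have : Ip b A YF p (\sum_j lam j *: map_mpoly phi (e j)).
  split.
    apply: (sm_sum _ (graded_sm _ _ _)) => j _; apply: (smZ _ (graded_sm _ _ _)); apply/graded_pieceP => w ne.
    by rewrite mcoeff_map_mpoly (proj1 (graded_pieceP _ _ _) (ge j)) ?raddf0.
  move=> s u w hu hw eu.
  have dhs (T : comNzRingType) (a : 'I_q -> T) (f : 'I_q -> {mpoly T[n]}) :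
      dh b u ('X_[w] * \sum_j a j *: f j) = \sum_j a j *: dh b u ('X_[w] * f j).
    rewrite mulr_sumr; elim: (index_enum _) => [|j s' IH]; first by rewrite !big_nil dh_0.
    by rewrite !big_cons -scalerAr (dh_lin Hex) IH.
  have := flat_residue gi gE (@chart_ring_sm R d n b (val s)) (@flat s) (NF := YF s) (m := mapL phi).
  case: (HYF s) => _ YFs _ => /(_ YFs (mapL_lin phi)) H.
  rewrite dhs; have := H _ (fun j => dh b u ('X_[w] * e j)).
  rewrite (eq_bigr (fun j => lam j *: dh b u ('X_[w] * map_mpoly phi (e j)))); last first.
    by move=> j _; rewrite (mapL_dh Hex) rmorphM /= map_mpolyX.
  apply.
  - by move=> v Yv; rewrite /YF base_changeE; apply: span_sub; exists v.
  - by move=> j; apply: (dh_chart Hex).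
  by rewrite -dhs; apply: Ic.
by move=> /ind /(_ i0) /eqP; rewrite l1 oner_eq0.
Qed.

Hypothesis HYg : forall s t : chart, val t \subset val s -> Y t = smallest (@is_chart_ideal R d n b (val t)) (Y s).
Hypothesis hilb : has_hilbert_poly b A YF P.
Variable p0 : 'cV[int]_r.
Hypothesis p0T : p0 \in pts.
Let J t := Ip b A YF (p0 + h *+ t).

Lemma J_ray t : [/\ has_dim (inS (ray h mon p0 t)) (J t) (Qf (p0 + h *+ t)), gen_at (mon h) J t & hsat (mon h) (ray h mon p0) J t].
Proof.
move: t; apply: (T_mum RS p0T (fam_Ip TS p0 HYF)).
have [I HI [vs hvs]] := hilb; rewrite (saturated_ideal_uniq Hfan Hex HI HYF) in hvs.
have [N hN] : exists N, forall v, v \in vs -> forall t, (N <= t)%N -> nef_monoid A Delta (p0 + h *+ t - v).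
  apply: (@seq_bound _ vs (fun v N1 => forall t, (N1 <= t)%N -> nef_monoid A Delta (p0 + h *+ t - v))).
    by move=> v N N' le H t le'; apply: H; apply: leq_trans le'.
  move=> v _; have [N hN] := nef_deep Hfan Hex Hmu (p0 - v); exists N => t /hN.
  by rewrite addrAC.
exists N => t le; have [|q hq eq] := hvs (p0 + h *+ t); first by move=> v /hN; apply.
have -> : Qf (p0 + h *+ t) = q by apply/eqP; rewrite -(eqr_nat rat) -(T_poly RS t p0T) eq.
rewrite /ray -gS; move: hq; apply: has_dim_ext; first exact: graded_sm.
by move=> v gv; apply: (IY_Ip Hex HYF gv).
Qed.

(** On the ray the fibre ideal is generated by its first piece, which has finitely many generators.
    Each comes from the family after multiplication by monomials of large degree, since the fibre is
    defined by the reductions of the ideal of [Y]. *)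
Lemma J_lift_deep : exists N, forall t, (N <= t)%N -> J t `<=` mapT phi (Ip b A Y) (p0 + h *+ t).
Proof.
have HL : HT0 A h pts (mapT phi (Ip b A Y)) := HT0_map phi (Ip_HT0 TS pts HY).
have eYF : YF = YL b h mu t0 (mapT phi (Ip b A Y)).
  by rewrite (YL_map TS RS phi (Ip_HT0 TS pts HY)) (YL_Ip TS t0 (conj HY HYg)).
have T0 : inT h pts (p0 + h *+ 0) by exists p0 => //; exists 0%N.
have [|||gs gsJ gsS] := @span_finite F n (mon (p0 + h *+ 0)) _ (J 0).
- exact: monU.
- exact: (Ip_sm Hex HYF).
- by move=> f [gf _]; rewrite -gS.
have [N hN] : exists N, forall g, g \in gs -> forall N' w, (N <= N')%N -> deg w = h *+ N' ->
    mapT phi (Ip b A Y) (p0 + h *+ 0 + h *+ N') ('X_[w] * g).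
  apply: (@seq_bound _ gs (fun g N => forall N' w, (N <= N')%N -> deg w = h *+ N' ->
    mapT phi (Ip b A Y) (p0 + h *+ 0 + h *+ N') ('X_[w] * g))).
    by move=> g N N' le H N'' w le'; apply: H; apply: leq_trans le'.
  by move=> g /gsJ; rewrite /J eYF; apply: (Ip_YL_word TS RS HL T0).
have gen t : J t `<=` span [set f | exists w g, [/\ deg w = h *+ t, g \in gs & f = 'X_[w] * g]].
  elim: t => [|t IH].
    move=> f /gsS; apply: span_min; first exact: span_sm.
    by move=> g gg; apply: span_sub; exists 0%MM, g; rewrite mdeg_zero mulr0n mpolyX0 mul1r.
  have [_ ga _] := J_ray t; move=> f /ga; apply: span_min; first exact: span_sm.
  move=> _ [g [f' [gG Jf' ->]]]; move: f' {Jf'} (IH _ Jf').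
  apply: (@span_min _ _ _ [set f' | span _ ('X_[g] * f')]).
    split=> /=; first by rewrite mulr0; apply: (sm0 (span_sm _)).
    by move=> a u v hu hv; rewrite mulrDr -scalerAr; apply: (smD (span_sm _)) => //; apply: (smZ _ (span_sm _)).
  move=> _ [w [g' [ew gg ->]]] /=; apply: span_sub; exists (g + w)%MM, g'; split => //.
    by move: gG; rewrite monE => /eqP eg; rewrite mdeg_add eg ew mulrS.
  by rewrite mpolyXD mulrA.
exists N => t le f /gen; apply: span_min; first exact: span_sm.
by move=> _ [w [g [ew gg ->]]]; have := hN g gg t w le ew; rewrite addr0.
Qed.

Variables (T : comNzRingType) (io : {rmorphism R -> T}) (ph : {rmorphism T -> F}).
Hypotheses (iofrac : forall a, exists x y, phi y != 0 /\ io y * a = io x).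
Hypotheses (ioeq0 : forall x, io x = 0 -> exists2 y, phi y != 0 & y * x = 0).
Hypotheses (ioU : forall y, phi y != 0 -> exists v, io y * v = 1).
Hypotheses (phio : forall x, ph (io x) = phi x) (Hl : local_map ph).
Let Yl := subscheme_base_change io Y.
Let HYl := base_change_chart io HY.
Let I' t := Ip b A Yl (p0 + h *+ t).

Lemma YlF : YF = subscheme_base_change ph Yl.
Proof. by apply: base_change_comp => x; rewrite phio. Qed.

Lemma I'_indep t : indep_at (ray h mon p0) ph I' J t.
Proof.
move=> q e eS ind c Ic.
have He j : exists yf : R * {mpoly R[n]}, [/\ phi yf.1 != 0, inS (ray h mon p0 t) yf.2 & io yf.1 *: e j = map_mpoly io yf.2].
  by have [y [f0 [h1 h2 h3]]] := clear_poly iofrac (eS j); exists (y, f0).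
have [yf hyf] := choice He.
have Hc j : exists xz : R * R, phi xz.2 != 0 /\ io xz.2 * c j = io xz.1.
  by have [x [z hz]] := iofrac (c j); exists (x, z).
have [xz hxz] := choice Hc.
pose D j := \prod_(i | i != j) ((xz i).2 * (yf i).1).
have D0 j : phi (D j) != 0.
  rewrite rmorph_prod; apply/prodf_neq0 => i _; rewrite rmorphM mulf_neq0 //; first by case: (hxz i).
  by case: (hyf i).
pose f0 := \sum_j (D j * (xz j).1) *: (yf j).2.
have ef0 : map_mpoly io f0 = io (\prod_i ((xz i).2 * (yf i).1)) *: \sum_j c j *: e j.
  rewrite raddf_sum scaler_sumr; apply: eq_bigr => j _ /=.
  have [_ _ e2] := hyf j; have [_ e1] := hxz j.
  rewrite map_mpolyZ -e2 (bigD1 j) //= !scalerA; congr (_ *: _).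
  by rewrite !rmorphM -e1; ring.
have gf0 : graded_piece A (p0 + h *+ t) f0.
  rewrite gS; apply: (sm_sum _ (inS_sm _)) => j _; apply: (smZ _ (inS_sm _)).
  by case: (hyf j).
have [y [y0 Iy]] : exists y, phi y != 0 /\ Ip b A Y (p0 + h *+ t) (y *: f0).
  apply: (Ip_loc TS iofrac ioeq0 HY gf0); rewrite ef0.
  exact: (smZ _ (Ip_sm Hex HYl _)).
have [|||x [x0 hx]] := @residue_indep (p0 + h *+ t) q (fun j => (yf j).2) (fun j => y * (D j * (xz j).1)).
- by move=> j; rewrite gS; case: (hyf j).
- move=> c' Hc' j; suff /eqP : c' j * phi (yf j).1 = 0.
    by rewrite mulf_eq0; case: (hyf j) => /negbTE -> _ _; rewrite orbF => /eqP.
  move: j; apply: ind; have <- : \sum_j c' j *: map_mpoly phi (yf j).2 =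
      \sum_j (c' j * phi (yf j).1) *: map_mpoly ph (e j); last exact: Hc'.
  apply: eq_bigr => j _; rewrite -scalerA; congr (_ *: _); have [_ _ e2] := hyf j.
  rewrite -phio -map_mpolyZ e2; apply/mpolyP => m.
  by rewrite !mcoeff_map_mpoly; apply/esym/phio.
- by move: Iy; rewrite scaler_sumr; under eq_bigr do rewrite scalerA.
move=> j.
have unit z w : phi z != 0 -> io z * w = 0 -> w = 0.
  by move=> /ioU [v hv] ew; rewrite -[w]mul1r -hv mulrAC ew mul0r.
have := hx j => /(congr1 io); rewrite raddf0 rmorphM => /(unit _ _ x0); rewrite rmorphM => /(unit _ _ y0).
rewrite rmorphM => /(unit _ _ (D0 j)); have [z0 <-] := hxz j.
exact: unit.
Qed.

Lemma I'_lift t : lift_at ph I' J t.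
Proof.
have [N hN] := J_lift_deep.
apply: (@local_lifting n (mon h) (ray h mon p0) (fun t => monU _) (@ray_mul _ _ _ _ _ _ _ _ _ _ TS p0)
  _ F ph I' J 0 N Hl (fam_Ip TS p0 HYl) (fam_Ip TS p0 HYF)).
- by move=> t' f If; rewrite /J YlF; apply: (Ip_map TS).
- exact: I'_indep.
- by move=> t' _; case: (J_ray t').
- move=> t' le f /(hN t' le).
  apply: (@span_min _ _ _ [set f | exists2 g, I' t' g & map_mpoly ph g = f]).
    split; first by exists 0; [exact: (sm0 (Ip_sm Hex HYl _))|rewrite raddf0].
    move=> a u v [g1 h1 <-] [g2 h2 <-]; have [a' ha'] := (proj1 Hl) a.
    exists (a' *: g1 + g2); last by rewrite raddfD /= map_mpolyZ ha'.
    by apply: (smD (Ip_sm Hex HYl _)) => //; apply: (smZ _ (Ip_sm Hex HYl _)).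
  move=> _ [g Ig <-]; exists (map_mpoly io g); first exact: (Ip_map TS).
  by apply/mpolyP => m; rewrite !mcoeff_map_mpoly; apply: phio.
by [].
Qed.

Lemma J_lift t f : J t f -> exists y g, [/\ phi y != 0, Ip b A Y (p0 + h *+ t) g & phi y *: f = map_mpoly phi g].
Proof.
move=> /I'_lift [g Ig <-]; have gS' : inS (mon (p0 + h *+ t)) g by rewrite -gS; case: Ig.
have [y [g0 [y0 g0S eg]]] := clear_poly iofrac gS'.
have gg0 : graded_piece A (p0 + h *+ t) g0 by rewrite gS.
have [y' [y'0 Iy']] := Ip_loc TS iofrac ioeq0 HY gg0 (eq_ind _ (Ip b A Yl _) (smZ (io y) (Ip_sm Hex HYl _) Ig) _ eg).
exists (y' * y), (y' *: g0); rewrite rmorphM mulf_neq0 //; split => //.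
rewrite -scalerA map_mpolyZ; congr (_ *: _); rewrite -phio -map_mpolyZ eg.
by apply/mpolyP => m; rewrite !mcoeff_map_mpoly; apply: phio.
Qed.

Lemma I'_free t : locally_free (inS (mon (p0 + h *+ t))) (I' t) (Qf (p0 + h *+ t)).
Proof.
have [[e0 [eV eSp eI]] _ _] := J_ray t.
have He j : exists e, inS (ray h mon p0 t) e /\ map_mpoly ph e = e0 j.
  by have [e h1 h2] := lift_inS Hl (eV j); exists e.
have [e he] := choice He.
have HI := Ip_sm Hex HYl (p0 + h *+ t).
exists [:: 1]; split; first by apply: idgen_sub => /=; rewrite mem_head.
move=> f; rewrite inE => /eqP ->; exists e; split.
- by move=> j; case: (he j).
- pose W := [set v | exists c : 'I_(Qf (p0 + h *+ t)) -> T, I' t (v - \sum_j c j *: e j)].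
  move=> v vS; have : W v; last by move=> [c hc]; exists 0%N, c; rewrite expr0 scale1r.
  apply: (nak_inS Hl (monU _)) vS.
    split; first by exists (fun=> 0); rewrite sub0r big1 ?oppr0 => [|j _]; rewrite ?scale0r //; apply: (sm0 HI).
    move=> a u w [c hc] [c' hc']; exists (fun j => a * c j + c' j).
    have := smD HI (smZ a HI hc) hc'; congr (I' t _); rewrite scalerBr addrACA -opprD; congr (_ - _).
    by rewrite scaler_sumr -big_split; apply: eq_bigr => j _; rewrite scalerDl scalerA.
  move=> m mm; have [c hc] := eSp _ (inS_X mm); have [y Iy ey] := I'_lift hc.
  have [c' hc'] := local_lift_fun Hl c; exists (\sum_j c' j *: e j + y); split.
  - by exists c'; rewrite addrAC subrr add0r.
  - apply: (smD (inS_sm _)); last by rewrite -gS; case: Iy.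
    by apply: (sm_sum _ (inS_sm _)) => j _; apply: (smZ _ (inS_sm _)); case: (he j).
  rewrite raddfD /= ey raddf_sum addrC /=.
  rewrite [X in _ + X](eq_bigr (fun j => c j *: e0 j)); first by rewrite subrK.
  by move=> j _; rewrite map_mpolyZ hc'; case: (he j) => _ ->.
move=> c Ic; exists 0%N => j; rewrite expr0 mul1r; move: j.
apply: (I'_indep _ _ Ic); first by move=> j; case: (he j).
move=> c' Hc'; apply: eI; move: Hc'; congr (J t _).
by apply: eq_bigr => j _; case: (he j) => _ ->.
Qed.

End AtResidueField.

(** The vanishing of the large minors holds in each localization, where [I'_free] applies. A
    nonvanishing minor of size [size ms - Qf q] at a residue field is lifted by [J_lift]. *)
Lemma Ip_HT (R : comNzRingType) (Y : chart_ideals R d Delta) : is_closed_subscheme b Y -> flat_over_base b Y ->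
  (forall (F : fieldType) (phi : {rmorphism R -> F}), is_residue_field phi ->
     has_hilbert_poly b A (subscheme_base_change phi Y) P) ->
  HT A h pts Qf (Ip b A Y).
Proof.
move=> [HY HYg] flat hp; split; first exact: (Ip_HT0 TS pts HY).
move=> p [p0 p0T [t ->]]; rewrite gS; set q := p0 + h *+ t; set ms := mon q.
have msU : uniq ms by apply: monU.
apply/(locally_free_vec _ (vecE msU (R := R))).
have cod (F : fieldType) (phi : {rmorphism R -> F}) : is_residue_field phi -> (Qf q <= size ms)%N /\
    exists M : 'M[F]_(size ms - Qf q, size ms), row_free M /\
      forall i, Ip b A (subscheme_base_change phi Y) q (vec (row i M)).
  move=> Hr; have [h1 _ _] := J_ray HY (hp F phi Hr) p0T t.
  exact: (codim_minor msU (Ip_sm Hex (base_change_chart phi HY) q) h1).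
have lem : (Qf q <= size ms)%N.
  apply: contrapT => no; have : [set (0 : R)] 1; last by move=> /eqP; rewrite oner_eq0.
  apply: residue_ideal_unit; first by split=> // a x y -> ->; rewrite mulr0 addr0.
  by move=> F phi Hr; case: no; case: (cod F phi Hr).
apply: locally_free_of_minors => //.
- split=> /=; first by rewrite raddf0; apply: (sm0 (Ip_sm Hex HY _)).
  move=> a u v hu hv; rewrite linearP; apply: (smD (Ip_sm Hex HY _)) => //.
  exact: (smZ _ (Ip_sm Hex HY _)).
- move=> M g hM; apply: residue_eq0 => F phi Hr; apply/loci_eq0.
  have lf := I'_free HY flat Hr HYg (hp F phi Hr) p0T (@loc_frac R F phi) (fun x => proj1 (loci_eq0 phi x)) (@loci_unit R F phi) (locphi_i phi) (locphi_local Hr) t.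
  have [E hE HE] := proj_of msU (Ip_sm Hex (base_change_chart (loci phi) HY) q) lf.
  have lt : (size ms < size ms - Qf q + 1 + Qf q)%N by lia.
  have mv := @lf_minors_vanish _ _ _ E (size ms - Qf q + 1) hE lt (map_mx (loci phi) M) g.
  rewrite -det_map_mx map_mxsub; apply: mv => i.
  by rewrite -[lker _ _]/(_ *m E = 0) -map_row; apply/HE; rewrite -map_vec; apply: (Ip_map TS); apply: hM.
move=> F phi Hr; have [_ [M0 [free hM0]]] := cod F phi Hr.
have HX i : exists yg : R * {mpoly R[n]}, [/\ phi yg.1 != 0, Ip b A Y q yg.2 & phi yg.1 *: vec (row i M0) = map_mpoly phi yg.2].
  by have [y [g hg]] := J_lift HY flat Hr HYg (hp F phi Hr) p0T (@loc_frac R F phi) (fun x => proj1 (loci_eq0 phi x)) (@loci_unit R F phi) (locphi_i phi) (locphi_local Hr) (hM0 i); exists (y, g).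
have [yg hyg] := choice HX.
have igS i : inS ms (yg i).2 by rewrite /ms -gS; case: (hyg i) => _ [].
pose M := \matrix_i crd ms (yg i).2.
have eM : map_mx phi M = diag_mx (\row_i phi (yg i).1) *m M0.
  apply/row_matrixP => i; rewrite row_mul row_diag_mx -scalemxAl -rowE -map_row rowK mxE.
  by have [_ _ e] := hyg i; rewrite -(vecK (map_mx phi (crd ms (yg i).2)) msU) -map_vec crdK // -e crdZ vecK.
have full : row_full (map_mx phi M)^T.
  rewrite /row_full mxrank_tr eM mxrankMfree // -[_ == _]/(row_free _) row_free_unit unitmxE det_diag unitfE.
  by apply/prodf_neq0 => i _; rewrite mxE; case: (hyg i).
exists M, (fullrankfun full); split.
  by move=> i; rewrite rowK /= crdK //; case: (hyg i).
have := fullrowsub_unit full; rewrite unitmxE unitfE -det_map_mx -det_tr; congr (\det _ != 0).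
by apply/matrixP => i j; rewrite !mxE.
Qed.

End HilbToHT2.

(** * The submodule generated in finitely many degrees *)

Section LfIncl.
Variables (R : comNzRingType) (m q : nat).

(** A surjection between locally free modules of the same rank is an isomorphism: in local bases its
    matrix [C] has a one-sided inverse, hence an invertible determinant. *)
Lemma lf_incl_eq (E E' : 'M[R]_m) : lf_proj q E -> lf_proj q E' -> lker E `<=` lker E' -> lker E' `<=` lker E.
Proof.
move=> [EE [fs [fs1 fsE]]] [EE' [gs [gs1 gsE]]] sub v hv.
have EI : E *m E' = E'.
  apply/row_matrixP => i; rewrite -[in RHS](mul1mx E') row_mul [in RHS]row_mul.
  apply/eqP; rewrite eq_sym -subr_eq0 -mulmxBl -raddfB; apply/eqP; apply: sub.
  by rewrite -[lker _ _]/(_ *m E = 0) -row_mul mulmxBl mul1mx EE subrr row0.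
pose w := v *m E.
have wE' : w *m E' = 0 by rewrite /w -mulmxA EI.
apply/rowP => i; rewrite [RHS]mxE -/w; apply: residue_eq0 => F phi Hphi.
have [f ff f0] := unit_ideal_image phi fs1; have [g gg g0] := unit_ideal_image phi gs1.
have [N [X [Y [eXY eYX]]]] := fsE f ff; have [N' [X' [Y' [eXY' eYX']]]] := gsE g gg.
set a := f ^+ N in eXY eYX; set c := g ^+ N' in eXY' eYX'.
set B := Y' *m X; set C := Y *m X'.
have aX : a *: (X' *m Y') = X *m C *m Y'.
  transitivity ((a *: E) *m (c *: E')); first by rewrite -scalemxAl -scalemxAr EI eXY'.
  by rewrite eXY eXY' /C !mulmxA.
have BC : c *: (B *m C) = (a * c * c)%:M.
  have e : a *: (Y' *m X' *m (Y' *m X')) = B *m C *m (Y' *m X').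
    by have := congr1 (fun M => Y' *m M *m X') aX; rewrite -scalemxAr -scalemxAl /B !mulmxA.
  by rewrite eYX' !mul_mx_scalar in e; rewrite -e !scale_scalar_mx mulrA.
pose u := w *m X.
have aw : a *: w = u *m Y by rewrite /u -mulmxA -eXY -scalemxAr /w -mulmxA EE.
have uC : c *: (u *m C) = 0.
  have : u *m C *m (Y' *m X') = 0.
    rewrite mulmxA /C mulmxA -aw -!mulmxA [X' *m _]mulmxA -eXY' -!scalemxAl -scalemxAr mulmxA wE'.
    by rewrite mul0mx !scaler0.
  by rewrite eYX' mul_mx_scalar.
have uD : (c * \det C) *: u = 0.
  have := congr1 (fun M => M *m \adj C) uC; rewrite mul0mx -scalemxAl -mulmxA mul_mx_adj.
  by rewrite mul_mx_scalar scalerA.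
have dBC : c ^+ q * (\det B * \det C) = (a * c * c) ^+ q by rewrite -det_mulmx -detZ BC det_scalar.
exists (c * (a * c * c) ^+ q * a).
  have a0 : phi a != 0 by rewrite rmorphXn expf_neq0.
  have c0 : phi c != 0 by rewrite rmorphXn expf_neq0.
  have ac : phi (a * c * c) != 0 by rewrite (rmorphM phi) (rmorphM phi) !mulf_neq0.
  by rewrite (rmorphM phi) (rmorphM phi) (rmorphXn phi) mulf_neq0 // mulf_neq0 // expf_neq0.
have : (c * (a * c * c) ^+ q * a) *: w = 0.
  rewrite -scalerA aw scalemxAl -dBC (_ : c * _ = c ^+ q * \det B * (c * \det C)); last by ring.
  by rewrite -scalerA uD scaler0 mul0mx.
by move=> /rowP /(_ i); rewrite !mxE.
Qed.

End LfIncl.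

(** Multilinearity of the determinant, one row at a time. *)
Lemma minors_vanish_span (R : comNzRingType) (m k : nat) (G : set 'rV[R]_m) :
  minors_vanish G k -> minors_vanish (span G) k.
Proof.
move=> H M g hM.
suff : forall s : seq 'I_k, forall M : 'M[R]_(k, m), (forall i, span G (row i M)) ->
    (forall i, i \notin s -> G (row i M)) -> \det (colsub g M) = 0.
  by move=> /(_ (enum 'I_k) M hM); apply=> i; rewrite mem_enum.
elim=> [|i0 s IH] M1 h1 h2; first by apply: H => i; apply: h2.
have [i0s|i0s] := boolP (i0 \in s).
  by apply: IH => // i is'; apply: h2; rewrite inE negb_or is' andbT; apply: contraNneq is' => ->.
pose M' v := \matrix_i (if i == i0 then v else row i M1).
have := h1 i0; have e1 : M' (row i0 M1) = M1.
  by apply/row_matrixP => i; rewrite rowK; case: eqP => [->|].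
rewrite -[M1 in colsub g M1]e1; move: (row i0 M1) => v; clear e1.
apply: (@span_min _ _ _ [set v | \det (colsub g (M' v)) = 0]); last first.
  move=> v' Gv' /=; apply: IH => [i|i is']; rewrite rowK; case: eqP => [_|/eqP ne] //; first exact: span_sub.
  by apply: h2; rewrite inE negb_or ne.
have rw' v1 v2 : row' i0 (colsub g (M' v1)) = row' i0 (colsub g (M' v2)).
  by apply/matrixP => i j; rewrite !mxE eq_sym (negbTE (neq_lift i0 i)).
split=> /=.
  by rewrite (expand_det_row _ i0) big1 // => j _; rewrite !mxE eqxx mxE mul0r.
move=> a u w hu hw.
rewrite (@determinant_multilinear _ _ _ (colsub g (M' u)) (colsub g (M' w)) i0 a 1) ?hu ?hw ?mulr0 ?addr0 //.
by apply/rowP => j; rewrite !mxE eqxx !mxE mul1r.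
Qed.

Lemma unit_ideal_mul (R : comNzRingType) (fs gs : seq R) : ideal_gen [set` fs] 1 -> ideal_gen [set` gs] 1 ->
  ideal_gen [set` [seq f * g | f <- fs, g <- gs]] 1.
Proof.
move=> h1 h2; set I := ideal_gen [set` [seq f * g | f <- fs, g <- gs]].
have HI : is_ideal I by apply: idgen_id.
suff H x : ideal_gen [set` fs] x -> forall y, ideal_gen [set` gs] y -> I (x * y).
  by rewrite -[1]mulr1; apply: H.
apply: (@idgen_min _ _ [set x | forall y, ideal_gen [set` gs] y -> I (x * y)]).
  split=> [y _|a u v hu hv y hy]; first by rewrite mul0r; apply: (id0 HI).
  by rewrite mulrDl -mulrA; apply: (idD HI); [apply: (idM _ HI); apply: hu|apply: hv].
move=> f ff; apply: (@idgen_min _ _ [set y | I (f * y)]).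
  split=> [|a u v hu hv] /=; first by rewrite mulr0; apply: (id0 HI).
  by rewrite mulrDr mulrCA; apply: (idD HI) => //; apply: (idM _ HI).
by move=> g gg; apply: idgen_sub => /=; apply/allpairsP; exists (f, g).
Qed.

Lemma lf_direct_sum (R : comNzRingType) (V : lmodType R) (V1 V2 N : set V) q1 q2 :
  is_submodule V1 -> is_submodule V2 -> is_submodule N ->
  (forall v1 v2, V1 v1 -> V2 v2 -> N (v1 + v2) -> N v1 /\ N v2) ->
  locally_free V1 N q1 -> locally_free V2 N q2 -> locally_free (smadd V1 V2) N (q1 + q2).
Proof.
move=> H1 H2 HN dir [fs [fs1 fsE]] [gs [gs1 gsE]].
exists [seq f * g | f <- fs, g <- gs]; split; first exact: unit_ideal_mul.
move=> _ /allpairsP [[f g] /= [ff gg ->]].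
have [e1 [a1 a2 a3]] := fsE f ff; have [e2 [b1 b2 b3]] := gsE g gg.
exists (catf e1 e2); split.
- move=> j; rewrite /catf; case: (fintype.split j) => i; first by apply: smadd_l.
  exact: smadd_r.
- move=> v [v1 hv1 hv2]; have [N1 [c1 hc1]] := a2 v1 hv1; have [N2 [c2 hc2]] := b2 _ hv2.
  pose al := f ^+ N2 * g ^+ (N1 + N2); pose be := f ^+ (N1 + N2) * g ^+ N1.
  exists (N1 + N2)%N, (catf (fun j => al * c1 j) (fun j => be * c2 j)); rewrite catf_cat.
  have := smD HN (smZ al HN hc1) (smZ be HN hc2); congr (N _).
  rewrite !scalerBr !scalerA addrACA -opprD; congr (_ - (_ + _)).
  + have -> : al * f ^+ N1 = (f * g) ^+ (N1 + N2) by rewrite /al exprMn mulrAC -exprD [(N2 + _)%N]addnC.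
    have -> : be * g ^+ N2 = (f * g) ^+ (N1 + N2) by rewrite /be exprMn -mulrA -exprD.
    by rewrite addrC subrK.
  + by rewrite scaler_sumr; apply: eq_bigr => j _; rewrite scalerA.
  + by rewrite scaler_sumr; apply: eq_bigr => j _; rewrite scalerA.
move=> c; rewrite catf_sum => Nc.
have [||n1 n2] := dir _ _ _ _ Nc; try by apply: sm_sum => // j _; apply: smZ.
have [N1 hN1] := a3 _ n1; have [N2 hN2] := b3 _ n2; exists (N1 + N2)%N => j.
rewrite exprMn; case: (splitP j) => i ei.
  have -> : j = lshift q2 i by apply: val_inj.
  by rewrite [f ^+ _]exprD -!mulrA mulrCA [g ^+ _ * _]mulrC mulrA mulrA -[_ * f ^+ N1 * _]mulrA hN1 mulr0 mul0r.
have -> : j = rshift q1 i by apply: val_inj.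
by rewrite [g ^+ _]exprD -!mulrA hN2 !mulr0.
Qed.

Section ResidueMinor.
Variables (R : comNzRingType) (n : nat) (ms : seq 'X_{1..n}) (N : set {mpoly R[n]}).
Hypotheses (msU : uniq ms) (HN : is_submodule N) (NS : N `<=` inS ms).

Lemma span_clear (F : fieldType) (phi : {rmorphism R -> F}) f : is_residue_field phi ->
  span (map_mpoly phi @` N) f -> exists y g, [/\ phi y != 0, N g & phi y *: f = map_mpoly phi g].
Proof.
move=> Hr; apply: (@span_min _ _ _ [set f | exists y g, [/\ phi y != 0, N g & phi y *: f = map_mpoly phi g]]).
  split; first by exists 1, 0; split; [rewrite rmorph1 oner_neq0|exact: sm0|rewrite scaler0 raddf0].
  move=> a u v [y1 [g1 [h1 s1 e1]]] [y2 [g2 [h2 s2 e2]]]; have [x [y [y0 e]]] := Hr a.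
  exists (y * y1 * y2), ((x * y2) *: g1 + (y * y1) *: g2); split.
  - by rewrite !rmorphM !mulf_neq0.
  - by apply: (smD HN); apply: (smZ _ HN).
  rewrite [RHS]raddfD /= !map_mpolyZ -e1 -e2 scalerDr !scalerA !rmorphM e.
  by congr (_ *: _ + _); field.
move=> _ [g Ng <-]; exists 1, g; split => //; first by rewrite rmorph1 oner_neq0.
by rewrite rmorph1 scale1r.
Qed.

(** A smaller corank leaves at least [size ms - q] independent rows; the first ones are kept,
    denominators are cleared row by row, and independent columns are selected. *)
Lemma residue_minor (F : fieldType) (phi : {rmorphism R -> F}) q q' : is_residue_field phi -> (q' <= q)%N ->
  has_dim (inS ms) (span (map_mpoly phi @` N)) q' ->
  exists (M : 'M[R]_(size ms - q, size ms)) (g : 'I_(size ms - q) -> 'I_(size ms)),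
    (forall i, N (vec (row i M))) /\ phi (\det (colsub g M)) != 0.
Proof.
move=> Hr le hd; have [_ [M1 [free1 hM1]]] := codim_minor msU (span_sm _) hd.
pose M0 : 'M[F]_(size ms - q, size ms) := pid_mx (size ms - q) *m M1.
have free : row_free M0.
  rewrite /row_free mxrankMfree // rank_pid_mx //.
  by apply: leq_sub2l.
have hM0 i : span (map_mpoly phi @` N) (vec (row i M0)).
  rewrite row_mul mulmx_sum_row linear_sum; apply: (sm_sum _ (span_sm _)) => j _.
  by rewrite linearZ; apply: (smZ _ (span_sm _)); apply: hM1.
have HX i : exists yg : R * {mpoly R[n]}, [/\ phi yg.1 != 0, N yg.2 & phi yg.1 *: vec (row i M0) = map_mpoly phi yg.2].
  by have [y [g hg]] := span_clear Hr (hM0 i); exists (y, g).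
have [yg hyg] := choice HX.
have igS i : inS ms (yg i).2 by apply: NS; case: (hyg i).
pose M := \matrix_i crd ms (yg i).2.
have eM : map_mx phi M = diag_mx (\row_i phi (yg i).1) *m M0.
  apply/row_matrixP => i; rewrite row_mul row_diag_mx -scalemxAl -rowE -map_row rowK mxE.
  by have [_ _ e] := hyg i; rewrite -(vecK (map_mx phi (crd ms (yg i).2)) msU) -map_vec crdK // -e crdZ vecK.
have full : row_full (map_mx phi M)^T.
  rewrite /row_full mxrank_tr eM mxrankMfree // -[_ == _]/(row_free _) row_free_unit unitmxE det_diag unitfE.
  by apply/prodf_neq0 => i _; rewrite mxE; case: (hyg i).
exists M, (fullrankfun full); split.
  by move=> i; rewrite rowK /= crdK //; case: (hyg i).
have := fullrowsub_unit full; rewrite unitmxE unitfE -det_map_mx -det_tr; congr (\det _ != 0).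
by apply/matrixP => i j; rewrite !mxE.
Qed.

End ResidueMinor.

Section Generated.
Variables (RR : realType) (d n r : nat) (b : 'M[int]_(d, n)) (Delta : {set {set 'I_n}}).
Variables (A : 'M[int]_(r, n)) (h : 'cV[int]_r) (mu : {set 'I_n} -> 'X_{1..n}).
Variable (mon : 'cV[int]_r -> seq 'X_{1..n}).
Hypothesis TS : toric_setup RR b Delta A h mu mon.
Variables (pts : seq 'cV[int]_r) (Qf : 'cV[int]_r -> nat).
Local Notation deg := (mdegree A).
Local Notation T := (inT h pts).
Let monU := ts_uniq TS.
Let monE := ts_monE TS.
Let gS := graded_inS monE.
Variable D : seq 'cV[int]_r.
Hypotheses (DU : uniq D) (DT : forall p, p \in D -> T p).
Hypothesis HD : forall M, upc M -> (forall p, p \in D -> cnt mon p M = Qf p) ->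
  forall p, T p -> (cnt mon p (genD mon M D) <= Qf p)%N.
Hypothesis QfS : forall p, T p -> (Qf p <= size (mon p))%N.

Lemma supp_sm (R : comNzRingType) D' : is_submodule (@supp_in R n r A D').
Proof.
split=> [m|a u v hu hv m]; first by rewrite msupp0.
apply: contraTT => no; rewrite mcoeff_msupp negbK mcoeffD mcoeffZ.
have e f : supp_in A D' f -> f@_m = 0 by move=> hf; apply: memN_msupp_eq0; apply: contra no; apply: hf.
by rewrite !e // mulr0 addr0.
Qed.

Lemma component_supp (R : comNzRingType) D' p (f : {mpoly R[n]}) : supp_in A D' f -> p \notin D' -> component A p f = 0.
Proof.
move=> hf pD; apply/mpolyP => w; rewrite mcoeff_component mcoeff0; case: eqP => // e.
by apply: memN_msupp_eq0; apply: contra pD => /hf; rewrite e.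
Qed.

Lemma component0 (R : comNzRingType) p : component A p (0 : {mpoly R[n]}) = 0.
Proof. by apply/mpolyP => w; rewrite mcoeff_component !mcoeff0 if_same. Qed.

Lemma component_map (R R' : comNzRingType) (phi : {rmorphism R -> R'}) p (f : {mpoly R[n]}) :
  map_mpoly phi (component A p f) = component A p (map_mpoly phi f).
Proof.
apply/mpolyP => w; rewrite mcoeff_map_mpoly !mcoeff_component mcoeff_map_mpoly.
by case: ifP => //; rewrite raddf0.
Qed.

Record hs0 (R : comNzRingType) (L : set {mpoly R[n]}) : Prop := Hs0 {
  hs_sm : is_submodule L; hs_supp : L `<=` supp_in A D; hs_gr : is_graded A L;
  hs_mul : forall p q f m, p \in D -> q \in D -> L f -> graded_piece A p f ->
    deg m = q - p -> L ('X_[m] * f) }.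

Record hs (R : comNzRingType) (L : set {mpoly R[n]}) : Prop := Hs {
  hs_0 :> hs0 L; hs_lf : forall p, p \in D -> locally_free (graded_piece A p) L (Qf p) }.

Lemma lf_total (R : comNzRingType) (L : set {mpoly R[n]}) D' : uniq D' -> is_submodule L -> is_graded A L ->
  (forall p, p \in D' -> locally_free (graded_piece A p) L (Qf p)) ->
  locally_free (supp_in A D') L (\sum_(p <- D') Qf p)%N.
Proof.
move=> + HL gL; elim: D' => [_ _|p D' IH /= /andP [pD uD'] H].
  rewrite big_nil; exists [:: 1]; split; first by apply: idgen_sub => /=; rewrite mem_head.
  move=> f _; exists (fun _ => 0); split => [[]//|v hv|c _].
    exists 0%N, (fun=> 0); rewrite big_ord0 subr0 (_ : v = 0) ?scaler0; first exact: sm0.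
    by apply/mpolyP => w; rewrite mcoeff0; apply: memN_msupp_eq0; apply/negP => /hv.
  by exists 0%N => -[].
rewrite big_cons (_ : supp_in A (p :: D') = smadd (graded_piece A p) (supp_in A D')).
  apply: lf_direct_sum => //; [exact: graded_sm|exact: supp_sm| |by apply: H; rewrite mem_head|].
    move=> v1 v2 g1 g2 hL; have L1 : L v1.
      by have := gL p _ hL; rewrite -[v1 in _ (v1 + _)]scale1r componentZD scale1r component_id // (component_supp g2 pD) addr0.
    by split => //; have := smB HL hL L1; rewrite addrC addKr.
  by apply: IH => // p' p'D; apply: H; rewrite inE p'D orbT.
apply/seteqP; split=> v.
  move=> hv; exists (component A p v); first exact: graded_component.
  move=> m; apply: contraTT => mD; rewrite mcoeff_msupp negbK mcoeffB mcoeff_component.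
  case: ifP => [_|/negbT ne]; first by rewrite subrr.
  rewrite subr0; apply/eqP; apply: memN_msupp_eq0; apply/negP => /hv.
  by rewrite inE (negbTE ne) (negbTE mD).
move=> [u hu hv]; rewrite -(subrK u v); apply: (smD (supp_sm _ _)).
  by move=> m /hv; rewrite inE => ->; rewrite orbT.
by move=> m /hu; rewrite !inE => /eqP ->; rewrite eqxx.
Qed.

(** The piece of degree [p] of the submodule of the coordinate ring generated by [L]. *)
Definition gen (R : comNzRingType) (L : set {mpoly R[n]}) p : set {mpoly R[n]} :=
  span [set f | exists q m f', [/\ q \in D, deg m = p - q, L f' & f = 'X_[m] * component A q f']].

Lemma gen_in (R : comNzRingType) (L : set {mpoly R[n]}) p : gen L p `<=` graded_piece A p.
Proof.
apply: span_min; first exact: graded_sm.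
move=> _ [q [m [f [_ em _ ->]]]]; rewrite -[p](subrK q) -em addrC; apply: gradedXM.
exact: graded_component.
Qed.

Lemma gen_mul (R : comNzRingType) (L : set {mpoly R[n]}) p q m f : deg m = q - p -> gen L p f -> gen L q ('X_[m] * f).
Proof.
move=> em; apply: (@span_min _ _ _ [set f | gen L q ('X_[m] * f)]).
  split=> /=; first by rewrite mulr0; apply: (sm0 (span_sm _)).
  by move=> a u v hu hv; rewrite mulrDr -scalerAr; apply: (smD (span_sm _)) => //; apply: (smZ _ (span_sm _)).
move=> _ [q' [m' [f' [q'D em' Lf' ->]]]] /=; apply: span_sub; exists q', (m + m')%MM, f'; split => //.
  by rewrite mdeg_add em em' addrA subrK.
by rewrite mpolyXD mulrA.
Qed.

Lemma gen_HT0 (R : comNzRingType) (L : set {mpoly R[n]}) : HT0 A h pts (gen L).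
Proof. by split=> [p _|p _|p q m f _ _]; [exact: span_sm|exact: gen_in|exact: gen_mul]. Qed.

Lemma gen_D (R : comNzRingType) (L : set {mpoly R[n]}) p f : hs0 L -> p \in D -> graded_piece A p f -> gen L p f <-> L f.
Proof.
move=> HL pD gf; split.
  apply: span_min; first exact: (hs_sm HL).
  move=> _ [q [m [f' [qD em Lf' ->]]]]; have Lc : L (component A q f') by apply: (hs_gr HL).
  by apply: (hs_mul HL qD pD Lc _ em); apply: graded_component.
move=> Lf; apply: span_sub; exists p, 0%MM, f; rewrite mpolyX0 mul1r component_id //; split => //.
by rewrite mdeg_zero subrr.
Qed.

Lemma gen_map (R R' : comNzRingType) (phi : {rmorphism R -> R'}) (L : set {mpoly R[n]}) p :
  gen (span (map_mpoly phi @` L)) p = span (map_mpoly phi @` gen L p).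
Proof.
apply/seteqP; split; apply: span_min; try exact: span_sm.
  move=> _ [q [m [f [qD em Lf ->]]]]; move: f Lf.
  apply: (@span_min _ _ _ [set f | span _ ('X_[m] * component A q f)]).
    split=> /=; first by rewrite component0 mulr0; apply: (sm0 (span_sm _)).
    move=> a u v hu hv; rewrite componentZD mulrDr -scalerAr.
    by apply: (smD (span_sm _)) => //; apply: (smZ _ (span_sm _)).
  move=> _ [f Lf <-] /=; apply: span_sub; exists ('X_[m] * component A q f).
    by apply: span_sub; exists q, m, f.
  by rewrite rmorphM /= map_mpolyX component_map.
move=> _ [f + <-]; move: f; apply: (@span_min _ _ _ [set f | gen _ p (map_mpoly phi f)]).
  split=> /=; first by rewrite raddf0; apply: (sm0 (span_sm _)).
  move=> a u v hu hv; rewrite raddfD /= map_mpolyZ.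
  by apply: (smD (span_sm _)) => //; apply: (smZ _ (span_sm _)).
move=> _ [q [m [f [qD em Lf ->]]]] /=; apply: span_sub; exists q, m, (map_mpoly phi f); split => //.
  by apply: span_sub; exists f.
by rewrite rmorphM /= map_mpolyX component_map.
Qed.

(** The leading monomials of the generated submodule form a monomial ideal with the prescribed
    counts in the degrees of [D], so [HD] bounds the counts on the rays. *)
Lemma gen_field (F : fieldType) (L : set {mpoly F[n]}) p : hs L -> T p ->
  exists2 q, (q <= Qf p)%N & has_dim (@graded_piece F n r A p) (gen L p) q.
Proof.
move=> HL Tp; pose M := [set m | leads (gen L (deg m)) (mon (deg m)) m].
have upM : upc M.
  move=> m m' le [f [If fS f0 lf]]; exists ('X_[(m' - m)%MM] * f); split.
  - by apply: gen_mul If; rewrite mdeg_sub.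
  - apply: inS_XM fS => w; rewrite !monE mdeg_add => /eqP ->.
    by rewrite -mdeg_add submK.
  - by rewrite mulf_eq0 negb_or mpolyX_neq0 f0.
  - by rewrite mlead_XM // lf submK.
have dim q : has_dim (@graded_piece F n r A q) (gen L q) (cnt mon q M).
  rewrite gS; have := initial_basis (monU q) (span_sm _ : is_submodule (gen L q)); congr has_dim.
  apply: eq_in_count => m; rewrite monE => /eqP em; congr (~~ _).
  by rewrite /M /= em.
exists (cnt mon p M); last exact: dim.
apply: leq_trans (HD upM _ Tp).
  apply: cnt_mono => m [m0 [q [Mm0 _ _ le]]]; exact: upM le Mm0.
move=> q qD; apply: (has_dim_uniq (graded_sm _ _ q) (span_sm _ : is_submodule (gen L q)) (dim q)).
have := locally_free_has_dim (hs_sm HL) (hs_lf HL qD); apply: has_dim_ext; first exact: graded_sm.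
by move=> v gv; apply: iff_sym; apply: (gen_D HL qD gv).
Qed.

Lemma map_graded (R R' : comNzRingType) (phi : {rmorphism R -> R'}) (L : set {mpoly R[n]}) p f : is_graded A L ->
  span (map_mpoly phi @` L) f -> span (map_mpoly phi @` (L `&` graded_piece A p)) (component A p f).
Proof.
move=> gL; apply: (@span_min _ _ _ [set f | span _ (component A p f)]).
  split=> /=; first by rewrite component0; apply: (sm0 (span_sm _)).
  by move=> a u v hu hv; rewrite componentZD; apply: (smD (span_sm _)) => //; apply: (smZ _ (span_sm _)).
move=> _ [g Lg <-] /=; rewrite -component_map; apply: span_sub; exists (component A p g) => //.
by split; [exact: gL|exact: graded_component].
Qed.

Lemma map_supp (R R' : comNzRingType) (phi : {rmorphism R -> R'}) (L : set {mpoly R[n]}) : L `<=` supp_in A D ->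
  span (map_mpoly phi @` L) `<=` supp_in A D.
Proof.
move=> LD; apply: span_min; first exact: supp_sm.
move=> _ [f Lf <-] m; rewrite mcoeff_msupp mcoeff_map_mpoly => ne; apply: (LD _ Lf).
by rewrite mcoeff_msupp; apply: contra ne => /eqP ->; rewrite raddf0.
Qed.

Lemma span_imgS (R R' : comNzRingType) (phi : {rmorphism R -> R'}) (L L' : set {mpoly R[n]}) : L `<=` L' ->
  span (map_mpoly phi @` L) `<=` span (map_mpoly phi @` L').
Proof.
by move=> sub; apply: span_min; [exact: span_sm|move=> _ [f Lf <-]; apply: span_sub; exists f => //; apply: sub].
Qed.

Lemma hs0_map (R R' : comNzRingType) (phi : {rmorphism R -> R'}) (L : set {mpoly R[n]}) : hs0 L ->
  hs0 (span (map_mpoly phi @` L)).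
Proof.
move=> HL; split.
- exact: span_sm.
- by apply: map_supp; apply: (hs_supp HL).
- by move=> p f /(@map_graded _ _ phi _ p _ (hs_gr HL)); apply: span_imgS => g [].
move=> p q f m pD qD Lf gf em; have := @map_graded _ _ phi _ p _ (hs_gr HL) Lf; rewrite (component_id gf).
apply: (@span_min _ _ _ [set f | span _ ('X_[m] * f)]).
  split=> /=; first by rewrite mulr0; apply: (sm0 (span_sm _)).
  by move=> a u v hu hv; rewrite mulrDr -scalerAr; apply: (smD (span_sm _)) => //; apply: (smZ _ (span_sm _)).
move=> _ [g [Lg gg] <-] /=; apply: span_sub; exists ('X_[m] * g); first exact: (hs_mul HL pD qD).
by rewrite rmorphM /= map_mpolyX.
Qed.

Lemma hs_map (R R' : comNzRingType) (phi : {rmorphism R -> R'}) (L : set {mpoly R[n]}) : hs L ->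
  hs (span (map_mpoly phi @` L)).
Proof.
move=> HL; split; first exact: (hs0_map phi HL).
move=> p pD; pose N0 : set {mpoly R[n]} := L `&` graded_piece A p.
have HI : is_submodule N0 := smI (hs_sm HL) (@graded_sm n r A R p).
have lf' : locally_free (graded_piece A p) N0 (Qf p).
  have := hs_lf HL pD; rewrite gS => lf; have [E hE HE] := proj_of (monU p) (hs_sm HL) lf.
  apply: (of_proj (monU p) hE) => w; rewrite -HE; split=> [[]//|Lw]; split => //.
  by rewrite gS; apply: vec_inS.
rewrite !gS in lf' *; have [E hE HE] := proj_of (monU p) HI lf'.
apply: (of_proj (monU p) (lf_proj_map phi hE)) => w.
have := proj_map (monU p) phi (_ : N0 `<=` inS (mon p)) (proj1 hE) HE w.
rewrite -gS => <-; last by move=> f [].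
split=> [Lw|]; last by apply: span_imgS => f [].
have gv : graded_piece A p (vec w : {mpoly R'[n]}) by rewrite gS; apply: vec_inS.
by have := @map_graded _ _ phi _ p _ (hs_gr HL) Lw; rewrite (component_id gv).
Qed.

Definition genmx (R : comNzRingType) (L : set {mpoly R[n]}) p : set 'rV[R]_(size (mon p)) := [set w | gen L p (vec w)].

Arguments genmx {R} L p _.

(** At every residue field [gen_field] bounds the corank from above, which yields invertible minors;
    the assumed vanishing bounds it from below. *)
Lemma gen_lf (R : comNzRingType) (L : set {mpoly R[n]}) : hs L ->
  (forall p, T p -> minors_vanish (genmx L p) (size (mon p) - Qf p + 1)) -> HT A h pts Qf (gen L).
Proof.
move=> HL mv; split; first exact: gen_HT0.
move=> p Tp; rewrite gS; apply/(locally_free_vec _ (vecE (monU p) (R := R))).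
have HN : is_submodule (gen L p) by apply: span_sm.
apply: locally_free_of_minors (mv p Tp) _; [|exact: QfS|].
  split; first by rewrite /genmx /= raddf0; apply: (sm0 HN).
  by move=> a u v hu hv; rewrite /genmx /= linearP; apply: (smD HN) => //; apply: (smZ _ HN).
move=> F phi Hr; have [q le hd] := gen_field (hs_map phi HL) Tp; rewrite gen_map gS in hd.
have [|M [g [h1 h2]]] := residue_minor (monU p) HN _ Hr le hd; first by rewrite -gS; apply: gen_in.
by exists M, g.
Qed.

End Generated.

(** * The canonical map and its closedness *)

Lemma span_map_id (R : comNzRingType) (V : lmodType R) (f : V -> V) (N : set V) :
  is_submodule N -> f =1 id -> span (f @` N) = N.
Proof.
move=> HN fid; apply/seteqP; split=> [|v Nv]; last by apply: span_sub; exists v.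
by apply: span_min => // _ [v Nv <-]; rewrite fid.
Qed.

Lemma span_map_comp (R R' R'' : comNzRingType) (V : lmodType R) (V' : lmodType R') (V'' : lmodType R'')
    (phi : R' -> R'') (f : V -> V') (g : V' -> V'') (f' : V -> V'') (N : set V) :
  (forall v, f' v = g (f v)) -> g 0 = 0 -> (forall a u v, g (a *: u + v) = phi a *: g u + g v) ->
  span (f' @` N) = span (g @` span (f @` N)).
Proof.
move=> e g0 gl; apply/seteqP; split; apply: span_min; try exact: span_sm.
  by move=> _ [v Nv <-]; rewrite e; apply: span_sub; exists (f v) => //; apply: span_sub; exists v.
move=> _ [v + <-]; move: v; apply: (@span_min _ _ _ [set v | span (f' @` N) (g v)]).
  split=> /=; first by rewrite g0; apply: (sm0 (span_sm _)).
  by move=> a u v hu hv; rewrite gl; apply: (smD (span_sm _)) => //; apply: (smZ _ (span_sm _)).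
by move=> _ [v Nv <-] /=; apply: span_sub; exists v.
Qed.

Section Canonical.
Variables (RR : realType) (k : fieldType) (d n r : nat) (b : 'M[int]_(d, n)) (Delta : {set {set 'I_n}}).
Variables (A : 'M[int]_(r, n)) (h : 'cV[int]_r) (mu : {set 'I_n} -> 'X_{1..n}).
Variable (mon : 'cV[int]_r -> seq 'X_{1..n}).
Hypothesis TS : toric_setup RR b Delta A h mu mon.
Variables (P : {mpoly rat[r]}) (pts : seq 'cV[int]_r) (t0 : nat) (Qf : 'cV[int]_r -> nat).
Hypothesis RS : ray_setup Delta A h mon P pts t0 Qf.
Local Notation deg := (mdegree A).
Local Notation T := (inT h pts).
Let Hfan := ts_fan TS.
Let Hex := ts_ex TS.
Let Hmu := ts_mu TS.
Let monU := ts_uniq TS.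
Let monE := ts_monE TS.
Let gS := graded_inS monE.
Variable D : seq 'cV[int]_r.
Hypotheses (DU : uniq D) (DT : forall p, p \in D -> T p).
Hypothesis HD : forall M, upc M -> (forall p, p \in D -> cnt mon p M = Qf p) ->
  forall p, T p -> (cnt mon p (genD mon M D) <= Qf p)%N.
Hypothesis QfS : forall p, T p -> (Qf p <= size (mon p))%N.
Local Notation hilb := (Hilb k b A Delta P).
Local Notation genL := (gen A D).
Local Notation hsL := (hs A Qf D).
Local Notation hs0L := (hs0 A D).
Local Notation HTL := (HT A h pts Qf).

Lemma point_HT (R : comAlgType k) (Y : carrier hilb R) : points Y -> HTL (Ip b A Y).
Proof. by move=> [h1 h2 h3]; apply: (Ip_HT TS RS). Qed.

Lemma point_YL (R : comAlgType k) (Y : carrier hilb R) : points Y -> YL b h mu t0 (Ip b A Y) = Y.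
Proof. by move=> [h1 _ _]; apply: (YL_Ip TS). Qed.

Lemma point_chart (R : comAlgType k) (Y : carrier hilb R) : points Y -> forall s, is_chart_ideal b (val s) (Y s).
Proof. by move=> [[]]. Qed.

Lemma hilb_map (R R' : comAlgType k) (phi : {lrmorphism R -> R'}) (Y : carrier hilb R) : points Y ->
  base_change (f := hilb) phi Y = YL b h mu t0 (mapT phi (Ip b A Y)).
Proof.
by move=> pY; rewrite (YL_map TS RS (phi : {rmorphism R -> R'}) (point_HT pY)) (point_YL pY).
Qed.

Lemma Ip_base (R R' : comAlgType k) (phi : {lrmorphism R -> R'}) (Y : carrier hilb R) p : points Y -> T p ->
  Ip b A (base_change (f := hilb) phi Y) p = span (map_mpoly phi @` Ip b A Y p).
Proof.
move=> pY Tp; rewrite hilb_map // (HT_Ip TS RS _ Tp) //.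
exact: (HT_map TS (phi : {rmorphism R -> R'}) (point_HT pY)).
Qed.

Lemma hilb_functor : is_functor hilb.
Proof.
split.
- move=> R R' phi Y pY; rewrite hilb_map //; apply: (YL_point TS RS).
  exact: (HT_map TS (phi : {rmorphism R -> R'}) (point_HT pY)).
- move=> R Y pY /=; rewrite (base_changeE (idfun : {rmorphism R -> R})); apply: funext => s.
  apply: span_map_id; first by case: (point_chart pY s).
  by move=> g; apply: lext => m; rewrite (coeff_mapL (idfun : {rmorphism R -> R})).
move=> R R' R'' phi psi Y pY /=.
exact: (@base_change_comp _ _ _ _ _ _ (phi : {rmorphism R -> R'}) (psi : {rmorphism R' -> R''}) (psi \o phi)).
Qed.

Lemma hs_point (R : comAlgType k) (L : set {mpoly R[n]}) : points (f := HSD k A P D) L <-> hsL L.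
Proof.
have ev p q : p \in D -> eval_at P p = q%:R -> q = Qf p.
  move=> /DT [p0 hp [t ->]]; rewrite (T_poly RS) // => /eqP; rewrite eqr_nat => /eqP.
  by [].
split=> [[[h1 h2 h3] h4 h5]|[[h1 h2 h3 h4] h5]].
  by split=> // p pD; have [q eq lf] := h5 p pD; rewrite -(ev p q pD eq).
split => // p pD; exists (Qf p); last exact: h5.
by have [p0 hp [t ->]] := DT pD; apply: (T_poly RS).
Qed.

Lemma hs_functor : is_functor (HSD k A P D).
Proof.
split.
- move=> R R' phi L /hs_point HL; apply/hs_point.
  exact: (hs_map TS (phi : {rmorphism R -> R'}) HL).
- move=> R L [[h1 _ _] _ _]; apply: span_map_id => // f; apply/mpolyP => m.
  by rewrite (mcoeff_map_mpoly (idfun : {rmorphism R -> R})).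
move=> R R' R'' phi psi L [[h1 _ _] _ _]; apply: (span_map_comp (phi := psi)) => [f||a u v].
- by apply/mpolyP => m; rewrite !mcoeff_map_mpoly.
- exact: raddf0.
by rewrite raddfD /= map_mpolyZ.
Qed.

Definition eta (R : comAlgType k) (Y : carrier hilb R) : carrier (HSD k A P D) R := IY b A Y `&` supp_in A D.

Lemma graded_ext (R : comNzRingType) (L L' : set {mpoly R[n]}) : is_submodule L' -> is_graded A L ->
  L `<=` supp_in A D -> (forall p f, p \in D -> graded_piece A p f -> L f -> L' f) -> L `<=` L'.
Proof.
move=> HL' gL LD H f Lf; rewrite [f](component_sum A); apply: (sm_sum _ HL') => p _.
have [pD|pD] := boolP (p \in D); last by rewrite (component_supp (LD _ Lf) pD); apply: sm0.
by apply: (H p) => //; [exact: graded_component|exact: gL].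
Qed.

Lemma eta_piece (R : comAlgType k) (Y : carrier hilb R) p f : points Y -> p \in D -> graded_piece A p f ->
  eta Y f <-> Ip b A Y p f.
Proof.
move=> pY pD gf; rewrite /eta; split=> [[If _]|If]; first exact/(IY_Ip Hex (point_chart pY) gf).
split; first exact/(IY_Ip Hex (point_chart pY) gf).
by move=> m /gf; rewrite inE => /eqP ->.
Qed.

Lemma eta_hs (R : comAlgType k) (Y : carrier hilb R) : points Y -> hsL (eta Y).
Proof.
move=> pY; have HC := point_chart pY; split; first split.
- by apply: smI; [apply: (IY_sm Hex HC)|apply: supp_sm].
- by move=> f [].
- move=> p f [If fD]; split; first exact: (IY_graded Hex HC).
  by move=> m; rewrite mcoeff_msupp mcoeff_component; case: ifP => // _; rewrite ?eqxx // -mcoeff_msupp; apply: fD.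
- move=> p q f m pD qD ef gf em; apply/(eta_piece pY qD).
    by rewrite -[q](subrK p) -em addrC; apply: gradedXM.
  rewrite -[q](subrK p) -em addrC; apply: (Ip_mul Hfan Hex HC).
  exact/(eta_piece pY pD gf).
move=> p pD; have := HT_lf (point_HT pY) (DT pD); rewrite gS => lf.
have [E hE HE] := proj_of (monU p) (Ip_sm Hex HC p) lf.
apply: (of_proj (monU p) hE) => w; rewrite -HE; apply: eta_piece => //.
by rewrite gS; apply: vec_inS.
Qed.

Lemma gen_sub_Ip (R : comAlgType k) (Y : carrier hilb R) p : points Y -> genL (eta Y) p `<=` Ip b A Y p.
Proof.
move=> pY; have HC := point_chart pY; apply: span_min; first exact: (Ip_sm Hex HC).
move=> _ [q [m [f [qD em ef ->]]]]; rewrite -[p](subrK q) -em addrC; apply: (Ip_mul Hfan Hex HC).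
by case: ef => If _; apply: If.
Qed.

Local Notation gmx L p := (@genmx n r A mon D _ L p).
Local Notation minT L := (forall p, T p -> minors_vanish (gmx L p) (size (mon p) - Qf p + 1)).

Lemma eta_minors (R : comAlgType k) (Y : carrier hilb R) : points Y -> minT (eta Y).
Proof.
move=> pY p Tp M g hM; have := HT_lf (point_HT pY) Tp; rewrite gS => lf.
have [E hE HE] := proj_of (monU p) (Ip_sm Hex (point_chart pY) p) lf.
have lt : (size (mon p) < size (mon p) - Qf p + 1 + Qf p)%N by have := QfS Tp; lia.
apply: (lf_minors_vanish hE lt) => i; apply/HE; apply: (gen_sub_Ip pY).
exact: hM.
Qed.

(** Both sides are locally free of the same corank and one contains the other. Hence [Y] is
    determined by the degrees in [D], which makes [eta] injective. *)
Lemma gen_eta (R : comAlgType k) (Y : carrier hilb R) p : points Y -> T p -> genL (eta Y) p = Ip b A Y p.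
Proof.
move=> pY Tp; apply/seteqP; split; first exact: gen_sub_Ip.
have HG := gen_lf TS HD QfS (eta_hs pY) (eta_minors pY).
have := HT_lf HG Tp; have := HT_lf (point_HT pY) Tp; rewrite gS => lf lf'.
have [E hE HE] := proj_of (monU p) (Ip_sm Hex (point_chart pY) p) lf.
have [E' hE' HE'] := proj_of (monU p) (span_sm _ : is_submodule (genL (eta Y) p)) lf'.
move=> f If; have fS : inS (mon p) f by rewrite -gS; case: If.
rewrite -(crdK (monU p) fS); apply/HE'; apply: (lf_incl_eq hE' hE) => [w /HE' hw|]; last first.
  by apply/HE; rewrite crdK.
by apply/HE; apply: (gen_sub_Ip pY).
Qed.

Lemma eta_inj (R : comAlgType k) (Y Y' : carrier hilb R) : points Y -> points Y' -> eta Y = eta Y' -> Y = Y'.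
Proof.
move=> pY pY' e; rewrite -(point_YL pY) -(point_YL pY'); apply: funext => s.
have E N : (t0 <= N)%N -> Ip b A Y (h *+ N) = Ip b A Y' (h *+ N).
  by move=> le; rewrite -!gen_eta ?e //; apply: (inT_h RS).
by apply/seteqP; split=> g [N [f [le Lf ->]]]; exists N, f; rewrite E // in Lf *.
Qed.

Lemma eta_surj (R : comAlgType k) (L : set {mpoly R[n]}) : hsL L -> minT L -> exists2 Y : carrier hilb R, points Y & eta Y = L.
Proof.
move=> HL mv; have HG := gen_lf TS HD QfS HL mv; have pY := YL_point TS RS HG.
exists (YL b h mu t0 (genL L)) => //; have He := eta_hs pY.
have key p f : p \in D -> graded_piece A p f -> eta (YL b h mu t0 (genL L)) f <-> L f.
  move=> pD gf; rewrite (eta_piece pY pD gf) (HT_Ip TS RS HG (DT pD)).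
  exact: (gen_D HL pD gf).
apply/seteqP; split; apply: graded_ext; try by [exact: (hs_sm HL)|exact: (hs_gr HL)|exact: (hs_supp HL)|exact: (hs_sm He)|exact: (hs_gr He)|exact: (hs_supp He)].
  by move=> p f pD gf /(key _ _ pD gf).
by move=> p f pD gf /(key _ _ pD gf).
Qed.

Lemma eta_image (R : comAlgType k) (L : set {mpoly R[n]}) : hsL L ->
  (exists2 Y : carrier hilb R, points Y & eta Y = L) <-> minT L.
Proof.
move=> HL; split=> [[Y pY <-]|]; first exact: eta_minors.
exact: eta_surj.
Qed.

Lemma eta_base (R R' : comAlgType k) (phi : {lrmorphism R -> R'}) (Y : carrier hilb R) : points Y ->
  eta (base_change (f := hilb) phi Y) = span (map_mpoly phi @` eta Y).
Proof.
move=> pY; have [F1 _ _] := hilb_functor; have pY' := F1 _ _ phi _ pY.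
have He := eta_hs pY'; have HL := hs_map TS (phi : {rmorphism R -> R'}) (eta_hs pY).
have key p f : p \in D -> graded_piece A p f -> eta (base_change (f := hilb) phi Y) f <-> span (map_mpoly phi @` eta Y) f.
  move=> pD gf; rewrite (eta_piece pY' pD gf) (Ip_base phi pY (DT pD)) -(gen_D HL pD gf).
  by rewrite (gen_map A D (phi : {rmorphism R -> R'})) gen_eta //; apply: DT.
apply/seteqP; split; apply: graded_ext; try by [exact: (hs_sm HL)|exact: (hs_gr HL)|exact: (hs_supp HL)|exact: (hs_sm He)|exact: (hs_gr He)|exact: (hs_supp He)].
  by move=> p f pD gf /(key _ _ pD gf).
by move=> p f pD gf /(key _ _ pD gf).
Qed.

Definition Uminors (R : comAlgType k) (L : set {mpoly R[n]}) : set R :=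
  [set x | exists p (M : 'M[R]_(size (mon p) - Qf p + 1, size (mon p))) g,
    [/\ T p, forall i, gmx L p (row i M) & x = \det (colsub g M)]].

(** The base change of the generated submodule is spanned by images of its elements, and minors need
    only be checked on a spanning set. So the closed condition is compatible with every [phi]. *)
Lemma Uminors_map (R R' : comAlgType k) (phi : {lrmorphism R -> R'}) (L : set {mpoly R[n]}) :
  minT (span (map_mpoly phi @` L)) <-> forall x, Uminors L x -> phi x = 0.
Proof.
have gm p := gen_map A D (phi : {rmorphism R -> R'}) L p.
split=> [mv x [p [M [g [Tp hM ->]]]]|H p Tp].
  rewrite -det_map_mx map_mxsub; apply: (mv p Tp) => i; rewrite /genmx /= -map_row gm -map_vec.
  by apply: span_sub; exists (vec (row i M)) => //; apply: hM.
have mv : minors_vanish (map_mx phi @` gmx L p) (size (mon p) - Qf p + 1).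
  move=> M g hM.
  have H0 i : exists v, gmx L p v /\ map_mx phi v = row i M by have [v h1 h2] := hM i; exists v.
  have [N hN] := choice H0.
  have -> : M = map_mx phi (\matrix_i N i).
    by apply/row_matrixP => i; rewrite -map_row rowK; case: (hN i).
  rewrite -map_mxsub det_map_mx; apply: H; exists p, (\matrix_i N i), g; split => // i.
  by rewrite rowK; case: (hN i).
move=> M g hM; apply: (minors_vanish_span mv) => i; have := hM i; rewrite /genmx /= gm -{2}(vecK (row i M) (monU p)).
apply: (@span_min _ _ _ [set f | span _ (crd (mon p) f)]).
  split=> /=; first by rewrite (_ : crd _ 0 = 0); [exact: (sm0 (span_sm _))|apply/rowP => j; rewrite !mxE mcoeff0].
  move=> a f f' hf hf'; rewrite (_ : crd _ _ = a *: crd (mon p) f + crd (mon p) f').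
    by apply: (smD (span_sm _)) => //; apply: (smZ _ (span_sm _)).
  by apply/rowP => j; rewrite !mxE mcoeffD mcoeffZ.
move=> _ [f Gf <-] /=; have fS : inS (mon p) f by rewrite -gS; apply: gen_in Gf.
apply: span_sub; exists (crd (mon p) f); first by rewrite /genmx /= crdK.
by rewrite -{2}(crdK (monU p) fS) map_vec vecK.
Qed.

Lemma idgen_van (R R' : comAlgType k) (phi : {lrmorphism R -> R'}) (U : set R) :
  (forall c, ideal_gen U c -> phi c = 0) <-> (forall x, U x -> phi x = 0).
Proof.
split=> [H x Ux|H]; first by apply: H; apply: idgen_sub.
apply: idgen_min => //; split=> [|a x y /= hx hy]; rewrite /= ?raddf0 //.
by rewrite rmorphD rmorphM /= in hx hy *; rewrite hx hy mulr0 addr0.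
Qed.

Lemma eta_closed : is_closed_embedding eta.
Proof.
split; first split.
- exact: hilb_functor.
- exact: hs_functor.
- by move=> R Y pY; apply/hs_point; apply: eta_hs.
- by move=> R R' phi Y pY; apply: eta_base.
- by move=> R Y Y'; apply: eta_inj.
move=> R L /hs_point HL; exists (ideal_gen (Uminors L)); first exact: idgen_id.
move=> R' phi; have HL' := hs_map TS (phi : {rmorphism R -> R'}) HL.
by rewrite (eta_image HL') Uminors_map idgen_van.
Qed.

Lemma eta_canonical : is_canonical_map eta.
Proof.
move=> R Y pY; exists (IY b A Y) => //; case: pY => -[h1 h2] _ _.
exact: (IY_ideal_of Hfan Hex Hmu h1 h2).
Qed.

End Canonical.

(** * Rank one matrices *)

Section RankOne.
Variables (R : comNzRingType) (n : nat).
Implicit Type M : 'M[R]_n.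

Definition entries M := [seq M x.1 x.2 | x <- enum {: 'I_n * 'I_n}].

(** The image of [M] is a line bundle quotient of $R^n$. Where some entry of column [b] is
    invertible, that column gives homogeneous coordinates of the corresponding point of projective
    space; other columns give proportional ones. *)
Record rank1 M : Prop := Rank1 {
  r1_mul : forall a b c d, M a b * M c d = M a d * M c b;
  r1_unit : ideal_gen [set` entries M] 1 }.

Lemma entryP M f : f \in entries M -> exists a b, f = M a b.
Proof. by move=> /mapP [[a b] _ ->]; exists a, b. Qed.

Lemma r1_local M (V : lmodType R) (N : set V) v : rank1 M -> is_submodule N ->
  (forall a b, exists e, N (M a b ^+ e *: v)) -> N v.
Proof.
move=> HM HN H; rewrite -[v]scale1r.
apply: (@unit_ideal_powers _ [set x | N (x *: v)] (entries M)) (r1_unit HM) _ => [|f /entryP [a [b ->]]]; last exact: H.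
split=> /=; first by rewrite scale0r; apply: sm0.
by move=> x y z hy hz; rewrite scalerDl -scalerA; apply: (smD HN) => //; apply: (smZ _ HN).
Qed.

Lemma r1_local0 M x : rank1 M -> (forall a b, exists e, M a b ^+ e * x = 0) -> x = 0.
Proof.
move=> HM H; apply: (local_eq0 (r1_unit HM)) => f /entryP [a [b ->]]; exact: H.
Qed.

Lemma r1_rel M u a b : rank1 M -> lker M (M a b *: u - (u *m M) 0 b *: delta_mx 0 a).
Proof.
move=> HM; rewrite /lker /= mulmxBl -!scalemxAl -rowE; apply/rowP => c; rewrite !mxE.
rewrite mulr_sumr mulr_suml -sumrB big1 // => x _.
by rewrite mulrCA -mulrA [M x b * _](r1_mul HM) (mulrC (M x c)) subrr.
Qed.

Lemma r1_lf M : rank1 M -> locally_free setT (lker M) 1.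
Proof.
move=> HM; exists (entries M); split; first exact: (r1_unit HM).
move=> f /entryP [a [b ->]]; exists (fun=> delta_mx 0 a); split => //.
  by move=> v _; exists 1%N, (fun=> (v *m M) 0 b); rewrite big_ord1 expr1; apply: r1_rel.
move=> c; rewrite big_ord1 /lker /= -scalemxAl -rowE => /rowP /(_ b); rewrite !mxE => e.
by exists 1%N => j; rewrite (ord1 j) expr1 mulrC.
Qed.

(** Where an entry [M a b] is invertible, the quotient is generated by the class of the basis vector
    [a], and so is its further quotient by [M']. *)
Lemma r1_eq M M' : rank1 M -> rank1 M' -> lker M `<=` lker M' -> lker M = lker M'.
Proof.
move=> HM HM' sub; apply/seteqP; split=> // u hu; apply/rowP => b; rewrite [RHS]mxE.
apply: (r1_local0 HM') => a c; exists 1%N; rewrite expr1.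
have /sub := r1_rel u a b HM; rewrite /lker /= mulmxBl -!scalemxAl hu scaler0 sub0r -rowE.
by move=> /rowP /(_ c); rewrite !mxE => /eqP; rewrite oppr_eq0 mulrC => /eqP.
Qed.

End RankOne.

Lemma r1_map (R R' : comNzRingType) n (phi : {rmorphism R -> R'}) (M : 'M[R]_n) : rank1 M -> rank1 (map_mx phi M).
Proof.
move=> HM; split=> [a b c d|]; first by rewrite !mxE -!rmorphM (r1_mul HM).
have -> : entries (map_mx phi M) = [seq phi x | x <- entries M].
  by rewrite /entries -[RHS]map_comp; apply: eq_map => x /=; rewrite mxE.
exact: (@idgen_map _ _ phi _ (r1_unit HM)).
Qed.

Lemma r1_lker_map (R R' : comNzRingType) n (phi : {rmorphism R -> R'}) (M : 'M[R]_n) : rank1 M ->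
  span (map_mx phi @` lker M) = lker (map_mx phi M) :> set 'rV[R']_n.
Proof.
move=> HM; apply/seteqP; split.
  apply: span_min; first exact: lker_sm.
  by move=> _ [u hu <-]; rewrite /lker /= -map_mxM hu map_mx0.
move=> u hu; apply: (r1_local (r1_map phi HM) (span_sm _)) => a b; exists 1%N; rewrite expr1.
have -> : map_mx phi M a b *: u = \sum_c u 0 c *: map_mx phi (M a b *: (delta_mx 0 c : 'rV[R]_n) - ((delta_mx 0 c : 'rV[R]_n) *m M) 0 b *: delta_mx 0 a).
  transitivity (map_mx phi M a b *: u - (u *m map_mx phi M) 0 b *: (delta_mx 0 a : 'rV[R']_n)).
    by rewrite (hu : u *m _ = 0) [X in _ - X *: _]mxE scale0r subr0.
  apply/rowP => x; rewrite !mxE summxE mulr_suml [X in _ * X](_ : _ = \sum_c u 0 c * (c == x)%:R); last first.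
    by rewrite (bigD1 x) //= eqxx mulr1 big1 ?addr0 // => c /negPf ->; rewrite mulr0.
  rewrite mulr_sumr -sumrB; apply: eq_bigr => c _; rewrite -rowE !mxE rmorphB !rmorphM !rmorph_nat eqxx /= (eq_sym x c).
  by rewrite mulrBr; congr (_ - _); [rewrite mulrCA|rewrite mulrA].
apply: (sm_sum _ (span_sm _)) => c _; apply: (smZ _ (span_sm _)); apply: span_sub.
exists (M a b *: (delta_mx 0 c : 'rV[R]_n) - ((delta_mx 0 c : 'rV[R]_n) *m M) 0 b *: delta_mx 0 a) => //.
exact: r1_rel.
Qed.

Section LfMinors.
Variables (R : comNzRingType) (m q : nat) (E : 'M[R]_m).
Hypothesis hE : lf_proj q E.

(** Locally $E = X Y$ up to a power of [f], so each [q]-minor is a product of a minor of [X] and one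
    of [Y]. *)
Lemma lf_minor_mul (c c' d d' : 'I_q -> 'I_m) :
  \det (mxsub c c' E) * \det (mxsub d d' E) = \det (mxsub c d' E) * \det (mxsub d c' E).
Proof.
case: hE => _ [fs [h1 hfs]]; apply/eqP; rewrite -subr_eq0; apply/eqP; apply: (local_eq0 h1) => f /hfs [N [X [Y [e1 _]]]].
have H (x y : 'I_q -> 'I_m) : (f ^+ N) ^+ q * \det (mxsub x y E) = \det (rowsub x X) * \det (colsub y Y).
  rewrite -det_mulmx -detZ; congr (\det _); apply/matrixP => i j; rewrite !mxE.
  by move/matrixP: e1 => /(_ (x i) (y j)); rewrite !mxE => ->; apply: eq_bigr => l _; rewrite !mxE.
exists (N * q + N * q)%N; rewrite exprD exprM; set F := _ ^+ q in H *.
transitivity ((F * \det (mxsub c c' E)) * (F * \det (mxsub d d' E)) - (F * \det (mxsub c d' E)) * (F * \det (mxsub d c' E))).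
  by ring.
by rewrite !H; ring.
Qed.

Lemma lf_minor_unit (F : fieldType) (phi : {rmorphism R -> F}) :
  exists c c' : 'I_q -> 'I_m, phi (\det (mxsub c c' E)) != 0.
Proof.
case: hE => _ [fs [h1 hfs]]; have [f /hfs [N [X [Y [e1 e2]]]] f0] := unit_ideal_image phi h1.
have fN : phi (f ^+ N) != 0 by rewrite rmorphXn expf_neq0.
have eYX : map_mx phi Y *m map_mx phi X = (phi (f ^+ N))%:M by rewrite -map_mxM e2 map_scalar_mx.
have fX : row_full (map_mx phi X).
  apply/row_fullP; exists ((phi (f ^+ N))^-1 *: map_mx phi Y).
  by rewrite -scalemxAl eYX scale_scalar_mx mulVf.
have fY : row_full (map_mx phi Y)^T.
  apply/row_fullP; exists ((phi (f ^+ N))^-1 *: (map_mx phi X)^T).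
  by rewrite -scalemxAl -trmx_mul eYX tr_scalar_mx scale_scalar_mx mulVf.
exists (fullrankfun fX), (fullrankfun fY).
have uX := fullrowsub_unit fX; have uY := fullrowsub_unit fY; rewrite !unitmxE !unitfE in uX uY.
have : phi ((f ^+ N) ^+ q * \det (mxsub (fullrankfun fX) (fullrankfun fY) E)) != 0.
  rewrite -detZ (_ : _ *: _ = rowsub (fullrankfun fX) X *m colsub (fullrankfun fY) Y).
    rewrite det_mulmx rmorphM mulf_neq0 // -det_map_mx; first by rewrite map_mxsub.
    by rewrite -det_tr; move: uY; congr (_ != 0); congr (\det _); apply/matrixP => i j; rewrite !mxE.
  apply/matrixP => i j; rewrite !mxE; move/matrixP: e1 => /(_ (fullrankfun fX i) (fullrankfun fY j)).
  by rewrite !mxE => ->; apply: eq_bigr => l _; rewrite !mxE.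
by apply: contra => /eqP e0; rewrite rmorphM e0 mulr0.
Qed.

End LfMinors.

Lemma r1_of (R : comNzRingType) m (L : set 'rV[R]_m) : is_submodule L -> locally_free setT L 1 ->
  exists2 M, rank1 M & L = lker M.
Proof.
move=> HL lf; have [E hE ->] := lf_proj_of HL lf; exists E => //.
have e1 (c c' : 'I_1 -> 'I_m) : \det (mxsub c c' E) = E (c 0) (c' 0) by rewrite det_mx11 !mxE.
split=> [a b c d|].
  by have := lf_minor_mul hE (fun=> a) (fun=> b) (fun=> c) (fun=> d); rewrite !e1.
apply: (residue_ideal_unit (idgen_id _)) => F phi _; have [c [c']] := lf_minor_unit hE phi; rewrite e1 => ne.
by exists (E (c 0) (c' 0)) => //; apply: idgen_sub; apply/mapP; exists (c 0, c' 0); rewrite ?mem_enum.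
Qed.

(** * Pluecker coordinates *)

Section Pluecker.
Variables (m q N : nat) (dec : 'I_N -> {ffun 'I_q -> 'I_m}) (enc : {ffun 'I_q -> 'I_m} -> 'I_N).
Hypotheses (encK : cancel enc dec) (decK : cancel dec enc).

(* Coordinates are indexed by all q-tuples of indices, [ins c t i] replaces the t-th one by i. *)
Definition ins c t i := enc [ffun s => if s == t then i else dec c s].

(** For Pluecker coordinates [l] of a quotient, Cramer's rule puts these vectors in the kernel;
    where [l c] is invertible they span it. *)
Definition vv (Q : comNzRingType) (l : 'I_N -> Q) c i : 'rV[Q]_m :=
  l c *: delta_mx 0 i - \sum_t l (ins c t i) *: delta_mx 0 (dec c t).

(** The incidence equations: [w] lies in the kernel exactly when they all vanish, by [lker_tst].
    They are linear in [w] and in the coordinates. *)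
Definition tst (Q : comNzRingType) (l : 'I_N -> Q) (w : 'rV[Q]_m) d s := \sum_i w 0 i * l (ins d s i).

Definition pl (Q : comNzRingType) (G : 'M[Q]_(m, q)) c := \det (rowsub (dec c) G).

Lemma vv_map (Q Q' : comNzRingType) (psi : {rmorphism Q -> Q'}) (l : 'I_N -> Q) c i :
  map_mx psi (vv l c i) = vv (psi \o l) c i.
Proof.
apply/rowP => j; rewrite !mxE !summxE rmorphB rmorphM rmorph_nat rmorph_sum; congr (_ - _).
by apply: eq_bigr => t _; rewrite !mxE rmorphM rmorph_nat.
Qed.

Lemma vvZ (Q : comNzRingType) a (l : 'I_N -> Q) c i : vv (fun x => a * l x) c i = a *: vv l c i.
Proof. by rewrite /vv scalerBr scalerA scaler_sumr; congr (_ - _); apply: eq_bigr => t _; rewrite scalerA. Qed.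

Lemma tst_map (Q Q' : comNzRingType) (psi : {rmorphism Q -> Q'}) (l : 'I_N -> Q) w d s :
  psi (tst l w d s) = tst (psi \o l) (map_mx psi w) d s.
Proof. by rewrite /tst rmorph_sum; apply: eq_bigr => i _; rewrite rmorphM mxE. Qed.

Lemma tstZ (Q : comNzRingType) a (l : 'I_N -> Q) w d s : tst (fun x => a * l x) w d s = a * tst l w d s.
Proof. by rewrite /tst mulr_sumr; apply: eq_bigr => i _; rewrite mulrCA. Qed.

Lemma tstZD (Q : comNzRingType) a (l : 'I_N -> Q) u w d s : tst l (a *: u + w) d s = a * tst l u d s + tst l w d s.
Proof. by rewrite /tst mulr_sumr -big_split; apply: eq_bigr => i _; rewrite !mxE mulrDl mulrA. Qed.

(** A vector passing the incidence tests is thus, up to the factor [l c], a combination of the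
    Cramer vectors. *)
Lemma vv_sum (Q : comNzRingType) (l : 'I_N -> Q) (w : 'rV[Q]_m) c :
  l c *: w = \sum_i w 0 i *: vv l c i + \sum_t tst l w c t *: delta_mx 0 (dec c t).
Proof.
rewrite {1}[w]row_sum_delta scaler_sumr.
have -> : \sum_t tst l w c t *: (delta_mx 0 (dec c t) : 'rV[Q]_m) =
    \sum_i w 0 i *: (\sum_t l (ins c t i) *: (delta_mx 0 (dec c t) : 'rV[Q]_m)).
  under [RHS]eq_bigr => i _ do rewrite scaler_sumr; rewrite exchange_big; apply: eq_bigr => t _.
  by rewrite /tst scaler_suml; apply: eq_bigr => i _; rewrite scalerA.
by rewrite -big_split; apply: eq_bigr => i _ /=; rewrite scalerBr subrK !scalerA mulrC.
Qed.

Section Minors.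
Variables (Q : comNzRingType) (G : 'M[Q]_(m, q)).

Lemma pl_ins c t i : pl G (ins c t i) = \sum_j G i j * cofactor (rowsub (dec c) G) t j.
Proof.
rewrite /pl /ins encK (expand_det_row _ t); apply: eq_bigr => j _; rewrite mxE ffunE eqxx; congr (_ * (_ * \det _)).
by apply/matrixP => x y; rewrite !mxE ffunE eq_sym (negPf (neq_lift _ _)).
Qed.

Lemma pl_tst w d s : w *m G = 0 -> tst (pl G) w d s = 0.
Proof.
move=> h; rewrite /tst; under eq_bigr => i _ do rewrite pl_ins mulr_sumr.
rewrite exchange_big big1 // => j _; under eq_bigr => i _ do rewrite mulrA.
by rewrite -mulr_suml; move/rowP: h => /(_ j); rewrite !mxE => ->; rewrite mul0r.
Qed.

Lemma pl_cramer c i : pl G c *: row i G = \sum_t pl G (ins c t i) *: row (dec c t) G.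
Proof.
have -> : pl G c *: row i G = row i G *m \adj (rowsub (dec c) G) *m rowsub (dec c) G.
  by rewrite -mulmxA mul_adj_mx mul_mx_scalar.
rewrite mulmx_sum_row; apply: eq_bigr => t _; congr (_ *: _); last by apply/rowP => j; rewrite !mxE.
by rewrite pl_ins mxE; apply: eq_bigr => j _; rewrite !mxE.
Qed.

Lemma pl_vv c i : vv (pl G) c i *m G = 0.
Proof.
rewrite /vv mulmxBl -scalemxAl -rowE pl_cramer mulmx_suml; apply/eqP; rewrite subr_eq0; apply/eqP.
by apply: eq_bigr => t _; rewrite -scalemxAl -rowE.
Qed.

Lemma pl_rep c s t : s != t -> dec c s = dec c t -> pl G c = 0.
Proof. by move=> ne e; apply: (determinant_alternate ne) => j; rewrite !mxE e. Qed.

Lemma pl_comb (l : 'I_N -> Q) c d : (forall i, vv l c i *m G = 0) ->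
  l c ^+ q * pl G d = \det (\matrix_(s, t) l (ins c t (dec d s))) * pl G c.
Proof.
move=> h; rewrite /pl -detZ -det_mulmx; congr (\det _); apply/matrixP => s j; rewrite !mxE.
have := h (dec d s); rewrite /vv mulmxBl -scalemxAl -rowE mulmx_suml => /rowP /(_ j) /eqP.
rewrite !mxE subr_eq0 => /eqP ->; rewrite summxE; apply: eq_bigr => t _.
by rewrite -scalemxAl -rowE !mxE.
Qed.

Lemma pl_det c d : pl G c * \det (\matrix_(s, t) pl G (ins c t (dec d s))) = pl G c ^+ q * pl G d.
Proof. by rewrite (pl_comb d (pl_vv c)) mulrC. Qed.

End Minors.

(** The [q]-th exterior power of [E], in the redundant coordinates indexed by all tuples; each
    column consists of Pluecker coordinates of the quotient. *)
Definition Lam (Q : comNzRingType) (E : 'M[Q]_m) : 'M[Q]_N := \matrix_(a, b) pl (colsub (dec b) E) a.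

Lemma LamE (Q : comNzRingType) (E : 'M[Q]_m) a b : Lam E a b = \det (mxsub (dec a) (dec b) E).
Proof. by rewrite mxE /pl; congr (\det _); apply/matrixP => i j; rewrite !mxE. Qed.

Lemma Lam_map (Q Q' : comNzRingType) (psi : {rmorphism Q -> Q'}) (E : 'M[Q]_m) :
  Lam (map_mx psi E) = map_mx psi (Lam E).
Proof. by apply/matrixP => a b; rewrite [RHS]mxE !LamE -det_map_mx map_mxsub. Qed.

Local Notation cl M b := (fun c => M c b).

Section Gr.
Variables (R : comNzRingType) (E : 'M[R]_m).
Hypothesis hE : lf_proj q E.

Lemma cl_Lam b : cl (Lam E) b = pl (colsub (dec b) E).
Proof. by apply: funext => c; rewrite mxE. Qed.

Lemma Lam_r1 : rank1 (Lam E).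
Proof.
split=> [a b c d|]; first by rewrite !LamE; apply: (lf_minor_mul hE).
apply: (residue_ideal_unit (idgen_id _)) => F phi _; have [c [c' ne]] := lf_minor_unit hE phi.
exists (\det (mxsub c c' E)) => //; apply: idgen_sub; apply/mapP; exists (enc (finfun c), enc (finfun c')); rewrite ?mem_enum //.
by rewrite LamE !encK; congr (\det _); apply/matrixP => i j; rewrite !mxE !ffunE.
Qed.

Lemma Lam_vv b c i : lker E (vv (cl (Lam E) b) c i).
Proof.
rewrite /lker /=; case: hE => _ [fs [h1 hfs]]; apply/rowP => j; rewrite [RHS]mxE.
apply: (local_eq0 h1) => f /hfs [M [X [Y [e1 _]]]]; exists (M * q + M)%N.
have H a : (f ^+ M) ^+ q * Lam E a b = \det (colsub (dec b) Y) * pl X a.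
  rewrite mulrC [RHS]mulrC -det_mulmx mulrC LamE -detZ; congr (\det _); apply/matrixP => x y; rewrite !mxE.
  by move/matrixP: e1 => /(_ (dec a x) (dec b y)); rewrite !mxE => ->; apply: eq_bigr => l _; rewrite !mxE.
have -> : f ^+ (M * q + M) * (vv (cl (Lam E) b) c i *m E) 0 j = (vv (fun a => (f ^+ M) ^+ q * Lam E a b) c i *m (f ^+ M *: E)) 0 j.
  by rewrite vvZ -scalemxAl -scalemxAr !mxE exprD exprM mulrA.
rewrite (_ : (fun a => _) = (fun a => \det (colsub (dec b) Y) * pl X a)); last by apply: funext.
by rewrite vvZ e1 mulmxA -(scalemxAl _ _ X) pl_vv scaler0 mul0mx mxE.
Qed.

Lemma lker_tst w : lker E w <-> forall b d s, tst (cl (Lam E) b) w d s = 0.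
Proof.
split=> [h b d s|h].
  rewrite cl_Lam; apply: pl_tst; apply/matrixP => x j; move/matrixP: h => /(_ x (dec b j)).
  by rewrite !mxE => e; rewrite -[RHS]e; apply: eq_bigr => i _; rewrite !mxE.
apply: (r1_local Lam_r1 (lker_sm E)) => c b; exists 1%N; rewrite expr1 (vv_sum (cl (Lam E) b)).
rewrite [X in _ + X]big1 ?addr0; last by move=> t _; rewrite h scale0r.
by apply: (sm_sum _ (lker_sm E)) => i _; apply: (smZ _ (lker_sm E)); apply: Lam_vv.
Qed.

(** Where [M c b] is invertible, [hd] expresses the whole column [b] by the coordinates next to [c],
    as [pl_comb] does for [Lam E]; the columns are therefore proportional. *)
Lemma Lam_eq (M : 'M[R]_N) : rank1 M -> (forall b c i, lker E (vv (cl M b) c i)) ->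
  (forall b c d, M c b * \det (\matrix_(s, t) M (ins c t (dec d s)) b) = M c b ^+ q * M d b) -> lker M = lker (Lam E).
Proof.
move=> HM hv hd; apply: (r1_eq HM Lam_r1) => u hu; apply/rowP => b'; rewrite [RHS]mxE.
apply: (r1_local0 HM) => c b; exists q.+1.
have key d : M c b ^+ q.+1 * Lam E d b' = M d b * (M c b ^+ q * Lam E c b').
  have := @pl_comb _ (colsub (dec b') E) (cl M b) c d; rewrite exprS -mulrA !mxE => ->.
    by rewrite [LHS]mulrA hd -mulrA mulrCA.
  move=> i; have := hv b c i; rewrite /lker /= => h; apply/matrixP => x j; move/matrixP: h => /(_ x (dec b' j)).
  by rewrite !mxE => e; rewrite -[RHS]e; apply: eq_bigr => y _; rewrite !mxE.
rewrite mxE mulr_sumr (eq_bigr (fun d => u 0 d * M d b * (M c b ^+ q * Lam E c b'))); last first.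
  by move=> d _; rewrite mulrCA key [LHS]mulrA.
by rewrite -mulr_suml; move/rowP: hu => /(_ b); rewrite !mxE => ->; rewrite mul0r.
Qed.

End Gr.

(** The Pluecker embedding on submodules. Quantifying over all idempotents avoids choosing one;
    [PlE] evaluates it with any of them. *)
Definition Pl (R : comNzRingType) (K : set 'rV[R]_m) : set 'rV[R]_N :=
  [set u | forall E, lf_proj q E -> K = lker E -> lker (Lam E) u].

Lemma PlE (R : comNzRingType) (E : 'M[R]_m) : lf_proj q E -> Pl (lker E) = lker (Lam E).
Proof.
move=> hE; apply/seteqP; split=> [u /(_ E hE erefl)//|u hu E' hE' e].
rewrite -(Lam_eq hE' (Lam_r1 hE)) // => [b c i|b c d]; first by rewrite -e; apply: Lam_vv.
by have := pl_det (colsub (dec b) E) c d; rewrite -cl_Lam.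
Qed.

Lemma Pl_inj (R : comNzRingType) (E E' : 'M[R]_m) : lf_proj q E -> lf_proj q E' ->
  Pl (lker E) = Pl (lker E') -> lker E `<=` lker E'.
Proof.
move=> hE hE'; rewrite !PlE // => e w /(lker_tst hE) h; apply/(lker_tst hE') => b d s.
have H (M : 'M[R]_N) b0 : ((\sum_i w 0 i *: (delta_mx 0 (ins d s i) : 'rV[R]_N)) *m M) 0 b0 = tst (cl M b0) w d s.
  by rewrite mulmx_suml summxE /tst; apply: eq_bigr => i _; rewrite -scalemxAl -rowE !mxE.
have : lker (Lam E) (\sum_i w 0 i *: (delta_mx 0 (ins d s i) : 'rV[R]_N)).
  by apply/rowP => b0; rewrite H h mxE.
by rewrite e => /rowP /(_ b); rewrite H mxE.
Qed.

End Pluecker.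

(** * Closed subfunctors of projective space *)

Section Forms.
Variables (k : fieldType) (N : nat).

(* A homogeneous polynomial of degree [fdeg], given by its values. *)
Record form := Form { fdeg : nat;
  fev : forall Q : comNzRingType, (k -> Q) -> ('I_N -> Q) -> Q;
  fev_map : forall (Q Q' : comNzRingType) (psi : {rmorphism Q -> Q'}) io l,
    fev (psi \o io) (psi \o l) = psi (fev io l);
  fev_hom : forall (Q : comNzRingType) (io : k -> Q) a l,
    fev io (fun c => a * l c) = a ^+ fdeg * fev io l }.

Definition fpoly (f : form) : {mpoly k[N]} := fev f (@mpolyC N k) (fun i => 'X_i).

Lemma fpoly_mmap (f : form) (Q : comNzRingType) (io : {rmorphism k -> Q}) l : mmap io l (fpoly f) = fev f io l.
Proof.
have := fev_map f (mmap io l : {rmorphism {mpoly k[N]} -> Q}) (@mpolyC N k) (fun i => 'X_i).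
rewrite /fpoly => <-; congr (fev f _ _); apply: funext => x /=; first by rewrite mmapC.
by rewrite mmapX mmap1U.
Qed.

Lemma mmap_cong (S : comNzRingType) (I : set S) (io : {rmorphism k -> S}) l l' (F : {mpoly k[N]}) : is_ideal I ->
  (forall i, I (l i - l' i)) -> I (mmap io l F - mmap io l' F).
Proof.
move=> HI h; have mulI x y z t : I (x - y) -> I (z - t) -> I (x * z - y * t).
  move=> h1 h2; rewrite (_ : _ - _ = x * (z - t) + (x - y) * t); last by ring.
  by apply: (idD HI); [apply: (idM _ HI)|apply: (idMr _ HI)].
rewrite /mmap -sumrB; apply: (id_sum _ HI) => w _; rewrite -mulrBr; apply: (idM _ HI).
rewrite /mmap1; apply: (big_ind2 (fun x y => I (x - y))) => [|x y z t|i _].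
- by rewrite subrr; apply: id0.
- exact: mulI.
elim: (w i) => [|e IH]; first by rewrite !expr0 subrr; apply: id0.
by rewrite !exprS; apply: mulI.
Qed.

Lemma linear_formP (R : comNzRingType) a (u v : 'rV[R]_N) :
  linear_form (a *: u + v) = a *: linear_form u + linear_form v.
Proof.
rewrite /linear_form scaler_sumr -big_split; apply: eq_bigr => i _ /=.
by rewrite !mxE scalerDl scalerA.
Qed.

Lemma linear_form_delta (R : comNzRingType) i : linear_form (delta_mx 0 i : 'rV[R]_N) = 'X_i.
Proof.
rewrite /linear_form (bigD1 i) //= mxE !eqxx scale1r big1 ?addr0 // => j ne.
by rewrite mxE (negPf ne) andbF scale0r.
Qed.

Lemma linear_form_eval (R : comNzRingType) (v : 'rV[R]_N) l : (linear_form v).@[l] = \sum_i v 0 i * l i.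
Proof. by rewrite /linear_form raddf_sum; apply: eq_bigr => i _; rewrite /= mevalZ mevalXU. Qed.

Section Vanish.
Variables (R : comAlgType k) (M : 'M[R]_N) (f : form).
Hypothesis HM : rank1 M.
Local Notation I := (ideal_gen (@linear_form R N @` lker M)).

(** Modulo the linear forms in the kernel, $M_{ab} x_c \equiv x_a M_{cb}$. Hence $M_{ab}^e f(x) =
    f(M_{ab} x) \equiv x_a^e f(M_{\cdot b}) = 0$, where [e] is the degree of [f], and the entries
    generate the unit ideal. *)
Lemma form_ideal : (forall b, fev f (in_alg R) (fun c => M c b) = 0) -> I (map_mpoly (in_alg R) (fpoly f)).
Proof.
move=> h; have HI : is_ideal I by apply: idgen_id.
pose io : {rmorphism k -> {mpoly R[N]}} := @mpolyC N R \o in_alg R.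
have -> : map_mpoly (in_alg R) (fpoly f) = fev f io (fun i => 'X_i).
  have := fev_map f (map_mpoly (in_alg R) : {rmorphism {mpoly k[N]} -> {mpoly R[N]}}) (@mpolyC N k) (fun i => 'X_i).
  by move=> /= <-; congr (fev f _ _); apply: funext => x /=; rewrite ?map_mpolyC ?map_mpolyX.
apply: (r1_local HM) => [|a b].
  split; first exact: id0.
  by move=> x u v hu hv; rewrite -mul_mpolyC; apply: (proj2 HI).
exists (fdeg f); rewrite -mul_mpolyC rmorphXn -fev_hom -fpoly_mmap.
have -> : mmap io (fun c => (M a b)%:MP * 'X_c) (fpoly f) =
    mmap io (fun c => (M a b)%:MP * 'X_c) (fpoly f) - mmap io (fun c => 'X_a * (M c b)%:MP) (fpoly f).
  rewrite [X in _ - X]fpoly_mmap fev_hom (_ : fev f _ _ = (fev f (in_alg R) (fun c => M c b))%:MP).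
    by rewrite h mpolyC0 mulr0 subr0.
  by rewrite -(fev_map f (@mpolyC N R)).
apply: mmap_cong => // c; apply: idgen_sub.
exists (M a b *: (delta_mx 0 c : 'rV[R]_N) - ((delta_mx 0 c : 'rV[R]_N) *m M) 0 b *: delta_mx 0 a).
  exact: r1_rel.
by rewrite addrC -scaleNr linear_formP -[M a b *: _]addr0 linear_formP !linear_form_delta -rowE mxE
  (_ : linear_form 0 = 0) ?addr0 ?scaleNr ?mul_mpolyC 1?addrC ?[_ * (M c b)%:MP]mulrC ?mul_mpolyC //
  /linear_form big1 // => i _; rewrite mxE scale0r.
Qed.

(** Evaluation at the column [b] kills the linear forms in the kernel of [M]. *)
Lemma ideal_form : I (map_mpoly (in_alg R) (fpoly f)) -> forall b, fev f (in_alg R) (fun c => M c b) = 0.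
Proof.
move=> h b; pose ev : {rmorphism {mpoly R[N]} -> R} := meval (fun c => M c b).
have <- : ev (map_mpoly (in_alg R) (fpoly f)) = fev f (in_alg R) (fun c => M c b).
  have := fev_map f (ev \o map_mpoly (in_alg R)) (@mpolyC N k) (fun i => 'X_i).
  move=> /= <-; congr (fev f _ _); apply: funext => x /=; first by rewrite map_mpolyC mevalC.
  by rewrite map_mpolyX mevalXU.
move: h; apply: (@idgen_min _ _ [set g | ev g = 0]) => [|_ [u hu <-]].
  split=> [|a x y hx hy]; first exact: (raddf0 ev).
  apply: etrans (rmorphD ev _ _) _; rewrite (hy : ev y = 0) addr0; apply: etrans (rmorphM ev _ _) _.
  by rewrite (hx : ev x = 0) mulr0.
by rewrite /= linear_form_eval; move/rowP: hu => /(_ b); rewrite !mxE.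
Qed.

End Vanish.

Local Notation A1 := (const_mx 1 : 'M[int]_(1, N)).

(** The standard grading is the one given by a single row of ones, so the results on [component]
    apply to it. *)
Lemma total_degree w : mdegree A1 w = const_mx (mdeg w)%:Z.
Proof.
apply/matrixP => i j; rewrite !mxE mdegE -[in RHS](big_mkcond xpredT) raddf_sum /=.
by apply: eq_bigr => l _; rewrite !mxE mul1r.
Qed.

Lemma pihomog_component (R : comNzRingType) e (f : {mpoly R[N]}) :
  pihomog [measure of mdeg] e f = component A1 (const_mx e%:Z) f.
Proof.
rewrite /pihomog /component; apply: eq_bigl => w; rewrite total_degree.
by apply/eqP/eqP => [->//|/matrixP /(_ 0 0)]; rewrite !mxE => -[].
Qed.

Lemma linear_ideal_homog (R : comNzRingType) (L : set 'rV[R]_N) e g :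
  ideal_gen (@linear_form R N @` L) g -> ideal_gen (@linear_form R N @` L) (pihomog [measure of mdeg] e g).
Proof.
set I := ideal_gen _; have HI : is_ideal I by apply: idgen_id.
have HIs : is_submodule I by split; [exact: id0|move=> a u v hu hv; rewrite -mul_mpolyC; apply: (proj2 HI)].
rewrite pihomog_component; move: (const_mx e%:Z) => p h; move: h p.
apply: (@idgen_min _ _ [set f | forall p, I (component A1 p f)]) => [|_ [u Lu <-] p /=].
  split=> /= [p|a x y hx hy p]; first by rewrite component0; apply: id0.
  have {}hx : forall p, I (component A1 p (a * x)).
    rewrite [a]mpolyE mulr_suml => {}p.
    apply: (@sm_sum _ _ [set f | I (component A1 p f)]) => [|w _ /=].
      split=> /=; first by rewrite component0; apply: id0.
      by move=> b u v hu hv; rewrite componentZD; apply: (smD HIs) => //; apply: (smZ _ HIs).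
    rewrite -scalerAl -[_ *: _]addr0 componentZD component0 addr0; apply: (smZ _ HIs).
    by rewrite -[p](subrK (mdegree A1 w)) componentXM; apply: (idM _ HI).
  by rewrite -[_ * _]scale1r componentZD scale1r; apply: (idD HI).
have gu : graded_piece A1 (const_mx 1) (linear_form u).
  apply: (sm_sum _ (graded_sm _ _ _)) => i _; apply: (smZ _ (graded_sm _ _ _)).
  by move=> w; rewrite msuppX inE => /eqP ->; rewrite total_degree mdeg1 inE.
have [<-|ne] := eqVneq (const_mx 1) p; first by rewrite component_id //; apply: idgen_sub; exists u.
by rewrite (component_ne gu ne); apply: id0.
Qed.

End Forms.

Section Representable.
Variables (k : fieldType) (m q N : nat) (dec : 'I_N.+1 -> {ffun 'I_q -> 'I_m}) (enc : {ffun 'I_q -> 'I_m} -> 'I_N.+1).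
Hypotheses (encK : cancel enc dec) (decK : cancel dec enc).
Variables (I1 : Type) (St : I1 -> 'M[k]_m) (I2 : Type) (I3 : I2 -> Type) (sz ee : I2 -> nat).
Variable W : forall x, I3 x -> 'M[k]_(m, sz x).

Local Notation ins := (ins dec enc).
Local Notation vv := (vv dec enc).
Local Notation tst := (tst dec enc).
Local Notation Lam := (Lam dec).
Local Notation Pl := (Pl dec).
Local Notation cl M b := (fun c => M c b).

(** A subfunctor of the Grassmannian: stability under the endomorphisms [St], and vanishing of
    minors of the images under the maps [W]. All data are defined over [k]. *)
Definition Gr1 (R : comAlgType k) (K : set 'rV[R]_m) := [/\ is_submodule K, locally_free setT K q,
  forall al w, K w -> K (w *m map_mx (in_alg R) (St al)) &
  forall x, minors_vanish [set v | exists y, exists2 w, K w & v = w *m map_mx (in_alg R) (W (x := x) y)] (ee x)].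

Section Equations.
Variables (c d : 'I_N.+1) (i : 'I_m) (s : 'I_q) (T : 'M[k]_m).
Variables (x : I2) (y : 'I_(ee x) -> I3 x) (j : 'I_(ee x) -> 'I_m) (g : 'I_(ee x) -> 'I_(sz x)).

Definition FRev (Q : comNzRingType) (io : k -> Q) (l : 'I_N.+1 -> Q) := l c.
Definition FTev (Q : comNzRingType) (io : k -> Q) l := tst l (vv l c i *m map_mx io T) d s.
Definition FCev (Q : comNzRingType) (io : k -> Q) (l : 'I_N.+1 -> Q) :=
  l c * \det (\matrix_(s, t) l (ins c t (dec d s))) - l c ^+ q * l d.
Definition FWev (Q : comNzRingType) (io : k -> Q) l :=
  \det (colsub g (\matrix_a (vv l c (j a) *m map_mx io (W (y a))))).

Definition FR : form k N.+1.
Proof. by refine (@Form k N.+1 1 FRev _ _) => // Q io a l; rewrite expr1. Defined.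

Definition FT : form k N.+1.
Proof.
refine (@Form k N.+1 2 FTev _ _) => [Q Q' psi io l|Q io a l].
  by rewrite /FTev tst_map map_mxM vv_map -map_mx_comp.
rewrite /FTev tstZ vvZ -scalemxAl -[a *: _]addr0 tstZD [tst l 0 d s]big1 ?addr0; first by rewrite expr2 mulrA.
by move=> i' _; rewrite mxE mul0r.
Defined.

Definition FC : form k N.+1.
Proof.
refine (@Form k N.+1 q.+1 FCev _ _) => [Q Q' psi io l|Q io a l].
  rewrite /FCev rmorphB !rmorphM rmorphXn -det_map_mx; congr (_ * \det _ - _).
  by apply/matrixP => a b; rewrite !mxE.
rewrite /FCev (_ : \matrix_(_, _) _ = a *: \matrix_(s, t) l (ins c t (dec d s))); last by apply/matrixP => u v; rewrite !mxE.
by rewrite detZ exprMn exprS; ring.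
Defined.

Definition FW : form k N.+1.
Proof.
refine (@Form k N.+1 (ee x) FWev _ _) => [Q Q' psi io l|Q io a l].
  rewrite /FWev -det_map_mx map_mxsub; congr (\det (colsub _ _)); apply/row_matrixP => u.
  by rewrite -map_row !rowK map_mxM vv_map -map_mx_comp.
rewrite /FWev -detZ; congr (\det _); apply/matrixP => u v; rewrite !mxE vvZ mulr_sumr.
by apply: eq_bigr => w _; rewrite !mxE mulrA.
Defined.

End Equations.

(** Together: coordinates with a repeated index vanish; the Cramer vectors, and their images under
    [St], pass the incidence tests; the coordinates satisfy the determinantal relations of [pl_det];
    the minors of the images of Cramer vectors vanish. *)
Inductive eqn : form k N.+1 -> Prop :=
| eqnR c s t : s != t -> dec c s = dec c t -> eqn (FR c)
| eqn1 c d i s : eqn (FT c d i s 1%:M)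
| eqnT c d i s al : eqn (FT c d i s (St al))
| eqnC c d : eqn (FC c d)
| eqnW c x y j g : eqn (@FW c x y j g).

Lemma eqn_Gr (R : comAlgType k) (E : 'M[R]_m) f b : lf_proj q E -> Gr1 (lker E) -> eqn f -> fev f (in_alg R) (cl (Lam E) b) = 0.
Proof.
move=> hE [_ _ h1 h2] [c s t ne e|c d i s|c d i s al|c d|c x y j g] /=.
- by rewrite /FRev mxE; apply: pl_rep ne e.
- rewrite /FTev; apply: (proj1 (lker_tst encK hE _)); rewrite map_mx1 mulmx1.
  exact: (Lam_vv encK hE).
- rewrite /FTev; apply: (proj1 (lker_tst encK hE _)); apply: h1.
  exact: (Lam_vv encK hE).
- apply/eqP; rewrite /FCev subr_eq0; apply/eqP.
  by have := pl_det encK (colsub (dec b) E) c d; rewrite -cl_Lam.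
apply: (h2 x) => a; rewrite rowK; exists (y a), (vv (cl (Lam E) b) c (j a)) => //.
exact: (Lam_vv encK hE).
Qed.

Lemma Gr_eqn (R : comAlgType k) (M : 'M[R]_N.+1) : rank1 M ->
  (forall f, eqn f -> forall b, fev f (in_alg R) (cl M b) = 0) ->
  exists2 E, lf_proj q E & Gr1 (lker E) /\ lker M = lker (Lam E).
Proof.
move=> HM h; pose K := [set w : 'rV[R]_m | forall b d s, tst (cl M b) w d s = 0].
(* The equations hold within one column, whereas membership in [K] tests the Cramer vectors of one
   column against all columns. The rank one relations exchange columns. *)
have mix (T : 'M[R]_m) b c i : (forall b d s, tst (cl M b) (vv (cl M b) c i *m T) d s = 0) -> K (vv (cl M b) c i *m T).
  move=> hT l d s; apply: (r1_local0 HM) => a b'; exists 2%N.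
  have col j : (fun c => M a b' * M c j) = (fun c => M a j * M c b') by apply: funext => e; rewrite (r1_mul HM).
  rewrite expr2 -mulrA mulrCA -[M a b' * tst _ _ _ _]tstZ col tstZ.
  have -> : M a b' * (M a l * tst (cl M b') (vv (cl M b) c i *m T) d s) =
      M a l * tst (cl M b') ((M a b' *: vv (cl M b) c i) *m T) d s.
    rewrite -scalemxAl -[_ *: _]addr0 tstZD [tst _ 0 _ _]big1 ?addr0; first by rewrite mulrCA.
    by move=> e _; rewrite mxE mul0r.
  rewrite -vvZ col vvZ -scalemxAl -[_ *: _]addr0 tstZD hT [tst _ 0 _ _]big1 ?addr0 ?mulr0 // => e _.
  by rewrite mxE mul0r.
have HK : is_submodule K.
  split=> [b d s|a u v hu hv b d s]; first by apply: big1 => i _; rewrite mxE mul0r.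
  by rewrite tstZD hu hv mulr0 addr0.
have vvK b c i : K (vv (cl M b) c i).
  rewrite -[vv _ _ _]mulmx1; apply: mix => b' d s.
  by have := h _ (eqn1 c d i s) b'; rewrite /= /FTev map_mx1.
have gK b c w : K w -> M c b *: w = \sum_i w 0 i *: vv (cl M b) c i.
  move=> Kw; rewrite (vv_sum dec enc (cl M b)) [X in _ + X]big1 ?addr0 // => t _.
  by rewrite Kw scale0r.
(* Where [M c b] is invertible, the basis vectors with indices in [c] form a basis of the quotient;
   for independence, the mixed coordinates have a repeated index and vanish. *)
have lf : locally_free setT K q.
  exists (entries M); split; first exact: (r1_unit HM).
  move=> f /entryP [c [b ->]]; exists (fun t => delta_mx 0 (dec c t)); split => // [v _|x hx].
    exists 1%N, (fun t => tst (cl M b) v c t); rewrite expr1 (vv_sum dec enc (cl M b)) addrK.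
    by apply: (sm_sum _ HK) => i _; apply: (smZ _ HK).
  exists 1%N => t; rewrite expr1; have := hx b c t; rewrite /tst.
  rewrite (eq_bigr (fun i => \sum_e x e * ((dec c e == i)%:R * M (ins c t i) b))); last first.
    by move=> i _; rewrite summxE mulr_suml; apply: eq_bigr => e _; rewrite !mxE eqxx /= mulrA eq_sym.
  rewrite exchange_big (bigD1 t) //= [X in _ + X]big1 ?addr0 => [|e ne].
    rewrite -mulr_sumr (bigD1 (dec c t)) //= eqxx mul1r big1 ?addr0; last first.
      by move=> i ne; rewrite eq_sym (negPf ne) mul0r.
    rewrite (_ : ins c t (dec c t) = c) 1?mulrC // /ins -[RHS]decK; congr enc.
    by apply/ffunP => s; rewrite ffunE; case: eqP => // ->.
  rewrite -mulr_sumr (bigD1 (dec c e)) //= eqxx mul1r big1 ?addr0; last first.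
    by move=> i ne'; rewrite eq_sym (negPf ne') mul0r.
  have := h _ (@eqnR (ins c t (dec c e)) e t ne _) b; rewrite /= /FRev => -> //; first exact: mulr0.
  by rewrite /ins encK !ffunE eqxx (negPf ne).
have [E hE KE] := lf_proj_of HK lf; exists E => //; rewrite -KE; split; last first.
  apply: (Lam_eq encK hE HM) => [b c i|b c d]; first by rewrite -KE.
  by have /eqP := h _ (eqnC c d) b; rewrite /= subr_eq0 => /eqP.
split=> // [al w Kw|x A g hA].
  apply: (r1_local HM HK) => c b; exists 1%N; rewrite expr1 scalemxAl (gK b c) // mulmx_suml.
  apply: (sm_sum _ HK) => i _; rewrite -scalemxAl; apply: (smZ _ HK); apply: mix => b' d s.
  exact: (h _ (eqnT c d i s al)).
apply: (r1_local0 HM) => c b; exists (ee x); rewrite -detZ.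
pose G := [set v | exists y i, v = vv (cl M b) c i *m map_mx (in_alg R) (W (x := x) y)].
have mv : minors_vanish G (ee x).
  move=> A' g' hA'; have [y hy] := choice hA'; have [j hj] := choice hy.
  have := h _ (@eqnW c x y j g') b; rewrite /= /FWev => <-; congr (\det (colsub _ _)).
  by apply/row_matrixP => a; rewrite rowK.
have -> : M c b *: colsub g A = colsub g (M c b *: A) by apply/matrixP => u v; rewrite !mxE.
apply: (minors_vanish_span mv) => a; have [y [w Kw e]] := hA a.
rewrite (_ : row a (M c b *: A) = M c b *: row a A); last by apply/rowP => u; rewrite !mxE.
rewrite e scalemxAl gK // mulmx_suml; apply: (sm_sum _ (span_sm _)) => i _; rewrite -scalemxAl.
by apply: (smZ _ (span_sm _)); apply: span_sub; exists y, i.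
Qed.

Variables (F : functor_data k) (kap : forall R : comAlgType k, carrier F R -> set 'rV[R]_m).
Hypotheses (FF : is_functor F) (kap_pt : forall R (Y : carrier F R), points Y -> Gr1 (kap Y)).
Hypothesis kap_surj : forall (R : comAlgType k) (K : set 'rV[R]_m), Gr1 K -> exists2 Y, points Y & kap Y = K.
Hypothesis kap_inj : forall R (Y Y' : carrier F R), points Y -> points Y' -> kap Y = kap Y' -> Y = Y'.
Hypothesis kap_nat : forall (R R' : comAlgType k) (phi : {lrmorphism R -> R'}) (Y : carrier F R), points Y ->
  kap (base_change phi Y) = span (map_mx phi @` kap Y).

Lemma projective_scheme_functor (J : set {mpoly k[N.+1]}) : is_functor (projective_scheme J).
Proof.
split.
- move=> R R' phi L [HL lf hJ]; have [M HM e] := r1_of HL lf; split => [||f Jf].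
  + exact: span_sm.
  + by rewrite /= e (r1_lker_map (phi : {rmorphism R -> R'}) HM); apply: r1_lf; apply: r1_map.
  pose I := ideal_gen (@linear_form R' N.+1 @` span (map_mx phi @` L)); have := hJ f Jf; change (ideal_gen (@linear_form R N.+1 @` L) (map_mpoly (in_alg R) f) -> I (map_mpoly (in_alg R') f)).
  rewrite (_ : map_mpoly (in_alg R') f = map_mpoly phi (map_mpoly (in_alg R) f)); last first.
    by apply/mpolyP => w; rewrite !mcoeff_map_mpoly /= linearZ /= rmorph1.
  apply: (@idgen_min _ _ [set g | I (map_mpoly phi g)]) => [|_ [u Lu <-] /=].
    split=> /= [|a x y hx hy]; first by rewrite raddf0; apply: (id0 (idgen_id _)).
    by rewrite rmorphD rmorphM /=; apply: (proj2 (idgen_id _)).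
  apply: idgen_sub; exists (map_mx phi u); first by apply: span_sub; exists u.
  by rewrite /linear_form raddf_sum; apply: eq_bigr => i _; rewrite /= map_mpolyZ map_mpolyX mxE.
- move=> R L [HL _ _]; apply: span_map_id => // v; exact: map_mx_id.
move=> R R' R'' phi psi L [HL _ _]; apply: (span_map_comp (phi := psi)) => [v||a u v].
- by rewrite -map_mx_comp.
- exact: map_mx0.
by rewrite map_mxD map_mxZ.
Qed.

(** [J] consists of all polynomials vanishing on the image of the functor, so it is homogeneous
    without further generators being named. It contains the forms in [eqn], and these already force
    a point into the image. *)
Lemma representable_of_equations : representable_by_projective_scheme F.
Proof.
pose J := [set f : {mpoly k[N.+1]} | forall (R : comAlgType k) (Y : carrier F R), points Y ->
  ideal_gen (@linear_form R N.+1 @` Pl (kap Y)) (map_mpoly (in_alg R) f)].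
have kE (R : comAlgType k) (Y : carrier F R) : points Y ->
    exists2 E, lf_proj q E & kap Y = lker E /\ Pl (kap Y) = lker (Lam E).
  move=> /kap_pt [HK lf _ _]; have [E hE ->] := lf_proj_of HK lf; exists E => //; split => //.
  exact: (PlE encK).
exists N, J; split.
  split.
    split=> [R Y _|a f g hf hg R Y pY]; first by rewrite raddf0; apply: (id0 (idgen_id _)).
    by rewrite rmorphD rmorphM /=; apply: (proj2 (idgen_id _)); [apply: hf|apply: hg].
  move=> e f Jf R Y pY.
  have -> : map_mpoly (in_alg R) (pihomog [measure of mdeg] e f) = pihomog [measure of mdeg] e (map_mpoly (in_alg R) f).
    by rewrite !pihomog_component component_map.
  by apply: (@linear_ideal_homog N.+1 R (Pl (kap Y)) e); apply: Jf.
exists (fun R Y => Pl (kap Y)).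
  split=> //; first exact: projective_scheme_functor.
    move=> R Y pY; have [E hE [_ e2]] := kE R Y pY; split; last by move=> f Jf; apply: Jf.
      by rewrite e2; apply: lker_sm.
    by rewrite e2; apply: r1_lf; apply: (Lam_r1 encK hE).
  move=> R R' phi Y pY; have [E hE [e1 e2]] := kE R Y pY; rewrite /= kap_nat // e2.
  rewrite (r1_lker_map (phi : {rmorphism R -> R'}) (Lam_r1 encK hE)) -Lam_map e1.
  rewrite lker_map; last by case: hE.
  by apply: (PlE encK); apply: lf_proj_map.
move=> R L [HL lf hJ]; have [M HM eL] := r1_of HL lf.
have van f : eqn f -> forall b, fev f (in_alg R) (cl M b) = 0.
  move=> ef; apply: ideal_form; rewrite -eL; apply: hJ => R' Y pY.
  have [E hE [e1 ->]] := kE R' Y pY; apply: (form_ideal (Lam_r1 encK hE)) => b.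
  by apply: (eqn_Gr b hE _ ef); rewrite -e1; apply: kap_pt.
have [E hE [hG eM]] := Gr_eqn HM van; have [Y pY eY] := kap_surj hG.
exists Y; split; first by split=> //; rewrite eY (PlE encK hE) eL.
move=> Y' [pY' eY']; apply: kap_inj => //.
have [E' hE' [e1 _]] := kE R Y' pY'.
have e : Pl (lker E) = Pl (lker E') by rewrite -e1 eY' (PlE encK hE) -eM eL.
by rewrite eY e1; apply/seteqP; split; apply: (Pl_inj encK) => //.
Qed.

End Representable.

(** * Representability *)

Lemma crdP (R : comNzRingType) n (ms : seq 'X_{1..n}) a (f g : {mpoly R[n]}) :
  crd ms (a *: f + g) = a *: crd ms f + crd ms g.
Proof. by apply/rowP => j; rewrite !mxE mcoeffD mcoeffZ. Qed.

Lemma span_crd (R : comNzRingType) n (ms : seq 'X_{1..n}) (G : set {mpoly R[n]}) f :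
  span G f -> span (crd ms @` G) (crd ms f).
Proof.
apply: (@span_min _ _ _ [set f | span _ (crd ms f)]) => [|g Gg /=]; last by apply: span_sub; exists g.
split=> /=; first by rewrite (_ : crd _ 0 = 0); [exact: (sm0 (span_sm _))|apply/rowP => j; rewrite !mxE mcoeff0].
by move=> a u v hu hv; rewrite crdP; apply: (smD (span_sm _)) => //; apply: (smZ _ (span_sm _)).
Qed.

Lemma span_vec (R R' : comNzRingType) (phi : {rmorphism R -> R'}) n (ms : seq 'X_{1..n}) (L : set {mpoly R[n]}) :
  uniq ms -> L `<=` inS ms ->
  [set w : 'rV[R']_(size ms) | span (map_mpoly phi @` L) (vec w)] = span (map_mx phi @` [set w | L (vec w)]).
Proof.
move=> msU LS; apply/seteqP; split=> [w /= /(span_crd (ms := ms))|].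
  rewrite vecK //; apply: span_min; first exact: span_sm.
  move=> _ [_ [f Lf <-] <-]; apply: span_sub; exists (crd ms f); first by rewrite /= crdK //; apply: LS.
  by rewrite -{2}(crdK msU (LS _ Lf)) map_vec vecK.
apply: span_min.
  split=> /=; first by rewrite raddf0; apply: (sm0 (span_sm _)).
  by move=> a u v hu hv; rewrite linearP; apply: (smD (span_sm _)) => //; apply: (smZ _ (span_sm _)).
by move=> _ [w Lw <-] /=; rewrite -map_vec; apply: span_sub; exists (vec w).
Qed.

(* The matrix of f |-> 'X_[u] * component A p f, truncated to the span of ms'. *)
Definition opM (k : nzRingType) n r (A : 'M[int]_(r, n)) (ms ms' : seq 'X_{1..n}) p u : 'M[k]_(size ms, size ms') :=
  \matrix_(i, j) ((mdegree A (nth 0%MM ms i) == p) && ((u + nth 0%MM ms i)%MM == nth 0%MM ms' j))%:R.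

Lemma opME (k : fieldType) (R : comAlgType k) n r (A : 'M[int]_(r, n)) (ms ms' : seq 'X_{1..n}) p u (w : 'rV[R]_(size ms)) :
  crd ms' ('X_[u] * component A p (vec w)) = w *m map_mx (in_alg R) (opM k A ms ms' p u).
Proof.
apply/rowP => j; rewrite !mxE mcoeffXM; set v := nth _ ms' j.
have [le|le] := boolP (u <= v)%MM; last first.
  rewrite big1 // => i _; rewrite !mxE rmorph_nat; case: eqP => _ //=; last by rewrite mulr0.
  by case: eqP => [e|_]; [case/negP: le; rewrite /v -e lem_addr|rewrite mulr0].
rewrite mcoeff_component; have H i : ((u + nth 0%MM ms i)%MM == v) = (nth 0%MM ms i == (v - u)%MM).
  by apply/eqP/eqP => [<-|->]; [rewrite addmC addmK|rewrite addmC submK].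
case: ifP => [/eqP e|ne].
  rewrite /vec raddf_sum; apply: eq_bigr => i _ /=; rewrite mcoeffZ mcoeffX !mxE H rmorph_nat.
  by case: (nth _ _ _ =P _) => [->|_]; rewrite ?e ?eqxx ?andbF.
rewrite big1 // => i _; rewrite !mxE H rmorph_nat; case: (nth _ _ _ =P (v - u)%MM) => [->|_]; last by rewrite andbF mulr0.
by rewrite ne mulr0.
Qed.

Section Embedding.
Variables (RR : realType) (k : fieldType) (d n r : nat) (b : 'M[int]_(d, n)) (Delta : {set {set 'I_n}}).
Variables (A : 'M[int]_(r, n)) (h : 'cV[int]_r) (mu : {set 'I_n} -> 'X_{1..n}).
Variable (mon : 'cV[int]_r -> seq 'X_{1..n}).
Hypothesis TS : toric_setup RR b Delta A h mu mon.
Variables (P : {mpoly rat[r]}) (pts : seq 'cV[int]_r) (t0 : nat) (Qf : 'cV[int]_r -> nat).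
Hypothesis RS : ray_setup Delta A h mon P pts t0 Qf.
Local Notation deg := (mdegree A).
Local Notation T := (inT h pts).
Let monU := ts_uniq TS.
Let monE := ts_monE TS.
Let gS := graded_inS monE.
Variable D : seq 'cV[int]_r.
Hypotheses (DU : uniq D) (DT : forall p, p \in D -> T p).
Hypothesis HD : forall M, upc M -> (forall p, p \in D -> cnt mon p M = Qf p) ->
  forall p, T p -> (cnt mon p (genD mon M D) <= Qf p)%N.
Hypothesis QfS : forall p, T p -> (Qf p <= size (mon p))%N.
Local Notation hilb := (Hilb k b A Delta P).
Local Notation hsL := (hs A Qf D).
Local Notation hs0L := (hs0 A D).
Local Notation gmx L p := (@genmx n r A mon D _ L p).
Local Notation minT L := (forall p, T p -> minors_vanish (gmx L p) (size (mon p) - Qf p + 1)).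

Definition msD : seq 'X_{1..n} := flatten [seq mon p | p <- D].

Lemma msDE w : (w \in msD) = (deg w \in D).
Proof.
apply/flatten_mapP/idP => [[p pD]|wD]; first by rewrite monE => /eqP ->.
by exists (deg w); rewrite ?monE.
Qed.

Lemma msDU : uniq msD.
Proof.
rewrite /msD; elim: D DU => //= p D' IH /andP [pD uD]; rewrite cat_uniq monU IH // andbT /=.
apply/hasPn => w /flatten_mapP [p' p'D]; rewrite monE => /eqP e; rewrite -e in p'D.
by rewrite monE; apply: contra pD => /eqP <-.
Qed.

Lemma suppE (R : comNzRingType) : supp_in A D = inS msD :> set {mpoly R[n]}.
Proof. by apply/seteqP; split=> f hf w wf; have := hf w wf; rewrite msDE. Qed.

Local Notation mD := (size msD).
Local Notation qD := (\sum_(p <- D) Qf p)%N.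

(** Multiplication operators on the pieces, cut off outside [D]. For [x.2] zero they are the
    projections to graded pieces, so stability also encodes gradedness. *)
Definition stab (x : 'cV[int]_r * 'X_{1..n}) : 'M[k]_mD := opM k A msD msD x.1 x.2.
Definition genW (p : {p | T p}) (x : 'cV[int]_r * 'X_{1..n}) : 'M[k]_(mD, size (mon (sval p))) :=
  opM k A msD (mon (sval p)) x.1 x.2.
Definition gsz (p : {p | T p}) := size (mon (sval p)).
Definition gee (p : {p | T p}) := (size (mon (sval p)) - Qf (sval p) + 1)%N.

Local Notation GrD := (@Gr1 k mD qD _ stab _ (fun=> ('cV[int]_r * 'X_{1..n})%type) gsz gee genW).

Definition kap (R : comAlgType k) (Y : carrier hilb R) : set 'rV[R]_mD := [set w | eta D Y (vec w)].

Lemma comp_in (R : comNzRingType) (f : {mpoly R[n]}) p : supp_in A D f -> supp_in A D (component A p f).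
Proof. by move=> fD w; rewrite mcoeff_msupp mcoeff_component; case: ifP; rewrite ?eqxx // -mcoeff_msupp => _; apply: fD. Qed.

Lemma crd_out (R : comNzRingType) (ms : seq 'X_{1..n}) (f : {mpoly R[n]}) p :
  graded_piece A p f -> (forall w, w \in ms -> deg w != p) -> crd ms f = 0.
Proof.
move=> /graded_pieceP gf hms; apply/rowP => j; rewrite !mxE; apply: gf.
by apply: hms; apply: mem_nth.
Qed.

Lemma XM_graded (R : comNzRingType) (f : {mpoly R[n]}) p q u : deg u = q - p -> graded_piece A q ('X_[u] * component A p f).
Proof. by move=> eu; rewrite -[q](subrK p) -eu addrC; apply: gradedXM; apply: graded_component. Qed.

Lemma stab_hs (R : comAlgType k) (L : set {mpoly R[n]}) x w : hs0L L -> L (vec w) ->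
  L (vec (w *m map_mx (in_alg R) (stab x))).
Proof.
case: x => p u HL Lw; rewrite /stab -opME /=; set q := deg u + p.
have eu : deg u = q - p by rewrite addrK.
have [pD|pD] := boolP (p \in D); last first.
  rewrite (component_supp (hs_supp HL Lw) pD) mulr0 (_ : crd _ 0 = 0) ?raddf0; first exact: (sm0 (hs_sm HL)).
  by apply/rowP => j; rewrite !mxE mcoeff0.
have gq := @XM_graded R (vec w) p q u eu; have [qD|qD] := boolP (q \in D).
  have hL : L ('X_[u] * component A p (vec w)).
    by apply: (hs_mul HL pD qD) => //; [apply: (hs_gr HL)|apply: graded_component].
  by rewrite crdK //; [exact: msDU|rewrite -suppE; apply: (hs_supp HL)].
rewrite (crd_out gq) ?raddf0; first exact: (sm0 (hs_sm HL)).
by move=> v; rewrite msDE; apply: contraL => /eqP ->.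
Qed.

Lemma gen_row (R : comAlgType k) (L : set {mpoly R[n]}) (p : {p | T p}) x w : supp_in A D (vec w) -> L (vec w) ->
  gmx L (sval p) (w *m map_mx (in_alg R) (genW p x)).
Proof.
case: x => q u wD Lw; rewrite /genW -opME /genmx /=; set f := 'X_[u] * _.
have z0 : crd (mon (sval p)) f = 0 -> gen A D L (sval p) (vec (crd (mon (sval p)) f)).
  by move=> ->; rewrite raddf0; apply: (sm0 (span_sm _)).
have [qD|qD] := boolP (q \in D); last first.
  by apply: z0; rewrite /f (component_supp wD qD) mulr0; apply/rowP => j; rewrite !mxE mcoeff0.
have [eu|ne] := eqVneq (deg u) (sval p - q); last first.
  have gq := @XM_graded R (vec w) q (deg u + q) u (esym (addrK _ _)).
  apply: z0; apply: (crd_out gq) => v; rewrite monE => /eqP ->; apply: contra ne => /eqP ->.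
  by rewrite addrK.
rewrite crdK //; last by rewrite -gS; apply: XM_graded.
by apply: span_sub; exists q, u, (vec w).
Qed.

Lemma kap_Gr (R : comAlgType k) (Y : carrier hilb R) : points Y -> GrD (kap Y).
Proof.
move=> pY; have He := eta_hs TS RS DT pY; have mv := eta_minors TS RS DU QfS pY; split.
- split; first by rewrite /kap /= raddf0; apply: (sm0 (hs_sm He)).
  by move=> a u v hu hv; rewrite /kap /= linearP; apply: (smD (hs_sm He)) => //; apply: (smZ _ (hs_sm He)).
- apply/(locally_free_vec _ (vecE msDU (R := R))); rewrite -suppE.
  by apply: lf_total => //; [exact: (hs_sm He)|exact: (hs_gr He)|move=> p pD; apply: (hs_lf He)].
- by move=> x w Kw; apply: (stab_hs x (hs_0 He) Kw).
move=> p M g hM; apply: (mv _ (svalP p)) => i; have [x [w Kw ->]] := hM i.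
by apply: gen_row => //; apply: (hs_supp He).
Qed.

Lemma kap_inj (R : comAlgType k) (Y Y' : carrier hilb R) : points Y -> points Y' -> kap Y = kap Y' -> Y = Y'.
Proof.
move=> pY pY' e; apply: (eta_inj TS RS DU DT HD QfS pY pY').
have sub (Z Z' : carrier hilb R) : kap Z = kap Z' -> eta D Z `<=` eta D Z'.
  move=> ez f ef; have fS : inS msD f by rewrite -suppE; case: ef.
  have := congr1 (fun S : set _ => S (crd msD f)) ez; rewrite /kap /= crdK //; last exact: msDU.
  by move=> <-.
by apply/seteqP; split; apply: sub.
Qed.

Lemma kap_base (R R' : comAlgType k) (phi : {lrmorphism R -> R'}) (Y : carrier hilb R) : points Y ->
  kap (base_change (f := hilb) phi Y) = span (map_mx phi @` kap Y).
Proof.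
move=> pY; rewrite /kap (eta_base TS RS DU DT HD QfS phi pY).
apply: (span_vec (phi : {rmorphism R -> R'}) msDU); rewrite -suppE.
exact: (hs_supp (eta_hs TS RS DT pY)).
Qed.

(* The ranks of the graded pieces are at least Qf p by vanishing of minors, and add up to the sum of the Qf p. *)
Lemma piece_lf (R : comAlgType k) (L : set {mpoly R[n]}) : hs0L L -> minT L -> locally_free (supp_in A D) L qD ->
  forall p, p \in D -> locally_free (graded_piece A p) L (Qf p).
Proof.
move=> HL mv lf p pD; have Tp := DT pD.
have gD p' w : p' \in D -> gen A D L p' (vec w : {mpoly R[n]}) <-> L (vec (ms := mon p') w).
  by move=> p'D; apply: (gen_D HL p'D); rewrite gS; apply: vec_inS.
have gIn p' : gen A D L p' `<=` inS (mon p') by rewrite -gS; apply: gen_in.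
rewrite gS; apply/(locally_free_vec _ (vecE (monU p) (R := R))).
rewrite (_ : [set w | L (vec w)] = gmx L p); last by apply/seteqP; split=> w /= /gD; apply.
have HN p' : is_submodule (gen A D L p') by apply: span_sm.
apply: locally_free_of_minors (mv p Tp) _; [|exact: QfS|].
  split; first by rewrite /genmx /= raddf0; apply: (sm0 (HN p)).
  by move=> a u v hu hv; rewrite /genmx /= linearP; apply: (smD (HN p)) => //; apply: (smZ _ (HN p)).
move=> F phi Hr; pose L' := span (map_mpoly phi @` L); have HL' : hs0L L' := hs0_map phi HL.
pose q' p' := count (fun w => ~~ `[< leads (gen A D L' p') (mon p') w >]) (mon p').
have dim p' : has_dim (inS (mon p')) (span (map_mpoly phi @` gen A D L p')) (q' p').
  by rewrite -gen_map; apply: (initial_basis (monU p') (span_sm _)).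
(* A smaller corank at a residue field would give a nonzero minor of the size at which all minors
   vanish. *)
have ge p' : p' \in D -> (Qf p' <= q' p')%N.
  move=> p'D; rewrite leqNgt; apply/negP => lt; have le : (q' p' <= (Qf p').-1)%N by lia.
  have [M [g [hM]]] := residue_minor (monU p') (HN p') (gIn p') Hr le (dim p').
  have es : (size (mon p') - Qf p' + 1 = size (mon p') - (Qf p').-1)%N by have := QfS (DT p'D); lia.
  by have := mv p' (DT p'D); rewrite es => /(_ M g hM) ->; rewrite rmorph0 eqxx.
have sq : (\sum_(p' <- D) q' p' = qD)%N.
  have lf1 : locally_free (supp_in A D) L' (\sum_(p' <- D) q' p')%N.
    apply: (lf_total DU (hs_sm HL') (hs_gr HL')) => p' p'D; apply: has_dim_locally_free.
    have := dim p'; rewrite -gen_map -gS; apply: has_dim_ext; first exact: graded_sm.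
    by move=> v gv; apply: (gen_D HL' p'D gv).
  rewrite suppE in lf; have [E hE HE] := proj_of msDU (hs_sm HL) lf.
  have lf2 : locally_free (supp_in A D) L' qD.
    rewrite suppE; apply: (of_proj msDU (lf_proj_map phi hE)) => w.
    by apply: (proj_map msDU phi _ (proj1 hE) HE); rewrite -suppE; apply: (hs_supp HL).
  by apply: (has_dim_uniq (@supp_sm n r A F D) (hs_sm HL')); apply: locally_free_has_dim => //; apply: (hs_sm HL').
have qe : q' p = Qf p.
  apply/eqP; rewrite eqn_leq (ge p pD) andbT; move: sq; rewrite !(bigD1_seq p) //= => sq.
  have : (\sum_(i <- D | i != p) Qf i <= \sum_(i <- D | i != p) q' i)%N.
    by rewrite big_seq_cond [X in (_ <= X)%N]big_seq_cond; apply: leq_sum => i /andP [iD _]; apply: ge.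
  by lia.
have [M [g [h1 h2]]] := residue_minor (monU p) (HN p) (gIn p) Hr (leqnn _) (dim p).
by rewrite qe in M g h1 h2; exists M, g.
Qed.

Lemma kap_surj (R : comAlgType k) (K : set 'rV[R]_mD) : GrD K -> exists2 Y : carrier hilb R, points Y & kap Y = K.
Proof.
move=> [HK lf st mv]; pose L : set {mpoly R[n]} := [set f | supp_in A D f /\ K (crd msD f)].
have vD (w : 'rV[R]_mD) : supp_in A D (vec w) by rewrite suppE; apply: vec_inS.
have LK w : L (vec w) <-> K w by rewrite /L /= vecK //; [split=> [[]|]|exact: msDU].
have rep (f : {mpoly R[n]}) : supp_in A D f -> vec (crd msD f) = f by rewrite suppE => fS; apply: crdK => //; apply: msDU.
have Lop p u f : L f -> supp_in A D ('X_[u] * component A p f) -> L ('X_[u] * component A p f).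
  move=> [fD Kf] XD; split => //; rewrite -[in component _ _ _](rep f fD) opME.
  exact: (st (p, u)).
have HL : hs0L L.
  split.
  - split; first by split; [exact: (sm0 (@supp_sm n r A R D))|rewrite (_ : crd _ 0 = 0); [exact: (sm0 HK)|apply/rowP => j; rewrite !mxE mcoeff0]].
    move=> a f g [fD Kf] [gD Kg]; split; first by apply: (smD (@supp_sm n r A R D)) => //; apply: (smZ _ (@supp_sm n r A R D)).
    by rewrite crdP; apply: (smD HK) => //; apply: (smZ _ HK).
  - by move=> f [].
  - by move=> p f Lf; have := Lop p 0%MM f Lf; rewrite mpolyX0 mul1r; apply; apply: comp_in; case: Lf.
  move=> p q f u pD qD Lf gf eu; have := Lop p u f Lf; rewrite (component_id gf); apply.
  by move=> w wX; have := @XM_graded R f p q u eu; rewrite (component_id gf) => /(_ w wX); rewrite inE => /eqP ->.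
have mT : minT L.
  move=> p Tp M g hM; pose x : {p | T p} := exist _ p Tp.
  apply: (minors_vanish_span (mv x)) => i; have := hM i; rewrite /genmx /= => /(span_crd (ms := mon p)).
  rewrite vecK //; apply: span_min; first exact: span_sm.
  move=> _ [_ [q [u [f [qD eu [fD Kf] ->]]]] <-]; apply: span_sub.
  by exists (q, u), (crd msD f) => //; rewrite -opME rep.
have lfL : locally_free (supp_in A D) L qD.
  rewrite suppE; apply/(locally_free_vec _ (vecE msDU (R := R))).
  by rewrite (_ : [set w | L (vec w)] = K) //; apply/seteqP; split=> w /LK.
have hL : hsL L by split => //; apply: piece_lf.
have [Y pY eY] := eta_surj TS RS DT HD QfS hL mT.
by exists Y => //; rewrite /kap eY; apply/seteqP; split=> w /LK.
Qed.

Lemma hilb_representable : representable_by_projective_scheme hilb.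
Proof.
(* This makes the set of tuples nonempty, so that its cardinal is a successor, as projective space
   requires. *)
have le : (qD <= mD)%N.
  rewrite size_flatten /shape -map_comp sumnE big_map big_seq [X in (_ <= X)%N]big_seq.
  by apply: leq_sum => p pD; apply: QfS; apply: DT.
have card : (#|{ffun 'I_qD -> 'I_mD}| = #|{ffun 'I_qD -> 'I_mD}|.-1.+1)%N.
  rewrite prednK // card_ffun !card_ord expn_gt0; move: le; move: mD qD => a c.
  by case: c => [|c]; rewrite ?orbT //; case: a.
pose dec i := enum_val (cast_ord (esym card) i); pose enc f := cast_ord card (enum_rank f).
have encK : cancel enc dec by move=> f; rewrite /enc /dec cast_ordK enum_rankK.
have decK : cancel dec enc by move=> i; rewrite /enc /dec enum_valK cast_ordKV.
apply: (@representable_of_equations k mD qD _ dec enc encK decK _ stab _ (fun=> ('cV[int]_r * 'X_{1..n})%type) gsz gee genW hilb kap).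
- exact: (hilb_functor k TS RS).
- by move=> R Y; apply: kap_Gr.
- by move=> R K; apply: kap_surj.
- by move=> R Y Y'; apply: kap_inj.
by move=> R R' phi Y; apply: kap_base.
Qed.

End Embedding.

(** The subscheme that realizes [P] is regarded as a family over [k], and the quotients of its
    graded pieces have dimension [Qf p]. *)
Lemma ray_dim_bound (RR : realType) (k : fieldType) (d n r : nat) (b : 'M[int]_(d, n)) (Delta : {set {set 'I_n}})
    (A : 'M[int]_(r, n)) (h : 'cV[int]_r) (mu : {set 'I_n} -> 'X_{1..n}) (mon : 'cV[int]_r -> seq 'X_{1..n})
    (P : {mpoly rat[r]}) (pts : seq 'cV[int]_r) (t0 : nat) (Qf : 'cV[int]_r -> nat) :
  toric_setup RR b Delta A h mu mon -> ray_setup Delta A h mon P pts t0 Qf -> multigraded_hilbert_poly k b A Delta P ->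
  forall p, inT h pts p -> (Qf p <= size (mon p))%N.
Proof.
move=> TS RS [Y [HY _] HP] p [p0 p0T [t ->]].
have eY : subscheme_base_change (idfun : {rmorphism k -> k}) Y = Y.
  rewrite (base_changeE (idfun : {rmorphism k -> k})); apply: funext => s; apply: span_map_id; first by case: (HY s).
  by move=> g; apply: lext => m; rewrite (coeff_mapL (idfun : {rmorphism k -> k})).
have HP' : has_hilbert_poly b A (subscheme_base_change (idfun : {rmorphism k -> k}) Y) P by rewrite eY.
have [hd _ _] := J_ray TS RS HY HP' p0T t; have HC := base_change_chart (idfun : {rmorphism k -> k}) HY.
have [le _] := codim_minor (ts_uniq TS _) (Ip_sm (ts_ex TS) HC _) hd; exact: le.
Qed.

Theorem theorem6p2 (RR : realType) (k : fieldType) (d n r : nat)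
    (b : 'M[int]_(d, n)) (Delta : {set {set 'I_n}}) (A : 'M[int]_(r, n))
    (P : {mpoly rat[r]}) :
  smooth_projective_fan RR b Delta ->
  r = (n - d)%N ->
  short_exact b A ->
  multigraded_hilbert_poly k b A Delta P ->
  representable_by_projective_scheme (Hilb k b A Delta P) /\
  exists (D : seq 'cV[int]_r)
    (eta : forall R, carrier (Hilb k b A Delta P) R -> carrier (HSD k A P D) R),
    is_canonical_map eta /\ is_closed_embedding eta.
Proof.
move=> Hfan _ Hex HP; have [h [mu [mon TS]]] := toric_setup_ex Hfan Hex.
have [pts [t0 [Qf RS]]] := ray_setup_ex TS HP; have QfS := ray_dim_bound TS RS HP.
(* The degrees of the embedding are those of [degree_bound] for the values of [P] on the rays;
   duplicates are removed because the ranks are summed over the list. *)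
have [D0 [DT0 HD0]] := degree_bound mon (inT h pts) Qf.
have DU := undup_uniq D0; have DT p : p \in undup D0 -> inT h pts p by rewrite mem_undup; apply: DT0.
have HD M : upc M -> (forall p, p \in undup D0 -> cnt mon p M = Qf p) ->
    forall p, inT h pts p -> (cnt mon p (genD mon M (undup D0)) <= Qf p)%N.
  move=> uM hM p Tp; rewrite (_ : genD mon M (undup D0) = genD mon M D0).
    by apply: HD0 => // p' p'D; apply: hM; rewrite mem_undup.
  apply/seteqP; split=> m [m0 [p' [h1 h2 h3 h4]]]; exists m0, p'; split => //; first by rewrite -mem_undup.
  by rewrite mem_undup.
split; first exact: (hilb_representable k TS RS DU DT HD QfS).
exists (undup D0), (fun R Y => eta (undup D0) Y); split.
  exact: (eta_canonical TS).
exact: (eta_closed k TS RS DU DT HD QfS).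
Qed.
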